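(* Let $\kappa\in(0,\kappa_{max})$ and $\rho=\frac{j(\kappa)}{c(\kappa)}$, and suppose that $\left(\frac{j}{c}\right)'(\kappa)>0$. Then, for all $s>\frac{n-1}{2}$, there exist constants $\delta>0$ and $C>0$ (independent of the initial condition) such that for any initial condition $f_0$ with mass $\rho$ satisfying $\|f_0-\rho M_{\kappa\Omega}\|_{H^s}<\delta$ for some $\Omega\in\mathbb S$, there exists $\Omega_\infty\in\mathbb S$ such that the solution $f$ of $\partial_t f=Q(f)$ with $f(0)=f_0$ satisfies, for all $t\geq 0$, $$\|f(t)-\rho M_{\kappa\Omega_\infty}\|_{H^s}\leq C\,\|f_0-\rho M_{\kappa\Omega}\|_{H^s}\,e^{-\lambda t},$$ where the rate is given by $$\lambda=\frac{c(\kappa)\,\tau(j(\kappa))}{j'(\kappa)}\,\Lambda_\kappa\left(\frac{j}{c}\right)'(\kappa).$$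
   Context: Let $n\ge 2$ and let $\mathbb S$ be the unit sphere of $\mathbb R^n$ with the uniform probability measure $d\omega$. $\nabla_\omega$, $\nabla_\omega\cdot$, $\Delta_\omega$ are the gradient, divergence and Laplace–Beltrami operator on $\mathbb S$; $P_{\omega^\perp}=\mathrm{Id}-\omega\otimes\omega$. $H^s=H^s(\mathbb S)$ is the usual Sobolev space; for functions $g$ with $\int_{\mathbb S} g\,d\omega=0$ the norm is $\|g\|_{H^s}^2=\int_{\mathbb S} g(-\Delta_\omega)^s g\,d\omega$. The functions $\nu:[0,\infty)\to[0,\infty)$ and $\tau:[0,\infty)\to(0,\infty)$ are such that $r\mapsto\nu(r)/r$ and $r\mapsto\tau(r)$ are Lipschitz and bounded; $\tau_0=\tau(0)>0$. The function $k(r)=\nu(r)/\tau(r)$ is increasing; $\kappa_{max}=\lim_{r\to\infty}k(r)\in(0,\infty]$ and $j:[0,\kappa_{max})\to[0,\infty)$ is the inverse function of $k$. Moreover $k$ is differentiable with Lipschitz derivative $k'$. For $f$ on $\mathbb S$, $J_f=\int_{\mathbb S}\omega f\,d\omega$, $\Omega_f=J_f/|J_f|$, and $$Q(f)=-\nu(|J_f|)\nabla_\omega\cdot(P_{\omega^\perp}\Omega_f\,f)+\tau(|J_f|)\Delta_\omega f$$ (with $Q(f)=\tau_0\Delta_\omega f$ if $J_f=0$). An initial condition is a finite nonnegative measure $f_0\in H^s(\mathbb S)$; its mass is $\int_{\mathbb S} f_0\,d\omega$. For such $f_0$ there is a unique global weak solution $f$ of $\partial_t f=Q(f)$, $f(0)=f_0$,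 with $f\in C([0,\infty),H^s)\cap C^1((0,\infty),C^\infty(\mathbb S))$ and $f>0$ for $t>0$; mass is conserved. The von Mises–Fisher distribution is $M_{\kappa\Omega}(\omega)=e^{\kappa\,\omega\cdot\Omega}/\int_{\mathbb S}e^{\kappa\,\upsilon\cdot\Omega}d\upsilon$ for $\kappa\ge0$, $\Omega\in\mathbb S$, and $c(\kappa)=\frac{\int_0^\pi\cos\theta\,e^{\kappa\cos\theta}\sin^{n-2}\theta\,d\theta}{\int_0^\pi e^{\kappa\cos\theta}\sin^{n-2}\theta\,d\theta}$, so that $J_{M_{\kappa\Omega}}=c(\kappa)\Omega$. Primes on $j$, $c$, $\frac jc$ denote derivatives with respect to $\kappa$. $\Lambda_\kappa$ is the best constant in the weighted Poincaré inequality $\langle|\nabla_\omega g|^2\rangle_M\ge\Lambda_\kappa\langle(g-\langle g\rangle_M)^2\rangle_M$, where $\langle g\rangle_M=\int_{\mathbb S} g\,M_{\kappa\Omega}\,d\omega$ (it does not depend on $\Omega$). *)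

(* Defs.v *)
From HB Require Import structures.
From mathcomp Require Import all_boot all_order all_algebra.
From mathcomp Require Import all_classical all_reals all_analysis.
Set Implicit Arguments.
Unset Strict Implicit.
Unset Printing Implicit Defensive.
Import Order.TTheory GRing.Theory Num.Theory.
Import numFieldNormedType.Exports.
Local Open Scope classical_set_scope.
Local Open Scope ring_scope.

Notation borelRn R n := (g_sigma_algebraType (@open 'rV[R]_n)).

Section Sphere.
Context {R : realType} {n : nat}.
Local Notation V := 'rV[R]_n.
Implicit Types (f g u : V -> R) (A : V -> V) (x w v : V).

Definition dot x v : R := (x *m v^T) 0 0.

(* The library's norm on row vectors is the sup norm. *)
Definition eucl x : R := Num.sqrt (dot x x).

Definition sphere : set V := [set w | eucl w = 1].

(* Functions and vector fields on the sphere are represented by functions on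
   R^n, of which only the values on [sphere] matter.  Differentiation on the
   sphere is that of the extension which is constant along rays. *)
Definition radial_ext (T : Type) (h : V -> T) : V -> T :=
  fun x => h ((eucl x)^-1 *: x).

Definition partials (l : seq 'I_n) f : V -> R :=
  foldr (fun i h => 'D_(delta_mx 0 i) h) f l.

Definition smooth f : Prop :=
  forall (l : seq 'I_n) x, x != 0 ->
    differentiable (partials l (radial_ext f)) x.

(* Convergence in the Frechet space of smooth functions on the sphere. *)
Definition smooth_cvg (F : set_system R) (f_ : R -> V -> R) f : Prop :=
  forall (l : seq 'I_n) (e : R), 0 < e ->
    \forall t \near F, forall w, sphere w ->
      `|partials l (radial_ext (f_ t)) w - partials l (radial_ext f) w| < e.

Definition sgrad f w : V := \row_i 'D_(delta_mx 0 i) (radial_ext f) w.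

Definition sdiv A w : R :=
  \sum_i 'D_(delta_mx 0 i) (radial_ext (fun x => A x 0 i)) w.

Definition slaplacian f : V -> R := sdiv (sgrad f).

(* Orthogonal projection of [v] on the tangent space at [w]. *)
Definition tproj w v : V := v - dot w v *: w.

Section UniformMeasure.
Variable sigma : probability (borelRn R n) R.

Definition uniform_on_sphere : Prop :=
  sigma sphere = 1%E /\
  forall (O : 'M[R]_n) (B : set (borelRn R n)), O *m O^T = 1%:M ->
    measurable B -> sigma ((fun x : V => x *m O) @^-1` B) = sigma B.

(* Elements of H^s(S) are given by their action on smooth functions. *)
Definition of_measure (mu : {measure set (borelRn R n) -> \bar R})
    (phi : V -> R) : R :=
  \int[mu]_(w in sphere) phi w.

Definition of_density f (phi : V -> R) : R :=
  \int[sigma]_(w in sphere) (f w * phi w).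

Definition eigenfunction (m : R) : set (V -> R) :=
  [set Y | smooth Y /\ forall w, sphere w -> - slaplacian Y w = m * Y w].

(* Squared L^2 norm of the orthogonal projection of the distribution [L] on the
   eigenspace of [- slaplacian] for [m]; it is 0 if [m] is not an eigenvalue. *)
Definition spectral_mass (L : (V -> R) -> R) (m : R) : \bar R :=
  ereal_sup [set ((L Y) ^+ 2)%:E | Y in
    [set Y | eigenfunction m Y /\ of_density Y Y <= 1]].

(* Spectral definition of the integral of g (- Delta)^s g, to which the square
   of the mean is added, so that the norm is defined on all of H^s and is the
   given one on distributions of mean zero.  It is +oo outside H^s. *)
Definition sobolev_norm (s : R) (L : (V -> R) -> R) : \bar R :=
  sqrte (((L (cst 1)) ^+ 2)%:E +
         \esum_(m in [set m : R | (0 < m)%R]) ((m `^ s)%R%:E * spectral_mass L m))%E.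

Definition flux u : V := \row_i \int[sigma]_(w in sphere) (w 0 i * u w).

Definition direction u : V := (eucl (flux u))^-1 *: flux u.

Definition Q (nu tau : R -> R) u w : R :=
  if flux u == 0 then tau 0 * slaplacian u w
  else - nu (eucl (flux u)) * sdiv (fun x => u x *: tproj x (direction u)) w
       + tau (eucl (flux u)) * slaplacian u w.

Definition vonMises (k : R) v w : R :=
  expR (k * dot w v) / \int[sigma]_(x in sphere) expR (k * dot x v).

Definition vM_mean (k : R) v f : R :=
  \int[sigma]_(w in sphere) (f w * vonMises k v w).

(* Best constant in the weighted Poincare inequality. By rotation invariance it
   is the same for each direction [v], hence the quantification over [v]. *)
Definition poincare_constant (k : R) : R :=
  sup [set L : R | forall v g, sphere v -> smooth g ->
    L * vM_mean k v (fun w => (g w - vM_mean k v g) ^+ 2)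
      <= vM_mean k v (fun w => (eucl (sgrad g w)) ^+ 2)].

(* Solution of [d/dt f = Q f] with values in H^s: the measure [f t] has
   density [u t] for [t > 0], and [f 0] is the initial condition. *)
Definition solution (nu tau : R -> R) (s : R)
    (f : R -> {finite_measure set (borelRn R n) -> \bar R}) : Prop :=
  [/\ forall t, 0 <= t -> (sobolev_norm s (of_measure (f t)) < +oo)%E,
      forall t0, 0 <= t0 ->
        sobolev_norm s (of_measure (f t) \- of_measure (f t0))
          @[t --> within [set t | 0 <= t] (nbhs t0)] --> 0%E &
      exists u du : R -> V -> R, forall t, 0 < t ->
        [/\ forall B : set (borelRn R n), measurable B ->
              f t B = (\int[sigma]_(w in B `&` sphere) (u t w)%:E)%E,
            smooth (u t) /\ smooth (du t),
            smooth_cvg (0^') (fun h w => h^-1 * (u (t + h) w - u t w)) (du t),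
            smooth_cvg (nbhs t) du (du t) &
            forall w, sphere w -> 0 < u t w /\ du t w = Q nu tau (u t) w]].

End UniformMeasure.
End Sphere.

Definition order_param {R : realType} (n : nat) (k : R) : R :=
  (\int[lebesgue_measure]_(th in `[0, pi])
     (cos th * expR (k * cos th) * sin th ^+ (n - 2))) /
  (\int[lebesgue_measure]_(th in `[0, pi])
     (expR (k * cos th) * sin th ^+ (n - 2))).

(* Conditions on [nu], [tau] : [0, +oo) -> R, with k = nu / tau, [kmax] the
   limit of k at +oo and [j] : [0, kmax) -> [0, +oo) the inverse of k. *)
Record coefficients {R : realType} (nu tau : R -> R) (kmax : \bar R)
    (j : R -> R) : Prop := Coefficients {
  nu_ge0 : forall r, 0 <= r -> 0 <= nu r ;
  tau_gt0 : forall r, 0 <= r -> 0 < tau r ;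
  nu_lip : [lipschitz nu r / r | r in `]0, +oo[] ;
  nu_bnd : [bounded nu r / r | r in `]0, +oo[] ;
  tau_lip : [lipschitz tau r | r in `[0, +oo[] ;
  tau_bnd : [bounded tau r | r in `[0, +oo[] ;
  k_incr : forall x y, 0 <= x -> x < y -> nu x / tau x < nu y / tau y ;
  k_lim : (nu r / tau r)%:E @[r --> +oo] --> kmax ;
  kK : forall r, 0 <= r ->
    ((nu r / tau r)%:E < kmax)%E /\ j (nu r / tau r) = r ;
  jK : forall x, 0 <= x -> (x%:E < kmax)%E ->
    0 <= j x /\ nu (j x) / tau (j x) = x ;
  (* The derivative of k is one-sided at 0. *)
  k_diff : exists dk : R -> R,
    [lipschitz dk r | r in `[0, +oo[] /\
    forall r, 0 <= r ->
      (nu x / tau x - nu r / tau r) / (x - r)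
        @[x --> within `[0, +oo[ (r^')] --> dk r }.

(* Main.v *)
(** Let M be the von Mises-Fisher density of parameter kappa in the current
    direction Omega of the flux, and write f = M (rho + eta).  The energy
    <eta^2>_M / 2 - rho k'(j) (|J_f| - j)^2 / 2 controls <eta^2>_M because
    theta := 1 - rho k'(j) Var_M(omega . Omega) is positive, which is the
    hypothesis (j/c)' > 0; along the flow its derivative is at most -2 lambda
    times itself up to a cubic error, by the weighted Poincare inequality.
    Hence the L^2 distance to M and the speed of Omega decay like
    exp(-lambda t), and Omega converges.

    The H^s bound is obtained degree by degree.  If Y is a spherical harmonic
    of degree l, with eigenvalue m = l (l + n - 2), then y = <f - rho M_oo, Y>
    satisfies y' = tau (- m y + O(l) terms of degrees l-1, l, l+1) + a source
    which decays like exp(-lambda t).  Thus exp(lambda t) |y| is bounded by its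
    initial value plus O(1/l) times the bounds for the neighbouring degrees.
    Starting from the uniform L^2 bound, finitely many iterations make the
    bounds summable with the weights (m + 1)^s. *)

(* Since [k'(j) j' = 1] and [c'] is the variance of omega . Omega under M,
   [(j/c)' = theta / (k'(j) c)], so the rate equals tau(j) Lambda theta. It is reached by applying
   the weighted Poincare inequality not to eta but to eta - rho k'(j) (|J_f| - j) omega . Omega: the
   Dirichlet integral of this function is exactly the quadratic part of the dissipation. The
   obstacle is time 0, where the solution is only an element of H^s and no derivative is available.
   Every differential inequality starts at some t1 > 0 with constants independent of t1, and t1
   tends to 0. Closeness in L^2 at small times costs a little room, so the estimates are proved for
   every D above the initial distance, with one limit direction for all D, and D decreases to that
   distance. The Sobolev norm tests all smooth eigenfunctions of the Laplacian, so the spectrum has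
   to be identified. Rotation invariance is all that is known about sigma: it gives integration by
   parts, the density of polynomials and the completeness of spherical harmonics. In low degrees
   diffusion may be slower than the rate; there the L^2 decay replaces the degree estimate. *)
Require Import Defs.
From HB Require Import structures.
From mathcomp Require Import all_boot all_order all_algebra.
From mathcomp Require Import all_classical all_reals all_analysis.
From mathcomp Require Import measurable_realfun ring lra.
Import Order.TTheory GRing.Theory Num.Theory.
Import numFieldNormedType.Exports.
Local Open Scope classical_set_scope.
Local Open Scope ring_scope.

Set Implicit Arguments.
Unset Strict Implicit.
Unset Printing Implicit Defensive.

(** * The uniform measure on the sphere *)

Section Geometry.
Context {R : realType} {n : nat}.
Local Notation V := 'rV[R]_n.
Implicit Types (x y z v w : V) (a b c : R).

Lemma dotE x v : dot x v = \sum_i x 0 i * v 0 i.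
Proof. by rewrite /dot mxE; apply: eq_bigr => i _; rewrite mxE. Qed.

Lemma dotC x v : dot x v = dot v x.
Proof. by rewrite !dotE; apply: eq_bigr => i _; rewrite mulrC. Qed.

Lemma dotDl x y v : dot (x + y) v = dot x v + dot y v.
Proof. by rewrite /dot mulmxDl mxE. Qed.

Lemma dotDr x y v : dot v (x + y) = dot v x + dot v y.
Proof. by rewrite dotC dotDl !(dotC v). Qed.

Lemma dotZl c x v : dot (c *: x) v = c * dot x v.
Proof. by rewrite /dot -scalemxAl mxE. Qed.

Lemma dotZr c x v : dot v (c *: x) = c * dot v x.
Proof. by rewrite dotC dotZl dotC. Qed.

Lemma dotNl x v : dot (- x) v = - dot x v.
Proof. by rewrite -scaleN1r dotZl mulN1r. Qed.

Lemma dotNr x v : dot v (- x) = - dot v x.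
Proof. by rewrite dotC dotNl dotC. Qed.

Lemma dotBl x y v : dot (x - y) v = dot x v - dot y v.
Proof. by rewrite dotDl dotNl. Qed.

Lemma dotBr x y v : dot v (x - y) = dot v x - dot v y.
Proof. by rewrite dotDr dotNr. Qed.

Lemma dot0l v : dot 0 v = 0.
Proof. by rewrite /dot mul0mx mxE. Qed.

Lemma dot0r v : dot v 0 = 0.
Proof. by rewrite dotC dot0l. Qed.

Lemma dot_delta v i : dot v (delta_mx 0 i) = v 0 i.
Proof.
rewrite dotE (bigD1 i)//= mxE !eqxx mulr1 big1 ?addr0// => k ki.
by rewrite mxE (negbTE ki) mulr0.
Qed.

Lemma dotxx_ge0 x : 0 <= dot x x.
Proof. by rewrite dotE sumr_ge0// => i _; rewrite -expr2 sqr_ge0. Qed.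

Lemma dotxx_eq0 x : (dot x x == 0) = (x == 0).
Proof.
apply/eqP/eqP => [|->]; last by rewrite dot0l.
rewrite dotE => /psumr_eq0P x0; apply/rowP => i; rewrite mxE.
by apply/eqP; rewrite -sqrf_eq0 expr2 x0// => j _; rewrite -expr2 sqr_ge0.
Qed.

Lemma dotxx_gt0 x : (0 < dot x x) = (x != 0).
Proof. by rewrite lt_def dotxx_ge0 andbT dotxx_eq0. Qed.

Lemma eucl_ge0 x : 0 <= eucl x.
Proof. exact: sqrtr_ge0. Qed.

Lemma sqr_eucl x : eucl x ^+ 2 = dot x x.
Proof. by rewrite sqr_sqrtr// dotxx_ge0. Qed.

Lemma eucl_gt0 x : (0 < eucl x) = (x != 0).
Proof. by rewrite sqrtr_gt0 dotxx_gt0. Qed.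

Lemma eucl_eq0 x : (eucl x == 0) = (x == 0).
Proof.
by apply: negb_inj; rewrite -eucl_gt0 lt_def eucl_ge0 andbT.
Qed.

Lemma euclZ c x : eucl (c *: x) = `|c| * eucl x.
Proof.
by rewrite /eucl dotZl dotZr mulrA -expr2 sqrtrM ?sqr_ge0// sqrtr_sqr.
Qed.

Lemma dot_CS x v : dot x v ^+ 2 <= dot x x * dot v v.
Proof.
have [->|v0] := eqVneq v 0; first by rewrite !dot0r expr0n mulr0.
have := dotxx_ge0 (dot v v *: x - dot x v *: v).
rewrite !(dotBl, dotBr, dotZl, dotZr) (dotC v x).
have vv : 0 < dot v v by rewrite dotxx_gt0.
set a := dot x v; set b := dot x x; set d := dot v v => h.
rewrite -subr_ge0 -(pmulr_rge0 _ vv).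
by move: h; congr (_ <= _); rewrite /d; ring.
Qed.

Lemma ler_dot x v : `|dot x v| <= eucl x * eucl v.
Proof.
rewrite -(ler_pXn2r (n := 2)) ?nnegrE ?mulr_ge0 ?eucl_ge0//.
by rewrite -normrX exprMn !sqr_eucl ger0_norm ?sqr_ge0 ?dot_CS.
Qed.

Lemma ler_euclD x v : eucl (x + v) <= eucl x + eucl v.
Proof.
rewrite -(ler_pXn2r (n := 2)) ?nnegrE ?addr_ge0 ?eucl_ge0//.
rewrite sqr_eucl !(dotDl, dotDr) sqrrD !sqr_eucl (dotC v x).
have := le_trans (ler_norm _) (ler_dot x v); lra.
Qed.

Lemma euclN x : eucl (- x) = eucl x.
Proof. by rewrite /eucl dotNl dotNr opprK. Qed.

Lemma ler_coord_eucl x i : `|x 0 i| <= eucl x.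
Proof.
rewrite -(ler_pXn2r (n := 2)) ?nnegrE ?eucl_ge0// -normrX ger0_norm ?sqr_ge0//.
rewrite sqr_eucl dotE (bigD1 i)//= -expr2 lerDl sumr_ge0// => k _.
by rewrite -expr2 sqr_ge0.
Qed.

Lemma ler_norm_eucl x : `|x| <= eucl x.
Proof.
rewrite [leLHS]/Num.norm /= mx_normrE; apply: bigmax_le; first exact: eucl_ge0.
by case=> i j _ /=; rewrite ord1 ler_coord_eucl.
Qed.

Lemma sphereE w : sphere w <-> dot w w = 1.
Proof.
rewrite /sphere /=; split => [w1|w1]; first by rewrite -sqr_eucl w1 expr1n.
by rewrite /eucl w1 sqrtr1.
Qed.

Lemma sphere_neq0 w : sphere w -> w != 0.
Proof. by move=> w1; rewrite -eucl_gt0 w1. Qed.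

Lemma sphere_normalize x : x != 0 -> sphere ((eucl x)^-1 *: x).
Proof.
move=> x0; rewrite /sphere /= euclZ ger0_norm ?invr_ge0 ?eucl_ge0//.
by rewrite mulVf// eucl_eq0.
Qed.

Lemma radial_extE T (f : V -> T) w : sphere w -> radial_ext f w = f w.
Proof. by rewrite /radial_ext => ->; rewrite invr1 scale1r. Qed.

Lemma radial_extZ T (f : V -> T) c x : 0 < c ->
  radial_ext f (c *: x) = radial_ext f x.
Proof.
move=> c0; rewrite /radial_ext euclZ gtr0_norm// invfM scalerA mulrAC.
by rewrite mulVf ?mul1r ?gt_eqF.
Qed.

Lemma differentiable_dotxx x : differentiable (fun y => dot y y) x.
Proof.
have -> : (fun y => dot y y) = \sum_i (fun y => y 0 i * y 0 i).
  by apply/funext => y; rewrite dotE fct_sumE.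
apply: differentiable_sum => i.
exact/differentiableM/differentiable_coord/differentiable_coord.
Qed.

Lemma differentiable_eucl x : x != 0 -> differentiable (@eucl R n) x.
Proof.
move=> x0; apply: (@differentiable_comp _ _ _ _ (fun y => dot y y) Num.sqrt).
  exact: differentiable_dotxx.
apply/derivable1_diffP.
by case: (@is_derive1_sqrt R (dot x x)); rewrite ?dotxx_gt0.
Qed.

Lemma continuous_eucl : continuous (@eucl R n).
Proof.
move=> x; apply: (@continuous_comp _ _ _ (fun y => dot y y) Num.sqrt).
  exact/differentiable_continuous/differentiable_dotxx.
exact: sqrt_continuous.
Qed.

Lemma sphere_closed : closed (@sphere R n).
Proof.
have -> : @sphere R n = @eucl R n @^-1` [set 1] by [].
apply: closed_comp => [x _|]; first exact: continuous_eucl.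
exact: closed_eq.
Qed.

Lemma sphere_compact : compact (@sphere R n).
Proof.
apply: bounded_closed_compact; last exact: sphere_closed.
exists 1; split => // M M1 w w1 /=.
by rewrite (le_trans (ler_norm_eucl w))// w1 ltW.
Qed.

Lemma sphere_measurable : measurable (@sphere R n : set (borelRn R n)).
Proof.
rewrite -[X in measurable X]setCK; apply: measurableC.
by apply: sub_sigma_algebra; apply: closed_openC; exact: sphere_closed.
Qed.

Lemma near_neq0 x : x != 0 -> \forall y \near x, y != 0.
Proof.
rewrite -eucl_gt0 => x0.
by apply: filterS (cvgr_gt _ (@continuous_eucl x) _ x0) => y; rewrite eucl_gt0.
Qed.

(** Only the values of [f] on the sphere are meaningful, so the condition bears on the radial
    extension; this turns continuity relative to the sphere into continuity at points of R^n. *)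
Definition scont (f : V -> R) := forall w, sphere w ->
  {for w, continuous (radial_ext f)}.

Lemma scont_cst c : scont (cst c).
Proof. by move=> w _; exact: (@cst_continuous V R c w). Qed.

Lemma scontD f g : scont f -> scont g -> scont (fun w => f w + g w).
Proof. by move=> cf cg w w1; exact: (continuousD (cf w w1) (cg w w1)). Qed.

Lemma scontN f : scont f -> scont (fun w => - f w).
Proof. by move=> cf w w1; exact: (continuousN (cf w w1)). Qed.

Lemma scontB f g : scont f -> scont g -> scont (fun w => f w - g w).
Proof. by move=> cf cg; apply: scontD => //; exact: scontN. Qed.

Lemma scontM f g : scont f -> scont g -> scont (fun w => f w * g w).
Proof. by move=> cf cg w w1; exact: (continuousM (cf w w1) (cg w w1)). Qed.

Lemma scontZ c f : scont f -> scont (fun w => c * f w).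
Proof. by move=> cf; apply: scontM => //; exact: scont_cst. Qed.

Lemma scontX f k : scont f -> scont (fun w => f w ^+ k).
Proof.
move=> cf; elim: k => [|k ih]; first exact: scont_cst.
by under [X in scont X]funext do rewrite exprS; exact: scontM.
Qed.

Lemma scont_sum (I : Type) (r : seq I) (P : pred I) (f : I -> V -> R) :
  (forall i, scont (f i)) -> scont (fun w => \sum_(i <- r | P i) f i w).
Proof.
move=> cf; elim: r => [|i r ih].
  by under [X in scont X]funext do rewrite big_nil; exact: scont_cst.
under [X in scont X]funext do rewrite big_cons.
by case: (P i) => //; exact: scontD.
Qed.

Lemma scont_comp f (h : R -> R) : continuous h -> scont f ->
  scont (fun w => h (f w)).
Proof.
move=> ch cf w w1.
exact: (@continuous_comp _ _ _ (radial_ext f) h w (cf w w1) (ch _)).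
Qed.

Lemma scont_coord i : scont (fun w => w 0 i).
Proof.
move=> w w1.
have h : {for w, continuous (fun x : V => (eucl x)^-1 * x 0 i)}.
  apply: continuousM; last exact/differentiable_continuous/differentiable_coord.
  by apply: continuousV; [rewrite w1 oner_neq0|exact: continuous_eucl].
move: h; rewrite /prop_for /continuous_at /radial_ext mxE.
by rewrite (_ : (fun x : V => ((eucl x)^-1 *: x) 0 i) = fun x => (eucl x)^-1 * x 0 i)//;
    apply/funext => x; rewrite mxE.
Qed.

Lemma scont_dot v : scont (dot ^~ v).
Proof.
under [X in scont X]funext do rewrite dotE.
by apply: scont_sum => i; apply: scontM; [exact: scont_coord|exact: scont_cst].
Qed.

Lemma scont_bounded f : scont f ->
  exists2 M : R, 0 < M & forall w, sphere w -> `|f w| <= M.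
Proof.
move=> cf.
have cc : {within @sphere R n, continuous (radial_ext f)}.
  by apply: continuous_in_subspaceT => w /set_mem w1; exact: cf.
have [M [Mreal hM]] := compact_bounded (continuous_compact cc sphere_compact).
exists (`|M| + 1); first by rewrite ltr_wpDl.
move=> w w1; apply: (hM (`|M| + 1)); first by rewrite (le_lt_trans (ler_norm M))// ltrDl.
by exists w => //; rewrite radial_extE.
Qed.

Lemma scont_measurable f : scont f ->
  measurable_fun (@sphere R n : set (borelRn R n)) f.
Proof.
move=> cf; apply: (measurability _ (measurable_realfun.RGenOpens.measurableE R)) => //.
move=> /= _ [_ [a [b ->] <-]].
(* The preimage itself need not be open, but by continuity its interior contains all of its points
   that lie on the sphere. *)
pose O := (radial_ext f @^-1` `]a, b[)°.
have -> : sphere `&` f @^-1` `]a, b[ = @sphere R n `&` O.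
  apply/seteqP; split => w [w1 fw]; split => //.
    apply: (cf w w1); rewrite radial_extE//.
    by apply: open_nbhs_nbhs; split => //; exact: interval_open.
  by move/interior_subset: fw; rewrite /= radial_extE.
apply: measurableI; first exact: sphere_measurable.
by apply: sub_sigma_algebra; exact: open_interior.
Qed.

End Geometry.

Fact sint_key : unit. Proof. exact: tt. Qed.
Definition sint {R : realType} {n : nat} :=
  locked_with sint_key
    (fun (mu : {finite_measure set (borelRn R n) -> \bar R}) (f : 'rV[R]_n -> R) =>
       \int[mu]_(w in sphere) f w).

Lemma sintE {R : realType} {n : nat}
    (mu : {finite_measure set (borelRn R n) -> \bar R}) (f : 'rV[R]_n -> R) :
  sint mu f = \int[mu]_(w in sphere) f w.
Proof. by rewrite /sint unlock. Qed.

Section Integral.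
Context {R : realType} {n : nat}.
Local Notation V := 'rV[R]_n.
Variable mu : {finite_measure set (borelRn R n) -> \bar R}.
Local Notation I := (sint mu).
Implicit Types (f g : V -> R).

Lemma scont_integrable f : scont f ->
  mu.-integrable (@sphere R n : set (borelRn R n)) (EFin \o f).
Proof.
move=> cf; have [M M0 hM] := scont_bounded cf.
apply: measurable_bounded_integrable => //.
- exact: sphere_measurable.
- by rewrite ltey_eq fin_num_measure//; exact: sphere_measurable.
- exact: scont_measurable.
- exists M; split => //; first exact: gtr0_real.
  by move=> K MK w w1 /=; rewrite (le_trans (hM w w1))// ltW.
Qed.

Lemma eq_sint f g : (forall w, sphere w -> f w = g w) -> I f = I g.
Proof. by move=> fg; rewrite !sintE; apply: eq_Rintegral => w /set_mem; exact: fg. Qed.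

Lemma sintD f g : scont f -> scont g -> I (fun w => f w + g w) = I f + I g.
Proof.
move=> cf cg; rewrite !sintE RintegralD//; try exact: scont_integrable.
exact: sphere_measurable.
Qed.

Lemma sintZ c f : scont f -> I (fun w => c * f w) = c * I f.
Proof.
move=> cf; rewrite !sintE RintegralZl//; last exact: scont_integrable.
exact: sphere_measurable.
Qed.

Lemma sintN f : scont f -> I (fun w => - f w) = - I f.
Proof.
move=> cf; rewrite -mulN1r -sintZ//.
by apply: eq_sint => w _; rewrite mulN1r.
Qed.

Lemma sintB f g : scont f -> scont g -> I (fun w => f w - g w) = I f - I g.
Proof. by move=> cf cg; rewrite sintD ?sintN//; exact: scontN. Qed.

Lemma sint_sum (J : Type) (r : seq J) (P : pred J) (f : J -> V -> R) :
  (forall i, scont (f i)) ->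
  I (fun w => \sum_(i <- r | P i) f i w) = \sum_(i <- r | P i) I (f i).
Proof.
move=> cf; elim: r => [|i r ih].
  under eq_fun do rewrite big_nil.
  by rewrite big_nil sintE Rintegral_cst ?mul0r//; exact: sphere_measurable.
under eq_fun do rewrite big_cons; rewrite big_cons -ih.
by case: (P i) => //; rewrite sintD//; exact: scont_sum.
Qed.

Lemma sint_ge0 f : (forall w, sphere w -> 0 <= f w) -> 0 <= I f.
Proof. by move=> f0; rewrite sintE; apply: Rintegral_ge0. Qed.

Lemma ler_sint f g : scont f -> scont g ->
  (forall w, sphere w -> f w <= g w) -> I f <= I g.
Proof.
move=> cf cg fg; rewrite !sintE; apply: le_Rintegral => //; try exact: scont_integrable.
exact: sphere_measurable.
Qed.

Lemma sint_cst c : I (cst c) = c * fine (mu sphere).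
Proof. by rewrite sintE Rintegral_cst//; exact: sphere_measurable. Qed.

(** The integral of [m (x f + y g)^2] is a nonnegative quadratic form in [(x, y)], so its
    discriminant has a sign. *)
Lemma sint_CS (m f g : V -> R) : scont m -> scont f -> scont g ->
  (forall w, sphere w -> 0 <= m w) ->
  I (fun w => m w * (f w * g w)) ^+ 2
    <= I (fun w => m w * f w ^+ 2) * I (fun w => m w * g w ^+ 2).
Proof.
move=> cm cf cg m0.
set a := I (fun w => m w * (f w * g w)).
set b := I (fun w => m w * f w ^+ 2); set d := I (fun w => m w * g w ^+ 2).
have H x y : 0 <= x ^+ 2 * b + 2 * x * y * a + y ^+ 2 * d.
  have : 0 <= I (fun w => m w * (x * f w + y * g w) ^+ 2).
    by apply: sint_ge0 => w w1; rewrite mulr_ge0 ?m0 ?sqr_ge0.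
  rewrite (_ : I _ = I (fun w => (x ^+ 2 * (m w * f w ^+ 2) +
    2 * x * y * (m w * (f w * g w))) + y ^+ 2 * (m w * g w ^+ 2))); last first.
    by apply: eq_sint => w _; ring.
  have c1 : scont (fun w => m w * f w ^+ 2) by apply: scontM => //; exact: scontX.
  have c2 : scont (fun w => m w * g w ^+ 2) by apply: scontM => //; exact: scontX.
  have c3 : scont (fun w => m w * (f w * g w)) by apply: scontM => //; exact: scontM.
  rewrite sintD; [|by apply: scontD; exact: scontZ|exact: scontZ].
  by rewrite sintD; [|exact: scontZ|exact: scontZ]; rewrite !sintZ.
have b0 : 0 <= b by have := H 1 0; rewrite expr1n expr0n /=; lra.
have d0 : 0 <= d by have := H 0 1; rewrite expr1n expr0n /=; lra.
have := H d (- a); have := H (- a) b.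
have [d1|] := ltP 0 d.
  move=> _ h; rewrite -subr_ge0 -(pmulr_rge0 _ d1).
  by move: h; congr (_ <= _); ring.
move=> d1; have d2 : d = 0 by apply/eqP; rewrite eq_le d1.
rewrite d2 mulr0 => h _.
rewrite mulr0; have [->|a0] := eqVneq a 0; first by rewrite expr0n.
(* When [d] is 0 and [a] is not, these coefficients give the form the value [- a ^- 2], which is
   negative. *)
have := H (- a * (a ^- 2)) ((b + 1) * (a ^- 2) / 2); rewrite d2 mulr0 addr0.
have -> : 2 * (- a * (a ^- 2)) * ((b + 1) * (a ^- 2) / 2) * a = - ((b + 1) * a ^- 2).
  by field.
have -> : (- a * (a ^- 2)) ^+ 2 * b = b * a ^- 2 by field.
by rewrite mulrDl mul1r opprD addrA subrr add0r oppr_ge0 invr_le0 leNgt exprn_even_gt0.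
Qed.

End Integral.

(** * Smooth functions on the sphere *)

(** Applied to the difference of two functions that agree away from the origin, it carries
    differentiability from one to the other. *)
Lemma near0_diff (K : numFieldType) (U W : normedModType K) (F : U -> W) x :
  (\near x, F x = 0) -> differentiable F x.
Proof.
move=> F0.
have h : F \o shift x = cst (F x) + (\0 : {linear U -> W}) +o_ 0 id.
  apply/eqaddoP => _ /posnumP[e].
  have : \forall y \near 0, F (y + x) = 0 by rewrite (near_shift x) /=; near=> y;
    rewrite /= sub0r addrNK; near: y.
  apply: filterS => y /= Fy; rewrite !fctE/= Fy (nbhs_singleton F0).
  by rewrite addr0 subr0 normr0 mulr_ge0.
have d0 : 'd F x = (\0 : {linear U -> W}) :> (U -> W).
  by apply: diff_unique => // y; exact: cst_continuous.
by apply/diff_locallyP; rewrite d0; split => // y; exact: cst_continuous.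
Unshelve. all: by end_near. Qed.

Section Calculus.
Context {R : realType} {n : nat}.
Local Notation V := 'rV[R]_n.
Local Notation e_ i := (delta_mx 0 i : V).
Implicit Types (F G : V -> R) (f g : V -> R) (x v w : V) (c : R) (i j : 'I_n).

(** Away from the origin, where radial extensions can be smooth. The recursion on the order gives
    the inductions for products, inverses and exponentials that the lists of indices in [smooth] do
    not give directly; the derivative taken first is the last index of the list. *)
Fixpoint Ck k F : Prop := (forall x, x != 0 -> differentiable F x) /\
  if k is k'.+1 then forall i, Ck k' ('D_(e_ i) F) else True.

Lemma Ck_diff k F x : Ck k F -> x != 0 -> differentiable F x.
Proof. by case: k => [|k] [dF _] /dF. Qed.

Lemma CkP k F : Ck k F <-> forall l : seq 'I_n, (size l <= k)%N ->
  forall x, x != 0 -> differentiable (partials l F) x.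
Proof.
elim: k F => [|k ih] F; split => [CF l|CF].
- by rewrite leqn0 size_eq0 => /eqP -> x x0 /=; exact: (Ck_diff CF).
- by split => // x x0; exact: (CF [::]).
- case/lastP: l => [_ x x0|l i]; first exact: (Ck_diff CF).
  rewrite size_rcons ltnS => lk x x0; rewrite /partials foldr_rcons.
  by case: CF => _ /(_ i)/ih/(_ l lk x x0).
- split; first by move=> x x0; exact: (CF [::]).
  move=> i; apply/ih => l lk x x0.
  by have := CF (rcons l i); rewrite size_rcons /partials foldr_rcons; apply.
Qed.

Lemma smoothP f : smooth f <-> forall k, Ck k (radial_ext f).
Proof.
split=> [sf k|sf l x x0]; first by apply/CkP => l _ x x0; exact: sf.
by move/CkP : (sf (size l)); apply.
Qed.

Lemma eq_derive_off0 F G v x : (forall y, y != 0 -> F y = G y) -> x != 0 ->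
  'D_v F x = 'D_v G x.
Proof.
move=> FG x0; have [->|v0] := eqVneq v 0; first by rewrite !derive0.
apply: near_eq_derive => //.
by near=> y; apply: FG; near: y; exact: near_neq0.
Unshelve. all: by end_near. Qed.

Lemma eq_diff_off0 F G x : (forall y, y != 0 -> F y = G y) -> x != 0 ->
  differentiable F x -> differentiable G x.
Proof.
move=> FG x0 dF.
have -> : G = F + (G - F) by apply/funext => y /=; rewrite !fctE addrC subrK.
apply: differentiableD => //; apply: near0_diff.
by near=> y; rewrite !fctE FG ?subrr//; near: y; exact: near_neq0.
Unshelve. all: by end_near. Qed.

Lemma eq_Ck k F G : (forall y, y != 0 -> F y = G y) -> Ck k F -> Ck k G.
Proof.
elim: k F G => [|k ih] F G FG [dF CF]; split => //.
- by move=> x x0; apply: (eq_diff_off0 FG x0); exact: dF.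
- by move=> x x0; apply: (eq_diff_off0 FG x0); exact: dF.
- move=> i; apply: ih (CF i) => y y0; exact: eq_derive_off0.
Qed.

Lemma CkS k F : Ck k.+1 F -> Ck k F.
Proof.
elim: k F => [|k ih] F [dF CF]; split => // i.
exact: ih (CF i).
Qed.

Lemma Ck_cst k c : Ck k (cst c).
Proof.
elim: k c => [|k ih] c; split => //.
by move=> i; apply: eq_Ck (ih 0) => y _; rewrite derive_cst.
Qed.

Lemma CkD k F G : Ck k F -> Ck k G -> Ck k (fun x => F x + G x).
Proof.
elim: k F G => [|k ih] F G [dF CF] [dG CG]; split => //.
- by move=> x x0; apply: differentiableD; [exact: dF|exact: dG].
- by move=> x x0; apply: differentiableD; [exact: dF|exact: dG].
- move=> i; apply: eq_Ck (ih _ _ (CF i) (CG i)) => y y0.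
  by rewrite deriveD//; apply: diff_derivable; [exact: dF|exact: dG].
Qed.

Lemma CkM k F G : Ck k F -> Ck k G -> Ck k (fun x => F x * G x).
Proof.
elim: k F G => [|k ih] F G CF CG; split => //.
- by move=> x x0; apply: differentiableM; [exact: (Ck_diff CF)|exact: (Ck_diff CG)].
- by move=> x x0; apply: differentiableM; [exact: (Ck_diff CF)|exact: (Ck_diff CG)].
- move=> i; have [_ /(_ i) CFi] := CF; have [_ /(_ i) CGi] := CG.
  apply: eq_Ck (CkD (ih _ _ (CkS CF) CGi) (ih _ _ (CkS CG) CFi)) => y y0.
  rewrite deriveM//; apply: diff_derivable; [exact: (Ck_diff CF)|exact: (Ck_diff CG)].
Qed.

Lemma derive_expR F v x : differentiable F x ->
  'D_v (fun y => expR (F y)) x = expR (F x) * 'D_v F x.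
Proof.
move=> dF.
have de : differentiable expR (F x) by apply/derivable1_diffP/derivable_expR.
rewrite deriveE; last exact: (@differentiable_comp _ _ _ _ F expR).
rewrite (@diff_comp _ _ _ _ F expR)//= deriveE//.
have -> : 'd expR (F x) = (fun h => h *: expR (F x)) :> (R -> R).
  by rewrite diff1E//; apply/funext => h; rewrite derive1E; rewrite derive_val.
by rewrite /GRing.scale/= mulrC.
Qed.

Lemma Ck_exp k F : Ck k F -> Ck k (fun x => expR (F x)).
Proof.
elim: k F => [|k ih] F CF; split => //.
- move=> x x0; apply: (@differentiable_comp _ _ _ _ F expR); first exact: (Ck_diff CF).
  exact/derivable1_diffP/derivable_expR.
- move=> x x0; apply: (@differentiable_comp _ _ _ _ F expR); first exact: (Ck_diff CF).
  exact/derivable1_diffP/derivable_expR.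
- move=> i; have [_ /(_ i) CFi] := CF.
  apply: eq_Ck (CkM (ih _ (CkS CF)) CFi) => y y0.
  by rewrite derive_expR//; exact: (Ck_diff CF).
Qed.

Lemma derive_coord v x i : 'D_v (fun y : V => y 0 i) x = v 0 i.
Proof.
have := derive_mx (@derivable_id R V x v); rewrite derive_id => /matrixP/(_ 0 i).
by rewrite mxE => ->.
Qed.

Lemma Ck_coord k i : Ck k (fun x : V => x 0 i).
Proof.
case: k => [|k]; split => //.
- by move=> x _; exact: differentiable_coord.
- by move=> x _; exact: differentiable_coord.
- move=> j; apply: eq_Ck (Ck_cst k ((e_ j) 0 i)) => y _.
  by rewrite derive_coord.
Qed.

Lemma derive_eucl v x : x != 0 -> 'D_v (@eucl R n) x = dot x v / eucl x.
Proof.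
move=> x0; have de := differentiable_eucl x0.
have h : 'D_v (fun y : V => eucl y * eucl y) x = 2 * dot x v.
  rewrite (_ : (fun y => _) = \sum_i (fun y : V => y 0 i * y 0 i)); last first.
    by apply/funext => y; rewrite fct_sumE -expr2 sqr_eucl dotE.
  have dc i : derivable (fun y : V => y 0 i) x v.
    exact/diff_derivable/differentiable_coord.
  rewrite derive_sum; last by move=> i; exact: derivableM.
  rewrite dotE mulr_sumr; apply: eq_bigr => i _.
  by rewrite deriveM// derive_coord/= /GRing.scale/=; ring.
move: h; rewrite deriveM; [|exact: diff_derivable..].
rewrite /GRing.scale/= => h.
have e0 : eucl x != 0 by rewrite eucl_eq0.
by apply: (mulfI e0); rewrite mulrCA divff// mulr1; lra.
Qed.

(** The i-th partial derivative of 1/|x| is [- x_i |x|^-3], a product of a coordinate and of copies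
    of the function itself, hence the induction. *)
Lemma Ck_Veucl k : Ck k (fun x : V => (eucl x)^-1).
Proof.
have dV x : x != 0 -> differentiable (fun x : V => (eucl x)^-1) x.
  by move=> x0; apply: differentiableV; [exact: differentiable_eucl|rewrite eucl_eq0].
elim: k => [|k ih]; split => // i.
apply: eq_Ck (CkM (CkM (CkM ih ih) ih) (CkM (Ck_cst k (-1)) (Ck_coord k i))).
move=> x x0.
rewrite deriveV ?eucl_eq0//; last exact/diff_derivable/differentiable_eucl.
rewrite derive_eucl// dot_delta /cst /GRing.scale/=.
by field; rewrite eucl_eq0.
Qed.

Lemma Ck_eucl k : Ck k (@eucl R n).
Proof.
have CS : Ck k (fun x : V => \sum_(i <- enum 'I_n) x 0 i * x 0 i).
  elim: (enum _) => [|i r ih].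
    by apply: eq_Ck (Ck_cst k 0) => y _; rewrite big_nil.
  apply: eq_Ck (CkD (CkM (Ck_coord k i) (Ck_coord k i)) ih) => y _.
  by rewrite big_cons.
apply: eq_Ck (CkM CS (Ck_Veucl k)) => x x0.
by rewrite big_enum/= -dotE -sqr_eucl expr2 mulfK ?eucl_eq0.
Qed.

Lemma smooth_cst c : smooth (cst c : V -> R).
Proof. by apply/smoothP => k; exact: Ck_cst. Qed.

Lemma smoothD f g : smooth f -> smooth g -> smooth (fun w => f w + g w).
Proof. by move=> /smoothP sf /smoothP sg; apply/smoothP => k; exact: CkD (sf k) (sg k). Qed.

Lemma smoothM f g : smooth f -> smooth g -> smooth (fun w => f w * g w).
Proof. by move=> /smoothP sf /smoothP sg; apply/smoothP => k; exact: CkM (sf k) (sg k). Qed.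

Lemma smoothZ c f : smooth f -> smooth (fun w => c * f w).
Proof. by move=> sf; apply: smoothM => //; exact: smooth_cst. Qed.

Lemma smoothN f : smooth f -> smooth (fun w => - f w).
Proof. by move=> /(smoothZ (-1)); under eq_fun do rewrite mulN1r. Qed.

Lemma smoothB f g : smooth f -> smooth g -> smooth (fun w => f w - g w).
Proof. by move=> sf sg; apply: smoothD => //; exact: smoothN. Qed.

Lemma smoothX f k : smooth f -> smooth (fun w => f w ^+ k).
Proof.
move=> sf; elim: k => [|k ih]; first exact: smooth_cst.
by under eq_fun do rewrite exprS; exact: smoothM.
Qed.

Lemma smooth_sum (I : Type) (r : seq I) (P : pred I) (f : I -> V -> R) :
  (forall t : I, smooth (f t)) -> smooth (fun w => \sum_(t <- r | P t) f t w).
Proof.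
move=> cf; elim: r => [|t r ih].
  by under eq_fun do rewrite big_nil; exact: smooth_cst.
under eq_fun do rewrite big_cons.
by case: (P t) => //; exact: smoothD.
Qed.

Lemma smooth_exp f : smooth f -> smooth (fun w => expR (f w)).
Proof. by move=> /smoothP sf; apply/smoothP => k; exact: Ck_exp (sf k). Qed.

Lemma smooth_coord i : smooth (fun w : V => w 0 i).
Proof.
apply/smoothP => k; apply: eq_Ck (CkM (Ck_Veucl k) (Ck_coord k i)) => y _.
by rewrite /radial_ext mxE.
Qed.

Lemma smooth_dot v : smooth (fun w : V => dot w v).
Proof.
under eq_fun do rewrite dotE.
by apply: smooth_sum => i; apply: smoothM; [exact: smooth_coord|exact: smooth_cst].
Qed.

Lemma eq_smooth f g : (forall w, sphere w -> f w = g w) -> smooth f -> smooth g.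
Proof.
move=> fg /smoothP sf; apply/smoothP => k; apply: eq_Ck (sf k) => y y0.
by rewrite /radial_ext fg//; exact: sphere_normalize.
Qed.

Lemma smooth_diff f x : smooth f -> x != 0 -> differentiable (radial_ext f) x.
Proof. by move=> sf x0; exact: (sf [::]). Qed.

Lemma smooth_scont f : smooth f -> scont f.
Proof.
move=> sf w w1; apply: differentiable_continuous.
by apply: smooth_diff => //; exact: sphere_neq0.
Qed.

Fact sd_key : unit. Proof. exact: tt. Qed.
(** On the sphere this is the i-th Euclidean component of the tangential gradient, since the
    extension does not vary along rays. Computing with scalar components avoids frames and
    charts. *)
Definition sd := locked_with sd_key (fun i f w => 'D_(e_ i) (radial_ext f) w).

Lemma sdE i f w : sd i f w = 'D_(e_ i) (radial_ext f) w.
Proof. by rewrite /sd unlock. Qed.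

Lemma sgradE f w i : sgrad f w 0 i = sd i f w.
Proof. by rewrite mxE sdE. Qed.

Lemma sdivE (A : V -> V) w : sdiv A w = \sum_i sd i (fun x => A x 0 i) w.
Proof. by apply: eq_bigr => i _; rewrite sdE. Qed.

Lemma slaplacianE f w : slaplacian f w = \sum_i sd i (sd i f) w.
Proof.
rewrite /slaplacian sdivE; apply: eq_bigr => i _.
by under eq_fun do rewrite sgradE.
Qed.

(** The extension is homogeneous of degree 0, so its derivatives are homogeneous of degree -1:
    differentiate [F (c x) = F x]. *)
Lemma derive_radialZ f v c x : smooth f -> x != 0 -> 0 < c ->
  'D_v (radial_ext f) (c *: x) = c^-1 * 'D_v (radial_ext f) x.
Proof.
move=> sf x0 c0; pose S (y : V) := c *: y.
have dS : differentiable S x by apply: differentiableZ; exact: (@ex_diff _ _ _ _ _ id id (is_diff_id x)).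
have cx : S x != 0 by rewrite scaler_eq0 negb_or gt_eqF.
have dF := smooth_diff sf cx.
have -> : 'D_v (radial_ext f) x = 'D_v (radial_ext f \o S) x.
  rewrite (_ : radial_ext f \o S = radial_ext f)//.
  by apply/funext => y; rewrite /= radial_extZ.
rewrite [in RHS]deriveE; last exact: differentiable_comp.
rewrite diff_comp//= deriveE//.
have -> : 'd S x v = c *: v.
  by rewrite -deriveE// deriveZ ?derive_id//; exact: derivable_id.
by rewrite linearZ/= /GRing.scale/= mulrA mulVf ?mul1r ?gt_eqF.
Qed.

(** By homogeneity, the radial extension of [sd i f] is |x| times the partial derivative of the
    radial extension of [f]. *)
Lemma smooth_sd i f : smooth f -> smooth (sd i f).
Proof.
move=> sf; apply/smoothP => k.
have /smoothP/(_ k.+1)[_ /(_ i) Cf] := sf.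
apply: eq_Ck (CkM (Ck_eucl k) Cf) => x x0.
rewrite [in RHS]/radial_ext sdE derive_radialZ ?invr_gt0 ?eucl_gt0//.
by rewrite invrK.
Qed.

Lemma eq_sd i f g w : sphere w -> (forall w, sphere w -> f w = g w) ->
  sd i f w = sd i g w.
Proof.
move=> w1 fg; rewrite !sdE; apply: eq_derive_off0; last exact: sphere_neq0.
by move=> y y0; rewrite /radial_ext fg//; exact: sphere_normalize.
Qed.

Lemma sd_cst i c w : sd i (cst c) w = 0.
Proof. by rewrite sdE; exact: derive_cst. Qed.

Lemma smooth_derivable f v w : smooth f -> sphere w -> derivable (radial_ext f) w v.
Proof. by move=> sf w1; exact/diff_derivable/smooth_diff/sphere_neq0. Qed.

Lemma sdD i f g w : smooth f -> smooth g -> sphere w ->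
  sd i (fun w => f w + g w) w = sd i f w + sd i g w.
Proof. by move=> sf sg w1; rewrite !sdE -deriveD//; exact: smooth_derivable. Qed.

Lemma sdM i f g w : smooth f -> smooth g -> sphere w ->
  sd i (fun w => f w * g w) w = f w * sd i g w + g w * sd i f w.
Proof.
move=> sf sg w1; rewrite !sdE -(radial_extE f w1) -(radial_extE g w1).
by rewrite -[RHS]deriveM//; exact: smooth_derivable.
Qed.

Lemma sdZ i c f w : smooth f -> sphere w ->
  sd i (fun w => c * f w) w = c * sd i f w.
Proof.
by move=> sf w1; rewrite sdM ?sd_cst ?mulr0 ?addr0//; exact: smooth_cst.
Qed.

Lemma sdN i f w : smooth f -> sphere w ->
  sd i (fun w => - f w) w = - sd i f w.
Proof.
move=> sf w1; rewrite -mulN1r -sdZ//.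
by apply: eq_sd => // y _; rewrite mulN1r.
Qed.

Lemma sdB i f g w : smooth f -> smooth g -> sphere w ->
  sd i (fun w => f w - g w) w = sd i f w - sd i g w.
Proof. by move=> sf sg w1; rewrite sdD ?sdN//; exact: smoothN. Qed.

Lemma sd_sum i (I : Type) (r : seq I) (P : pred I) (f : I -> V -> R) w :
  (forall t : I, smooth (f t)) -> sphere w ->
  sd i (fun w => \sum_(t <- r | P t) f t w) w = \sum_(t <- r | P t) sd i (f t) w.
Proof.
move=> sf w1; elim: r => [|t r ih].
  by under eq_fun do rewrite big_nil; rewrite big_nil sd_cst.
under eq_fun do rewrite big_cons; rewrite big_cons -ih.
by case: (P t) => //; rewrite sdD//; exact: smooth_sum.
Qed.

Lemma sd_exp i f w : smooth f -> sphere w ->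
  sd i (fun w => expR (f w)) w = expR (f w) * sd i f w.
Proof.
move=> sf w1; rewrite !sdE -(radial_extE f w1) -derive_expR//.
exact/smooth_diff/sphere_neq0.
Qed.

Lemma sd_coord i j w : sphere w ->
  sd i (fun w => w 0 j) w = (i == j)%:R - w 0 i * w 0 j.
Proof.
move=> w1; have w0 := sphere_neq0 w1.
have -> : sd i (fun w => w 0 j) w = 'D_(e_ i) (fun x => (eucl x)^-1 * x 0 j) w.
  by rewrite sdE; congr ('D_(_) _ w); apply/funext => x; rewrite /radial_ext mxE.
have d1 := diff_derivable (v := e_ i) (differentiable_eucl w0).
rewrite deriveM; first last.
- exact/diff_derivable/differentiable_coord.
- by apply: derivableV => //; rewrite eucl_eq0.
rewrite deriveV ?eucl_eq0// derive_eucl// dot_delta derive_coord w1 mxE eqxx/=.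
by rewrite /GRing.scale/= eq_sym; field.
Qed.

(** Euler's identity in degree 0: difference quotients at [w] in the direction [w] itself vanish. *)
Lemma sd_radial f w : smooth f -> sphere w -> \sum_i w 0 i * sd i f w = 0.
Proof.
move=> sf w1; have w0 := sphere_neq0 w1; have df := smooth_diff sf w0.
have -> : \sum_i w 0 i * sd i f w = 'D_w (radial_ext f) w.
  rewrite deriveE// [X in _ = _ X](matrix_sum_delta w) big_ord1 linear_sum.
  by apply: eq_bigr => i _; rewrite linearZ/= -deriveE// sdE.
rewrite /derive; apply/cvg_lim => //.
apply: (@cvg_trans _ (cst (0 : R) @ (0 : R)^')); last exact: cvg_cst.
apply: near_eq_cvg; near=> h.
have h1 : 0 < h + 1.
  suff : -1 < h by lra.
  by near: h; apply: nbhs_dnbhs; apply: lt_nbhsr; rewrite oppr_lt0.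
by rewrite /= -[X in h *: w + X]scale1r -scalerDl radial_extZ// subrr scaler0.
Unshelve. all: by end_near. Qed.

Lemma sd_dot i v w : sphere w ->
  sd i (fun w => dot w v) w = v 0 i - w 0 i * dot w v.
Proof.
move=> w1; under eq_fun do rewrite dotE.
rewrite sd_sum//; last by move=> j; apply: smoothM; [exact: smooth_coord|exact: smooth_cst].
rewrite dotE mulr_sumr -[X in _ = X - _](dot_delta v i) dotC dotE -sumrB.
apply: eq_bigr => j _; rewrite sdM ?sd_cst//; [|exact: smooth_coord|exact: smooth_cst].
by rewrite sd_coord// mxE eqxx/= [j == i]eq_sym; ring.
Qed.

End Calculus.

(** * Rotations and integration by parts *)

Section Orthogonal.
Context {R : realType} {n : nat}.
Local Notation V := 'rV[R]_n.
Local Notation e_ i := (delta_mx 0 i : V).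
Implicit Types (a b x y v w : V) (O : 'M[R]_n).

Lemma orthogonalP O : (forall x y, dot (x *m O) (y *m O) = dot x y) ->
  O *m O^T = 1%:M.
Proof.
move=> H; apply/matrixP => i j; have := H (e_ i) (e_ j).
rewrite [X in _ = X]dot_delta [X in _ = X]mxE eqxx/= -!rowE dotE !mxE eq_sym => <-.
by apply: eq_bigr => k _; rewrite !mxE.
Qed.

Lemma dot_orthogonal O x y : O *m O^T = 1%:M ->
  dot (x *m O) (y *m O) = dot x y.
Proof. by move=> OO; rewrite /dot trmx_mul mulmxA -(mulmxA x) OO mulmx1. Qed.

Lemma eucl_orthogonal O x : O *m O^T = 1%:M -> eucl (x *m O) = eucl x.
Proof. by move=> OO; rewrite /eucl dot_orthogonal. Qed.

Lemma sphere_orthogonal O x : O *m O^T = 1%:M ->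
  sphere (x *m O) <-> sphere x.
Proof. by move=> OO; rewrite /sphere/= eucl_orthogonal. Qed.

Lemma continuous_orthogonal O : O *m O^T = 1%:M ->
  continuous (fun x : V => x *m O).
Proof.
move=> OO x; apply/(@cvgrPdist_lt _ _ _ (nbhs x)) => e e0.
have : eucl (x - y) @[y --> x] --> eucl (x - x).
  apply: (@continuous_comp _ _ _ (fun y => x - y) (@eucl R n)); last exact: continuous_eucl.
  by apply: continuousB; [exact: cst_continuous|].
rewrite subrr => /cvgr_lt/(_ e); rewrite {1}/eucl dot0l sqrtr0 => /(_ e0).
apply: filterS => y; apply: le_lt_trans.
by rewrite -mulmxBl (le_trans (ler_norm_eucl _))// eucl_orthogonal.
Qed.

Lemma measurable_orthogonal O : O *m O^T = 1%:M ->
  measurable_fun setT ((fun x : V => x *m O) : borelRn R n -> borelRn R n).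
Proof.
move=> OO; apply: (@measurability _ _ (borelRn R n) (borelRn R n) setT _ (@open V) erefl).
move=> _ [B oB <-]; rewrite setTI; apply: sub_sigma_algebra.
by apply: open_comp => // x _; exact: continuous_orthogonal.
Qed.

Lemma sphere_transitive v w : sphere v -> sphere w ->
  exists2 O : 'M[R]_n, O *m O^T = 1%:M & v *m O = w.
Proof.
move=> v1 w1; have [->|vw] := eqVneq v w.
  by exists 1%:M; rewrite ?trmx1 mulmx1.
have [z zE] : exists z, z = v - w by eexists.
have z0 : dot z z != 0 by rewrite dotxx_eq0 zE subr_eq0.
(* The reflection in the hyperplane orthogonal to [v - w], which exchanges [v] and [w] because they
   have the same norm. *)
pose O : 'M[R]_n := 1%:M - (2 / dot z z) *: (z^T *m z).
have OE x : x *m O = x - (2 * dot x z / dot z z) *: z.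
  rewrite mulmxBr mulmx1 -scalemxAr mulmxA [x *m z^T]mx11_scalar mul_scalar_mx.
  by rewrite scalerA -/(dot x z); congr (_ - _ *: _); ring.
exists O.
  apply: orthogonalP => x y; rewrite !OE !(dotBl, dotBr, dotZl, dotZr) (dotC z y).
  by field.
rewrite OE; have -> : 2 * dot v z / dot z z = 1.
  apply: (mulIf z0); rewrite mul1r divfK// zE !(dotBl, dotBr) (dotC w v).
  by move/sphereE: v1 => ->; move/sphereE: w1 => ->; ring.
by rewrite scale1r zE subKr.
Qed.

(** For orthonormal [a] and [b], the rotation of angle [t] in their plane, written as a perturbation
    of the identity. *)
Definition rot a b (t : R) x : V :=
  x + (((cos t - 1) * dot x a - sin t * dot x b) *: a +
       ((cos t - 1) * dot x b + sin t * dot x a) *: b).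

Lemma rot_orthogonal a b t : dot a a = 1 -> dot b b = 1 -> dot a b = 0 ->
  exists2 O : 'M[R]_n, O *m O^T = 1%:M & forall x, rot a b t x = x *m O.
Proof.
move=> aa bb ab.
pose O : 'M[R]_n := 1%:M + (((cos t - 1) *: (a^T *m a) - sin t *: (b^T *m a)) +
   ((cos t - 1) *: (b^T *m b) + sin t *: (a^T *m b))).
have OE x : rot a b t x = x *m O.
  have h v y : x *m (v^T *m y) = dot x v *: y.
    by rewrite mulmxA [x *m v^T]mx11_scalar mul_scalar_mx.
  rewrite /O !(mulmxDr, mulmxBr, mulmxN) mulmx1 -!scalemxAr !h /rot !scalerA.
  by rewrite [in LHS]scalerBl [in LHS]scalerDl.
exists O => //; apply: orthogonalP => x y; rewrite -!OE /rot.
rewrite !(dotDl, dotDr, dotZl, dotZr) (dotC a y) (dotC b y) (dotC b a) aa bb ab.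
have := cos2Dsin2 t; set c := cos t; set s := sin t => cs.
set xa := dot x a; set xb := dot x b; set ya := dot y a; set yb := dot y b.
transitivity (dot x y + (c ^+ 2 + s ^+ 2 - 1) * (xa * ya + xb * yb)); first by ring.
by rewrite cs; ring.
Qed.

Lemma is_derive_rot a b (t : R) x : is_derive t 1 (fun t : R => rot a b t x)
  ((- sin t * dot x a - cos t * dot x b) *: a +
   (- sin t * dot x b + cos t * dot x a) *: b).
Proof.
have dk (k : R -> R) (v : V) : differentiable k t -> derivable (fun s => k s *: v) t 1.
  by move=> dk; apply: diff_derivable; exact: differentiableZl.
have dc := @derivable_cos R t; have ds := @derivable_sin R t.
have dcs (c d : R) : derivable (fun t : R => (cos t - 1) * c + sin t * d) t 1.
  have d0 := derivableM (derivableB dc (derivable_cst (1 : R) t 1)) (derivable_cst c t 1).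
  exact: (derivableD d0 (derivableM ds (derivable_cst d t 1))).
have d1 : derivable (fun t : R => (cos t - 1) * dot x a - sin t * dot x b) t 1.
  by have := dcs (dot x a) (- dot x b); under eq_fun do rewrite mulrN.
have d2 := dcs (dot x b) (dot x a).
have drot : derivable (fun t => rot a b t x) t 1.
  apply: derivableD; first exact: derivable_cst.
  have d1' := dk _ a (iffLR (derivable1_diffP _ _) d1).
  have d2' := dk _ b (iffLR (derivable1_diffP _ _) d2).
  exact: (derivableD d1' d2').
apply: DeriveDef => //; rewrite derive_mx//; apply/matrixP => i k.
rewrite !mxE ord1.
have -> : (fun t => rot a b t x 0 k) = fun t => x 0 k +
    (((cos t - 1) * dot x a - sin t * dot x b) * a 0 k +
       ((cos t - 1) * dot x b + sin t * dot x a) * b 0 k).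
  by apply/funext => s; rewrite !mxE.
rewrite derive_val /GRing.scale/=; ring.
Qed.

(** The infinitesimal generator of the rotations in the plane of the axes [i] and [j]. *)
Definition angular i j (f : V -> R) : V -> R :=
  fun w => w 0 i * sd j f w - w 0 j * sd i f w.

Lemma smooth_angular i j f : smooth f -> smooth (angular i j f).
Proof.
move=> sf; apply: smoothB; apply: smoothM; try exact: smooth_coord;
  exact: smooth_sd.
Qed.

Lemma is_derive_rot_coord (i j : 'I_n) (f : V -> R) w (t : R) : i != j -> smooth f -> sphere w ->
  is_derive t 1 (fun t : R => f (rot (e_ i) (e_ j) t w))
    (angular i j f (rot (e_ i) (e_ j) t w)).
Proof.
move=> ij sf w1.
have eii (k : 'I_n) : dot (e_ k) (e_ k) = 1 by rewrite dot_delta mxE !eqxx.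
have eij : dot (e_ i) (e_ j) = 0 by rewrite dot_delta mxE eqxx/= eq_sym (negbTE ij).
have r1 s : sphere (rot (e_ i) (e_ j) s w).
  have [A AA ->] := rot_orthogonal s (eii i) (eii j) eij.
  exact/sphere_orthogonal.
rewrite (_ : (fun _ => _) = radial_ext f \o (fun t => rot (e_ i) (e_ j) t w)); last first.
  by apply/funext => s /=; rewrite radial_extE.
have dr := is_derive_rot (e_ i) (e_ j) t w.
have dr' : differentiable (fun t => rot (e_ i) (e_ j) t w) t.
  exact/derivable1_diffP/(@ex_derive _ _ _ _ _ _ _ dr).
have dF := smooth_diff sf (sphere_neq0 (r1 t)).
apply: DeriveDef; first exact/diff_derivable/differentiable_comp.
rewrite deriveE; last exact: differentiable_comp.
rewrite diff_comp//= -[X in 'd _ _ X]deriveE// derive_val linearD !linearZ/=.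
rewrite -!deriveE// /angular /GRing.scale/= !sdE.
move: ('D_(e_ i) _ _) ('D_(e_ j) _ _) => Di Dj; rewrite /rot !dot_delta !mxE !eqxx/= (negbTE ij) eq_sym (negbTE ij)/=.
ring.
Qed.

End Orthogonal.

Ltac smooth_tac := repeat first [assumption | exact: smooth_coord
  | exact: smooth_dot | exact: smooth_cst | apply: smooth_sum => ?
  | apply: smooth_sd | apply: smooth_exp | apply: smoothX
  | apply: smoothN | apply: smoothD | apply: smoothM ].

Section Invariance.
Context {R : realType} {n : nat}.
Variable sigma : probability (borelRn R n) R.
Hypothesis hsigma : uniform_on_sphere sigma.
Local Notation V := 'rV[R]_n.
Local Notation e_ i := (delta_mx 0 i : V).
Local Notation I := (sint sigma).
Implicit Types (f g : V -> R) (v w : V).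

Lemma sint1 c : I (cst c) = c.
Proof.
by rewrite -[RHS]mulr1 -[X in _ = c * X]/(fine 1%E) -(proj1 hsigma); exact: sint_cst.
Qed.

Lemma ler_norm_sint f (M : R) : scont f -> (forall w, sphere w -> `|f w| <= M) ->
  `|I f| <= M.
Proof.
move=> cf fM; rewrite ler_norml; apply/andP; split.
  rewrite -(sint1 (- M)); apply: ler_sint => //; first exact: scont_cst.
  by move=> w /fM; rewrite ler_norml => /andP[].
rewrite -(sint1 M); apply: ler_sint => //; first exact: scont_cst.
by move=> w /fM; rewrite ler_norml => /andP[].
Qed.

Lemma scont_orthogonal (O : 'M[R]_n) f : O *m O^T = 1%:M -> scont f ->
  scont (fun w => f (w *m O)).
Proof.
move=> OO cf w w1.
have wO : sphere (w *m O) by exact/sphere_orthogonal.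
have -> : radial_ext (fun w => f (w *m O)) = radial_ext f \o (fun x => x *m O).
  by apply/funext => x; rewrite /radial_ext /= eucl_orthogonal// scalemxAl.
apply: (@continuous_comp _ _ _ (fun x : V => x *m O) (radial_ext f)); last exact: cf.
exact: continuous_orthogonal.
Qed.

Lemma sint_orthogonal (O : 'M[R]_n) f : O *m O^T = 1%:M -> scont f ->
  I (fun w => f (w *m O)) = I f.
Proof.
move=> OO cf; rewrite !sintE [RHS]Rintegral_mkcond [LHS]Rintegral_mkcond.
pose F : V -> R := f \_ (@sphere R n).
have -> : (fun w => f (w *m O)) \_ sphere = fun w => F (w *m O).
  apply/funext => w; rewrite /F !patchE.
  have -> // : (w *m O \in (@sphere R n)) = (w \in (@sphere R n)).
  by apply/idP/idP => /set_mem h; apply/mem_set; apply/(sphere_orthogonal w OO).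
have mF : measurable_fun setT (F : borelRn R n -> R).
  apply/(@measurable_restrictT _ _ (borelRn R n) _ _ f sphere_measurable).
  exact: scont_measurable.
have [M M0 hM] := scont_bounded cf.
have FM w : `|F w| <= M.
  rewrite /F patchE; case: ifPn => [/set_mem|_]; first exact: hM.
  by rewrite normr0 ltW.
have mO := measurable_orthogonal OO.
have /measurable_EFinP mEF := mF.
congr fine; rewrite -[LHS]/(\int[sigma]_(x in (fun x : V => x *m O) @^-1` setT)
  ((EFin \o F) \o (fun x : V => x *m O)) x)%E.
rewrite -(integral_pushforward mO) //.
  apply: eq_measure_integral => A mA _; rewrite /pushforward.
  by have [_ h] := hsigma; exact: h.
suff : sigma.-integrable (setT : set (borelRn R n)) (EFin \o (F \o (fun x : V => x *m O))) by [].
apply: measurable_bounded_integrable => //.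
- by rewrite ltey_eq fin_num_measure.
- exact: (measurableT_comp mF mO).
- exists M; split => [|K MK w _ /=]; first exact: gtr0_real.
  by rewrite (le_trans (FM _))// ltW.
Qed.

(** The integral of [f] composed with the rotation of angle t does not depend on t, so its
    derivative at 0 vanishes. The exchange with the integral rests on a uniform second order
    estimate, where [M] bounds the angular derivative of the angular derivative. *)
Lemma sint_angular (i j : 'I_n) f : i != j -> smooth f -> I (angular i j f) = 0.
Proof.
move=> ij sf; have sf1 := smooth_angular i j sf.
have sf2 := smooth_angular i j sf1.
have [M M0 hM] := scont_bounded (smooth_scont sf2).
have eii (k : 'I_n) : dot (e_ k) (e_ k) = 1 by rewrite dot_delta mxE !eqxx.
have eij : dot (e_ i) (e_ j) = 0 by rewrite dot_delta mxE eqxx/= eq_sym (negbTE ij).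
pose r t w := rot (e_ i) (e_ j) t w.
have r1 s w : sphere w -> sphere (r s w).
  rewrite /r; have [A AA ->] := rot_orthogonal s (eii i) (eii j) eij.
  by move=> w1; exact/sphere_orthogonal.
have r0 w : r 0 w = w.
  by rewrite /r /rot cos0 sin0 subrr !mul0r subrr addr0 !scale0r !addr0.
have mvt g (t : R) w : smooth g -> 0 < t -> sphere w ->
    exists2 s : R, s \in `]0, t[ & g (r t w) - g w = angular i j g (r s w) * t.
  move=> sg t0 w1.
  have dg s : s \in `]0, t[ -> is_derive s 1 (fun t => g (r t w)) (angular i j g (r s w)).
    by move=> _; exact: is_derive_rot_coord.
  have cg : {within `[0, t], continuous (fun t => g (r t w))}.
    apply: derivable_within_continuous => s _.
    exact: (@ex_derive _ _ _ _ _ _ _ (is_derive_rot_coord s ij sg w1)).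
  have [s st] := MVT t0 dg cg.
  by rewrite r0 subr0; exists s.
have key (t : R) : 0 < t -> `|I (angular i j f)| <= M * t.
  move=> t0.
  have h (w : V) : sphere w -> `|f (r t w) - f w - angular i j f w * t| <= M * t ^+ 2.
    move=> w1; have [s + ->] := mvt f t w sf t0 w1.
    rewrite in_itv/= => /andP[s0 st].
    have [u _] := mvt _ s w sf1 s0 w1.
    rewrite -mulrBl => ->; rewrite !normrM (gtr0_norm s0) (gtr0_norm t0) expr2 mulrA.
    rewrite ler_pM2r//; apply: ler_pM => //; [exact: ltW|by apply: hM; exact: r1|exact: ltW].
  have cr : scont (fun w => f (r t w)).
    rewrite /r; have [A AA AE] := rot_orthogonal t (eii i) (eii j) eij.
    by under eq_fun do rewrite AE; apply: scont_orthogonal => //; exact: smooth_scont.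
  have Ir : I (fun w => f (r t w)) = I f.
    rewrite /r; have [A AA AE] := rot_orthogonal t (eii i) (eii j) eij.
    by under eq_fun do rewrite AE; apply: sint_orthogonal => //; exact: smooth_scont.
  have c1 := smooth_scont sf; have c2 := smooth_scont sf1.
  have E : I (fun w => f (r t w) - f w - angular i j f w * t) = - (I (angular i j f) * t).
    rewrite sintB; [|exact: scontB|by apply: scontM => //; exact: scont_cst].
    rewrite sintB// Ir subrr sub0r; congr (- _).
    by under eq_fun do rewrite mulrC; rewrite sintZ// mulrC.
  have : `|I (fun w => f (r t w) - f w - angular i j f w * t)| <= M * t ^+ 2.
    apply: ler_norm_sint => //; apply: scontB; first exact: scontB.
    by apply: scontM => //; exact: scont_cst.
  by rewrite E normrN normrM (gtr0_norm t0) expr2 mulrA ler_pM2r//.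
apply/eqP; rewrite -normr_le0; apply/ler_addgt0Pr => e e0; rewrite add0r.
apply: (le_trans (key (e / M) _)); first exact: divr_gt0.
by rewrite mulrCA divff ?mulr1// gt_eqF.
Qed.

(** Because the squares of the coordinates sum to 1 and the radial derivative vanishes, [sd i f] is
    a sum over j of angular derivatives of [w_j f], which integrate to 0, plus one copy of [w_i f]
    for each of the n - 1 indices j other than i. *)
Lemma sint_sd (i : 'I_n) f : smooth f ->
  I (sd i f) = (n%:R - 1) * I (fun w => w 0 i * f w).
Proof.
move=> sf; have sx (k : 'I_n) : smooth (fun w : V => w 0 k) by exact: smooth_coord.
have E w : sphere w -> sd i f w = \sum_j (angular j i (fun w => w 0 j * f w) w +
    (i != j)%:R * (w 0 i * f w)).
  move=> w1; have := sd_radial sf w1.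
  transitivity (\sum_j (w 0 j ^+ 2 * sd i f w - w 0 i * (w 0 j * sd j f w))).
    rewrite sumrB -mulr_suml -mulr_sumr sd_radial// mulr0 subr0.
    move/sphereE: w1; rewrite dotE; under eq_bigr do rewrite -expr2.
    by move=> ->; rewrite mul1r.
  apply: eq_bigr => j _; rewrite /angular !sdM// !sd_coord//.
  by rewrite eqxx; case: (eqVneq i j) => [->|_] /=; ring.
have cf := smooth_scont sf.
have cxf : scont (fun w => w 0 i * f w) by apply: scontM => //; exact: scont_coord.
have sxf (j : 'I_n) : smooth (fun w => w 0 j * f w) by exact: smoothM.
rewrite (eq_sint _ E) sint_sum; last first.
  move=> j; apply: scontD; last exact: scontZ.
  exact/smooth_scont/smooth_angular.
rewrite (eq_bigr (fun j => (i != j)%:R * I (fun w => w 0 i * f w))); last first.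
  move=> j _; rewrite sintD ?sintZ//; [|exact/smooth_scont/smooth_angular|exact: scontZ].
  case: eqVneq => [<-|ij] /=; last by rewrite sint_angular ?add0r// eq_sym.
  rewrite mul0r addr0; rewrite (_ : angular i i _ = cst 0) ?sint1//.
  by apply/funext => w; rewrite /angular subrr.
rewrite -mulr_suml; congr (_ * _).
rewrite (bigD1 i)//= eqxx add0r (eq_bigr (fun=> 1)); last first.
  by move=> j ji; rewrite eq_sym ji.
rewrite sumr_const cardC1 card_ord -subn1 natrB//.
by case: (n) (i) => [|//] [].
Qed.

Lemma sint_div (A : 'I_n -> V -> R) : (forall i, smooth (A i)) ->
  I (fun w => \sum_i sd i (A i) w) =
  (n%:R - 1) * I (fun w => \sum_i w 0 i * A i w).
Proof.
move=> sA; rewrite sint_sum; last by move=> i; exact/smooth_scont/smooth_sd.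
rewrite sint_sum; last first.
  by move=> i; apply: scontM; [exact: scont_coord|exact: smooth_scont].
by rewrite mulr_sumr; apply: eq_bigr => i _; exact: sint_sd.
Qed.

(** For a tangent field the curvature term on the right of [sint_div] disappears; what remains is
    the product rule. *)
Lemma sint_div_tangent (A : 'I_n -> V -> R) f : smooth f ->
  (forall i, smooth (A i)) ->
  (forall w, sphere w -> \sum_i w 0 i * A i w = 0) ->
  I (fun w => f w * \sum_i sd i (A i) w) = - I (fun w => \sum_i A i w * sd i f w).
Proof.
move=> sf sA wA; have := @sint_div (fun i w => f w * A i w).
have sfA (i : 'I_n) : smooth (fun w => f w * A i w) by exact: smoothM.
have c1 : scont (fun w => f w * \sum_i sd i (A i) w).
  apply: scontM; first exact: smooth_scont.
  by apply: scont_sum => i; exact/smooth_scont/smooth_sd.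
have c2 : scont (fun w => \sum_i A i w * sd i f w).
  by apply: scont_sum => i; apply: scontM; apply: smooth_scont => //; exact: smooth_sd.
move=> /(_ sfA); rewrite [X in _ = _ * X](_ : _ = 0); last first.
  rewrite -[RHS](sint1 0); apply: eq_sint => w /wA w0.
  under eq_bigr do rewrite mulrCA.
  by rewrite -mulr_sumr w0 mulr0.
rewrite mulr0 (@eq_sint _ _ _ _ (fun w => f w * (\sum_i sd i (A i) w) + \sum_i A i w * sd i f w)).
  by rewrite sintD// => /eqP; rewrite addr_eq0 => /eqP.
move=> w w1; rewrite mulr_sumr -big_split/=; apply: eq_bigr => i _.
by rewrite sdM.
Qed.

Definition sgdot f g : V -> R := fun w => \sum_i sd i f w * sd i g w.

Lemma sgdotC f g w : sgdot f g w = sgdot g f w.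
Proof. by apply: eq_bigr => i _; rewrite mulrC. Qed.

Lemma smooth_sgdot f g : smooth f -> smooth g -> smooth (sgdot f g).
Proof. by move=> sf sg; apply: smooth_sum => i; apply: smoothM; exact: smooth_sd. Qed.

Definition slap f : V -> R := fun w => \sum_i sd i (sd i f) w.

Lemma smooth_slap f : smooth f -> smooth (slap f).
Proof. by move=> sf; apply: smooth_sum => i; do 2 apply: smooth_sd. Qed.

Lemma sint_slap f g : smooth f -> smooth g ->
  I (fun w => f w * slap g w) = - I (sgdot f g).
Proof.
move=> sf sg; rewrite /slap (@sint_div_tangent (fun i => sd i g) f sf).
- by congr (- _); apply: eq_sint => w _; exact: sgdotC.
- by move=> i; exact: smooth_sd.
- by move=> w; exact: sd_radial.
Qed.

Lemma sint_slapC f g : smooth f -> smooth g ->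
  I (fun w => f w * slap g w) = I (fun w => slap f w * g w).
Proof.
move=> sf sg; rewrite sint_slap//; under [RHS]eq_sint do rewrite mulrC.
by rewrite sint_slap//; congr (- _); apply: eq_sint => w _; exact: sgdotC.
Qed.

End Invariance.

(** * Density of polynomials *)

Section Zonal.
Context {R : realType} {n : nat}.
Variable sigma : probability (borelRn R n) R.
Hypothesis hsigma : uniform_on_sphere sigma.
Hypothesis n2 : (2 <= n)%N.
Local Notation V := 'rV[R]_n.
Local Notation I := (sint sigma).
Implicit Types (f g : V -> R) (v w : V).

Lemma n1_ge1 : 1 <= n%:R - 1 :> R.
Proof.
have : (2%:R : R) <= n%:R by rewrite ler_nat.
lra.
Qed.

Lemma sphere_exists : exists v : V, sphere v.
Proof.
case: n n2 => // k _; exists (delta_mx 0 0); apply/sphereE.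
by rewrite dot_delta mxE !eqxx.
Qed.

Lemma dot_sphere_le1 v w : sphere v -> sphere w -> -1 <= dot w v <= 1.
Proof.
by move=> v1 w1; rewrite -ler_norml (le_trans (ler_dot _ _))// v1 w1 mulr1.
Qed.

Lemma slap_dot v w : sphere w ->
  slap (fun x => dot x v) w = - (n%:R - 1) * dot w v.
Proof.
move=> w1; rewrite /slap.
rewrite (eq_bigr (fun i => - (dot w v * (1 - w 0 i ^+ 2) + w 0 i * (v 0 i - w 0 i * dot w v)))); last first.
  move=> i _; rewrite (@eq_sd _ _ i _ (fun w => v 0 i - w 0 i * dot w v) w w1); last first.
    by move=> x x1; rewrite sd_dot.
  rewrite sdB//; [|exact: smooth_cst|by apply: smoothM; [exact: smooth_coord|exact: smooth_dot]].
  rewrite sd_cst sdM//; [|exact: smooth_coord|exact: smooth_dot].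
  by rewrite sd_coord// sd_dot// eqxx/=; ring.
rewrite sumrN big_split/= -mulr_sumr sumrB.
under [X in - (_ + X)]eq_bigr do rewrite mulrBr mulrA -expr2.
rewrite sumrB -mulr_suml.
have -> : \sum_i w 0 i ^+ 2 = 1.
  by move/sphereE: w1 => <-; rewrite dotE; apply: eq_bigr => i _; rewrite expr2.
rewrite -dotE sumr_const card_ord; ring.
Qed.

Lemma sgdot_dot v f w : smooth f -> sphere w ->
  sgdot (fun x => dot x v) f w = \sum_i v 0 i * sd i f w.
Proof.
move=> sf w1; rewrite /sgdot.
rewrite (eq_bigr (fun i => v 0 i * sd i f w - dot w v * (w 0 i * sd i f w))).
  by rewrite sumrB -mulr_sumr sd_radial// mulr0 subr0.
by move=> i _; rewrite sd_dot//; ring.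
Qed.

Lemma slapM f g w : smooth f -> smooth g -> sphere w ->
  slap (fun x => f x * g x) w = f w * slap g w + g w * slap f w + 2 * sgdot f g w.
Proof.
move=> sf sg w1; rewrite /slap /sgdot !mulr_sumr -!big_split/=.
apply: eq_bigr => i _.
rewrite (@eq_sd _ _ i _ (fun x => f x * sd i g x + g x * sd i f x) w w1); last first.
  by move=> x x1; rewrite sdM.
rewrite sdD//; try by apply: smoothM => //; exact: smooth_sd.
by rewrite !sdM//; try exact: smooth_sd; ring.
Qed.

Lemma eq_slap f g w : sphere w -> (forall w, sphere w -> f w = g w) ->
  slap f w = slap g w.
Proof.
move=> w1 fg; apply: eq_bigr => i _; apply: eq_sd => // x x1.
exact: eq_sd.
Qed.

Lemma slapD f g w : smooth f -> smooth g -> sphere w ->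
  slap (fun x => f x + g x) w = slap f w + slap g w.
Proof.
move=> sf sg w1; rewrite /slap -big_split/=; apply: eq_bigr => i _.
rewrite -sdD//; try exact: smooth_sd.
by apply: eq_sd => // x x1; rewrite sdD.
Qed.

Lemma slapZ c f w : smooth f -> sphere w ->
  slap (fun x => c * f x) w = c * slap f w.
Proof.
move=> sf w1; rewrite /slap mulr_sumr; apply: eq_bigr => i _.
rewrite -sdZ//; try exact: smooth_sd.
by apply: eq_sd => // x x1; rewrite sdZ.
Qed.

Lemma slap_cst c w : sphere w -> slap (cst c) w = 0.
Proof.
move=> w1; rewrite /slap big1// => i _.
rewrite (@eq_sd _ _ i _ (cst 0) w w1) ?sd_cst// => x x1.
by rewrite sd_cst.
Qed.

Lemma slap_sum (J : Type) (r : seq J) (P : pred J) (f : J -> V -> R) w :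
  (forall t, smooth (f t)) -> sphere w ->
  slap (fun x => \sum_(t <- r | P t) f t x) w = \sum_(t <- r | P t) slap (f t) w.
Proof.
move=> sf w1; elim: r => [|t r ih].
  by under eq_fun do rewrite big_nil; rewrite big_nil (slap_cst 0).
under eq_fun do rewrite big_cons; rewrite big_cons -ih.
by case: (P t) => //; rewrite slapD//; exact: smooth_sum.
Qed.

Lemma sd_expX i f k w : smooth f -> sphere w ->
  sd i (fun x => f x ^+ k.+1) w = k.+1%:R * f w ^+ k * sd i f w.
Proof.
move=> sf w1; elim: k => [|k ih].
  by rewrite expr0 !mul1r; apply: eq_sd.
rewrite (@eq_sd _ _ i _ (fun x => f x * f x ^+ k.+1) w w1); last first.
  by move=> x _; rewrite exprS.
rewrite sdM//; last exact: smoothX.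
by rewrite ih exprS -[in RHS]natr1; ring.
Qed.

(** Green's formula against [dot w v], an eigenfunction of the Laplacian for n - 1. *)
Lemma zonal_by_parts v f : smooth f ->
  I (fun w => \sum_i v 0 i * sd i f w) = (n%:R - 1) * I (fun w => dot w v * f w).
Proof.
move=> sf; have sx := @smooth_dot R n v.
transitivity (I (sgdot f (fun x => dot x v))).
  by apply: eq_sint => w w1; rewrite sgdotC sgdot_dot.
rewrite -[LHS]opprK -sint_slap// -sintZ; last by apply: smooth_scont; smooth_tac.
rewrite -sintN; last first.
  by apply: smooth_scont; apply: smoothM => //; apply: smooth_slap.
by apply: eq_sint => w w1; rewrite slap_dot//; ring.
Qed.

(* Up to normalization, an approximate identity at v as N goes to infinity. *)
Definition cap v N : V -> R := fun w => ((1 + dot w v) / 2) ^+ N.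

Lemma smooth_cap v N : smooth (cap v N).
Proof. by rewrite /cap; smooth_tac. Qed.

Lemma cap_ge0 v N w : sphere v -> sphere w -> 0 <= cap v N w.
Proof.
move=> v1 w1; have := dot_sphere_le1 v1 w1 => /andP[h _].
by rewrite exprn_ge0// divr_ge0//; lra.
Qed.

Lemma cap_le1 v N w : sphere v -> sphere w -> cap v N w <= 1.
Proof.
move=> v1 w1; have := dot_sphere_le1 v1 w1 => /andP[h1 h2].
by rewrite exprn_ile1//; lra.
Qed.

(** Integration by parts with y = (1 + <w, v>) / 2, for which [1 - <w, v>^2 = 4 y (1 - y)]. The
    ratio of consecutive integrals tends to 1, so the mass of the caps decays slower than any
    geometric sequence. *)
Lemma sint_cap_rec v N : sphere v ->
  (N%:R + n%:R - 1) * I (cap v N.+1) = (N%:R + (n%:R - 1) / 2) * I (cap v N).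
Proof.
move=> v1; have sc := smooth_cap v; have cc k := smooth_scont (sc k).
have sx := @smooth_dot R n v; have cx := smooth_scont sx.
have sy : smooth (fun w : V => (1 + dot w v) / 2) by smooth_tac.
have := zonal_by_parts v (sc N); case: N => [|N].
  rewrite (@eq_sint _ _ _ _ (cst 0)); last first.
    move=> w _; rewrite big1// => i _.
    by rewrite (_ : cap v 0 = cst 1) ?sd_cst ?mulr0.
  rewrite sint1// => /esym/eqP; rewrite mulf_eq0 gt_eqF ?(lt_le_trans _ n1_ge1)//=.
  move=> /eqP Ix.
  have -> : I (cap v 1) = 2^-1.
    transitivity (I (fun w => 2^-1 * (dot w v * cap v 0 w) + 2^-1 * cap v 0 w)).
      by apply: eq_sint => w _; rewrite /cap expr0 expr1; field.
    rewrite sintD; [|by apply: scontZ; exact: scontM|exact: scontZ].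
    rewrite !sintZ//; last exact: scontM.
    by rewrite Ix mulr0 add0r (_ : cap v 0 = cst 1) ?sint1 ?mulr1.
  by rewrite (_ : cap v 0 = cst 1) ?sint1//; lra.
rewrite (@eq_sint _ _ _ _ (fun w => (2 * N.+1%:R) * cap v N.+1 w + (- (2 * N.+1%:R)) * cap v N.+2 w)); last first.
  move=> w w1.
  have dy i : sd i (fun w : V => (1 + dot w v) / 2) w = 2^-1 * (v 0 i - w 0 i * dot w v).
    rewrite (@eq_sd _ _ i _ (fun w => 2^-1 * (1 + dot w v)) w w1); last first.
      by move=> x _; rewrite mulrC.
    rewrite sdZ//; last by smooth_tac.
    by rewrite sdD// ?sd_cst ?add0r ?sd_dot//; exact: smooth_cst.
  rewrite (eq_bigr (fun i => N.+1%:R * cap v N w * 2^-1 * (v 0 i * v 0 i) - N.+1%:R * cap v N w * 2^-1 * dot w v * (w 0 i * v 0 i))); last first.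
    by move=> i _; rewrite sd_expX// dy /cap; ring.
  rewrite sumrB -!mulr_sumr -!dotE.
  move/sphereE: v1 => ->; rewrite /cap !exprS; set y := (1 + dot w v) / 2.
  have -> : dot w v = 2 * y - 1 by rewrite /y; field.
  by field.
rewrite sintD ?sintZ//; try exact: scontZ.
rewrite (_ : I (fun w => dot w v * cap v N.+1 w) = 2 * I (cap v N.+2) - I (cap v N.+1)); last first.
  rewrite -sintZ// -sintB//; last exact: scontZ.
  by apply: eq_sint => w _; rewrite /cap [_ ^+ N.+2]exprS; field.
move: (N.+1%:R : R) (I (cap v N.+1)) (I (cap v N.+2)) => K a b; lra.
Qed.

Lemma sint_cap_gt0 v N : sphere v -> 0 < I (cap v N).
Proof.
move=> v1; elim: N => [|N ih].
  by rewrite (_ : cap v 0 = cst 1) ?sint1.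
have n1 := n1_ge1; have N0 : 0 <= N%:R :> R by [].
rewrite -(pmulr_rgt0 _ (_ : 0 < N%:R + n%:R - 1)); last by lra.
by rewrite sint_cap_rec// mulr_gt0//; lra.
Qed.

Lemma sint_cap_indep v w N : sphere v -> sphere w -> I (cap v N) = I (cap w N).
Proof.
move=> v1 w1; have [A AA vA] := sphere_transitive v1 w1.
rewrite -[RHS](@sint_orthogonal _ _ _ hsigma A)//; last exact/smooth_scont/smooth_cap.
by apply: eq_sint => x _; rewrite /cap -vA dot_orthogonal.
Qed.

Lemma cap_concentration (q e : R) : 0 <= q < 1 -> 0 < e ->
  exists N, forall v, sphere v -> q ^+ N <= e * I (cap v N).
Proof.
move=> /andP[q0 q1] e0; have [v v1] := sphere_exists.
suff [N hN] : exists N, q ^+ N <= e * I (cap v N).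
  by exists N => w w1; rewrite (sint_cap_indep N w1 v1).
have n1 := n1_ge1.
pose a N := I (cap v N); have a0 N : 0 < a N by exact: sint_cap_gt0.
(* From [N0] on, the ratio given by [sint_cap_rec] is at least q / r with [r = (1 + q) / 2], so q^N
   divided by the mass of the cap decreases geometrically with ratio r < 1. *)
have [N0 hN0] : exists N0 : nat, n%:R - 1 <= N0%:R * (1 - q).
  exists (Num.truncn ((n%:R - 1) / (1 - q))).+1.
  rewrite -ler_pdivrMr ?subr_gt0//.
  by rewrite ltW// truncnS_gt.
pose r := (1 + q) / 2.
have step N : (N0 <= N)%N -> q ^+ N.+1 / a N.+1 <= r * (q ^+ N / a N).
  move=> N0N; have NN : N0%:R <= N%:R :> R by rewrite ler_nat.
  have NN' : n%:R - 1 <= N%:R * (1 - q).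
    by apply: le_trans hN0 _; rewrite ler_pM2r// subr_gt0.
  have N00 : 0 <= N%:R :> R by [].
  rewrite ler_pdivrMr// mulrA mulrAC ler_pdivlMr//.
  have m0 : 0 < N%:R + n%:R - 1 :> R by lra.
  rewrite -(ler_pM2l m0) exprS.
  have -> : (N%:R + n%:R - 1) * (r * q ^+ N * a N.+1) = r * q ^+ N * ((N%:R + n%:R - 1) * a N.+1) by ring.
  rewrite /a sint_cap_rec// -/(a N).
  have -> : (N%:R + n%:R - 1) * (q * q ^+ N * a N) = q ^+ N * a N * (q * (N%:R + n%:R - 1)) by ring.
  have -> : r * q ^+ N * ((N%:R + (n%:R - 1) / 2) * a N) = q ^+ N * a N * (r * (N%:R + (n%:R - 1) / 2)) by ring.
  rewrite ler_wpM2l//; first by rewrite mulr_ge0 ?exprn_ge0// ltW.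
  rewrite /r.
  have : q * (n%:R - 1) <= n%:R - 1 by rewrite ler_piMl//; lra.
  lra.
have geo k : q ^+ (N0 + k) / a (N0 + k)%N <= r ^+ k * (q ^+ N0 / a N0).
  elim: k => [|k ih]; first by rewrite addn0 expr0 mul1r.
  rewrite addnS (le_trans (step _ (leq_addr _ _)))// exprS -mulrA ler_wpM2l//.
  by rewrite /r; lra.
have [k hk] : exists k, r ^+ k * (q ^+ N0 / a N0) <= e.
  have D0 : 0 <= q ^+ N0 / a N0 by rewrite divr_ge0 ?exprn_ge0// ltW.
  have r1 : `|r| < 1 by rewrite ger0_norm /r; lra.
  have /cvgrPdist_lt/(_ (e / (q ^+ N0 / a N0 + 1))) := cvg_expr r1.
  have D1 : 0 < q ^+ N0 / a N0 + 1 by lra.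
  move=> /(_ (divr_gt0 e0 D1))[k _ /(_ k (leqnn k))] /=.
  rewrite sub0r normrN ger0_norm ?exprn_ge0//; last by rewrite /r; lra.
  rewrite ltr_pdivlMr// mulrDr mulr1 => h; exists k.
  have : 0 <= r ^+ k by rewrite exprn_ge0// /r; lra.
  lra.
have h := le_trans (geo k) hk.
by exists (N0 + k)%N; rewrite -ler_pdivrMr; [exact: h|exact: a0].
Qed.

(** The sphere is split at [dot w v = 1 - d]: near the pole [f] varies by at most [e], and elsewhere
    the cap is at most [(1 - d / 2) ^+ N]. *)
Lemma cap_average v f N (d e M : R) : sphere v -> scont f -> 0 <= d ->
  (forall w, sphere w -> `|f w| <= M) ->
  (forall w, sphere w -> 1 - d < dot w v -> `|f w - f v| <= e) -> 0 <= e -> d <= 2 ->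
  `|I (fun w => f w * cap v N w) - f v * I (cap v N)|
    <= e * I (cap v N) + 2 * M * (1 - d / 2) ^+ N.
Proof.
move=> v1 cf d0 fM fe e0 d2; have cc := smooth_scont (smooth_cap v N).
have M0 : 0 <= M by exact: le_trans (fM v v1).
rewrite -[X in _ - X]sintZ// -sintB//; [|exact: scontM|exact: scontZ].
rewrite -[X in _ <= X + _]sintZ// -(@sint1 _ _ _ hsigma (2 * M * _)).
rewrite -sintD; [|exact: scontZ|exact: scont_cst].
have bound w : sphere w -> `|f w * cap v N w - f v * cap v N w| <=
    e * cap v N w + 2 * M * (1 - d / 2) ^+ N.
  move=> w1; rewrite -mulrBl normrM (ger0_norm (cap_ge0 N v1 w1)).
  have [dw|dw] := ltP (1 - d) (dot w v).
    rewrite (le_trans (ler_wpM2r (cap_ge0 N v1 w1) (fe w w1 dw)))// lerDl.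
    by rewrite !mulr_ge0// exprn_ge0//; lra.
  rewrite -[leLHS]add0r lerD//; first by rewrite mulr_ge0// cap_ge0.
  apply: ler_pM => //; first exact: cap_ge0.
    by rewrite (le_trans (ler_normB _ _))// mulr_natl mulr2n lerD ?fM.
  have := dot_sphere_le1 v1 w1 => /andP[h1 h2].
  rewrite /cap lerXn2r// ?nnegrE; lra.
rewrite ler_norml -sintN; last first.
  by apply: scontD; [exact: scontZ|exact: scont_cst].
have c1 : scont (fun w => f w * cap v N w - f v * cap v N w).
  by apply: scontB; [exact: scontM|exact: scontZ].
have c2 : scont (fun w => e * cap v N w + 2 * M * (1 - d / 2) ^+ N).
  by apply: scontD; [exact: scontZ|exact: scont_cst].
apply/andP; split; apply: ler_sint => //; first exact: scontN.
  by move=> w /bound; rewrite ler_norml => /andP[].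
by move=> w /bound; rewrite ler_norml => /andP[].
Qed.

Lemma dot_near v w (d : R) : sphere v -> sphere w -> 1 - d ^+ 2 / 2 < dot w v -> 0 < d ->
  `|w - v| < d.
Proof.
move=> v1 w1 h d0; apply: le_lt_trans (ler_norm_eucl _) _.
rewrite -(ltr_pXn2r (n := 2))// ?nnegrE ?eucl_ge0 ?(ltW d0)//.
rewrite sqr_eucl !(dotBl, dotBr) (dotC v w).
by move/sphereE: v1 => ->; move/sphereE: w1 => ->; lra.
Qed.

(** Expresses that sigma charges every neighbourhood of every point. If [f v > 0], averaging [f]
    over a sharp cap at [v] gives a positive value, although this average is at most the integral of
    [f]. *)
Lemma sint_eq0 f : scont f -> (forall w, sphere w -> 0 <= f w) -> I f = 0 ->
  forall v, sphere v -> f v = 0.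
Proof.
move=> cf f0 If v v1; apply/eqP; rewrite eq_le f0// andbT leNgt; apply/negP => fv.
have [M M0 fM] := scont_bounded cf.
have fv2 : 0 < f v / 2 by exact: divr_gt0.
have : \forall w \near v, `|radial_ext f v - radial_ext f w| < f v / 2.
  by have /cvgrPdist_lt := cf v v1; apply.
move=> /nbhs_ballP[d /= d0 hd].
pose d' := Num.min d 1; have d'0 : 0 < d' by rewrite lt_min d0/=.
have d'1 : d' <= 1 by rewrite ge_min lexx orbT.
have d'2 : d' ^+ 2 <= 1 by rewrite exprn_ile1// ltW.
have d'3 : 0 < d' ^+ 2 by rewrite exprn_gt0.
have q1 : 0 <= 1 - d' ^+ 2 / 2 / 2 < 1 by apply/andP; split; lra.
(* With this precision the error [2 M q^N] of the cap average is a quarter of [f v] times the mass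
   of the cap; the oscillation of [f] costs one half, which leaves a quarter. *)
have e1 : 0 < f v / (8 * M) by rewrite divr_gt0// mulr_gt0.
have [N /(_ v v1) hN] := cap_concentration q1 e1.
have fe w : sphere w -> 1 - d' ^+ 2 / 2 < dot w v -> `|f w - f v| <= f v / 2.
  move=> w1 dw; rewrite distrC ltW//.
  rewrite -(radial_extE f v1) -[X in _ - X](radial_extE f w1) radial_extE//.
  rewrite -{1}(radial_extE f v1); apply: hd; rewrite -ball_normE/=.
  rewrite distrC; apply: lt_le_trans (dot_near v1 w1 dw d'0) _.
  by rewrite ge_min lexx.
have := @cap_average v f N (d' ^+ 2 / 2) (f v / 2) M v1 cf _ fM fe _ _.
have a0 := sint_cap_gt0 N v1; have cc := smooth_scont (smooth_cap v N).
have -> : I (fun w => f w * cap v N w) = 0.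
  apply/eqP; rewrite eq_le sint_ge0 ?andbT; last first.
    by move=> w w1; rewrite mulr_ge0 ?f0 ?cap_ge0.
  rewrite -If; apply: ler_sint => //; first exact: scontM.
  by move=> w w1; rewrite ler_piMr ?f0 ?cap_le1.
rewrite sub0r normrN ger0_norm; last by rewrite mulr_ge0 ?f0// ltW.
move=> h0; have h : f v * I (cap v N) <= f v / 2 * I (cap v N) + 2 * M * (1 - d' ^+ 2 / 2 / 2) ^+ N.
  by apply: h0; lra.
have : 2 * M * (1 - d' ^+ 2 / 2 / 2) ^+ N <= 2 * M * (f v / (8 * M) * I (cap v N)).
  by rewrite ler_pM2l// mulr_gt0.
have -> : 2 * M * (f v / (8 * M) * I (cap v N)) = f v / 4 * I (cap v N).
  by field; rewrite gt_eqF.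
have : 0 < f v * I (cap v N) by rewrite mulr_gt0.
lra.
Qed.

Lemma scont_unif f (e : R) : scont f -> 0 < e -> exists2 d : R, 0 < d <= 1 &
  forall v w, sphere v -> sphere w -> 1 - d < dot w v -> `|f w - f v| <= e.
Proof.
move=> cf e0.
pose P (d : R) (v : V) := sphere v -> forall w, sphere w -> `|w - v| < d -> `|f w - f v| <= e.
have e2 : 0 < e / 2 by exact: divr_gt0.
have /compact_near_coveringP/(_ R (0 : R)^'+ P _) := @sphere_compact R n.
have H v : sphere v -> \forall v' \near v & d \near (0 : R)^'+, P d v'.
  move=> v1; have : \forall w \near v, `|radial_ext f v - radial_ext f w| < e / 2.
    by have /cvgrPdist_lt := cf v v1; apply.
  move=> /nbhs_ballP[r /= r0 hr].
  exists (ball v (r / 2), [set d : R | d < r / 2]) => /=.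
    split; first by apply: nbhsx_ballx; exact: divr_gt0.
    by apply: nbhs_right_lt; exact: divr_gt0.
  move=> [v' d] /= [v'r dr] v'1 w w1 wd.
  have hv' : `|f v - f v'| < e / 2.
    rewrite -(radial_extE f v1) -(radial_extE f v'1); apply: hr.
    by apply: le_ball v'r; rewrite ler_pdivrMr// ler_pMr// ler1n.
  have hw : `|f v - f w| < e / 2.
    rewrite -(radial_extE f v1) -(radial_extE f w1); apply: hr.
    rewrite (splitr r); apply: ball_triangle v'r _.
    by rewrite -ball_normE/= distrC (lt_trans wd).
  rewrite (_ : f w - f v' = (f v - f v') - (f v - f w)); last by ring.
  by rewrite (le_trans (ler_normB _ _))//; lra.
move=> /(_ H)[] d /= d0 hd.
pose r := Num.min (d / 2) 1; have r0 : 0 < r by rewrite lt_min ltr01 divr_gt0.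
have r1 : r <= 1 by rewrite ge_min lexx orbT.
exists (r ^+ 2 / 2).
  have : r ^+ 2 <= 1 by rewrite exprn_ile1// ltW.
  have : 0 < r ^+ 2 by rewrite exprn_gt0.
  by move=> *; apply/andP; split; lra.
move=> v w v1 w1 dw.
apply: (hd r _ r0 v v1 v1 w w1); last exact: dot_near.
rewrite /= sub0r normrN gtr0_norm//.
by rewrite (le_lt_trans (_ : r <= d / 2))// ?ge_min ?lexx// ltr_pdivrMr// ltr_pMr// ltr1n.
Qed.

(* Restrictions to the sphere of polynomials of degree at most d: a polynomial is
   c + sum_i x_i q_i with q_i of degree at most d - 1. *)
Fixpoint polyS d f : Prop := match d with
  | 0%N => exists c, forall w, sphere w -> f w = c
  | d'.+1 => exists c (q : 'I_n -> V -> R), (forall i, polyS d' (q i)) /\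
      forall w, sphere w -> f w = c + \sum_i w 0 i * q i w
  end.

Lemma polySP d f : polyS d.+1 f -> exists c (q : 'I_n -> V -> R),
  (forall i, polyS d (q i)) /\ forall w, sphere w -> f w = c + \sum_i w 0 i * q i w.
Proof. by []. Qed.

Lemma eq_poly d f g : (forall w, sphere w -> f w = g w) -> polyS d f -> polyS d g.
Proof.
case: d => [|d] fg /=; first by move=> [c fc]; exists c => w w1; rewrite -fg// fc.
by move=> [c [q [qP fE]]]; exists c, q; split=> // w w1; rewrite -fg// fE.
Qed.

Lemma smooth_poly d f : polyS d f -> smooth f.
Proof.
elim: d f => [|d ih] f /=.
  by move=> [c fc]; apply: (@eq_smooth _ _ (cst c)); [move=> w w1; rewrite fc|exact: smooth_cst].
move=> [c [q [qP fE]]].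
apply: (@eq_smooth _ _ (fun w => c + \sum_i w 0 i * q i w)); first by move=> w w1; rewrite fE.
apply: smoothD; first exact: smooth_cst.
by apply: smooth_sum => i; apply: smoothM; [exact: smooth_coord|exact: ih].
Qed.

Lemma poly_cst d c : polyS d (cst c).
Proof.
elim: d c => [|d ih] c /=; first by exists c.
exists c, (fun _ => cst 0); split=> // w _.
by rewrite big1 ?addr0// => i _; rewrite mulr0.
Qed.

Lemma polyD d f g : polyS d f -> polyS d g -> polyS d (fun w => f w + g w).
Proof.
elim: d f g => [|d ih] f g /=.
  by move=> [c fc] [c' gc]; exists (c + c') => w w1; rewrite fc ?gc.
move=> [c [q [qP fE]]] [c' [q' [qP' gE]]].
exists (c + c'), (fun i w => q i w + q' i w); split => [i|w w1]; first exact: ih.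
rewrite fE// gE// addrACA -big_split/=; congr (_ + _).
by apply: eq_bigr => i _; rewrite mulrDr.
Qed.

Lemma polyZ d a f : polyS d f -> polyS d (fun w => a * f w).
Proof.
elim: d f => [|d ih] f /=.
  by move=> [c fc]; exists (a * c) => w w1; rewrite fc.
move=> [c [q [qP fE]]].
exists (a * c), (fun i w => a * q i w); split => [i|w w1]; first exact: ih.
rewrite fE// mulrDr mulr_sumr; congr (_ + _).
by apply: eq_bigr => i _; rewrite mulrCA.
Qed.

Lemma poly_sum d (J : Type) (r : seq J) (f : J -> V -> R) :
  (forall t, polyS d (f t)) -> polyS d (fun w => \sum_(t <- r) f t w).
Proof.
move=> fP; elim: r => [|t r ih].
  by apply: eq_poly (poly_cst d 0) => w _; rewrite big_nil.
by apply: eq_poly (polyD (fP t) ih) => w _; rewrite big_cons.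
Qed.

Lemma poly_lift d f : polyS d f -> polyS d.+1 f.
Proof.
elim: d f => [|d ih] f.
  move=> [c fc]; exists c, (fun _ => cst 0); split; first by move=> i; exists 0.
  by move=> w w1; rewrite big1 ?addr0 ?fc// => i _; rewrite mulr0.
by move=> [c [q [qP fE]]]; exists c, q; split=> // i; exact: (ih (q i) (qP i)).
Qed.

Lemma poly_leq d d' f : (d <= d')%N -> polyS d f -> polyS d' f.
Proof.
move=> /subnK <-; elim: (d' - d)%N => [//|k ih] fP.
by rewrite addSn; apply: poly_lift; exact: ih.
Qed.

Lemma poly_coordM d i f : polyS d f -> polyS d.+1 (fun w => w 0 i * f w).
Proof.
move=> fP; exists 0, (fun j => if j == i then f else cst 0); split.
  by move=> j; case: ifP => // _; exact: poly_cst.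
move=> w w1; rewrite add0r (bigD1 i)//= eqxx big1 ?addr0// => j ji.
by rewrite (negbTE ji) mulr0.
Qed.

Lemma poly_dotM d v f : polyS d f -> polyS d.+1 (fun w => dot w v * f w).
Proof.
move=> fP; exists 0, (fun i w => v 0 i * f w); split; first by move=> i; exact: polyZ.
by move=> w _; rewrite add0r dotE mulr_suml; apply: eq_bigr => i _; rewrite mulrA.
Qed.

(** One factor (1 + <w, x>) / 2 of the cap is expanded in the coordinates of x, and the coordinate
    of w it brings is absorbed into [f]; hence the induction for all [f]. *)
Lemma poly_cap_average N f : scont f ->
  polyS N (fun x => I (fun w => f w * cap x N w)).
Proof.
elim: N f => [|N ih] f cf /=; first by exists (I (fun w => f w * 1)).
have cN x := smooth_scont (smooth_cap x N).
have cfi i : scont (fun w => w 0 i * f w) by apply: scontM => //; exact: scont_coord.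
have h1 : polyS N.+1 (fun x => 2^-1 * I (fun w => f w * cap x N w)).
  by apply: poly_lift; apply: polyZ; exact: ih.
have h2 : polyS N.+1 (fun x => \sum_i x 0 i * (2^-1 * I (fun w => (w 0 i * f w) * cap x N w))).
  exists 0, (fun i x => 2^-1 * I (fun w => (w 0 i * f w) * cap x N w)); split.
    by move=> i; apply: polyZ; exact: ih.
  by move=> w _; rewrite add0r.
apply: eq_poly (polyD h1 h2) => x _.
have c1 : scont (fun w => 2^-1 * (f w * cap x N w)) by apply: scontZ; exact: scontM.
have c2 i : scont (fun w => x 0 i * (2^-1 * (w 0 i * f w * cap x N w))).
  by apply: scontZ; apply: scontZ; exact: scontM.
rewrite -sintZ; last exact: scontM.
under eq_bigr => i _.
  rewrite -sintZ; last by apply: scontM.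
  rewrite -sintZ; last by apply: scontZ; apply: scontM.
  over.
rewrite -sint_sum// -sintD//; last exact: scont_sum.
apply: eq_sint => w _; rewrite /cap exprS; set y := (_ ^+ N).
rewrite (_ : \sum_i _ = 2^-1 * (dot w x * (f w * y))); first by field.
by rewrite dotE mulr_suml mulr_sumr; apply: eq_bigr => i _; ring.
Qed.

(** Averages over normalized caps are polynomials in the pole, and they converge uniformly as the
    exponent grows. The normalization is the same at all poles by rotation invariance. *)
Lemma poly_dense f (e : R) : scont f -> 0 < e -> exists d p, polyS d p /\
  forall w, sphere w -> `|f w - p w| <= e.
Proof.
move=> cf e0; have e2 : 0 < e / 2 by exact: divr_gt0.
have [d /andP[d0 d1] hd] := scont_unif cf e2.
have [M M0 fM] := scont_bounded cf.
have q1 : 0 <= 1 - d / 2 < 1 by apply/andP; split; lra.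
have e1 : 0 < e / (4 * M) by rewrite divr_gt0// mulr_gt0.
have [N hN] := cap_concentration q1 e1; have [v0 v01] := sphere_exists.
exists N, (fun x => (I (cap v0 N))^-1 * I (fun w => f w * cap x N w)); split.
  by apply: polyZ; exact: poly_cap_average.
move=> v v1; rewrite (sint_cap_indep N v01 v1).
have a0 := sint_cap_gt0 N v1.
have := @cap_average v f N d (e / 2) M v1 cf (ltW d0) fM (fun w => hd v w v1) (ltW e2).
have d2 : d <= 2 by lra.
move=> /(_ d2) h.
have -> : f v - (I (cap v N))^-1 * I (fun w => f w * cap v N w) =
    (f v * I (cap v N) - I (fun w => f w * cap v N w)) / I (cap v N).
  by field; rewrite gt_eqF.
rewrite normrM normfV (gtr0_norm a0) ler_pdivrMr// distrC; apply: (le_trans h).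
have : 2 * M * (1 - d / 2) ^+ N <= 2 * M * (e / (4 * M) * I (cap v N)).
  by rewrite ler_pM2l ?mulr_gt0//; exact: hN.
have -> : 2 * M * (e / (4 * M) * I (cap v N)) = e / 2 * I (cap v N).
  by field; rewrite gt_eqF.
lra.
Qed.

End Zonal.
Arguments polyS : simpl never.

(** * Spherical harmonics *)

Section Harmonics.
Context {R : realType} {n : nat}.
Variable sigma : probability (borelRn R n) R.
Hypothesis hsigma : uniform_on_sphere sigma.
Hypothesis n2 : (2 <= n)%N.
Local Notation V := 'rV[R]_n.
Local Notation I := (sint sigma).
Implicit Types (f g Y : V -> R) (v w : V).

Definition deg_eig (d : nat) : R := d%:R * (d%:R + n%:R - 2).
Local Notation md := deg_eig.

Lemma deg_eigS d : md d.+1 = md d + (2 * d%:R + n%:R - 1).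
Proof. by rewrite /md -natr1; ring. Qed.

Lemma deg_eig0 : md 0 = 0.
Proof. by rewrite /md mul0r. Qed.

Lemma deg_eig_lt d k : (d < k)%N -> md d < md k.
Proof.
move=> /subnK <-; elim: (k - d.+1)%N => [|j ih] /=.
  have := @n1_ge1 R n n2; have : 0 <= d%:R :> R by [].
  by rewrite add0n deg_eigS; lra.
apply: lt_trans ih _; rewrite addSn deg_eigS.
have := @n1_ge1 R n n2; have : 0 <= (j + d.+1)%:R :> R by [].
by lra.
Qed.

Lemma deg_eig_inj d k : md d = md k -> d = k.
Proof. by case: (ltngtP d k) => // /deg_eig_lt h e; move: h; rewrite e ltxx. Qed.

Lemma deg_eig_ge d : d%:R <= md d.
Proof.
rewrite /md; have := @n1_ge1 R n n2.
case: d => [|d]; first by rewrite !mul0r.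
rewrite -natr1 => h; rewrite ler_peMr ?addr_ge0//.
have : 0 <= d%:R :> R by []. lra.
Qed.

(** The tangential gradient is the Euclidean one minus its radial part. On the part of degree
    exactly d, Euler's identity makes the radial part d times f; everything else has degree at most
    d. *)
Lemma poly_sd d f i : polyS d f -> exists2 r, polyS d r &
  forall w, sphere w -> sd i f w = - (d%:R) * (w 0 i * f w) + r w.
Proof.
elim: d f => [|d ih] f.
  move=> [c fc]; exists (cst 0); first by exists 0.
  by move=> w w1; rewrite (@eq_sd _ _ i _ (cst c))// sd_cst oppr0 mul0r add0r.
move=> /polySP[c [q [qP fE]]]; have sq j := smooth_poly (qP j).
have /choice[r hr] : forall j, exists r, polyS d r /\
    forall w, sphere w -> sd i (q j) w = - (d%:R) * (w 0 i * q j w) + r w.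
  by move=> j; have [r rP rE] := ih _ (qP j); exists r.
exists (fun w => q i w + ((d.+1%:R * c) * (w 0 i * 1) + \sum_j w 0 j * r j w)).
  apply: polyD; first exact/poly_lift/qP.
  apply: (@polyD _ _ d.+1).
    by apply: polyZ; apply: poly_coordM; exact: poly_cst.
  by apply: (@poly_sum _ _ d.+1) => j; apply: poly_coordM; case: (hr j).
move=> w w1; have sx (j : 'I_n) : smooth (fun w : V => w 0 j) by exact: smooth_coord.
rewrite (@eq_sd _ _ i _ (fun w => c + \sum_j w 0 j * q j w) w w1 fE).
rewrite sdD ?sd_cst ?add0r//; [|exact: smooth_cst|by apply: smooth_sum => j; exact: smoothM].
rewrite sd_sum//; last by move=> j; exact: smoothM.
rewrite (eq_bigr (fun j => (i == j)%:R * q j w + ((- (d.+1%:R) * w 0 i) * (w 0 j * q j w) + w 0 j * r j w))); last first.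
  move=> j _; rewrite sdM// sd_coord//; have [_ ->]// := hr j.
  by rewrite -natr1; ring.
rewrite big_split/= (bigD1 i)//= eqxx mul1r big1 ?addr0; last first.
  by move=> j ji; rewrite eq_sym (negbTE ji) mul0r.
rewrite big_split/= -mulr_sumr fE//; ring.
Qed.

Lemma slap_coordM i f w : smooth f -> sphere w ->
  slap (fun w => w 0 i * f w) w = w 0 i * slap f w + 2 * sd i f w - (n%:R - 1) * (w 0 i * f w).
Proof.
move=> sf w1; have sx := @smooth_coord R n i.
rewrite slapM//.
rewrite (@eq_slap _ _ (fun w => w 0 i) (fun w : V => dot w (delta_mx 0 i)) w w1); last first.
  by move=> x _; rewrite dot_delta.
rewrite slap_dot// dot_delta.
have -> : sgdot (fun w : V => w 0 i) f w = sd i f w.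
  transitivity (sgdot (fun w : V => dot w (delta_mx 0 i)) f w).
    by apply: eq_bigr => j _; congr (_ * _); apply: eq_sd => // x _; rewrite dot_delta.
  rewrite sgdot_dot// (bigD1 i)//= mxE !eqxx mul1r big1 ?addr0// => j ji.
  by rewrite mxE (negbTE ji) andbF mul0r.
ring.
Qed.

(** The Laplacian is triangular for the filtration by degree, with diagonal entries [- md d]. These
    entries being distinct, polynomials can be decomposed into eigenfunctions. *)
Lemma poly_slap d f : polyS d.+1 f -> exists2 r, polyS d r &
  forall w, sphere w -> slap f w = - md d.+1 * f w + r w.
Proof.
elim: d f => [|d ih] f; move=> /polySP[c [q [qP fE]]].
  have sq j := smooth_poly (qP j).
  have sx (j : 'I_n) : smooth (fun w : V => w 0 j * q j w).
    by apply: smoothM => //; exact: smooth_coord.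
  exists (cst (md 1 * c)); first by exists (md 1 * c).
  move=> w w1; rewrite (eq_slap w1 fE) slapD//; [|exact: smooth_cst|exact: smooth_sum].
  rewrite slap_cst// add0r slap_sum// fE// mulrDr mulr_sumr addrAC.
  rewrite (_ : - md 1 * c + cst _ w = 0) ?add0r; last by rewrite /cst; ring.
  apply: eq_bigr => j _; rewrite slap_coordM//.
  have [cj qc] := qP j.
  rewrite (@eq_slap _ _ (q j) (cst cj))// slap_cst// (@eq_sd _ _ j (q j) (cst cj))// sd_cst.
  by rewrite deg_eigS deg_eig0; ring.
have sq j := smooth_poly (qP j).
have /choice[r hr] : forall j, exists r, polyS d r /\
    forall w, sphere w -> slap (q j) w = - md d.+1 * q j w + r w.
  by move=> j; have [r rP rE] := ih _ (qP j); exists r.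
have /choice[r' hr'] : forall j, exists r, polyS d.+1 r /\
    forall w, sphere w -> sd j (q j) w = - (d.+1%:R) * (w 0 j * q j w) + r w.
  by move=> j; have [r' rP rE] := poly_sd j (qP j); exists r'.
have sx (j : 'I_n) : smooth (fun w : V => w 0 j * q j w).
  by apply: smoothM => //; exact: smooth_coord.
exists (fun w => md d.+2 * c + \sum_j (w 0 j * r j w + 2 * r' j w)).
  apply: (@polyD _ _ d.+1); first exact: (@poly_cst _ _ d.+1).
  apply: (@poly_sum _ _ d.+1) => j; apply: (@polyD _ _ d.+1).
    by apply: poly_coordM; case: (hr j).
  by apply: (@polyZ _ _ d.+1); case: (hr' j).
move=> w w1; rewrite (eq_slap w1 fE) slapD//; [|exact: smooth_cst|exact: smooth_sum].
rewrite slap_cst// add0r slap_sum// fE// mulrDr mulr_sumr.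
rewrite (_ : - md d.+2 * c + _ + _ = \sum_i - md d.+2 * (w 0 i * q i w) + \sum_j (w 0 j * r j w + 2 * r' j w)); last first.
  ring.
rewrite -big_split/=; apply: eq_bigr => j _; rewrite slap_coordM//.
have [_ ->//] := hr j; have [_ ->//] := hr' j.
by rewrite [md d.+2]deg_eigS; ring.
Qed.

(** Spherical harmonics of degree [l]. The eigenvalue equation stands for homogeneity and
    harmonicity in R^n, as it is what orthogonality and the spectral norm rely on. *)
Definition harm (l : nat) Y := polyS l Y /\
  forall w, sphere w -> slap Y w = - md l * Y w.

Lemma harm0 l : harm l (cst 0).
Proof. by split; [exact: poly_cst|move=> w w1; rewrite slap_cst// mulr0]. Qed.

Lemma harm_smooth l Y : harm l Y -> smooth Y.
Proof. by move=> [/smooth_poly]. Qed.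

Lemma harmZ l c Y : harm l Y -> harm l (fun w => c * Y w).
Proof.
move=> hY; have sY := harm_smooth hY; case: hY => pY eY.
split; first exact: polyZ.
by move=> w w1; rewrite slapZ// eY//; ring.
Qed.

Lemma harmonic_decomposition d f : polyS d f -> exists2 p : nat -> V -> R,
  (forall l, harm l (p l)) & forall w, sphere w -> f w = \sum_(l < d.+1) p l w.
Proof.
elim: d f => [|d ih] f fP.
  exists (fun l : nat => if l == 0%N then f else cst 0).
    case=> [|l]; last exact: harm0.
    split => // w w1; case: fP => c fc.
    by rewrite (eq_slap w1 fc) slap_cst// deg_eig0 oppr0 mul0r.
  by move=> w w1; rewrite big_ord1.
have [r rP rE] := poly_slap fP; have [q qh qE] := ih _ rP.
have sf := smooth_poly fP; have sq l := harm_smooth (qh l).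
(* (slap + md d.+1) f = r = sum q_l, and slap + md d.+1 is md d.+1 - md l on q_l *)
pose p l w := (md d.+1 - md l)^-1 * q l w.
pose top w := f w - \sum_(l < d.+1) p l w.
have sp l : smooth (p l) by exact: smoothZ.
have hp l : harm l (p l) by exact: harmZ.
exists (fun l => if (l < d.+1)%N then p l else if l == d.+1 then top else cst 0).
  move=> l; case: ifPn => [_|ld]; first exact: hp.
  case: eqVneq => [->|_]; last exact: harm0.
  split.
    have pS : polyS d.+1 (fun w => -1 * \sum_(l < d.+1) p l w).
      apply: polyZ; apply: poly_sum => i.
      by apply: (poly_leq (ltnW (ltn_ord i))); case: (hp i).
    by apply: polyD => //; apply: eq_poly pS => w _; exact: mulN1r.
  move=> w w1; rewrite /top slapD//; last by apply: smoothN; exact: smooth_sum.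
  rewrite (@eq_slap _ _ (fun x => - _) (fun x => -1 * \sum_(l < d.+1) p l x) w w1); last first.
    by move=> x _; rewrite mulN1r.
  rewrite slapZ//; last exact: smooth_sum.
  rewrite slap_sum// rE// qE// mulrBr mulr_sumr -addrA; congr (_ + _).
  rewrite mulNr opprK mulr_sumr -big_split/=; apply: eq_bigr => i _.
  have [_ ->//] := hp i; rewrite /p.
  have : md d.+1 - md i != 0 by rewrite subr_eq0 gt_eqF// deg_eig_lt.
  by move=> ?; field.
move=> w w1; rewrite big_ord_recr/= ltnn eqxx /top.
rewrite (eq_bigr (fun l : 'I_d.+1 => p l w)); last by move=> i _; rewrite ltn_ord.
by rewrite addrC subrK.
Qed.

Lemma eig_orthogonal (a b : R) f g : smooth f -> smooth g -> a != b ->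
  (forall w, sphere w -> slap f w = - a * f w) ->
  (forall w, sphere w -> slap g w = - b * g w) -> I (fun w => f w * g w) = 0.
Proof.
move=> sf sg ab fa gb; have c : scont (fun w => f w * g w).
  by apply: smooth_scont; exact: smoothM.
have := sint_slapC hsigma sf sg.
rewrite (@eq_sint _ _ _ _ (fun w => - b * (f w * g w))); last first.
  by move=> w w1; rewrite gb//; ring.
rewrite (@eq_sint _ _ _ (fun w => slap f w * g w) (fun w => - a * (f w * g w))); last first.
  by move=> w w1; rewrite fa//; ring.
rewrite !sintZ// => /eqP; rewrite -subr_eq0 -mulrBl mulf_eq0 => /orP[|/eqP//].
by rewrite opprK addrC subr_eq0 (negbTE ab).
Qed.

Lemma harm_orthogonal l k f g : harm l f -> harm k g -> l != k ->
  I (fun w => f w * g w) = 0.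
Proof.
move=> hf hg lk; apply: (@eig_orthogonal (md l) (md k)).
- exact: harm_smooth hf.
- exact: harm_smooth hg.
- by apply: contraNneq lk => /deg_eig_inj ->.
- by case: hf.
- by case: hg.
Qed.

Lemma sint_sum_harm d (p : nat -> V -> R) k g :
  (forall l, harm l (p l)) -> harm k g -> (k < d)%N ->
  I (fun w => (\sum_(l < d) p l w) * g w) = I (fun w => p k w * g w).
Proof.
move=> ph gh kd; have sp l := harm_smooth (ph l); have sg := harm_smooth gh.
under eq_fun do rewrite mulr_suml.
rewrite sint_sum; last by move=> i; apply: smooth_scont; exact: smoothM.
rewrite (bigD1 (Ordinal kd))//= big1 ?addr0// => i ik.
exact: (harm_orthogonal (ph i) gh).
Qed.

Lemma poly_harm_orthogonal d l f Y : polyS d f -> harm l Y -> (d < l)%N ->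
  I (fun w => f w * Y w) = 0.
Proof.
move=> /harmonic_decomposition[p ph pE] hY dl.
have sp k := harm_smooth (ph k); have sY := harm_smooth hY.
rewrite (@eq_sint _ _ _ _ (fun w => \sum_(k < d.+1) p k w * Y w)); last first.
  by move=> w w1; rewrite pE// mulr_suml.
rewrite sint_sum; last by move=> i; apply: smooth_scont; exact: smoothM.
rewrite big1// => i _; apply: (harm_orthogonal (ph i) hY).
by rewrite neq_ltn (leq_trans (ltn_ord i)).
Qed.

Lemma parseval d (p : nat -> V -> R) : (forall l, harm l (p l)) ->
  I (fun w => (\sum_(l < d) p l w) ^+ 2) = \sum_(l < d) I (fun w => p l w ^+ 2).
Proof.
move=> ph; have sp l := harm_smooth (ph l).
have c l k : scont (fun w => p l w * p k w) by apply: smooth_scont; exact: smoothM.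
rewrite (@eq_sint _ _ _ _ (fun w => \sum_(l < d) (\sum_(k < d) p k w) * p l w)); last first.
  by move=> w _; rewrite expr2 mulr_sumr.
rewrite sint_sum; last first.
  by move=> i; apply: smooth_scont; apply: smoothM => //; exact: smooth_sum.
by apply: eq_bigr => i _; rewrite (sint_sum_harm ph (ph i)).
Qed.

(** The product of Y with <w, v> has components only in degrees l+1, l and l-1. The formula for the
    derivative follows by comparing the Laplacian of the product, computed on these components, with
    the product rule: each coefficient is half of [md l + n - 1] minus the eigenvalue of the
    component. *)
Lemma harm_dotM l Y v : harm l Y -> exists A C B, [/\ harm l.+1 A, harm l C, harm l.-1 B,
  [/\ I (fun w => A w ^+ 2) <= dot v v * I (fun w => Y w ^+ 2),
      I (fun w => C w ^+ 2) <= dot v v * I (fun w => Y w ^+ 2) &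
      I (fun w => B w ^+ 2) <= dot v v * I (fun w => Y w ^+ 2)]
  & forall w, sphere w -> \sum_i v 0 i * sd i Y w =
    - l%:R * A w + (n%:R - 1) / 2 * C w + (l%:R + n%:R - 2) * B w].
Proof.
move=> hY; have sY := harm_smooth hY; have [pY eY] := hY.
have sx := @smooth_dot R n v.
have pxY := poly_dotM v pY; have [p ph pE] := harmonic_decomposition pxY.
have sp k := harm_smooth (ph k).
(* The squared norm of the component of degree j is the pairing of Y with <w, v> times that
   component, a polynomial of degree j + 1 < l, hence orthogonal to Y. *)
have small j : (j.+1 < l)%N -> forall w, sphere w -> p j w = 0.
  move=> jl w w1; apply/eqP; rewrite -sqrf_eq0; apply/eqP.
  apply: (sint_eq0 hsigma n2 (f := fun w => p j w ^+ 2)) => //.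
  - exact/smooth_scont/smoothX.
  - by move=> x _; rewrite sqr_ge0.
  - have jl2 : (j < l.+2)%N by rewrite (ltn_trans (ltnSn j))// (ltn_trans jl)// ltnW.
    under eq_fun do rewrite expr2.
    rewrite -(sint_sum_harm ph (ph j) jl2).
    rewrite (@eq_sint _ _ _ _ (fun w => (dot w v * p j w) * Y w)); last first.
      by move=> x x1; rewrite -pE//; ring.
    by apply: (poly_harm_orthogonal _ hY jl); apply: poly_dotM; case: (ph j).
pose B := if l is l'.+1 then p l' else cst 0.
have hB : harm l.-1 B by rewrite /B; case: (l) => [|l'] //=; exact: harm0.
have decomp w : sphere w -> dot w v * Y w = p l.+1 w + p l w + B w.
  move=> w1; rewrite pE// !big_ord_recr/=.
  suff -> : \sum_(i < l) p i w = B w by ring.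
  rewrite /B; case: (l) small => [|l'] small; first by rewrite big_ord0.
  rewrite big_ord_recr/= big1 ?add0r// => i _; apply: small => //.
  by rewrite ltnS.
have IxY : \sum_(k < l.+2) I (fun w => p k w ^+ 2) <= dot v v * I (fun w => Y w ^+ 2).
  rewrite -parseval// -sintZ; last exact/smooth_scont/smoothX.
  apply: ler_sint.
  - by apply/smooth_scont/smoothX/smooth_sum.
  - by apply: scontZ; exact/smooth_scont/smoothX.
  - move=> w w1; rewrite -pE// exprMn ler_wpM2r ?sqr_ge0//.
    by rewrite (le_trans (dot_CS _ _))//; move/sphereE: w1 => ->; rewrite mul1r.
have pk k : (k < l.+2)%N -> I (fun w => p k w ^+ 2) <= dot v v * I (fun w => Y w ^+ 2).
  move=> kl; apply: le_trans IxY; rewrite (bigD1 (Ordinal kl))//= lerDl sumr_ge0//.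
  by move=> i _; apply: sint_ge0 => w _; rewrite sqr_ge0.
exists (p l.+1), (p l), B; split => //.
  split; [exact: pk|exact: pk|].
  rewrite /B; case: (l) pk => [|l'] pk; last by apply: pk; rewrite ltnW.
  rewrite /cst; under eq_fun do rewrite expr0n/=.
  rewrite (sint1 hsigma) mulr_ge0 ?dotxx_ge0//.
  by apply: sint_ge0 => w _; rewrite sqr_ge0.
move=> w w1; rewrite -sgdot_dot//.
have sB := harm_smooth hB.
have := slapM sx sY w1; rewrite slap_dot// eY//.
rewrite (eq_slap w1 decomp) slapD//; last exact: smoothD.
rewrite slapD//; have [_ ->//] := ph l.+1; have [_ ->//] := ph l; have [_ ->//] := hB.
have -> : Y w * (- (n%:R - 1) * dot w v) = - (n%:R - 1) * (p l.+1 w + p l w + B w).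
  by rewrite -decomp//; ring.
have -> : dot w v * (- md l * Y w) = - md l * (p l.+1 w + p l w + B w).
  by rewrite -decomp//; ring.
(* The formula for [md l.-1] fails at [l = 0], where [l.-1] is 0; but there [B] is the zero
   function. *)
have mB : md l.-1 * B w = (md l - (2 * l%:R + n%:R - 3)) * B w.
  rewrite /B; case: (l) => [|l'] /=; first by rewrite /cst !mulr0.
  by rewrite deg_eigS -natr1; ring.
have mB' : - md l.-1 * B w = - ((md l - (2 * l%:R + n%:R - 3)) * B w) by rewrite mulNr mB.
rewrite deg_eigS mB' => h.
set S := sgdot _ _ _ in h *.
have := h; set P := p l.+1 w; set Q := p l w; set T := B w; set M := md l.
move=> e; have : 2 * S = 2 * (- l%:R * P + (n%:R - 1) / 2 * Q + (l%:R + n%:R - 2) * T).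
  by move: e => /eqP; rewrite -subr_eq0 => /eqP e; apply/eqP; rewrite -subr_eq0; apply/eqP; rewrite -[RHS]oppr0 -e; field.
by move/mulfI; apply.
Qed.

End Harmonics.

(** * Sobolev norms and duality *)

Lemma quad_disc (R : realFieldType) (a b d : R) :
  (forall x y, 0 <= x ^+ 2 * b + 2 * x * y * a + y ^+ 2 * d) -> a ^+ 2 <= b * d.
Proof.
move=> H.
have b0 : 0 <= b by have := H 1 0; rewrite expr1n expr0n /=; lra.
have d0 : 0 <= d by have := H 0 1; rewrite expr1n expr0n /=; lra.
have := H d (- a); have := H (- a) b.
have [d1|] := ltP 0 d.
  move=> _ h; rewrite -subr_ge0 -(pmulr_rge0 _ d1).
  by move: h; congr (_ <= _); ring.
move=> d1; have d2 : d = 0 by apply/eqP; rewrite eq_le d1.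
rewrite d2 mulr0 => h _.
rewrite mulr0; have [->|a0] := eqVneq a 0; first by rewrite expr0n.
have := H (- a * (a ^- 2)) ((b + 1) * (a ^- 2) / 2); rewrite d2 mulr0 addr0.
have -> : 2 * (- a * (a ^- 2)) * ((b + 1) * (a ^- 2) / 2) * a = - ((b + 1) * a ^- 2).
  by field.
have -> : (- a * (a ^- 2)) ^+ 2 * b = b * a ^- 2 by field.
by rewrite mulrDl mul1r opprD addrA subrr add0r oppr_ge0 invr_le0 leNgt exprn_even_gt0.
Qed.

Lemma sum_CS (R : realFieldType) (N : nat) (x a b : nat -> R) :
  (forall l, (l < N)%N -> 0 <= a l) -> (forall l, (l < N)%N -> 0 <= b l) ->
  (forall l, (l < N)%N -> x l ^+ 2 <= a l * b l) ->
  (\sum_(l < N) x l) ^+ 2 <= (\sum_(l < N) a l) * (\sum_(l < N) b l).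
Proof.
move=> a0 b0 xab; apply: quad_disc => s t.
rewrite !mulr_sumr -!big_split/=; apply: sumr_ge0 => i _.
have := a0 _ (ltn_ord i); have := b0 _ (ltn_ord i); have := xab _ (ltn_ord i).
set X := x i; set A := a i; set B := b i => h B0 A0.
have [AA|AA] := ltP 0 A.
  rewrite -(pmulr_rge0 _ AA).
  have -> : A * (s ^+ 2 * A + 2 * s * t * X + t ^+ 2 * B) =
    (s * A + t * X) ^+ 2 + t ^+ 2 * (A * B - X ^+ 2) by ring.
  by apply: addr_ge0; [exact: sqr_ge0|rewrite mulr_ge0 ?sqr_ge0 ?subr_ge0].
have A1 : A = 0 by apply/eqP; rewrite eq_le AA.
have X0 : X = 0.
  by apply/eqP; rewrite -sqrf_eq0 eq_le sqr_ge0 andbT (le_trans h)// A1 mul0r.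
by rewrite A1 X0 !mulr0 !add0r mulr_ge0 ?sqr_ge0.
Qed.

Section Duality.
Context {R : realType} {n : nat}.
Variable sigma : probability (borelRn R n) R.
Hypothesis hsigma : uniform_on_sphere sigma.
Hypothesis n2 : (2 <= n)%N.
Local Notation V := 'rV[R]_n.
Local Notation I := (sint sigma).
Local Notation md := (@deg_eig R n).
Implicit Types (f g Y : V -> R) (v w : V) (L : (V -> R) -> R).

Definition l2 f : R := Num.sqrt (I (fun w => f w ^+ 2)).

Lemma sint_sqr_ge0 f : 0 <= I (fun w => f w ^+ 2).
Proof. by apply: sint_ge0 => w _; rewrite sqr_ge0. Qed.

Lemma l2_ge0 f : 0 <= l2 f. Proof. exact: sqrtr_ge0. Qed.

Lemma sqr_l2 f : l2 f ^+ 2 = I (fun w => f w ^+ 2).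
Proof. by rewrite sqr_sqrtr// sint_sqr_ge0. Qed.

Lemma eq_l2 f g : (forall w, sphere w -> f w = g w) -> l2 f = l2 g.
Proof. by move=> fg; congr Num.sqrt; apply: eq_sint => w w1; rewrite fg. Qed.

Lemma l2_CS f g : scont f -> scont g -> `|I (fun w => f w * g w)| <= l2 f * l2 g.
Proof.
move=> cf cg; rewrite -(ler_pXn2r (n := 2))// ?nnegrE ?mulr_ge0 ?l2_ge0//.
rewrite -normrX ger0_norm ?sqr_ge0// exprMn !sqr_l2.
have := @sint_CS R n sigma (cst 1) f g (@scont_cst _ _ 1) cf cg (fun _ _ => ler01).
by rewrite /cst; under eq_fun do rewrite mul1r; under [X in _ <= sint _ X * _ -> _]eq_fun do rewrite mul1r;
  under [X in _ <= _ * sint _ X -> _]eq_fun do rewrite mul1r.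
Qed.

Lemma l2D f g : scont f -> scont g -> l2 (fun w => f w + g w) <= l2 f + l2 g.
Proof.
move=> cf cg; rewrite -(ler_pXn2r (n := 2))// ?nnegrE ?addr_ge0 ?l2_ge0//.
rewrite sqrrD !sqr_l2 (@eq_sint _ _ _ _ (fun w => (f w ^+ 2 + g w ^+ 2) + 2 * (f w * g w))); last first.
  by move=> w _; ring.
have cfg := scontM cf cg; have cf2 := scontX (k := 2) cf; have cg2 := scontX (k := 2) cg.
rewrite sintD ?sintD ?sintZ//; [|exact: scontD|exact: scontZ].
by have := le_trans (ler_norm _) (l2_CS cf cg); lra.
Qed.

Lemma l2Z c f : scont f -> l2 (fun w => c * f w) = `|c| * l2 f.
Proof.
move=> cf; rewrite /l2 -[`|c|]sqrtr_sqr -sqrtrM ?sqr_ge0//.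
rewrite -sintZ; last exact: scontX.
by congr Num.sqrt; apply: eq_sint => w _; rewrite exprMn.
Qed.

Lemma l2_eq0 f : scont f -> l2 f = 0 -> forall w, sphere w -> f w = 0.
Proof.
move=> cf f0 w w1; apply/eqP; rewrite -sqrf_eq0; apply/eqP.
apply: (sint_eq0 hsigma n2 (f := fun w => f w ^+ 2)) => //; first exact: scontX.
  by move=> x _; rewrite sqr_ge0.
by rewrite -sqr_l2 f0 expr0n.
Qed.

Lemma l2_sup f (e : R) : 0 <= e -> scont f ->
  (forall w, sphere w -> `|f w| <= e) -> l2 f <= e.
Proof.
move=> e0 cf fe; rewrite -(ler_pXn2r (n := 2))// ?nnegrE ?l2_ge0// sqr_l2.
rewrite -(sint1 hsigma (e ^+ 2)); apply: ler_sint.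
- exact: scontX.
- exact: scont_cst.
- by move=> w w1; rewrite -[leLHS]ger0_norm ?sqr_ge0// normrX lerXn2r ?nnegrE ?fe.
Qed.

Lemma harm_approx f (e : R) : scont f -> 0 < e -> exists d (p : nat -> V -> R),
  (forall l, harm l (p l)) /\
  forall w, sphere w -> `|f w - \sum_(l < d) p l w| <= e.
Proof.
move=> cf e0; have [d [q [qP qf]]] := poly_dense hsigma n2 cf e0.
have [p ph pE] := harmonic_decomposition n2 qP.
by exists d.+1, p; split=> // w w1; rewrite -pE//; exact: qf.
Qed.

Lemma sum_harm_smooth d (p : nat -> V -> R) : (forall l, harm l (p l)) ->
  smooth (fun w => \sum_(l < d) p l w).
Proof. by move=> ph; apply: smooth_sum => i; exact: harm_smooth (ph i). Qed.

Lemma ler_addsqrP (a b : R) : (forall e, 0 < e -> a <= b + e ^+ 2) -> a <= b.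
Proof.
move=> h; apply/ler_addgt0Pr => e e0.
by apply: (le_trans (h (Num.sqrt e) _)); rewrite ?sqrtr_gt0// sqr_sqrtr// ltW.
Qed.

(* The sums of harmonics are dense, so testing against them is enough. *)
Lemma l2_duality g (B : R) : scont g -> 0 <= B ->
  (forall d p, (forall l, harm l (p l)) ->
    I (fun w => g w * \sum_(l < d) p l w) ^+ 2
      <= B * I (fun w => (\sum_(l < d) p l w) ^+ 2)) ->
  I (fun w => g w ^+ 2) <= B.
Proof.
move=> cg B0 h; apply: ler_addsqrP => e e0.
have [d [p [ph pg]]] := harm_approx cg e0; have {h} := h d p ph.
pose q w := \sum_(l < d) p l w.
rewrite (_ : I (fun w => _ * _) = I (fun w => g w * q w))//.
rewrite (_ : I (fun w => (\sum_(l < d) p l w) ^+ 2) = I (fun w => q w ^+ 2))//.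
have cq : scont q by apply: smooth_scont; exact: sum_harm_smooth.
have cgq := scontM cg cq; have cg2 := scontX (k := 2) cg; have cq2 := scontX (k := 2) cq.
have : l2 (fun w => g w - q w) ^+ 2 <= e ^+ 2.
  by rewrite lerXn2r ?nnegrE ?l2_ge0 ?(ltW e0)//; exact: l2_sup (ltW e0) (scontB cg cq) pg.
rewrite sqr_l2.
rewrite (@eq_sint _ _ _ _ (fun w => (g w ^+ 2 + q w ^+ 2) - 2 * (g w * q w))); last first.
  by move=> w _; ring.
rewrite sintB ?sintD ?sintZ//; [|exact: scontD|exact: scontZ].
set G := I (fun w => g w ^+ 2); set P := I (fun w => q w ^+ 2).
set X := I (fun w => g w * q w) => h1 h2.
have P0 : 0 <= P by exact: sint_sqr_ge0.
have [X0|X0] := leP X 0; first by lra.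
(* From [X ^+ 2 <= B * P] by the inequality of the means. Inserted in [G + P - 2 X <= e ^+ 2], it
   leaves [G <= B + e ^+ 2]. *)
have : 2 * X <= B + P.
  rewrite -(ler_pXn2r (n := 2))// ?nnegrE; [|lra|lra].
  have : 0 <= (B - P) ^+ 2 by rewrite sqr_ge0.
  by rewrite exprMn; lra.
by lra.
Qed.

(** Such a [Y] is orthogonal to all harmonics, whose finite sums are dense: the numbers [md l]
    exhaust the spectrum. *)
Lemma eigen_not_deg (m : R) Y : smooth Y ->
  (forall w, sphere w -> slap Y w = - m * Y w) -> (forall l, m != md l) ->
  forall w, sphere w -> Y w = 0.
Proof.
move=> sY eY ml w w1; apply/eqP; rewrite -sqrf_eq0; apply/eqP.
have cY := smooth_scont sY.
apply: (sint_eq0 hsigma n2 (f := fun w => Y w ^+ 2)) => //; first exact: scontX.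
  by move=> x _; rewrite sqr_ge0.
apply/eqP; rewrite eq_le sint_ge0 ?andbT; last by move=> x _; rewrite sqr_ge0.
apply: l2_duality => // d p ph; have sp l := harm_smooth (ph l).
under eq_fun do rewrite mulr_sumr.
rewrite sint_sum; last by move=> i; apply: scontM => //; exact: smooth_scont.
rewrite big1 ?expr0n ?mul0r// => i _.
by apply: (eig_orthogonal hsigma sY (sp i) (ml i) eY); case: (ph i).
Qed.

(** Carries a bound from polynomial eigenfunctions to all the smooth ones over which [spectral_mass]
    ranges. In a uniform approximation of [Y] by harmonics, the component [Z] of degree [l] is at
    least as close to [Y] in L^2 as the whole sum, because [Y] is orthogonal to the other
    components. *)
Lemma eigen_bound l g Y (a : R) : scont g -> smooth Y -> 0 <= a ->
  (forall w, sphere w -> slap Y w = - md l * Y w) ->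
  (forall Z, harm l Z -> `|I (fun w => g w * Z w)| <= a * l2 Z) ->
  `|I (fun w => g w * Y w)| <= a * l2 Y.
Proof.
move=> cg sY a0 eY ga; have cY := smooth_scont sY.
apply/ler_addgt0Pr => e' e'0; pose e := e' / (a + l2 g + 1).
have G0 : 0 < a + l2 g + 1 by rewrite ltr_wpDl// addr_ge0// l2_ge0.
have e0 : 0 < e by exact: divr_gt0.
have [d [p [ph pY]]] := harm_approx cY e0.
pose q w := \sum_(k < d) p k w.
pose Z := if (l < d)%N then p l else cst 0.
have hZ : harm l Z by rewrite /Z; case: ifP => // _; exact: harm0.
have sp k := harm_smooth (ph k); have sZ := harm_smooth hZ; have cZ := smooth_scont sZ.
have sq : smooth q by exact: sum_harm_smooth.
have Yp k : k != l -> I (fun w => Y w * p k w) = 0.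
  move=> kl; have kl' : md l != md k by apply: contraNneq kl => /(deg_eig_inj n2) ->.
  exact: (eig_orthogonal hsigma sY (sp k) kl' eY (proj2 (ph k))).
have Yq : I (fun w => Y w * q w) = I (fun w => Y w * Z w).
  under eq_fun do rewrite mulr_sumr.
  rewrite sint_sum; last by move=> i; apply: scontM => //; exact: smooth_scont.
  rewrite /Z; case: ifPn => [ld|ld].
    by rewrite (bigD1 (Ordinal ld))//= big1 ?addr0// => i il; exact: Yp.
  rewrite big1; last by move=> i _; apply: Yp; apply: contraNneq ld => <-.
  by rewrite -[LHS](sint1 hsigma); apply: eq_sint => w _; rewrite /cst mulr0.
have qq : I (fun w => Z w ^+ 2) <= I (fun w => q w ^+ 2).
  rewrite parseval// /Z; case: ifPn => [ld|ld].
    by rewrite (bigD1 (Ordinal ld))//= lerDl sumr_ge0// => i _; exact: sint_sqr_ge0.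
  rewrite /cst; under eq_fun do rewrite expr0n/=.
  by rewrite (sint1 hsigma) sumr_ge0// => i _; exact: sint_sqr_ge0.
have expand X : smooth X -> I (fun w => (Y w - X w) ^+ 2) =
    I (fun w => Y w ^+ 2) + I (fun w => X w ^+ 2) - 2 * I (fun w => Y w * X w).
  move=> sX; have cX := smooth_scont sX.
  have cgq := scontM cY cX; have cg2 := scontX (k := 2) cY; have cq2 := scontX (k := 2) cX.
  rewrite (@eq_sint _ _ _ _ (fun w => (Y w ^+ 2 + X w ^+ 2) - 2 * (Y w * X w))); last first.
    by move=> w _; ring.
  by rewrite sintB ?sintD ?sintZ//; [exact: scontD|exact: scontZ].
have cYZ : scont (fun w => Y w - Z w) by exact: scontB.
have YZe : l2 (fun w => Y w - Z w) <= e.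
  apply: le_trans (l2_sup (ltW e0) (scontB cY (smooth_scont sq)) pY).
  rewrite -(ler_pXn2r (n := 2))// ?nnegrE ?l2_ge0// !sqr_l2.
  by rewrite !expand// Yq; lra.
have Z1 : l2 Z <= l2 Y + e.
  rewrite (@eq_l2 Z (fun w => Y w + (-1) * (Y w - Z w))); last by move=> w _; ring.
  rewrite (le_trans (l2D _ _))//; first exact: scontZ.
  by rewrite l2Z// normrN1 mul1r lerD2l.
have -> : I (fun w => g w * Y w) = I (fun w => g w * Z w) + I (fun w => g w * (Y w - Z w)).
  by rewrite -sintD; [|exact: scontM|exact: scontM]; apply: eq_sint => w _; ring.
apply: (le_trans (ler_normD _ _)); apply: (@le_trans _ _ (a * (l2 Y + e) + l2 g * e)).
  apply: lerD; first by rewrite (le_trans (ga _ hZ))// ler_wpM2l.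
  by rewrite (le_trans (l2_CS cg cYZ))// ler_wpM2l ?l2_ge0.
have : e * (a + l2 g + 1) = e' by rewrite /e divfK ?gt_eqF.
by lra.
Qed.

Definition sphere_linear L := [/\ forall f g, (forall w, sphere w -> f w = g w) -> L f = L g,
  forall f g, smooth f -> smooth g -> L (fun w => f w + g w) = L f + L g &
  forall c f, smooth f -> L (fun w => c * f w) = c * L f].

Lemma sphere_linear0 L : sphere_linear L -> L (cst 0) = 0.
Proof.
move=> [Le LD LZ]; have := LZ 0 (cst 0) (smooth_cst 0).
by move=> h; rewrite -[RHS](mul0r (L (cst 0))) -h; apply: Le => w _; rewrite /cst mulr0.
Qed.

Lemma sphere_linear_sum L d (p : nat -> V -> R) : sphere_linear L -> (forall l, smooth (p l)) ->
  L (fun w => \sum_(l < d) p l w) = \sum_(l < d) L (p l).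
Proof.
move=> lL sp; have [Le LD LZ] := lL; elim: d => [|d ih].
  rewrite [RHS]big_ord0 -[RHS](sphere_linear0 lL); apply: Le => w _.
  by rewrite big_ord0.
rewrite big_ord_recr/= -ih -LD//; last exact: smooth_sum.
by apply: Le => w _; rewrite big_ord_recr.
Qed.

Lemma of_densityE g f : of_density sigma g f = I (fun w => g w * f w).
Proof. by rewrite sintE. Qed.

Lemma eigenfunctionP (m : R) Y : eigenfunction m Y <->
  smooth Y /\ forall w, sphere w -> slap Y w = - m * Y w.
Proof.
split=> -[sY h]; split=> // w w1; have := h w w1; rewrite slaplacianE -/(slap Y w).
  by move=> /eqP; rewrite eqr_oppLR => /eqP ->; rewrite mulNr.
by move=> ->; rewrite mulNr opprK.
Qed.

Local Notation S L m := (spectral_mass sigma L m).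

Lemma spectral_mass_ge0 L m : sphere_linear L -> (0 <= S L m)%E.
Proof.
move=> lL; apply: ereal_sup_ubound; exists (cst 0); last by rewrite (sphere_linear0 lL) expr0n.
split; first by apply/eigenfunctionP; split; [exact: smooth_cst|move=> w w1; rewrite slap_cst// mulr0].
rewrite of_densityE (@eq_sint _ _ _ _ (cst 0)) ?(sint1 hsigma)//.
by move=> w _; rewrite /cst mulr0.
Qed.

Lemma spectral_mass_not_deg L m : sphere_linear L -> (forall l, m != md l) -> S L m = 0%E.
Proof.
move=> lL ml; apply/eqP; rewrite eq_le spectral_mass_ge0// andbT.
apply: ge_ereal_sup => _ [Y [/eigenfunctionP[sY eY] _] <-].
have [Le _ _] := lL; rewrite (Le Y (cst 0)); last exact: (eigen_not_deg sY eY ml).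
by rewrite (sphere_linear0 lL) expr0n.
Qed.

(** In the sum over all real m > 0, only the eigenvalues [md l] with l > 0 contribute, and each
    occurs once since [md] is injective. *)
Lemma sobolev_normE s L : sphere_linear L ->
  sobolev_norm sigma s L = sqrte (((L (cst 1)) ^+ 2)%:E +
    \sum_(l <oo | (0 < l)%N) ((md l `^ s)%:E * S L (md l)))%E.
Proof.
move=> lL; rewrite /sobolev_norm; congr (sqrte (_ + _)).
pose B := md @` [set l | (0 < l)%N].
rewrite (esumID B)/=; last first.
  by move=> m _; rewrite mule_ge0 ?lee_fin ?powR_ge0// spectral_mass_ge0.
rewrite [X in (_ + X)%E]esum1 ?adde0; last first.
  move=> m [m0 Bm]; rewrite spectral_mass_not_deg ?mule0// => l.
  apply/eqP => ml; apply: Bm; exists l => //=; rewrite lt0n; apply/negP => /eqP l0.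
  by have : 0 < m := m0; rewrite ml l0 deg_eig0 ltxx.
have -> : [set m : R | 0 < m] `&` B = B.
  apply/seteqP; split => [m []//|m Bm]; split => //.
  by case: Bm => l /= l0 <-; rewrite -(@deg_eig0 R n); exact: deg_eig_lt.
rewrite /B (esum_pred_image (fun m => ((m `^ s)%R%:E * S L m)%E))//.
  by move=> l _; rewrite mule_ge0 ?lee_fin ?powR_ge0// spectral_mass_ge0.
by move=> l k _ _ /(deg_eig_inj n2).
Qed.

(** Together with its converse [sobolev_norm_ge], this reduces every later statement on the norm to
    partial sums of a real sequence indexed by the degree. *)
Lemma sobolev_norm_le (s : R) L (a : nat -> R) (B : R) : sphere_linear L -> 0 <= B ->
  (forall l Y, (0 < l)%N -> smooth Y -> (forall w, sphere w -> slap Y w = - md l * Y w) ->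
    l2 Y <= 1 -> L Y ^+ 2 <= a l) ->
  (forall N, L (cst 1) ^+ 2 + \sum_(0 <= l < N | (0 < l)%N) md l `^ s * a l <= B ^+ 2) ->
  (sobolev_norm sigma s L <= B%:E)%E.
Proof.
move=> lL B0 La hN; rewrite sobolev_normE//.
rewrite -[B%:E]gee0_abs ?lee_fin// -sqrte_sqr lee_sqrt; last first.
  by rewrite -EFin_expe lee_fin sqr_ge0.
rewrite -EFin_expe -leeBrDl//.
apply: lime_le.
  apply: is_cvg_nneseries => l _ _.
  by rewrite mule_ge0 ?lee_fin ?powR_ge0// spectral_mass_ge0.
apply: nearW => N; rewrite -EFinB.
apply: (@le_trans _ _ (\sum_(0 <= l < N | (0 < l)%N) (md l `^ s * a l)%:E)%E).
  apply: lee_sum => l l0; rewrite EFinM lee_wpmul2l ?lee_fin ?powR_ge0//.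
  apply: ge_ereal_sup => _ [Y [/eigenfunctionP[sY eY] Y1] <-].
  rewrite lee_fin; apply: La => //.
  rewrite -(ler_pXn2r (n := 2))// ?nnegrE ?l2_ge0// sqr_l2 expr1n.
  by move: Y1; rewrite of_densityE; under eq_fun do rewrite -expr2.
by rewrite sumEFin lee_fin lerBrDl; exact: hN.
Qed.

Lemma sobolev_norm_ge (s : R) L (B : R) : sphere_linear L -> (sobolev_norm sigma s L <= B%:E)%E ->
  exists a : nat -> R, [/\ forall l, 0 <= a l,
    forall l Z, (0 < l)%N -> smooth Z -> (forall w, sphere w -> slap Z w = - md l * Z w) ->
      L Z ^+ 2 <= a l * I (fun w => Z w ^+ 2) &
    forall N, L (cst 1) ^+ 2 + \sum_(0 <= l < N | (0 < l)%N) md l `^ s * a l <= B ^+ 2].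
Proof.
move=> lL; rewrite sobolev_normE// => hB.
have B0 : 0 <= B by rewrite -lee_fin (le_trans _ hB)// sqrte_ge0.
have Sge l : (0 <= (md l `^ s)%:E * S L (md l))%E.
  by rewrite mule_ge0 ?lee_fin ?powR_ge0// spectral_mass_ge0.
have part N : (((L (cst 1)) ^+ 2)%:E + \sum_(0 <= l < N | (0 < l)%N) ((md l `^ s)%:E * S L (md l))
    <= (B ^+ 2)%:E)%E.
  apply: (@le_trans _ _ (((L (cst 1)) ^+ 2)%:E +
    \sum_(l <oo | (0 < l)%N) ((md l `^ s)%:E * S L (md l)))%E).
    by rewrite leeD2l// nneseries_lim_ge.
  move: hB; rewrite -{1}[B%:E]gee0_abs ?lee_fin// -sqrte_sqr lee_sqrt//.
  by rewrite -EFin_expe lee_fin sqr_ge0.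
have mpos l : (0 < l)%N -> 0 < md l.
  by move=> l0; rewrite -(@deg_eig0 R n); exact: deg_eig_lt.
have Sfin l : (0 < l)%N -> S L (md l) \is a fin_num.
  move=> l0; rewrite ge0_fin_numE ?spectral_mass_ge0//.
  have := part l.+1; rewrite big_mkcond/= big_nat_recr//= l0 => h.
  have h2 : ((md l `^ s)%:E * S L (md l) <= (B ^+ 2)%:E)%E.
    apply: le_trans h; rewrite addeA leeDr// adde_ge0 ?lee_fin ?sqr_ge0//.
    by apply: sume_ge0 => k _; case: ifP.
  rewrite ltey; apply/eqP => Sy; move: h2; rewrite Sy.
  by rewrite gt0_muley// lte_fin powR_gt0// mpos.
exists (fun l => fine (S L (md l))); split.
- by move=> l; rewrite fine_ge0// spectral_mass_ge0.
- move=> l Z l0 sZ eZ; have [Le LD LZ] := lL.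
  have cZ := smooth_scont sZ.
  have [Z0|Z0] := eqVneq (l2 Z) 0.
    rewrite (Le Z (cst 0)); last exact: l2_eq0.
    by rewrite (sphere_linear0 lL) expr0n/= mulr_ge0 ?sint_sqr_ge0// fine_ge0// spectral_mass_ge0.
  have Zp : 0 < l2 Z by rewrite lt_def Z0 l2_ge0.
  rewrite -sqr_l2 -ler_pdivrMr ?exprn_gt0//.
  rewrite (_ : _ / _ = (L (fun w => (l2 Z)^-1 * Z w)) ^+ 2); last first.
    by rewrite LZ// exprMn exprVn mulrC.
  rewrite -lee_fin fineK ?Sfin//; apply: ereal_sup_ubound.
  exists (fun w => (l2 Z)^-1 * Z w) => //; split.
    apply/eigenfunctionP; split; first exact: smoothZ.
    by move=> w w1; rewrite slapZ// eZ//; ring.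
  rewrite of_densityE; under eq_fun do rewrite -expr2.
  rewrite -sqr_l2 l2Z// ger0_norm ?invr_ge0 ?l2_ge0// mulVf// expr1n//.
- move=> N; rewrite -lee_fin EFinD (le_trans _ (part N))// leeD2l//.
  rewrite -sumEFin; apply: lee_sum => l l0; rewrite EFinM fineK//.
  exact: Sfin.
Qed.

(** For [s >= 0] the weights of positive degrees are at least 1, so the norm dominates the norm dual
    to L^2. *)
Lemma sobolev_duality (s : R) L (B : R) : 0 <= s -> sphere_linear L ->
  (sobolev_norm sigma s L <= B%:E)%E -> forall d (p : nat -> V -> R),
  (forall l, harm l (p l)) ->
  L (fun w => \sum_(l < d) p l w) ^+ 2 <= B ^+ 2 * I (fun w => (\sum_(l < d) p l w) ^+ 2).
Proof.
move=> s0 lL hB d p ph; have [a [a0 La aB]] := sobolev_norm_ge lL hB.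
have sp l := harm_smooth (ph l); have [Le LD LZ] := lL.
rewrite sphere_linear_sum// parseval//.
(* In degree 0 the Sobolev norm contains the squared mean in place of a spectral mass. *)
pose a' l := if l is 0%N then L (cst 1) ^+ 2 else a l.
apply: le_trans (@sum_CS R d (fun l => L (p l)) a' (fun l => I (fun w => p l w ^+ 2)) _ _ _) _.
- by case=> [|l] _ /=; rewrite ?sqr_ge0.
- by move=> l _; exact: sint_sqr_ge0.
- case=> [|l] _ /=; last exact: La (sp l.+1) (proj2 (ph l.+1)).
  have [[c pc] _] := ph 0%N.
  rewrite (Le (p 0%N) (fun w => c * cst 1 w)); last by move=> w w1; rewrite pc// /cst mulr1.
  rewrite LZ; last exact: smooth_cst.
  rewrite (@eq_sint _ _ _ _ (cst (c ^+ 2))); last by move=> w w1; rewrite pc.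
  by rewrite (sint1 hsigma) exprMn mulrC.
apply: ler_wpM2r; first by apply: sumr_ge0 => i _; exact: sint_sqr_ge0.
apply: le_trans (aB d); case: d => [|d]; first by rewrite big_ord0 big_geq// addr0 sqr_ge0.
rewrite big_ord_recl/= lerD2l.
rewrite [leRHS]big_mkcond/= [leRHS]big_nat_recl//= add0r big_mkord; apply: ler_sum => i _.
rewrite ler_peMl// -[leLHS](powRr0 (md i.+1)) ler_powR// .
by apply: le_trans (deg_eig_ge n2 _); rewrite ler1n.
Qed.

Definition pairing g f : R := I (fun w => g w * f w).

Lemma pairing_linear g : scont g -> sphere_linear (pairing g).
Proof.
move=> cg; rewrite /pairing; split=> [f h fh|f h sf sh|c f sf].
- by apply: eq_sint => w w1; rewrite fh.
- rewrite -sintD; try (by apply: scontM => //; exact: smooth_scont).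
  by apply: eq_sint => w _; rewrite mulrDr.
- rewrite -sintZ; last by apply: scontM => //; exact: smooth_scont.
  by apply: eq_sint => w _; ring.
Qed.

Lemma sgdot_CS f g : smooth f -> smooth g ->
  I (sgdot f g) ^+ 2 <= I (sgdot f f) * I (sgdot g g).
Proof.
move=> sf sg; apply: quad_disc => x y.
have c f' g' : smooth f' -> smooth g' -> scont (sgdot f' g').
  by move=> ? ?; apply: smooth_scont; exact: smooth_sgdot.
rewrite -!sintZ; try exact: c.
rewrite -sintD ?scontZ//; try exact: c; try (apply: scontZ; exact: c).
rewrite -sintD; [|by apply: scontD; apply: scontZ; exact: c|by apply: scontZ; exact: c].
apply: sint_ge0 => w _; rewrite /sgdot !mulr_sumr -!big_split/=.
apply: sumr_ge0 => i _; have := sqr_ge0 (x * sd i f w + y * sd i g w).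
by congr (_ <= _); ring.
Qed.

(** By duality: a sum p of harmonics is, up to its mean, minus the Laplacian of some [Q], so the
    pairing of [g] with p is that of the gradients of [g] and [Q]. The Dirichlet integral of [Q] is
    at most the squared norm of p since positive degrees have [md l >= 1]. The constant 1 is enough
    to make the weighted constant positive. *)
Lemma poincare g : smooth g -> I g = 0 -> I (fun w => g w ^+ 2) <= I (sgdot g g).
Proof.
move=> sg g0; have cg := smooth_scont sg.
have D0 : 0 <= I (sgdot g g).
  by apply: sint_ge0 => w _; apply: sumr_ge0 => i _; rewrite -expr2 sqr_ge0.
apply: l2_duality => // d p ph; have sp l := harm_smooth (ph l).
have mge1 l : (0 < l)%N -> 1 <= md l.
  by move=> l0; apply: le_trans (deg_eig_ge n2 _); rewrite ler1n.
pose q l := if l is 0%N then cst 0 else (fun w => (md l)^-1 * p l w) : V -> R.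
have hq l : harm l (q l) by case: l => [|l]; [exact: harm0|exact: harmZ].
have sq l := harm_smooth (hq l).
pose Q w := \sum_(l < d) q l w; have sQ : smooth Q by exact: sum_harm_smooth.
have E : I (fun w => g w * \sum_(l < d) p l w) = I (sgdot g Q).
  rewrite -[RHS]opprK -sint_slap// -sintN; last first.
    by apply: scontM => //; apply: smooth_scont; exact: smooth_slap.
  have cgp l : scont (fun w => g w * p l w) by apply: scontM => //; exact: smooth_scont.
  transitivity (\sum_(l < d) I (fun w => g w * p l w)).
    by rewrite -sint_sum//; apply: eq_sint => w _; rewrite mulr_sumr.
  transitivity (\sum_(l < d) I (fun w => g w * (- slap (q l) w))).
    apply: eq_bigr => -[[|l] ld] _ /=.
      have [[c pc] _] := ph 0%N.
      rewrite (@eq_sint _ _ _ _ (fun w => c * g w)); last by move=> w w1; rewrite pc// mulrC.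
      rewrite sintZ// g0 mulr0 -[LHS](sint1 hsigma); apply: eq_sint => w w1.
      by rewrite slap_cst// oppr0 mulr0.
    apply: eq_sint => w w1; have [_ ->//] := hq l.+1; rewrite /q.
    have : md l.+1 != 0 by rewrite gt_eqF// (lt_le_trans _ (mge1 _ _)).
    by move=> ?; field.
  rewrite -sint_sum; last first.
    by move=> i; apply: scontM => //; apply: scontN; apply: smooth_scont; exact: smooth_slap.
  apply: eq_sint => w w1; rewrite -mulr_sumr sumrN /Q slap_sum//; ring.
rewrite E; apply: le_trans (sgdot_CS sg sQ) _; rewrite ler_wpM2l//.
rewrite -[I (sgdot Q Q)]opprK -sint_slap// -sintN; last first.
  by apply: smooth_scont; apply: smoothM => //; exact: smooth_slap.
pose r l := fun w => md l * q l w.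
have hr l : harm l (r l) by exact: harmZ.
have sr l := harm_smooth (hr l).
rewrite (@eq_sint _ _ _ _ (fun w => \sum_(l < d) (Q w * r l w))); last first.
  move=> w w1; rewrite -mulr_sumr -mulrN; congr (_ * _).
  rewrite /Q slap_sum// -sumrN; apply: eq_bigr => i _.
  by have [_ ->//] := hq i; rewrite /r; ring.
rewrite sint_sum; last by move=> i; apply: smooth_scont; exact: smoothM.
rewrite parseval//; apply: ler_sum => i _.
rewrite (sint_sum_harm hsigma n2 hq (hr i))//; apply: ler_sint.
- by apply: smooth_scont; exact: smoothM.
- by apply: smooth_scont; exact: smoothX.
- move=> w w1; rewrite /r /q; case: i => -[|l] ld /=.
    by rewrite /cst mul0r sqr_ge0.
  have m1 := mge1 l.+1 isT; have m0 : 0 < md l.+1 by exact: lt_le_trans m1.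
  have -> : (md l.+1)^-1 * p l.+1 w * (md l.+1 * ((md l.+1)^-1 * p l.+1 w)) = (md l.+1)^-1 * p l.+1 w ^+ 2.
    by field; rewrite gt_eqF.
  by rewrite ler_piMl ?sqr_ge0// invf_le1.
Qed.

End Duality.

(** * The order parameter *)

Section ExpTaylor.
Context {R : realType}.
Implicit Types (x y : R).

Definition expT N y : R := \sum_(0 <= k < N) y ^+ k / k`!%:R.

Lemma expT_cvg y : expT N y @[N --> \oo] --> expR y.
Proof.
have -> : (fun N => expT N y) = series (exp_coeff y).
  by apply/funext => N; rewrite /expT /series/=; apply: eq_bigr => i _.
exact: is_cvg_series_exp_coeff.
Qed.

Lemma expT_le N y : 0 <= y -> expT N y <= expR y.
Proof.
move=> y0; have h := @expT_cvg y.
rewrite -(cvg_lim (@Rhausdorff R) h).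
apply: nondecreasing_cvgn_le; last exact: (cvgP _ h).
apply/nondecreasing_seqP => M.
by rewrite /expT [in leRHS]big_nat_recr//= lerDl divr_ge0// exprn_ge0.
Qed.

Lemma expT_error N (K y : R) : `|y| <= K -> `|expR y - expT N y| <= expR K - expT N K.
Proof.
move=> yK; have K0 : 0 <= K by exact: le_trans yK.
apply/ler_addgt0Pr => e e0.
have /cvgrPdist_lt/(_ e e0)[M _ hM] := @expT_cvg y.
pose M' := maxn M N.
have h1 : `|expR y - expT M' y| < e by apply: hM; rewrite /= leq_maxl.
have h2 : `|expT M' y - expT N y| <= expT M' K - expT N K.
  rewrite /expT (@big_cat_nat _ _ _ N 0 M')//= ?leq_maxr//.
  rewrite [X in _ <= X - _](@big_cat_nat _ _ _ N 0 M')//= ?leq_maxr//.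
  rewrite addrAC subrr add0r [X in _ <= X]addrAC subrr add0r.
  apply: (le_trans (ler_norm_sum _ _ _)); apply: ler_sum => i _.
  by rewrite normrM normrX normfV [`|_%:R|]ger0_norm// ler_wpM2r// lerXn2r ?nnegrE.
have h3 := expT_le M' K0.
rewrite (_ : _ - _ = (expR y - expT M' y) + (expT M' y - expT N y)); last by rewrite addrA subrK.
by rewrite (le_trans (ler_normD _ _))//; lra.
Qed.

(** From [exp y (1 - y) <= 1] one gets [(exp y - 1 - y) (1 - y) <= y^2], and 1 - y is at least
    1/2. *)
Lemma expR_taylor2 y : `|y| <= 2^-1 -> `|expR y - 1 - y| <= 2 * y ^+ 2.
Proof.
move=> y2; have := y2; rewrite ler_norml => /andP[y3 y4].
have h1 := expR_ge1Dx y; have h2 := expR_ge1Dx (- y).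
rewrite ger0_norm; last by lra.
have h3 : expR y * (1 - y) <= 1.
  by rewrite -[leRHS](mulfV (lt0r_neq0 (expR_gt0 y))) -expRN ler_pM2l ?expR_gt0.
have y1 : 0 < 1 - y by lra.
rewrite -(ler_pM2r y1).
have : (expR y - 1 - y) * (1 - y) <= y ^+ 2 by rewrite expr2; lra.
have : y ^+ 2 <= 2 * y ^+ 2 * (1 - y).
  have : 0 <= y ^+ 2 * (1 - 2 * y) by rewrite mulr_ge0 ?sqr_ge0//; lra.
  lra.
lra.
Qed.

(** A quadratic remainder suffices for differentiability; this is how integrals depending on a
    parameter are differentiated, from a pointwise bound on the integrand. *)
Lemma taylor_is_derive (F : R -> R) (x F' C d : R) : 0 < d ->
  (forall h, `|h| < d -> `|F (x + h) - F x - h * F'| <= C * h ^+ 2) -> is_derive x 1 F F'.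
Proof.
move=> d0 H; have C0 : 0 <= C.
  have := H (d / 2); rewrite gtr0_norm ?divr_gt0// => /(_ _)/(le_trans (normr_ge0 _)).
  have d2 : d / 2 < d by rewrite ltr_pdivrMr// ltr_pMr// ltr1n.
  move=> /(_ d2); rewrite pmulr_lge0// exprn_gt0// divr_gt0//.
have h : h^-1 *: ((F \o shift x) (h *: (1 : R)) - F x) @[h --> 0^'] --> F'.
  apply/cvgrPdist_le => e e0.
  near=> h.
  have h0 : h != 0 by near: h; exact: nbhs_dnbhs_neq.
  have hd : `|h| < Num.min d (e / (C + 1)).
    near: h; apply: nbhs_dnbhs.
    have : 0 < Num.min d (e / (C + 1)) by rewrite lt_min d0/= divr_gt0// ltr_wpDl.
    move=> m0; exists (Num.min d (e / (C + 1))) => //= z /=.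
    by rewrite sub0r normrN.
  move: hd; rewrite lt_min => /andP[hd he].
  have -> : F' - h^-1 *: ((F \o shift x) (h *: 1) - F x) = - (h^-1 * (F (x + h) - F x - h * F')).
    by rewrite /= /GRing.scale/= mulr1 (addrC h x); field.
  rewrite normrN normrM normfV ler_pdivrMl ?normr_gt0//.
  apply: (le_trans (H h hd)); rewrite -[h ^+ 2]ger0_norm ?sqr_ge0// normrX expr2.
  rewrite mulrCA ler_wpM2l//; move: he; rewrite ltr_pdivlMr ?ltr_wpDl//.
  rewrite mulrDr mulr1 => he.
  by have := normr_ge0 h; lra.
by apply: DeriveDef; [exact: cvgP h|exact: cvg_lim h].
Unshelve. all: by end_near. Qed.

End ExpTaylor.

(** * Trigonometric integrals over a half period *)

Section Trig.
Context {R : realType}.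
Local Notation mu := (@lebesgue_measure R).
Implicit Types (f g : R -> R).

Fact cint_key : unit. Proof. exact: tt. Qed.
Definition cint := locked_with cint_key
  (fun f : R -> R => \int[mu]_(t in `[0, pi]) f t).
Local Notation J := cint.

Lemma cintE f : J f = \int[mu]_(t in `[0, pi]) f t.
Proof. by rewrite /cint unlock. Qed.

Lemma eq_J f g : (forall t, f t = g t) -> J f = J g.
Proof. by move=> fg; congr J; apply/funext. Qed.

Lemma contM f g : continuous f -> continuous g -> continuous (fun t => f t * g t).
Proof. by move=> cf cg t; exact: (continuousM (cf t) (cg t)). Qed.

Lemma contD f g : continuous f -> continuous g -> continuous (fun t => f t + g t).
Proof. by move=> cf cg t; exact: (continuousD (cf t) (cg t)). Qed.

Lemma contZ c f : continuous f -> continuous (fun t => c * f t).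
Proof. by apply: contM => t; exact: cst_continuous. Qed.

Lemma contX f p : continuous f -> continuous (fun t => f t ^+ p).
Proof.
by move=> cf t; apply: (@continuous_comp _ _ _ f (fun x => x ^+ p));
  [exact: cf|exact: exprn_continuous].
Qed.

Lemma cont_integrable f : continuous f -> mu.-integrable `[0, pi] (EFin \o f).
Proof.
move=> cf; apply: continuous_compact_integrable; first exact: segment_compact.
exact: continuous_subspaceT.
Qed.

Lemma JD f g : continuous f -> continuous g -> J (fun t => f t + g t) = J f + J g.
Proof. by move=> cf cg; rewrite !cintE RintegralD//; exact: cont_integrable. Qed.

Lemma JZ c f : continuous f -> J (fun t => c * f t) = c * J f.
Proof. by move=> cf; rewrite !cintE RintegralZl//; exact: cont_integrable. Qed.

Lemma J_le f g : continuous f -> continuous g ->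
  (forall t, 0 <= t <= pi -> f t <= g t) -> J f <= J g.
Proof.
move=> cf cg fg; rewrite !cintE; apply: le_Rintegral => //; try exact: cont_integrable.
Qed.

Definition tm m p : R -> R := fun t => cos t ^+ p * sin t ^+ m.

Lemma tm_continuous m p : continuous (@tm m p).
Proof.
by apply: contM; apply: contX; [exact: continuous_cos|exact: continuous_sin].
Qed.

Lemma tm_derive m p (t : R) : is_derive t (1 : R) (tm m.+1 p)
  ((m.+1)%:R * tm m p.+1 t - p%:R * tm m.+2 p.-1 t).
Proof.
have dc : is_derive t 1 (cos ^+ p : R -> R) ((p%:R * cos t ^+ p.-1) *: - sin t).
  exact: is_deriveX.
have ds : is_derive t 1 (sin ^+ m.+1 : R -> R) ((m.+1%:R * sin t ^+ m) *: cos t).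
  exact: is_deriveX.
have := is_deriveM dc ds.
have -> : (cos ^+ p : R -> R) * (sin ^+ m.+1) = tm m.+1 p by rewrite !exprfctE.
move=> h; apply: (is_derive_eq h).
rewrite /tm /GRing.scale/= !exprS; set C := cos t; set S := sin t.
have -> : (cos ^+ p : R -> R) t = C ^+ p by rewrite exprfctE.
have -> : (sin * sin ^+ m : R -> R) t = S * S ^+ m by rewrite mulrfctE exprfctE.
ring.
Qed.

(** [cos^p sin^(m+1)] vanishes at both ends of the interval, so its derivative has integral 0. *)
Lemma J_tm_rec m p : (m.+1)%:R * J (tm m p.+1) = p%:R * J (tm m.+2 p.-1).
Proof.
pose f t : R := m.+1%:R * tm m p.+1 t + (- p%:R) * tm m.+2 p.-1 t.
have c1 := @tm_continuous m p.+1; have c2 := @tm_continuous m.+2 p.-1.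
have c3 := @contZ m.+1%:R _ c1; have c4 := @contZ (- p%:R) _ c2.
have cf : continuous f := contD c3 c4.
have : J f = 0.
  rewrite cintE /Rintegral (@continuous_FTC2 _ f (tm m.+1 p) 0 pi)//.
  - by rewrite /tm sinpi sin0 !expr0n/= !mulr0 subrr.
  - exact: pi_gt0.
  - exact: continuous_subspaceT.
  - split.
    + by move=> t _; case: (tm_derive m p t).
    + by apply: cvg_at_right_filter; exact: tm_continuous.
    + by apply: cvg_at_left_filter; exact: tm_continuous.
  - by move=> t _; rewrite derive1E (derive_val (is_derive:=tm_derive m p t)) /f mulNr.
rewrite JD// !JZ//; lra.
Qed.

Lemma tm_sin2 m p t : tm m.+2 p t = tm m p t - tm m p.+2 t.
Proof.
rewrite /tm !exprS.
have -> : sin t * (sin t * sin t ^+ m) = (1 - cos t ^+ 2) * sin t ^+ m.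
  by rewrite -(cos2Dsin2 t); ring.
ring.
Qed.

Lemma J_tm_rec2 m p : (p.+1 + m.+1)%:R * J (tm m p.+2) = p.+1%:R * J (tm m p).
Proof.
have := J_tm_rec m p.+1; rewrite /=.
rewrite (@eq_J (tm m.+2 p) (fun t => tm m p t + (-1) * tm m p.+2 t)); last first.
  by move=> t; rewrite tm_sin2 mulN1r.
have c := @tm_continuous m.
rewrite JD//; last exact: contZ.
rewrite JZ// natrD; lra.
Qed.

Lemma J_tm1 m : J (tm m 1) = 0.
Proof.
have := J_tm_rec m 0; rewrite mul0r => /eqP; rewrite mulf_eq0 pnatr_eq0/=.
by move/eqP.
Qed.

(** Wallis recursion in steps of two, from the integrals of 1 and of the sine. *)
Lemma J_tm0_gt0 m : 0 < J (tm m 0).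
Proof.
have c := @tm_continuous.
have step k : 0 < J (tm k 0) -> 0 < J (tm k.+2 0).
  move=> h.
  have e1 : (1 + k.+1)%:R * J (tm k 2) = J (tm k 0) by rewrite J_tm_rec2 mul1r.
  rewrite (@eq_J (tm k.+2 0) (fun t => tm k 0 t + (-1) * tm k 2 t)); last first.
    by move=> t; rewrite tm_sin2 mulN1r.
  rewrite JD//; last exact: contZ.
  rewrite [X in _ + X]JZ//; move: e1; rewrite natrD => e1.
  have : 0 < k.+1%:R :> R by [].
  set a := J (tm k 0) in h e1 *; set b := J (tm k 2) in e1 *; set K := (k.+1%:R : R) in e1 *.
  move=> K0; have : a = b + K * b by rewrite -e1; ring.
  have [b0|b0] := ltP 0 b; first by move=> ->; have := mulr_gt0 K0 b0; lra.
  by lra.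
have H k : 0 < J (tm k 0) /\ 0 < J (tm k.+1 0).
  elim: k => [|k [h1 h2]]; last by split=> //; exact: step.
  split.
    rewrite (@eq_J (tm 0 0) (cst (1 : R))); last by move=> t; rewrite /tm !expr0 mulr1.
    rewrite cintE /Rintegral (@continuous_FTC2 _ (cst (1 : R)) id 0 pi)//.
    + by rewrite /= subr0 pi_gt0.
    + exact: pi_gt0.
    + by apply: continuous_subspaceT => t; exact: cst_continuous.
    + split.
      * by move=> t _; exact: derivable_id.
      * by apply: cvg_at_right_filter; exact: cvg_id.
      * by apply: cvg_at_left_filter; exact: cvg_id.
    + by move=> t _; rewrite derive1E derive_id.
  have c1 := c 1%N 0%N.
  rewrite cintE /Rintegral (@continuous_FTC2 _ (tm 1 0) (fun t => - cos t) 0 pi)//.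
  - by rewrite /= cospi cos0; lra.
  - exact: pi_gt0.
  - exact: continuous_subspaceT.
  - split.
    + by move=> t _; apply: derivableN; exact: derivable_cos.
    + by apply: cvg_at_right_filter; apply: continuousN; exact: continuous_cos.
    + by apply: cvg_at_left_filter; apply: continuousN; exact: continuous_cos.
  - move=> t _; rewrite derive1E deriveN; last exact: derivable_cos.
    by rewrite (derive_val (is_derive:=is_derive_cos t)) opprK /tm expr0 mul1r expr1.
by case: (H m).
Qed.

End Trig.

(** * Moments of one coordinate and the order parameter as integrals over the sphere *)

Section VonMises.
Context {R : realType} {n : nat}.
Variable sigma : probability (borelRn R n) R.
Hypothesis hsigma : uniform_on_sphere sigma.
Hypothesis n2 : (2 <= n)%N.
Local Notation V := 'rV[R]_n.
Local Notation I := (sint sigma).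
Implicit Types (f g : V -> R) (u v w : V) (k : R).

Lemma smooth_ev k v : smooth (fun w : V => expR (k * dot w v)).
Proof. by smooth_tac. Qed.

(* Unnormalized p-th moment of the projection on v for the weight expR (k * dot w v). *)
Definition pv p k v : R := I (fun w => dot w v ^+ p * expR (k * dot w v)).

Lemma pv_indep p k v v' : sphere v -> sphere v' -> pv p k v = pv p k v'.
Proof.
move=> v1 v1'; have [A AA vA] := sphere_transitive v1 v1'.
rewrite /pv -[RHS](@sint_orthogonal _ _ _ hsigma A)//; last by apply: smooth_scont; smooth_tac.
by apply: eq_sint => x _; rewrite -vA dot_orthogonal.
Qed.

Lemma sint_moment v p : sphere v ->
  (p.+1%:R + n%:R - 1) * I (fun w => dot w v ^+ p.+2) = p.+1%:R * I (fun w => dot w v ^+ p).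
Proof.
move=> v1; have sx := @smooth_dot R n v.
have sX q : smooth (fun w : V => dot w v ^+ q) by smooth_tac.
have cX q := smooth_scont (sX q).
have := zonal_by_parts hsigma v (sX p.+1).
rewrite (@eq_sint _ _ _ _ (fun w => p.+1%:R * dot w v ^+ p - p.+1%:R * dot w v ^+ p.+2)); last first.
  move=> w w1.
  rewrite (eq_bigr (fun i => p.+1%:R * dot w v ^+ p * (v 0 i * v 0 i) - p.+1%:R * dot w v ^+ p * dot w v * (w 0 i * v 0 i))); last first.
    by move=> i _; rewrite sd_expX// sd_dot//; ring.
  by rewrite sumrB -!mulr_sumr -!dotE; move/sphereE: v1 => ->; rewrite !exprS; ring.
rewrite sintB ?sintZ//; try exact: scontZ.
rewrite (@eq_sint _ _ _ (fun w => dot w v * dot w v ^+ p.+1) (fun w => dot w v ^+ p.+2)); last first.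
  by move=> w _; rewrite -exprS.
by lra.
Qed.

Lemma sint_dot v : I (fun w => dot w v) = 0.
Proof.
have := zonal_by_parts hsigma v (@smooth_cst R n 1).
rewrite (@eq_sint _ _ _ _ (cst 0)); last first.
  by move=> w w1; rewrite big1// => i _; rewrite sd_cst mulr0.
rewrite (sint1 hsigma) => /esym/eqP; rewrite mulf_eq0.
rewrite gt_eqF ?(lt_le_trans _ (n1_ge1 n2))//= => /eqP <-.
by apply: eq_sint => w _; rewrite mulr1.
Qed.

Local Notation J := cint.

(** Both families of moments obey the same recursion in steps of two, which comes from integration
    by parts on each side. This replaces the computation of the law of <w, v> under sigma. *)
Lemma cint_moment v p : sphere v ->
  J (tm (n - 2) p) = J (tm (n - 2) 0) * I (fun w => dot w v ^+ p).
Proof.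
move=> v1; suff H q : J (tm (n - 2) q) = J (tm (n - 2) 0) * I (fun w => dot w v ^+ q) /\
    J (tm (n - 2) q.+1) = J (tm (n - 2) 0) * I (fun w => dot w v ^+ q.+1) by case: (H p).
elim: q => [|q [h1 h2]]; split => //.
- by rewrite (@eq_sint _ _ _ _ (cst 1)) ?(sint1 hsigma) ?mulr1.
- by rewrite J_tm1 (@eq_sint _ _ _ _ (fun w => dot w v)) ?sint_dot ?mulr0.
have nE : (q.+1 + (n - 2).+1)%:R = q.+1%:R + n%:R - 1 :> R.
  have -> : (n - 2).+1 = (n - 1)%N by rewrite -subSn.
  by rewrite natrD natrB ?addrA// ltnW.
have n0 : q.+1%:R + n%:R - 1 != 0 :> R by rewrite -nE pnatr_eq0 addnS.
apply: (mulfI n0); rewrite mulrCA sint_moment// -nE J_tm_rec2 h1; ring.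
Qed.

(** The moments identify the integrals of polynomials in <w, v>; the Taylor polynomials of the
    exponential converge uniformly on [-1, 1], with the same error [r N] on both sides. *)
Lemma cint_exp v p k : sphere v -> (p <= 1)%N ->
  J (fun t => cos t ^+ p * expR (k * cos t) * sin t ^+ (n - 2)) =
  J (tm (n - 2) 0) * pv p k v.
Proof.
move=> v1 p1; set m := (n - 2)%N; set a := J (tm m 0).
have a0 : 0 < a by exact: J_tm0_gt0.
have ccos := @continuous_cos R; have csin := @continuous_sin R.
have cexp : continuous (fun t : R => expR (k * cos t)).
  by move=> t; apply: (@continuous_comp _ _ _ (fun t => k * cos t) expR);
    [exact: contZ|exact: continuous_expR].
have cS := contX (p := m) csin; have cC q := contX (p := q) ccos.
have sE := smooth_ev k v; have cE := smooth_scont sE.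
have sx := @smooth_dot R n v.
have sX q : smooth (fun w : V => dot w v ^+ q) by smooth_tac.
have cX q := smooth_scont (sX q).
pose T N y : R := expT N (k * y).
have cT N : continuous (fun t => T N (cos t)).
  rewrite /T /expT; elim: N => [|N ih].
    by under eq_fun do rewrite big_geq//; move=> t; exact: cst_continuous.
  under eq_fun do rewrite big_nat_recr//=.
  apply: contD => //; apply: contM; last by move=> t; exact: cst_continuous.
  by apply: contX; exact: contZ.
have sT N : smooth (fun w : V => T N (dot w v)).
  by rewrite /T /expT; smooth_tac.
have E N : J (fun t => cos t ^+ p * T N (cos t) * sin t ^+ m) =
           a * I (fun w => dot w v ^+ p * T N (dot w v)).
  rewrite /T /expT; elim: N => [|N ih].
    rewrite (@eq_J _ _ (fun t => 0 * cos t)); last by move=> t; rewrite big_geq// mulr0 !mul0r.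
    rewrite JZ// mul0r (@eq_sint _ _ _ _ (cst 0)) ?(sint1 hsigma) ?mulr0//.
    by move=> w _; rewrite big_geq// mulr0.
  rewrite (@eq_J _ _ (fun t => cos t ^+ p * T N (cos t) * sin t ^+ m + (k ^+ N / N`!%:R) * tm m (p + N) t)); last first.
    by move=> t; rewrite big_nat_recr//= /T /expT /tm exprD exprMn; ring.
  rewrite JD; [|by apply: contM => //; exact: contM|by apply: contZ; exact: tm_continuous].
  rewrite JZ; last exact: tm_continuous.
  rewrite ih (cint_moment (p + N) v1) -/m -/a.
  rewrite (@eq_sint _ _ _ (fun w => dot w v ^+ p * \sum_(_ <= _ < N.+1) _)
     (fun w => dot w v ^+ p * T N (dot w v) + (k ^+ N / N`!%:R) * dot w v ^+ (p + N))); last first.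
    by move=> w _; rewrite big_nat_recr//= /T /expT exprD exprMn; ring.
  rewrite sintD ?sintZ//; [ring| |exact: scontZ].
  by apply: smooth_scont; apply: smoothM; [exact: sX|exact: sT].
pose r N : R := expR `|k| - expT N `|k|.
have err N y : -1 <= y <= 1 -> `|y ^+ p * expR (k * y) - y ^+ p * T N y| <= r N.
  move=> y1; have y1' : `|y| <= 1 by rewrite ler_norml.
  rewrite -mulrBr normrM normrX.
  apply: (@le_trans _ _ (1 * r N)); last by rewrite mul1r.
  apply: ler_pM => //; first by rewrite exprn_ile1.
  by apply: expT_error; rewrite normrM ler_piMr.
apply/eqP; rewrite -subr_eq0 -normr_le0; apply/ler_addgt0Pr => e e0; rewrite add0r.
have [N hN] : exists N, 2 * a * r N <= e.
  have e1 : 0 < e / (2 * a) by rewrite divr_gt0// mulr_gt0.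
  have /cvgrPdist_le/(_ _ e1)[N _ /(_ N (leqnn N))] := @expT_cvg R `|k|.
  move=> h; exists N; rewrite -ler_pdivlMl ?mulr_gt0// mulrC.
  exact: le_trans (ler_norm _) h.
apply: le_trans hN.
set A := J _; set B := pv p k v.
pose A' := J (fun t => cos t ^+ p * T N (cos t) * sin t ^+ m).
pose B' := I (fun w => dot w v ^+ p * T N (dot w v)).
have hA : `|A - A'| <= r N * a.
  have cA : continuous (fun t : R => cos t ^+ p * expR (k * cos t) * sin t ^+ m).
    by apply: contM => //; exact: contM.
  have cA' : continuous (fun t : R => (-1) * (cos t ^+ p * T N (cos t) * sin t ^+ m)).
    by apply: contZ; apply: contM => //; exact: contM.
  have -> : A - A' = J (fun t => cos t ^+ p * expR (k * cos t) * sin t ^+ m +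
      (-1) * (cos t ^+ p * T N (cos t) * sin t ^+ m)).
    rewrite JD// JZ ?mulN1r//; by apply: contM => //; exact: contM.
  have cab := contD cA cA'.
  have crt : continuous (fun t => r N * tm m 0 t) by apply: contZ; exact: tm_continuous.
  have b t : 0 <= t <= pi -> `|cos t ^+ p * expR (k * cos t) * sin t ^+ m +
      (-1) * (cos t ^+ p * T N (cos t) * sin t ^+ m)| <= r N * tm m 0 t.
    move=> tpi; rewrite mulN1r -mulrBl normrM /tm expr0 mul1r.
    have s0 : 0 <= sin t ^+ m by rewrite exprn_ge0// sin_ge0_pi.
    rewrite (ger0_norm s0) ler_wpM2r//; apply: err.
    by rewrite cos_geN1 cos_le1.
  rewrite -JZ; last exact: tm_continuous.
  rewrite ler_norml; apply/andP; split.
    rewrite -[leLHS]mulN1r -JZ//; apply: J_le => //; first exact: contZ.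
    by move=> t /b; rewrite ler_norml => /andP[h _]; rewrite [leLHS]mulN1r.
  by apply: J_le => // t /b; rewrite ler_norml => /andP[].
have hB : `|B - B'| <= r N.
  have cB : scont (fun w => dot w v ^+ p * expR (k * dot w v)) by exact: scontM.
  have cB' : scont (fun w => dot w v ^+ p * T N (dot w v)).
    by apply: scontM => //; exact: smooth_scont.
  rewrite /B /pv /B' -sintB//; apply: (ler_norm_sint hsigma); first exact: scontB.
  by move=> w w1; apply: err; exact: dot_sphere_le1.
have -> : A - a * B = (A - A') - a * (B - B').
  by rewrite mulrBr [A']E -/B'; ring.
apply: (le_trans (ler_normB _ _)).
rewrite [X in _ + X]normrM (gtr0_norm a0).
have : a * `|B - B'| <= a * r N by rewrite ler_pM2l.
by lra.
Qed.

Lemma order_paramE v k : sphere v -> order_param n k = pv 1 k v / pv 0 k v.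
Proof.
move=> v1; rewrite /order_param -!cintE.
have -> : cint (fun th : R => cos th * expR (k * cos th) * sin th ^+ (n - 2)) = J (tm (n - 2) 0) * pv 1 k v.
  by rewrite -cint_exp//; apply: eq_J => t; rewrite expr1.
have -> : cint (fun th : R => expR (k * cos th) * sin th ^+ (n - 2)) = J (tm (n - 2) 0) * pv 0 k v.
  by rewrite -cint_exp//; apply: eq_J => t; rewrite expr0 mul1r.
by rewrite -mulf_div divff ?mul1r// gt_eqF// J_tm0_gt0.
Qed.

Lemma pv0_gt0 v k : sphere v -> 0 < pv 0 k v.
Proof.
move=> v1; apply: (@lt_le_trans _ _ (expR (- `|k|))); first exact: expR_gt0.
rewrite -(sint1 hsigma (expR _)); apply: ler_sint; first exact: scont_cst.
  by apply: smooth_scont; smooth_tac.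
move=> w w1; rewrite expr0 mul1r ler_expR /cst.
rewrite -lerN2 opprK (le_trans (ler_norm _))// normrN normrM ler_piMr//.
by rewrite ler_norml dot_sphere_le1.
Qed.

Lemma is_derive_pv p k v : sphere v -> is_derive k 1 (fun k => pv p k v) (pv p.+1 k v).
Proof.
move=> v1; have sx := @smooth_dot R n v.
apply: (@taylor_is_derive _ _ _ _ (2 * expR `|k|) (2^-1)) => // h h2.
have sX q : smooth (fun w : V => dot w v ^+ q) by smooth_tac.
have cp q l : scont (fun w => dot w v ^+ q * expR (l * dot w v)).
  by apply: smooth_scont; smooth_tac.
rewrite /pv -sintB// -sintZ// -sintB; [|exact: scontB|exact: scontZ].
apply: (ler_norm_sint hsigma).
  by apply: scontB; [exact: scontB|exact: scontZ].
move=> w w1; set x := dot w v.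
have x1 : `|x| <= 1 by rewrite ler_norml dot_sphere_le1.
rewrite exprSr (_ : _ - _ = x ^+ p * (expR (k * x) * (expR (h * x) - 1 - h * x))); last first.
  by rewrite mulrDl expRD; ring.
have hx : `|h * x| <= 2^-1 by rewrite normrM (le_trans (ler_piMr _ x1))// ltW.
have := expR_taylor2 hx; rewrite !normrM normrX => t2.
rewrite -[leRHS]mul1r; apply: ler_pM => //; first by rewrite exprn_ile1.
rewrite -mulrA mulrCA; apply: ler_pM => //.
  rewrite ger0_norm ?expR_ge0// ler_expR (le_trans (ler_norm _))//.
  by rewrite normrM ler_piMr.
apply: (le_trans t2); rewrite ler_pM2l// exprMn ler_piMr ?sqr_ge0//.
by rewrite -real_normK ?num_real// exprn_ile1.
Qed.

(** The variance of <w, v> under the von Mises-Fisher law of parameter k; it turns out to be the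
    derivative of the order parameter. *)
Definition pvar k v : R := pv 2 k v / pv 0 k v - (pv 1 k v / pv 0 k v) ^+ 2.

Lemma is_derive_order_param v k : sphere v ->
  is_derive k 1 (fun k => order_param n k) (pvar k v).
Proof.
move=> v1.
have -> : (fun k => order_param n k) = (fun k => pv 1 k v * (pv 0 k v)^-1).
  by apply/funext => l; rewrite (order_paramE l v1).
have d0 := is_derive_pv 0 k v1; have d1 := is_derive_pv 1 k v1.
have z0 : pv 0 k v != 0 by rewrite gt_eqF// pv0_gt0.
have dV : is_derive k 1 (fun k => (pv 0 k v)^-1) (- (pv 0 k v) ^- 2 *: pv 1 k v).
  exact: is_deriveV.
have := is_deriveM d1 dV.
move=> h; apply: (is_derive_eq h).
by rewrite /pvar /GRing.scale/=; field.
Qed.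

End VonMises.

(** * Von Mises-Fisher densities *)

Section VonMisesMeasure.
Context {R : realType} {n : nat}.
Variable sigma : probability (borelRn R n) R.
Hypothesis hsigma : uniform_on_sphere sigma.
Hypothesis n2 : (2 <= n)%N.
Local Notation V := 'rV[R]_n.
Local Notation I := (sint sigma).
Implicit Types (f g : V -> R) (u v w : V).

Definition north : V := delta_mx 0 (Ordinal (ltnW n2)).

Lemma sphere_north : sphere north.
Proof. by apply/sphereE; rewrite dot_delta mxE !eqxx. Qed.

Variable k : R.
Hypothesis k0 : 0 <= k.
(** Evaluated at one fixed pole: by invariance it is the normalization for all unit directions, so
    that only the exponent of [vm] depends on the direction. *)
Definition vmZ : R := pv sigma 0 k north.
Definition vm v w : R := expR (k * dot w v) / vmZ.
Definition vmvar : R := pvar sigma k north.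
Local Notation c := (order_param n k).
Local Notation Z := vmZ.
Local Notation M := vm.

Lemma vmZ_gt0 : 0 < Z. Proof. exact: (pv0_gt0 hsigma _ sphere_north). Qed.

Lemma vmZE v : sphere v -> I (fun w => expR (k * dot w v)) = Z.
Proof.
move=> v1; rewrite /vmZ -(pv_indep hsigma 0 k v1 sphere_north).
by apply: eq_sint => w _; rewrite expr0 mul1r.
Qed.

Lemma vonMisesE v : sphere v -> vonMises sigma k v = M v.
Proof.
by move=> v1; apply/funext => w; rewrite /vonMises -sintE vmZE.
Qed.

Lemma smooth_vm v : smooth (M v).
Proof.
rewrite /vm; under eq_fun do rewrite mulrC.
by apply: smoothZ; exact: smooth_ev.
Qed.

Lemma scont_vm v : scont (M v). Proof. exact/smooth_scont/smooth_vm. Qed.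

Lemma vm_gt0 v w : 0 < M v w.
Proof. by rewrite divr_gt0 ?expR_gt0// vmZ_gt0. Qed.

Lemma sint_vm v : sphere v -> I (M v) = 1.
Proof.
move=> v1; have Z0 := vmZ_gt0.
rewrite (@eq_sint _ _ _ _ (fun w => Z^-1 * expR (k * dot w v))); last first.
  by move=> w _; rewrite /vm mulrC.
by rewrite sintZ ?vmZE ?mulVf ?gt_eqF//; exact/smooth_scont/smooth_ev.
Qed.

Lemma vm_le v w : sphere v -> sphere w -> M v w <= expR k / Z.
Proof.
move=> v1 w1; rewrite ler_pM2r ?invr_gt0 ?vmZ_gt0// ler_expR ler_piMr//.
by have /andP[] := dot_sphere_le1 v1 w1.
Qed.

Lemma vm_ge v w : sphere v -> sphere w -> expR (- k) / Z <= M v w.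
Proof.
move=> v1 w1; rewrite ler_pM2r ?invr_gt0 ?vmZ_gt0// ler_expR -[leLHS]mulr1 mulNr -mulrN.
by rewrite ler_wpM2l//; have /andP[] := dot_sphere_le1 v1 w1.
Qed.

Lemma expR_lip (a b B : R) : a <= B -> b <= B -> `|expR a - expR b| <= expR B * `|a - b|.
Proof.
wlog ab : a b / b <= a.
  move=> H aB bB; have [/H|/ltW/H] := leP b a; first exact.
  by move=> h; rewrite distrC [`|a - b|]distrC; exact: h.
move=> aB bB; rewrite ger0_norm ?subr_ge0 ?ler_expR// ger0_norm ?subr_ge0//.
have h : expR a - expR b <= expR a * (a - b).
  have := expR_ge1Dx (b - a); rewrite expRD expRN => h.
  have ea := expR_gt0 a.
  have : expR a * (1 + (b - a)) <= expR a * (expR b * (expR a)^-1) by rewrite ler_pM2l.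
  by rewrite mulrCA mulfV ?gt_eqF// mulr1; lra.
by apply: le_trans h _; rewrite ler_wpM2r ?subr_ge0// ler_expR.
Qed.

Lemma vm_lip v v' w : sphere v -> sphere v' -> sphere w ->
  `|M v w - M v' w| <= expR k * k / Z * eucl (v - v').
Proof.
move=> v1 v1' w1; have Z0 := vmZ_gt0.
rewrite /vm -mulrBl normrM [`|Z^-1|]gtr0_norm ?invr_gt0//.
rewrite mulrAC ler_pM2r ?invr_gt0//.
have le1 x : sphere x -> k * dot w x <= k.
  by move=> x1; rewrite ler_piMr//; have /andP[] := dot_sphere_le1 x1 w1.
apply: le_trans (expR_lip (le1 _ v1) (le1 _ v1')) _.
rewrite -mulrA ler_pM2l ?expR_gt0// -mulrBr -dotBr normrM ger0_norm// ler_wpM2l//.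
by apply: le_trans (ler_dot _ _) _; rewrite w1 mul1r.
Qed.

Lemma sd_vm v (i : 'I_n) w : sphere w -> sd i (M v) w = k * M v w * (v 0 i - w 0 i * dot w v).
Proof.
move=> w1; rewrite (@eq_sd _ _ i _ (fun w => Z^-1 * expR (k * dot w v)) w w1); last first.
  by move=> x _; rewrite /vm mulrC.
rewrite sdZ//; last exact: smooth_ev.
rewrite sd_exp//; last by smooth_tac.
rewrite sdZ//; last exact: smooth_dot.
by rewrite sd_dot// /vm; ring.
Qed.

Lemma sgdot_vm v f w : smooth f -> sphere w ->
  sgdot (M v) f w = k * M v w * \sum_i v 0 i * sd i f w.
Proof.
move=> sf w1; rewrite -sgdot_dot// /sgdot mulr_sumr; apply: eq_bigr => i _.
by rewrite (sd_vm v i w1) (sd_dot i v w1); ring.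
Qed.

(** M is an equilibrium: its gradient is k M times the gradient of <w, v>, and the rest is an
    integration by parts. *)
Lemma vm_stationary v f : smooth f ->
  I (fun w => M v w * (k * (\sum_i v 0 i * sd i f w) + slap f w)) = 0.
Proof.
move=> sf; have sM := smooth_vm v.
have sg : smooth (fun w => \sum_i v 0 i * sd i f w).
  by apply: smooth_sum => i; apply: smoothZ; exact: smooth_sd.
rewrite (@eq_sint _ _ _ _ (fun w => sgdot (M v) f w + M v w * slap f w)); last first.
  by move=> w w1; rewrite sgdot_vm//; ring.
have sl := smooth_slap sf.
rewrite sintD; [|by apply: smooth_scont; exact: smooth_sgdot|by apply: smooth_scont; exact: smoothM].
by rewrite sint_slap// subrr.
Qed.

Lemma vm_mean_dot v u : sphere v -> I (fun w => M v w * dot w u) = c * dot v u.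
Proof.
(* The isometry that fixes [v] and reverses its orthogonal complement. It preserves M, so the mean
   of w is parallel to [v]. *)
move=> v1; pose A : 'M[R]_n := 2 *: (v^T *m v) - 1%:M.
have vv : dot v v = 1 by exact/sphereE.
have AE x : x *m A = (2 * dot x v) *: v - x.
  rewrite /A mulmxBr mulmx1 -scalemxAr mulmxA -scalerA; congr (_ *: _ - _).
  by rewrite [x *m v^T]mx11_scalar mul_scalar_mx.
have AA : A *m A^T = 1%:M.
  apply: orthogonalP => x y; rewrite !AE !(dotBl, dotBr, dotZl, dotZr) vv (dotC v y); ring.
have cM : scont (M v) by exact: scont_vm.
have cMu : scont (fun w => M v w * dot w u) by apply: scontM => //; exact: scont_dot.
have cMv : scont (fun w => M v w * dot w v) by apply: scontM => //; exact: scont_dot.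
have cE : I (fun w => M v w * dot w v) = c.
  rewrite (order_paramE hsigma n2 _ v1) (pv_indep hsigma 0 k v1 sphere_north).
  rewrite mulrC -sintZ; last by apply: smooth_scont; smooth_tac.
  by apply: eq_sint => w _; rewrite /vm expr1; ring.
have := sint_orthogonal hsigma AA cMu.
rewrite (@eq_sint _ _ _ _ (fun w => (2 * dot v u) * (M v w * dot w v) - M v w * dot w u)); last first.
  move=> w w1; rewrite /vm AE !(dotBl, dotZl) vv mulr1.
  have -> : 2 * dot w v - dot w v = dot w v by ring.
  ring.
rewrite sintB ?sintZ//; last exact: scontZ.
by rewrite cE; lra.
Qed.

Lemma vm_mean_sqr v : sphere v -> I (fun w => M v w * dot w v ^+ 2) = vmvar + c ^+ 2.
Proof.
move=> v1; rewrite /vmvar /pvar -(order_paramE hsigma n2 _ sphere_north) subrK.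
rewrite (pv_indep hsigma 2 k sphere_north v1) mulrC -sintZ; last by apply: smooth_scont; smooth_tac.
by apply: eq_sint => w _; rewrite /vm; ring.
Qed.

Lemma vm_centered v g : sphere v -> scont g ->
  I (fun w => M v w * (g w - I (fun w => M v w * g w)) ^+ 2) =
  I (fun w => M v w * g w ^+ 2) - I (fun w => M v w * g w) ^+ 2.
Proof.
move=> v1 cg; set a := I (fun w => M v w * g w); have cM : scont (M v) by exact: scont_vm.
have cMg := scontM cM cg; have cMg2 := scontM cM (scontX (k := 2) cg).
rewrite (@eq_sint _ _ _ _ (fun w => M v w * g w ^+ 2 - (2 * a) * (M v w * g w) + a ^+ 2 * M v w)); last first.
  by move=> w _; ring.
rewrite sintD ?sintB ?sintZ ?sint_vm//; try (by apply: scontZ); last first.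
  by apply: scontB => //; exact: scontZ.
by rewrite -/a; ring.
Qed.

(** Zero variance would make <w, v> constant on the sphere, although it takes opposite nonzero
    values at v and -v. *)
Lemma vmvar_gt0 : 0 < vmvar.
Proof.
pose v := north; have v1 : sphere v := sphere_north.
have cd := @scont_dot R n v.
pose h w := M v w * (dot w v - c) ^+ 2.
have hE : I h = vmvar.
  have := vm_centered v1 cd; rewrite vm_mean_sqr// vm_mean_dot//.
  have -> : dot v v = 1 by exact/sphereE.
  by rewrite mulr1 /h => ->; rewrite addrK.
have ch : scont h.
  apply: scontM; first exact: scont_vm.
  by apply: scontX; apply: scontB => //; exact: scont_cst.
have h0 w : sphere w -> 0 <= h w by move=> _; rewrite mulr_ge0 ?sqr_ge0// ltW// vm_gt0.
rewrite lt_def -hE (sint_ge0 sigma h0) andbT; apply/eqP => /(sint_eq0 hsigma n2 ch h0) e.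
have z w : sphere w -> dot w v = c.
  move=> /e/eqP; rewrite mulf_eq0 gt_eqF ?vm_gt0//= sqrf_eq0 subr_eq0.
  by move/eqP.
have vN : sphere (- v) by apply/sphereE; rewrite dotNl dotNr opprK; exact/sphereE.
have := z _ v1; have := z _ vN; rewrite dotNl.
have -> : dot v v = 1 by exact/sphereE.
lra.
Qed.

(** Since <w, v> has mean 0 under sigma, the first moment is the integral of x (exp (k x) - 1),
    which is nonnegative, and positive at x = 1. *)
Lemma order_param_gt0 : 0 < k -> 0 < c.
Proof.
move=> kp; pose v := north; have v1 : sphere v := sphere_north.
rewrite (order_paramE hsigma n2 _ v1) divr_gt0 ?(pv0_gt0 hsigma)//.
pose h w := dot w v * (expR (k * dot w v) - 1).
have sh : smooth h by rewrite /h; smooth_tac.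
have ch := smooth_scont sh.
have -> : pv sigma 1 k v = I h.
  rewrite -[LHS]subr0 -(sint_dot hsigma n2 v) /pv -sintB.
  - by apply: eq_sint => w _; rewrite /h expr1; ring.
  - by apply: smooth_scont; smooth_tac.
  - exact: scont_dot.
have h0 w : sphere w -> 0 <= h w.
  move=> w1; rewrite /h; set x := dot w v; have [x0|x0] := leP 0 x.
    by rewrite mulr_ge0// subr_ge0 -expR0 ler_expR mulr_ge0.
  rewrite mulr_le0 ?(ltW x0)// subr_le0 -expR0 ler_expR pmulr_rle0// ltW//.
rewrite lt_def (sint_ge0 sigma h0) andbT; apply/eqP => /(sint_eq0 hsigma n2 ch h0) /(_ _ v1).
rewrite /h; have -> : dot v v = 1 by exact/sphereE.
rewrite mul1r mulr1 => /eqP; rewrite subr_eq0 => /eqP ek.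
by have := @expR_gt1 R k; rewrite kp ek ltxx.
Qed.

Lemma sqr_eucl_sgrad g w : eucl (sgrad g w) ^+ 2 = sgdot g g w.
Proof. by rewrite sqr_eucl dotE; apply: eq_bigr => i _; rewrite sgradE. Qed.

Local Notation Lam := (poincare_constant sigma k).

Lemma vM_meanE v g : sphere v -> vM_mean sigma k v g = I (fun w => M v w * g w).
Proof.
by move=> v1; rewrite /vM_mean -sintE; apply: eq_sint => w _; rewrite vonMisesE// mulrC.
Qed.

Let PS : set R := [set L : R | forall v g, sphere v -> smooth g ->
    L * I (fun w => M v w * (g w - I (fun w => M v w * g w)) ^+ 2)
      <= I (fun w => M v w * sgdot g g w)].

Lemma poincare_constantE : Lam = sup PS.
Proof.
rewrite /poincare_constant; congr sup; apply/seteqP; split => L /= H v g v1 sg;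
  have := H v g v1 sg; rewrite !vM_meanE//;
  by rewrite (@eq_sint _ _ _ (fun w => M v w * eucl (sgrad g w) ^+ 2)
       (fun w => M v w * sgdot g g w))// => w _; rewrite sqr_eucl_sgrad.
Qed.

Lemma sgdot_ge0 g w : 0 <= sgdot g g w.
Proof. by apply: sumr_ge0 => i _; rewrite -expr2 sqr_ge0. Qed.

(** Perturbation of the uniform Poincare inequality: the density M lies between [expR (- k) / Z] and
    [expR k / Z], and the variance is at most the second moment about any constant, here the uniform
    mean of [g]. *)
Lemma PS_lower : PS (expR (- k) / expR k).
Proof.
move=> v g v1 sg; have Z0 := vmZ_gt0; have cM : scont (M v) by exact: scont_vm.
have cg := smooth_scont sg; have cgg : scont (sgdot g g) by exact/smooth_scont/smooth_sgdot.
pose a := I g.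
pose g' := fun w => g w - a; have sg' : smooth g' by apply: smoothB => //; exact: smooth_cst.
have cg' := smooth_scont sg'.
have g'0 : I g' = 0.
  rewrite /g' sintB//; last exact: scont_cst.
  by rewrite -/(cst a) (sint1 hsigma) subrr.
have e1 : I (fun w => M v w * (g w - I (fun w => M v w * g w)) ^+ 2) <= I (fun w => M v w * g' w ^+ 2).
  have -> : I (fun w => M v w * (g w - I (fun w => M v w * g w)) ^+ 2) =
     I (fun w => M v w * (g' w - I (fun w => M v w * g' w)) ^+ 2).
    apply: eq_sint => w _; congr (_ * _ ^+ 2).
    rewrite (@eq_sint _ _ _ (fun w => M v w * g' w) (fun w => M v w * g w - a * M v w)); last first.
      by move=> x _; rewrite /g'; ring.
    rewrite sintB; [|exact: scontM|exact: scontZ].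
    rewrite sintZ// sint_vm//.
    by rewrite /g'; ring.
  rewrite vm_centered// gerBl sqr_ge0//.
have e2 : I (fun w => M v w * g' w ^+ 2) <= expR k / Z * I (fun w => g' w ^+ 2).
  rewrite -sintZ; last exact: scontX.
  apply: ler_sint; first by apply: scontM => //; exact: scontX.
    by apply: scontZ; exact: scontX.
  by move=> w w1; rewrite ler_wpM2r ?sqr_ge0// vm_le.
have e3 := poincare hsigma n2 sg' g'0.
have e4 : I (sgdot g' g') = I (sgdot g g).
  apply: eq_sint => w w1; apply: eq_bigr => i _.
  by rewrite /g' sdB//; [rewrite (sd_cst i a) subr0|exact: smooth_cst].
have e5 : expR (- k) / Z * I (sgdot g g) <= I (fun w => M v w * sgdot g g w).
  rewrite -sintZ//; apply: ler_sint; [exact: scontZ|exact: scontM|].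
  by move=> w w1; rewrite ler_wpM2r ?vm_ge// sgdot_ge0.
apply: le_trans e5; rewrite -e4.
have ek := expR_gt0 k; have eNk := expR_gt0 (- k).
apply: (@le_trans _ _ (expR (- k) / expR k * (expR k / Z * I (sgdot g' g')))).
  rewrite ler_pM2l ?divr_gt0//; apply: le_trans e1 _; apply: le_trans e2 _.
  by rewrite ler_pM2l ?divr_gt0.
by rewrite mulrA mulrA divfK ?gt_eqF.
Qed.

Lemma vm_poincare v g : sphere v -> smooth g ->
  Lam * (I (fun w => M v w * g w ^+ 2) - I (fun w => M v w * g w) ^+ 2)
    <= I (fun w => M v w * sgdot g g w).
Proof.
move=> v1 sg; have cg := smooth_scont sg; rewrite -vm_centered//.
set A := I _; set B := I _.
have A0 : 0 <= A by apply: sint_ge0 => w _; rewrite mulr_ge0 ?sqr_ge0// ltW// vm_gt0.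
have B0 : 0 <= B by apply: sint_ge0 => w _; rewrite mulr_ge0 ?sgdot_ge0// ltW// vm_gt0.
have [->|A1] := eqVneq A 0; first by rewrite mulr0.
have {A1}A0 : 0 < A by rewrite lt_def A1.
rewrite -ler_pdivlMr// poincare_constantE; apply: ge_sup.
  by exists (expR (- k) / expR k); exact: PS_lower.
by move=> L /(_ v g v1 sg); rewrite -ler_pdivlMr.
Qed.

Lemma poincare_constant_gt0 : 0 < Lam.
Proof.
rewrite poincare_constantE; apply: (@lt_le_trans _ _ (expR (- k) / expR k)).
  by rewrite divr_gt0 ?expR_gt0.
apply: ub_le_sup; last exact: PS_lower.
(* A supremum needs an upper bound for the admissible constants: the test function <w, v>, of
   positive variance, provides one. *)
pose v := north; have v1 : sphere v := sphere_north; have sd := @smooth_dot R n v.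
have := vmvar_gt0; have := vm_centered v1 (smooth_scont sd).
rewrite vm_mean_sqr// vm_mean_dot//; have -> : dot v v = 1 by exact/sphereE.
rewrite mulr1 addrK => e v0.
exists (I (fun w => M v w * sgdot (fun w => dot w v) (fun w => dot w v) w) / vmvar) => L /(_ v _ v1 sd).
rewrite vm_mean_dot//; have -> : dot v v = 1 by exact/sphereE.
by rewrite mulr1 e -ler_pdivlMr.
Qed.

End VonMisesMeasure.

(** * The coefficients *)

Section Coefficients.
Context {R : realType} {n : nat}.
Variable sigma : probability (borelRn R n) R.
Hypothesis hsigma : uniform_on_sphere sigma.
Hypothesis n2 : (2 <= n)%N.
Variables (nu tau : R -> R) (kmax : \bar R) (j : R -> R).
Hypothesis hcoef : coefficients nu tau kmax j.
Variable kappa : R.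
Hypothesis kappa0 : 0 < kappa.
Hypothesis kappa1 : (kappa%:E < kmax)%E.
Local Notation K := (fun r => nu r / tau r).

Lemma lipschitz_ex (f : R -> R) (A : set R) : [lipschitz f r | r in A] ->
  exists2 L : R, 0 < L & forall x y, A x -> A y -> `|f x - f y| <= L * `|x - y|.
Proof.
move=> /pinfty_ex_gt0[L L0 /= h]; exists L => // x y Ax Ay.
exact: (h (x, y) (conj Ax Ay)).
Qed.

Lemma bounded_ex (f : R -> R) (A : set R) : [bounded f r | r in A] ->
  exists2 L : R, 0 < L & forall x, A x -> `|f x| <= L.
Proof.
move=> /pinfty_ex_gt0[L L0 /= h]; exists L => // x Ax; exact: h.
Qed.

Lemma tau_lip_ex : exists2 L : R, 0 < L &
  forall x y : R, 0 <= x -> 0 <= y -> `|tau x - tau y| <= L * `|x - y|.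
Proof.
have [L L0 h] := lipschitz_ex (tau_lip hcoef); exists L => // x y x0 y0.
by apply: h; rewrite /= in_itv/= andbT.
Qed.

Lemma tau_bnd_ex : exists2 L : R, 0 < L & forall x, 0 <= x -> tau x <= L.
Proof.
have [L L0 h] := bounded_ex (tau_bnd hcoef); exists L => // x x0.
by apply: le_trans (ler_norm _) _; apply: h; rewrite /= in_itv/= andbT.
Qed.

(** The bound on nu(r)/r concerns r > 0, so it says nothing directly at 0. If j(kappa) were 0,
    monotonicity would give [kappa tau(x) < nu(x) <= C x] for all x > 0. *)
Lemma j_gt0 : 0 < j kappa.
Proof.
have [j0 jk] := jK hcoef (ltW kappa0) kappa1.
rewrite lt_def j0 andbT; apply/eqP => je; move: jk; rewrite je => k0E.
have [C C0 hC] := bounded_ex (nu_bnd hcoef); have [L L0 hL] := tau_lip_ex.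
have t0 := tau_gt0 hcoef (lexx 0).
(* The point where [kappa (tau 0 - L x) = C x]. *)
pose x := (kappa * tau 0) / (C + kappa * L).
have d0 : 0 < C + kappa * L by rewrite addr_gt0// mulr_gt0.
have x0 : 0 < x by rewrite divr_gt0// mulr_gt0.
have tx := tau_gt0 hcoef (ltW x0).
have h1 : kappa * tau x < nu x.
  by rewrite -ltr_pdivlMr// -k0E; exact: (k_incr hcoef).
have h2 : nu x <= C * x.
  rewrite -ler_pdivrMr// (le_trans (ler_norm _))//; apply: hC.
  by rewrite /= in_itv/= x0.
have h3 : tau 0 - L * x <= tau x.
  have := hL _ _ (lexx 0) (ltW x0); rewrite sub0r normrN [`|x|]gtr0_norm// => h.
  by have := le_trans (ler_norm _) h; lra.
have h4 : kappa * (tau 0 - L * x) <= kappa * tau x by rewrite ler_pM2l.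
have : x * (C + kappa * L) = kappa * tau 0 by rewrite divfK// gt_eqF.
lra.
Qed.

Lemma k_derive : exists2 dk : R -> R,
  (forall r : R, 0 < r -> is_derive r (1 : R) K (dk r)) &
  exists2 L : R, 0 < L & forall x y : R, 0 <= x -> 0 <= y -> `|dk x - dk y| <= L * `|x - y|.
Proof.
have [dk [/lipschitz_ex[L L0 hL] hd]] := k_diff hcoef; exists dk; last first.
  by exists L => // x y x0 y0; apply: hL; rewrite /= in_itv/= andbT.
move=> r r0; have := hd r (ltW r0) => hr.
have h : h^-1 *: ((K \o shift r) (h *: (1 : R)) - K r) @[h --> 0^'] --> dk r.
  apply/cvgrPdist_le => e e0; move/cvgrPdist_le : hr => /(_ e e0).
  move=> /nbhs_ballP[d /= d0 hd'].
  apply/nbhs_ballP; exists (Num.min d r) => /=; first by rewrite lt_min d0.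
  move=> h; rewrite /ball/= sub0r normrN lt_min => /andP[hd2 hr2] h0.
  have := hd' (r + h); rewrite /ball/= opprD addNKr normrN => /(_ hd2) H.
  have rh0 : r + h != r by rewrite -subr_eq0 addrAC subrr add0r.
  have rh : r + h \in `[0, +oo[.
    rewrite in_itv/= andbT; move: hr2; rewrite ltr_norml => /andP[]; lra.
  have := H rh0 rh; rewrite /GRing.scale/= mulr1 (addrC h r).
  by have -> : r + h - r = h; [rewrite addrAC subrr add0r|rewrite mulrC].
by apply: DeriveDef; [exact: cvgP h|exact: cvg_lim h].
Qed.

Lemma MVT_le (F dF : R -> R) (x y : R) : x <= y ->
  (forall z : R, x <= z <= y -> is_derive z (1 : R) F (dF z)) ->
  exists2 z, x <= z <= y & F y - F x = dF z * (y - x).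
Proof.
rewrite le_eqVlt => /predU1P[<- _|xy H].
  by exists x; rewrite ?lexx// !subrr mulr0.
have [z zi e] : exists2 c, c \in `]x, y[%R & F y - F x = dF c * (y - x).
  apply: MVT => //.
    by move=> z; rewrite in_itv/= => /andP[xz zy]; apply: H; rewrite !ltW.
  apply: continuous_in_subspaceT => z; rewrite inE/= in_itv/= => zi.
  by apply: differentiable_continuous; apply/derivable1_diffP; case: (H z zi).
by exists z => //; move: zi; rewrite in_itv/= => /andP[? ?]; rewrite !ltW.
Qed.

Hypothesis hderivable : derivable (fun x => j x / order_param n x) kappa 1.

Lemma near_kappa : \forall x \near kappa, 0 < x /\ (x%:E < kmax)%E.
Proof.
near=> x; split; first by near: x; exact: lt_nbhsr.
near: x; case E : kmax kappa1 => [r||]//.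
- by rewrite lte_fin => kr; near=> x; rewrite lte_fin; near: x; exact: lt_nbhsl.
- by move=> _; apply: nearW => x; rewrite ltry.
Unshelve. all: by end_near. Qed.

(** Near kappa, j is the product of j/c and c, hence differentiable; the chain rule for
    [K (j x) = x] then gives [k1 j' = 1], which excludes [k1 = 0]. *)
Lemma is_derive_j (k1 : R) : is_derive (j kappa) (1 : R) K k1 ->
  k1 != 0 /\ is_derive kappa (1 : R) j k1^-1.
Proof.
move=> dK; have dc := is_derive_order_param hsigma n2 kappa (sphere_north n2).
have dG := DeriveDef hderivable erefl.
have dGc := is_deriveM dG dc.
have nj : \near kappa, ((fun x => j x / order_param n x) * order_param n) kappa = j kappa.
  apply: filterS near_kappa => x [x0 _].
  by rewrite /GRing.mul/= divfK// gt_eqF// (order_param_gt0 hsigma n2 (ltW x0)).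
have dj := near_eq_is_derive nj dGc.
have dKj := is_derive1_comp dK dj.
have nid : \near kappa, (K \o j) kappa = id kappa.
  apply: filterS near_kappa => x [x0 x1].
  by have [_ e] := jK hcoef (ltW x0) x1.
have := near_eq_is_derive nid dKj; set D := (_ + _) => did.
have e : k1 * D = 1 by rewrite -(derive_val (is_derive := did)) derive_id.
have k10 : k1 != 0 by apply: contraPneq e => ->; rewrite mul0r => /eqP; rewrite eq_sym oner_eq0.
split; [exact: k10|]; apply: (is_derive_eq dj).
by apply: (mulfI k10); rewrite e mulfV.
Qed.

Lemma k_taylor : exists k1 : R, exists2 CK : R, 0 < CK & [/\ 0 < k1,
  is_derive (j kappa) (1 : R) K k1 &
  forall r : R, 0 < r -> `|K r - kappa - k1 * (r - j kappa)| <= CK * (r - j kappa) ^+ 2].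
Proof.
have [dk hK [L L0 hL]] := k_derive; have j0 := j_gt0.
have [_ jk] := jK hcoef (ltW kappa0) kappa1.
have [dk0 _] := is_derive_j (hK _ j0).
have taylor (r : R) : 0 < r ->
    `|K r - kappa - dk (j kappa) * (r - j kappa)| <= L * (r - j kappa) ^+ 2.
  move=> r0; rewrite (_ : K r - kappa = K r - K (j kappa)); last by rewrite jk.
  have [z [z0 zr] ->] : exists2 z, 0 < z /\ `|z - j kappa| <= `|r - j kappa| &
      K r - K (j kappa) = dk z * (r - j kappa).
    have [jr|rj] := leP (j kappa) r.
      have [z /andP[z1 z2] e] := MVT_le jr (fun z h => hK z (lt_le_trans j0 (proj1 (andP h)))).
      exists z => //; split; first exact: lt_le_trans z1.
      by rewrite !ger0_norm ?subr_ge0//; lra.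
    have [z /andP[z1 z2] e] := MVT_le (ltW rj) (fun z h => hK z (lt_le_trans r0 (proj1 (andP h)))).
    exists z; last by rewrite -opprB e; ring.
    split; first exact: lt_le_trans z1.
    by rewrite distrC [leRHS]distrC !ger0_norm ?subr_ge0//; lra.
  rewrite -mulrBl normrM expr2 -[(r - _) * (r - _)]ger0_norm ?normrM; last first.
    by rewrite -expr2 sqr_ge0.
  rewrite mulrA ler_wpM2r// (le_trans (hL _ _ (ltW z0) (ltW j0)))//.
  by rewrite ler_pM2l.
exists (dk (j kappa)), L; [exact: L0|split; [|exact: hK|exact: taylor]].
rewrite lt_neqAle eq_sym dk0/=.
rewrite leNgt; apply/negP => k1.
(* If the derivative were negative, the quadratic remainder [L h^2] would be only half of the linear
   decrease at this step, so K would decrease. *)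
pose h := - dk (j kappa) / (2 * L).
have h0 : 0 < h by rewrite divr_gt0 ?mulr_gt0// oppr_gt0.
have jh : 0 < j kappa + h by rewrite addr_gt0.
have := taylor _ jh; rewrite (_ : j kappa + h - j kappa = h); last by ring.
have : K (j kappa) < K (j kappa + h) by apply: (k_incr hcoef); [exact: ltW|rewrite ltrDl].
rewrite jk => kh /(le_trans (ler_norm _)).
have : L * h ^+ 2 = - dk (j kappa) * h / 2 by rewrite /h; field; rewrite gt_eqF.
have : 0 < - dk (j kappa) * h by rewrite mulr_gt0// oppr_gt0.
lra.
Qed.

(** With [j' = 1 / k1] and c' equal to the variance, the quotient rule gives
    [(j/c)' = theta / (k1 c)]; the sign of theta and the value of the rate follow. *)
Lemma rate_factor (k1 : R) : is_derive (j kappa) (1 : R) K k1 -> 0 < k1 ->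
  0 < derive1 (fun x => j x / order_param n x) kappa ->
  let theta := 1 - j kappa / order_param n kappa * k1 * vmvar sigma n2 kappa in
  0 < theta /\
  order_param n kappa * tau (j kappa) / derive1 j kappa * poincare_constant sigma kappa
    * derive1 (fun x => j x / order_param n x) kappa
  = tau (j kappa) * poincare_constant sigma kappa * theta.
Proof.
move=> dK k10 G0; have [k1n0 dj] := is_derive_j dK.
have jE : derive1 j kappa = k1^-1 by rewrite derive1E (derive_val (is_derive := dj)).
have c0 := order_param_gt0 hsigma n2 (ltW kappa0) kappa0.
have dc := is_derive_order_param hsigma n2 kappa (sphere_north n2).
have dcV : is_derive kappa (1 : R) (fun x => (order_param n x)^-1)
   (- (order_param n kappa) ^- 2 *: vmvar sigma n2 kappa).
  by apply: is_deriveV; rewrite gt_eqF.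
have := is_deriveM dj dcV.
set D := (_ + _) => dG.
have E : derive1 (fun x => j x / order_param n x) kappa = D.
  by rewrite derive1E (derive_val (is_derive := dG)).
move: G0; rewrite jE E /D /GRing.scale/=; set c := order_param n kappa in c0 *; set v := vmvar _ _ _.
have -> : j kappa * (- c ^- 2 * v) + c^-1 * k1^-1 = (1 - j kappa / c * k1 * v) / (k1 * c).
  by field; rewrite ?gt_eqF.
have kc0 : 0 < (k1 * c)^-1 by rewrite invr_gt0 mulr_gt0.
rewrite (pmulr_lgt0 _ kc0) => th0; split=> //.
by field; rewrite ?gt_eqF.
Qed.

End Coefficients.

(** * Gain of regularity *)

Section Iteration.
Context {R : realType} {n : nat}.
Hypothesis n2 : (2 <= n)%N.
Local Notation md := (@deg_eig R n).
Implicit Types (s G A B K : R) (a b g : nat -> R).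

(** The shift by 1 makes degree 0 and negative exponents harmless; in positive degrees these weights
    are comparable with [md l ^ s] when s >= 0. *)
Definition wt s l : R := (md l + 1) `^ s.
Definition weighted_sum s a N : R := \sum_(l < N) wt s l * a l ^+ 2.
Local Notation wsum := weighted_sum.
(** The coupling of neighbouring degrees by a gradient. At [l = 0] the predecessor is 0 again, which
    only enlarges the bound for nonnegative [a]. *)
Definition tri a l : R := a l.-1 + a l + a l.+1.
Definition gain b g a l : R := b l + g l * tri a l.

Lemma md_ge0 l : 0 <= md l.
Proof. exact: le_trans (ler0n _ l) (deg_eig_ge n2 l). Qed.

Lemma wt_ge0 s l : 0 <= wt s l. Proof. exact: powR_ge0. Qed.

Lemma wtD1 s l : wt (s + 1) l = wt s l * (md l + 1).
Proof.
have x0 : 0 < md l + 1 by rewrite ltr_wpDl ?md_ge0.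
by rewrite /wt powRD ?powRr1 ?(ltW x0)//; apply/implyP => _; rewrite gt_eqF.
Qed.

Lemma wt_le s s' l : s <= s' -> wt s l <= wt s' l.
Proof. by move=> ss; rewrite ler_powR// lerDr md_ge0. Qed.

Lemma wsum_le s s' a N : s <= s' -> wsum s a N <= wsum s' a N.
Proof. by move=> ss; apply: ler_sum => l _; rewrite ler_wpM2r ?sqr_ge0// wt_le. Qed.

Lemma wsum_ge0 s a N : 0 <= wsum s a N.
Proof. by apply: sumr_ge0 => l _; rewrite mulr_ge0 ?wt_ge0 ?sqr_ge0. Qed.

Lemma wsumS s a N : wsum s a N <= wsum s a N.+1.
Proof. by rewrite /weighted_sum big_ord_recr/= lerDl mulr_ge0 ?wt_ge0 ?sqr_ge0. Qed.

Lemma wsumZ s (c : R) a N : wsum s (fun l => c * a l) N = c ^+ 2 * wsum s a N.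
Proof. by rewrite /weighted_sum mulr_sumr; apply: eq_bigr => l _; ring. Qed.

Lemma wsumD s a b N : wsum s (fun l => a l + b l) N <= 2 * wsum s a N + 2 * wsum s b N.
Proof.
rewrite /weighted_sum !mulr_sumr -big_split/=; apply: ler_sum => l _.
have := wt_ge0 s l; move: (wt s l) (a l) (b l) => x y z x0.
have : 0 <= x * (y - z) ^+ 2 by rewrite mulr_ge0 ?sqr_ge0.
by rewrite !expr2; lra.
Qed.

Lemma wsum_shiftl s b N : wsum s (fun l => b l.-1) N.+1 = wsum s (fun=> b 0%N) 1 +
  \sum_(l < N) wt s l.+1 * b l ^+ 2.
Proof. by rewrite /weighted_sum big_ord_recl big_ord1. Qed.

Lemma wt_ratio s : exists2 c, 0 < c & forall l, wt s l.+1 <= c * wt s l /\ wt s l <= c * wt s l.+1.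
Proof.
(* Bounds the ratio of consecutive values of [md l + 1], because [md l.+1 - md l = 2 l + n - 1] and
   [l <= md l]. *)
pose q : R := n%:R + 3; have q1 : 1 <= q by rewrite /q; have : 0 <= n%:R :> R by []; lra.
have q0 : 0 < q by exact: lt_le_trans q1.
exists (q `^ `|s|); first by rewrite powR_gt0.
move=> l; have m0 := md_ge0 l; have m1 : l%:R <= md l := deg_eig_ge n2 l.
have x0 : 0 < md l + 1 by rewrite ltr_wpDl.
have y0 : 0 < md l.+1 + 1 by rewrite ltr_wpDl ?md_ge0.
have nr := @n1_ge1 R n n2; have l0 : 0 <= l%:R :> R by [].
have xy : md l + 1 <= md l.+1 + 1 by rewrite deg_eigS; lra.
have yx : md l.+1 + 1 <= q * (md l + 1).
  have : 0 <= n%:R * md l :> R by rewrite mulr_ge0.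
  by rewrite deg_eigS /q; lra.
rewrite /wt; have [s0|s0] := leP 0 s.
  rewrite (ger0_norm s0); split.
    rewrite -powRM ?(ltW q0) ?(ltW x0)// ge0_ler_powR ?nnegrE ?mulr_ge0 ?(ltW q0) ?(ltW x0) ?(ltW y0)//.
  apply: (@le_trans _ _ (1 * (md l.+1 + 1) `^ s)); last first.
    by rewrite ler_wpM2r ?powR_ge0// -(powRr0 q) ler_powR.
  by rewrite mul1r ge0_ler_powR ?nnegrE ?(ltW x0) ?(ltW y0).
have e z : z `^ s = (z `^ (- s))^-1 by rewrite -powRN opprK.
have sN : 0 <= - s by rewrite oppr_ge0 ltW.
rewrite (ltr0_norm s0).
rewrite !e; split.
  apply: (@le_trans _ _ (1 * ((md l + 1) `^ (- s))^-1)).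
    rewrite mul1r lef_pV2 ?posrE ?powR_gt0// ge0_ler_powR ?nnegrE ?(ltW x0) ?(ltW y0)//.
  by rewrite ler_wpM2r ?invr_ge0 ?powR_ge0// -(powRr0 q) ler_powR.
rewrite -ler_pdivrMl ?powR_gt0// -invfM lef_pV2 ?posrE ?mulr_gt0 ?powR_gt0//.
rewrite -powRM ?(ltW q0) ?(ltW x0)// ge0_ler_powR ?nnegrE ?mulr_ge0 ?(ltW q0) ?(ltW x0) ?(ltW y0)//.
Qed.

Lemma wsum_tri s : exists2 c, 0 < c & forall a A, (forall N, wsum s a N <= A) ->
  forall N, wsum s (tri a) N <= c * A.
Proof.
have [c c0 hc] := wt_ratio s; exists (3 * (2 + 2 * c)) => [|a A hA N].
  by rewrite mulr_gt0// ltr_wpDl// mulr_gt0.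
have A0 : 0 <= A := le_trans (wsum_ge0 s a 0) (hA 0%N).
have h1 : wsum s (fun l => a l.-1) N <= A + c * A.
  apply: (le_trans (wsumS _ _ _)); rewrite wsum_shiftl; apply: lerD; first by have := hA 1%N; rewrite /weighted_sum !big_ord1.
  apply: (@le_trans _ _ (c * wsum s a N)); last by rewrite ler_pM2l.
  rewrite /weighted_sum mulr_sumr; apply: ler_sum => l _; rewrite [leRHS]mulrA ler_wpM2r ?sqr_ge0//.
  by have [] := hc l.
have h2 : wsum s (fun l => a l.+1) N <= c * A.
  apply: (@le_trans _ _ (c * wsum s a N.+1)); last by rewrite ler_pM2l.
  rewrite /weighted_sum [in leRHS]big_ord_recl mulrDr ler_wpDl ?(mulr_ge0 (ltW c0)) ?(mulr_ge0 (wt_ge0 _ _) (sqr_ge0 _))//.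
  rewrite mulr_sumr; apply: ler_sum => l _; rewrite [leRHS]mulrA ler_wpM2r ?sqr_ge0//.
  by have [] := hc l.
have h3 := hA N.
apply: (@le_trans _ _ (3 * (wsum s (fun l => a l.-1) N + wsum s a N + wsum s (fun l => a l.+1) N))).
  rewrite /weighted_sum -!big_split/= mulr_sumr; apply: ler_sum => l _.
  have := wt_ge0 s l; rewrite /tri; move: (wt s l) (a l.-1) (a l) (a l.+1) => w x y z w0.
  have : 0 <= w * ((x - y) ^+ 2 + (y - z) ^+ 2 + (x - z) ^+ 2).
    by rewrite mulr_ge0// !addr_ge0 ?sqr_ge0.
  by rewrite !expr2; lra.
by have := ltW c0; lra.
Qed.

(** The hypothesis on [g] absorbs exactly one factor [md l + 1], that is one unit of the
    exponent. *)
Lemma wsum_gain s G : exists2 c, 0 < c & forall b g a A B,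
  (forall l, (md l + 1) * g l ^+ 2 <= G) ->
  (forall N, wsum s a N <= A) -> (forall N, wsum (s + 1) b N <= B) ->
  forall N, wsum (s + 1) (gain b g a) N <= c * (A + B).
Proof.
have [c c0 hc] := wsum_tri s; pose G' := `|G| + 1.
have G'0 : 0 < G' by rewrite /G' ltr_wpDl.
exists (2 + 2 * G' * c) => [|b g a A B hg hA hB N].
  by rewrite ltr_wpDl// !mulr_gt0.
have A0 : 0 <= A := le_trans (wsum_ge0 s a 0) (hA 0%N).
have B0 : 0 <= B := le_trans (wsum_ge0 (s + 1) b 0) (hB 0%N).
apply: (le_trans (wsumD _ _ _ _)).
have h1 : wsum (s + 1) (fun l => g l * tri a l) N <= G' * (c * A).
  apply: (@le_trans _ _ (G' * wsum s (tri a) N)); last by rewrite ler_pM2l// hc.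
  rewrite /weighted_sum mulr_sumr; apply: ler_sum => l _; rewrite wtD1 exprMn.
  rewrite (_ : _ * _ = ((md l + 1) * g l ^+ 2) * (wt s l * tri a l ^+ 2)); last by ring.
  rewrite ler_wpM2r ?(mulr_ge0 (wt_ge0 _ _) (sqr_ge0 _))//.
  by apply: le_trans (hg l) _; rewrite /G' (le_trans (ler_norm _))// lerDl.
have h2 := hB N.
have : 0 <= G' * c * B by rewrite !mulr_ge0 ?(ltW c0) ?(ltW G'0).
lra.
Qed.

Lemma wsum_cst s K N : s <= -1 -> wsum s (fun=> K) N <= 4 * K ^+ 2.
Proof.
move=> s1; rewrite /weighted_sum -mulr_suml ler_wpM2r ?sqr_ge0//.
(* A telescoping majorant: [md N >= N^2] gives [1 / (md N + 1) <= 4 / ((N + 1) (N + 2))]. *)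
suff : \sum_(l < N) wt s l <= 4 - 4 / N.+1%:R.
  by move/le_trans; apply; rewrite gerBl divr_ge0.
elim: N => [|N ih]; first by rewrite big_ord0 divr1 subrr.
rewrite big_ord_recr/=; apply: (le_trans (lerD ih (wt_le N s1))).
have m0 := md_ge0 N; have x0 : 0 < md N + 1 by rewrite ltr_wpDl.
rewrite /wt powR_inv1 ?(ltW x0)//.
have N0 : 0 <= N%:R :> R by [].
have mN : N%:R ^+ 2 <= md N.
  by rewrite /deg_eig expr2 ler_wpM2l// -addrA lerDl subr_ge0 ler_nat.
have e : 4 / N.+1%:R - 4 / N.+2%:R = 4 / ((N%:R + 1) * (N%:R + 2)) :> R.
  have -> : N.+2%:R = N%:R + 2 :> R by rewrite -addn2 natrD.
  have -> : N.+1%:R = N%:R + 1 :> R by rewrite -addn1 natrD.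
  by field; rewrite !gt_eqF//; lra.
suff : (md N + 1)^-1 <= 4 / ((N%:R + 1) * (N%:R + 2)) by rewrite -e; move: (4 / N.+1%:R) (4 / N.+2%:R) ((md N + 1)^-1) => x y z; lra.
rewrite -[leLHS]mul1r ler_pdivrMr// mulrAC ler_pdivlMr; last by rewrite mulr_gt0//; lra.
by have := sqr_ge0 (N%:R - 1 : R); move: mN; rewrite !expr2; lra.
Qed.

(* As g l = O((md l)^(-1/2)), each application of [gain] raises by one the exponent
   of the weight for which the bound is summable; constants are summable for
   the exponent -1, and about |s| + 1 applications reach s. *)
Lemma regularity s G : exists2 c, 0 < c & forall (P : (nat -> R) -> Prop) b g K B,
  0 <= K -> (forall l, 0 <= b l) -> (forall l, 0 <= g l) ->
  (forall l, (md l + 1) * g l ^+ 2 <= G) -> (forall N, wsum s b N <= B) ->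
  P (fun=> K) ->
  (forall a, (forall l, 0 <= a l) -> P a -> P (gain b g a)) ->
  exists a, [/\ forall l, 0 <= a l, P a & forall N, wsum s a N <= c * (B + K ^+ 2)].
Proof.
pose p := Num.bound (`|s| + 1); have hp : s - p.+1%:R <= -1.
  have : `|s| + 1 < p%:R by apply: archi_boundP; rewrite addr_ge0.
  rewrite -natr1.
  by have := ler_norm s; lra.
have H q : (q <= p.+1)%N -> exists2 c, 0 < c & forall (P : (nat -> R) -> Prop) b g K B,
  0 <= K -> (forall l, 0 <= b l) -> (forall l, 0 <= g l) ->
  (forall l, (md l + 1) * g l ^+ 2 <= G) -> (forall N, wsum s b N <= B) ->
  P (fun=> K) ->
  (forall a, (forall l, 0 <= a l) -> P a -> P (gain b g a)) ->
  exists a, [/\ forall l, 0 <= a l, P a &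
     forall N, wsum (s - p.+1%:R + q%:R) a N <= c * (B + K ^+ 2)].
  elim: q => [|q ih] qp.
    exists 4 => // P b g K B K0 b0 g0 hg hB PK _; exists (fun=> K); split => // N.
    rewrite addr0; apply: (le_trans (wsum_cst _ _ hp)); rewrite ler_pM2l// lerDr.
    exact: le_trans (wsum_ge0 _ _ _) (hB 0%N).
  have [c c0 hc] := ih (ltnW qp); have [d d0 hd] := wsum_gain (s - p.+1%:R + q%:R) G.
  exists (d * (c + 1)); first by rewrite mulr_gt0// addr_gt0.
  move=> P b g K B K0 b0 g0 hg hB PK step.
  have [a [a0 Pa ha]] := hc P b g K B K0 b0 g0 hg hB PK step.
  exists (gain b g a); split.
  - by move=> l; rewrite /gain /tri addr_ge0// mulr_ge0// !addr_ge0.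
  - exact: step.
  - move=> N; rewrite -(@natr1 R q) addrA.
    have hb N' : wsum (s - p.+1%:R + q%:R + 1) b N' <= B.
      apply: le_trans (wsum_le _ _ _) (hB N').
      have : q.+1%:R <= p.+1%:R :> R by rewrite ler_nat.
      by rewrite -natr1; lra.
    apply: (le_trans (hd _ _ _ _ _ hg ha hb N)).
    by rewrite -mulrA ler_pM2l//; have := sqr_ge0 K; lra.
have [c c0 hc] := H p.+1 (leqnn _); exists c => // P b g K B *.
have [a [a0 Pa ha]] := hc P b g K B ltac:(done) ltac:(done) ltac:(done) ltac:(done) ltac:(done) ltac:(done) ltac:(done).
by exists a; split=> // N; have := ha N; rewrite subrK.
Qed.

End Iteration.

(** * Bounds by degree, and their application to von Mises-Fisher densities *)

Section Spectrum.
Context {R : realType} {n : nat}.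
Variable sigma : probability (borelRn R n) R.
Hypothesis hsigma : uniform_on_sphere sigma.
Hypothesis n2 : (2 <= n)%N.
Local Notation V := 'rV[R]_n.
Local Notation I := (sint sigma).
Local Notation md := (@deg_eig R n).
Local Notation wsum := (@weighted_sum R n).
Implicit Types (f g Y : V -> R) (u v w : V) (L : (V -> R) -> R) (a b : nat -> R).

Let m_ge0 l : 0 <= md l := md_ge0 n2 l.

Definition degree_bound L a := forall l Y, harm l Y -> `|L Y| <= a l * l2 sigma Y.

Lemma l2_le f g c : 0 <= c -> I (fun w => f w ^+ 2) <= c ^+ 2 * I (fun w => g w ^+ 2) ->
  l2 sigma f <= c * l2 sigma g.
Proof.
move=> c0 h; rewrite -(ler_pXn2r (n := 2))// ?nnegrE ?mulr_ge0 ?l2_ge0//.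
by rewrite exprMn !sqr_l2.
Qed.

(** By [harm_dotM] the derivative along [v] shifts the degree by at most one, with coefficients at
    most l + n and components no larger than |v| times Y. *)
Lemma degree_bound_grad L a v l Y : sphere_linear L -> degree_bound L a -> (forall l, 0 <= a l) ->
  harm l Y -> `|L (fun w => \sum_i v 0 i * sd i Y w)| <=
    (l%:R + n%:R) * eucl v * tri a l * l2 sigma Y.
Proof.
move=> [Le LD LZ] La a0 hY.
have [A [C [B [hA hC hB [nA nC nB] e]]]] := harm_dotM hsigma n2 v hY.
have sA := harm_smooth hA; have sC := harm_smooth hC; have sB := harm_smooth hB.
have v0 := eucl_ge0 v; rewrite -!sqr_eucl in nA nC nB.
have {}nA := l2_le v0 nA; have {}nC := l2_le v0 nC; have {}nB := l2_le v0 nB.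
rewrite (Le _ _ e) LD ?LD ?LZ//; try (by apply: smoothZ); last by apply: smoothD; exact: smoothZ.
have l0 : 0 <= l%:R :> R by []. have nr := @n1_ge1 R n n2.
have bnd (q : R) k Z : harm k Z -> l2 sigma Z <= eucl v * l2 sigma Y -> `|q| <= l%:R + n%:R ->
    `|q * L Z| <= (l%:R + n%:R) * (eucl v * (a k * l2 sigma Y)).
  move=> hZ nZ hq; rewrite normrM; apply: ler_pM => //.
  apply: (le_trans (La _ _ hZ)); rewrite [leRHS]mulrCA ler_wpM2l//.
rewrite (_ : (_ * tri a l * _) = (l%:R + n%:R) * (eucl v * (a l.+1 * l2 sigma Y)) +
  (l%:R + n%:R) * (eucl v * (a l * l2 sigma Y)) + (l%:R + n%:R) * (eucl v * (a l.-1 * l2 sigma Y))); last first.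
  by rewrite /tri; ring.
apply: (le_trans (ler_normD _ _)); apply: lerD; last first.
  by apply: bnd => //; rewrite ger0_norm; lra.
apply: (le_trans (ler_normD _ _)); apply: lerD; apply: bnd => //.
  by rewrite normrN ger0_norm//; lra.
by rewrite ger0_norm; lra.
Qed.

(** The cost O(l) of a gradient divided by the eigenvalue gained by diffusion. In degree 0 the
    division by [md 0 = 0] gives 0, so that degree must be bounded separately. *)
Definition gfac (c : R) l : R := c * (l%:R + n%:R) / md l.

Lemma gfac_ge0 c l : 0 <= c -> 0 <= gfac c l.
Proof. by move=> c0; rewrite divr_ge0 ?m_ge0// mulr_ge0// addr_ge0. Qed.

Lemma gfac_le c l : (md l + 1) * gfac c l ^+ 2 <= 2 * (c * (1 + n%:R)) ^+ 2.
Proof.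
rewrite /gfac; case: l => [|l].
  by rewrite deg_eig0 invr0 mulr0 expr0n/= mulr0 mulr_ge0 ?sqr_ge0.
set x : R := l.+1%:R; have x1 : 1 <= x by rewrite ler1n.
have x0 : 0 < x by exact: lt_le_trans x1.
have mx : x ^+ 2 <= md l.+1.
  by rewrite /deg_eig -/x expr2 ler_wpM2l ?(ltW x0)// -addrA lerDl subr_ge0 ler_nat.
have xx : 1 <= x ^+ 2 by rewrite exprn_ege1.
have m0 : 0 < md l.+1 by apply: lt_le_trans mx; apply: lt_le_trans xx.
move: (md l.+1) m0 mx => m m0 mx.
rewrite exprMn exprVn mulrA ler_pdivrMr ?exprn_gt0//.
apply: (@le_trans _ _ (2 * m * (c * ((1 + n%:R) * x)) ^+ 2)).
  apply: ler_pM => //; [lra|exact: sqr_ge0|lra|].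
  rewrite !exprMn ler_wpM2l ?sqr_ge0// -exprMn ler_pXn2r ?nnegrE ?mulr_ge0 ?addr_ge0 ?(ltW x0)//.
  have : n%:R * 1 <= n%:R * x by rewrite ler_wpM2l.
  lra.
rewrite (_ : _ * _ ^+ 2 = 2 * (c * (1 + n%:R)) ^+ 2 * (m * x ^+ 2)); last by ring.
rewrite [m ^+ 2]expr2; apply: ler_wpM2l; first by rewrite (mulr_ge0 _ (sqr_ge0 _)).
by rewrite ler_pM2l.
Qed.

Variable k : R.
Hypothesis k0 : 0 <= k.
Local Notation M := (vm sigma n2 k).

Lemma vm_eigen v l Y : harm l Y ->
  md l * I (fun w => M v w * Y w) = k * I (fun w => M v w * \sum_i v 0 i * sd i Y w).
Proof.
move=> hY; have sY := harm_smooth hY; have sM := smooth_vm sigma n2 k v.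
have sg : smooth (fun w => \sum_i v 0 i * sd i Y w).
  by apply: smooth_sum => i; apply: smoothZ; exact: smooth_sd.
have := vm_stationary hsigma n2 k v sY.
rewrite (@eq_sint _ _ _ _ (fun w => k * (M v w * \sum_i v 0 i * sd i Y w) - md l * (M v w * Y w))); last first.
  by move=> w w1; have [_ ->//] := hY; ring.
have c1 : scont (fun w => M v w * \sum_i v 0 i * sd i Y w) by apply: smooth_scont; exact: smoothM.
have c2 : scont (fun w => M v w * Y w) by apply: smooth_scont; exact: smoothM.
by rewrite sintB ?sintZ//; [lra|exact: scontZ|exact: scontZ].
Qed.

Definition at0 (K : R) (l : nat) : R := if l is 0%N then K else 0.

Lemma at0_ge0 K l : 0 <= K -> 0 <= at0 K l. Proof. by case: l. Qed.

Lemma wsum_at0 s K N : wsum s (at0 K) N <= K ^+ 2.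
Proof.
case: N => [|N]; first by rewrite /weighted_sum big_ord0 sqr_ge0.
rewrite /weighted_sum big_ord_recl/= big1 ?addr0; last by move=> i _; rewrite expr0n mulr0.
by rewrite /wt deg_eig0 add0r powR1 mul1r.
Qed.

Lemma gain_ge0 b (g : nat -> R) a l : (forall l, 0 <= b l) -> (forall l, 0 <= g l) -> (forall l, 0 <= a l) ->
  0 <= gain b g a l.
Proof. by move=> b0 g0 a0; rewrite /gain /tri addr_ge0// mulr_ge0// !addr_ge0. Qed.

Lemma degree_bound_l2 g K : scont g -> l2 sigma g <= K -> degree_bound (pairing sigma g) (fun=> K).
Proof.
move=> cg gK l Y hY; apply: le_trans (l2_CS sigma cg (smooth_scont (harm_smooth hY))) _.
by rewrite ler_wpM2r ?l2_ge0.
Qed.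

Lemma gfac_step (c x y A : R) l : 0 <= c -> (0 < l)%N -> 0 <= A -> 0 <= y ->
  md l * x <= c * ((l%:R + n%:R) * A * y) -> x <= gfac c l * A * y.
Proof.
move=> c0 l0 A0 y0 h; have m0 : 0 < md l by rewrite -(@deg_eig0 R n); exact: deg_eig_lt.
rewrite -(ler_pM2l m0); apply: (le_trans h); rewrite /gfac le_eqVlt; apply/orP; left; apply/eqP.
by field; rewrite gt_eqF.
Qed.

(** Stationarity bounds the coefficients of M in degree l by [gfac] times those in neighbouring
    degrees, so M belongs to all H^s with bounds uniform in the direction. [at0] supplies degree
    0. *)
Lemma vm_degree_bound s : exists2 c, 0 < c & forall v, sphere v ->
  exists a, [/\ forall l, 0 <= a l, degree_bound (pairing sigma (M v)) a & forall N, wsum s a N <= c].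
Proof.
have [c c0 hc] := regularity n2 s (2 * (k * (1 + n%:R)) ^+ 2).
pose K := expR k / vmZ sigma n2 k; have K0 : 0 < K by rewrite divr_gt0 ?expR_gt0// vmZ_gt0.
exists (c * (K ^+ 2 + K ^+ 2)); first by rewrite mulr_gt0// addr_gt0// exprn_gt0.
move=> v v1; have sM := smooth_vm sigma n2 k v; have cM := smooth_scont sM.
have MK : l2 sigma (M v) <= K.
  apply: l2_sup => //; first exact: ltW.
  by move=> w w1; rewrite gtr0_norm ?vm_gt0//; exact: vm_le.
have lL := pairing_linear sigma cM.
apply: (hc (degree_bound (pairing sigma (M v))) (at0 K) (gfac k)) => //; first exact: ltW.
- by move=> l; apply: at0_ge0; exact: ltW.
- by move=> l; exact: gfac_ge0.
- by move=> l; exact: gfac_le.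
- by move=> N; exact: wsum_at0.
- exact: degree_bound_l2.
move=> a a0 Pa l Y hY; have Y0 := l2_ge0 sigma Y.
have t0 : 0 <= tri a l by rewrite /tri !addr_ge0.
case: l => [|l] in hY t0 *.
  apply: le_trans (degree_bound_l2 cM MK hY) _; rewrite ler_wpM2r//=.
  by rewrite /gain lerDl mulr_ge0// gfac_ge0.
rewrite /gain add0r; apply: gfac_step => //.
rewrite -{1}(ger0_norm (m_ge0 l.+1)) -normrM [pairing _ _ _]/(pairing _ _ _).
rewrite vm_eigen// normrM (ger0_norm k0) ler_wpM2l//.
by have := degree_bound_grad v lL Pa a0 hY; rewrite v1 mulr1.
Qed.

(** The difference satisfies the stationarity relation of [M v'] with a source linear in v - v',
    which is already bounded by [vm_degree_bound]; hence the factor |v - v'|. *)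
Lemma vm_diff_degree_bound s : exists2 c, 0 < c & forall v v', sphere v -> sphere v' ->
  exists a, [/\ forall l, 0 <= a l,
    degree_bound (pairing sigma (fun w => M v w - M v' w)) a &
    forall N, wsum s a N <= c * eucl (v - v') ^+ 2].
Proof.
have [c c0 hc] := regularity n2 s (2 * (k * (1 + n%:R)) ^+ 2).
have [m m0 hm] := vm_degree_bound s.
have [q q0 hq] := @wsum_gain R n n2 (s - 1) (2 * (k * (1 + n%:R)) ^+ 2).
pose K := expR k * k / vmZ sigma n2 k.
have K0 : 0 <= K by rewrite divr_ge0 ?mulr_ge0 ?expR_ge0// ltW// vmZ_gt0.
exists (c * (q * (m + K ^+ 2) + K ^+ 2)).
  by rewrite mulr_gt0// ltr_pwDl ?sqr_ge0// mulr_gt0// ltr_pwDl ?sqr_ge0.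
move=> v v' v1 v1'; pose d := eucl (v - v'); have d0 : 0 <= d by exact: eucl_ge0.
have sM u := smooth_vm sigma n2 k u; have cM u := smooth_scont (sM u).
pose D w := M v w - M v' w; have sD : smooth D by exact: smoothB.
have cD := smooth_scont sD.
have DK : l2 sigma D <= K * d.
  apply: l2_sup => //; first exact: mulr_ge0.
  by move=> w w1; exact: vm_lip.
have lL := pairing_linear sigma cD.
have [mu [mu0 Pmu hmu]] := hm v v1.
pose mu' l := d * mu l; have mu'0 l : 0 <= mu' l by exact: mulr_ge0.
(* The source of the iteration: degree 0, and [M v] tested against derivatives along v - v'. It is
   bounded at exponent s by one gain from exponent s - 1. *)
pose b := gain (at0 (K * d)) (gfac k) mu'.
have Kd0 : 0 <= K * d by exact: mulr_ge0.
have g0 l : 0 <= gfac k l by exact: gfac_ge0.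
have b0 l : 0 <= b l by apply: gain_ge0 => // l'; exact: at0_ge0.
have hb N : wsum s b N <= q * (d ^+ 2 * m + (K * d) ^+ 2).
  have := hq (at0 (K * d)) (gfac k) mu' (d ^+ 2 * m) ((K * d) ^+ 2).
  rewrite subrK; apply.
  - by move=> l; exact: gfac_le.
  - move=> N'; apply: (@le_trans _ _ (wsum s mu' N')); first by apply: wsum_le => //; lra.
    by rewrite wsumZ ler_wpM2l ?sqr_ge0.
  - by move=> N'; exact: wsum_at0.
have [|a [a0 Pa ha]] := hc (degree_bound (pairing sigma D)) b (gfac k) (K * d) _ Kd0 b0 g0
  (gfac_le k) hb (degree_bound_l2 cD DK).
  move=> a a0 Pa l Y hY; have Y0 := l2_ge0 sigma Y.
  have t0 : 0 <= tri a l by rewrite /tri !addr_ge0.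
  have t0' : 0 <= tri mu' l by rewrite /tri !addr_ge0.
  case: l => [|l] in hY t0 t0' *.
    apply: le_trans (degree_bound_l2 cD DK hY) _; rewrite ler_wpM2r//=.
    by rewrite /gain/= -addrA lerDl addr_ge0// mulr_ge0.
  rewrite /gain /b /gain add0r -mulrDr; apply: gfac_step => //; first exact: addr_ge0.
  rewrite -{1}(ger0_norm (m_ge0 l.+1)) -normrM.
  have sY := harm_smooth hY.
  have sg u : smooth (fun w => \sum_i u 0 i * sd i Y w).
    by apply: smooth_sum => i; apply: smoothZ; exact: smooth_sd.
  have cg u u' : scont (fun w => M u w * \sum_i u' 0 i * sd i Y w).
    by apply: scontM; [exact: cM|exact: smooth_scont].
  have cY u : scont (fun w => M u w * Y w) by apply: scontM; [exact: cM|exact: smooth_scont].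
  have -> : md l.+1 * pairing sigma D Y =
     k * (pairing sigma D (fun w => \sum_i v' 0 i * sd i Y w) +
          pairing sigma (M v) (fun w => \sum_i (v - v') 0 i * sd i Y w)).
    rewrite /pairing (@eq_sint _ _ _ (fun w => D w * Y w) (fun w => M v w * Y w - M v' w * Y w)); last first.
      by move=> w _; rewrite mulrBl.
    rewrite sintB// mulrBr !vm_eigen// -mulrBr; congr (_ * _).
    rewrite -sintB// -sintD; last 2 first.
    - by apply: scontM => //; exact: smooth_scont.
    - exact: cg.
    apply: eq_sint => w _.
    have -> : \sum_i (v - v') 0 i * sd i Y w = \sum_i v 0 i * sd i Y w - \sum_i v' 0 i * sd i Y w.
      by rewrite -sumrB; apply: eq_bigr => i _; rewrite !mxE mulrBl.
    by rewrite /D; ring.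
  rewrite normrM (ger0_norm k0) ler_wpM2l//.
  have e1 := degree_bound_grad v' lL Pa a0 hY.
  have e2 := degree_bound_grad (v - v') (pairing_linear sigma (cM v)) Pmu mu0 hY.
  apply: (le_trans (ler_normD _ _)); apply: (le_trans (lerD e1 e2)).
  rewrite v1' -/d /tri /mu'; rewrite le_eqVlt; apply/orP; left; apply/eqP; ring.
exists a; split => // N; apply: (le_trans (ha N)).
rewrite -/d le_eqVlt; apply/orP; left; apply/eqP; ring.
Qed.

End Spectrum.

(** * Energy dissipation *)

Section EnergyArithmetic.
Context {R : realType}.
Variables (rho k1 V0 Lam CK TM L Cw tau0 : R).
Hypotheses (rho0 : 0 < rho) (k10 : 0 < k1) (V00 : 0 <= V0) (Lam0 : 0 < Lam) (CK0 : 0 <= CK)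
  (TM0 : 0 < TM) (L0 : 0 <= L) (Cw0 : 0 <= Cw).
Let theta := 1 - rho * k1 * V0.
Hypothesis theta0 : 0 < theta.

(** The energy estimate as an inequality between numbers. [N] stands for the weighted norm of eta,
    [b] for |J| - rho c, [G] for the Dirichlet integral of eta, [P], [P2], [sb], [s2] for the
    integrals involving x = <w, Omega>, [e] for the Taylor remainder of k, [tr] for tau(|J|), and
    [W] for the effect of the motion of Omega. The two final hypotheses are the Poincare inequality
    for eta - rho q x and the positivity of the Dirichlet integral of eta - 2 rho q x. *)
Lemma energy_arith : exists C eps : R, [/\ 0 < C, 0 < eps &
  forall N G b P sb P2 s2 e tr W : R, 0 <= N <= eps ->
    b ^+ 2 <= V0 * N ^+ 2 -> `|b| <= N -> 0 <= sb <= 1 ->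
    P ^+ 2 <= G -> P2 ^+ 2 <= N ^+ 2 * G -> `|s2| <= N ->
    `|e| <= CK * b ^+ 2 -> 0 < tr <= TM -> `|tr - tau0| <= L * `|b| -> `|W| <= Cw * N ^+ 3 ->
    let q := k1 * b in
    Lam * (N ^+ 2 - 2 * (rho * q) * b + (rho * q) ^+ 2 * V0) <=
      G - 2 * (rho * q) * P + (rho * q) ^+ 2 * sb ->
    0 <= G - 4 * (rho * q) * P + 4 * (rho * q) ^+ 2 * sb ->
    tr * ((q + e) * (rho * P + P2) - G) - rho * q * (tr * ((q + e) * (rho * sb + s2) - P)) + W
    <= - 2 * (tau0 * Lam * theta) * (N ^+ 2 / 2 - rho * k1 * b ^+ 2 / 2) + C * N ^+ 3].
Proof.
have rk0 : 0 < rho * k1 by exact: mulr_gt0.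
pose a := k1 + CK; have a0 : 0 < a by rewrite ltr_pwDl.
pose C2 := rho * CK + a + rho * (rho * k1) * CK + rho * k1 * a.
have C20 : 0 < C2.
  have h1 : 0 <= rho * CK by rewrite mulr_ge0// ltW.
  have h2 : 0 <= rho * (rho * k1) * CK by rewrite !mulr_ge0// ltW.
  have h3 : 0 <= rho * k1 * a by rewrite !mulr_ge0// ltW.
  by rewrite /C2; lra.
pose C4 := 3 / 2 + (rho * k1) ^+ 2.
have C40 : 0 < C4 by rewrite /C4 ltr_pwDl// sqr_ge0.
have LT0 : 0 < Lam * theta by exact: mulr_gt0.
pose C := TM * C2 * C4 + TM * C2 * (Lam * theta) + L * (Lam * theta) + Cw.
(* The bound [C2 N <= 1] allows a fraction [C2 N] of the dissipation [D] to absorb the terms that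
   contain the gradient of eta. *)
exists C, (Num.min 1 C2^-1); split.
- have h1 : 0 < TM * C2 * C4 by rewrite !mulr_gt0.
  have h2 : 0 < TM * C2 * (Lam * theta) by rewrite !mulr_gt0.
  have h3 : 0 <= L * (Lam * theta) by rewrite mulr_ge0// ltW.
  by rewrite /C -addrA ltr_pwDl ?addr_ge0// addr_gt0.
- by rewrite lt_min ltr01 invr_gt0.
move=> N G b P sb P2 s2 e tr W /andP[N0]; rewrite le_min => /andP[N1 NC] hb bN /andP[sb0 sb1]
  hP hP2 hs2 he /andP[tr0 trM] htr hW q poinc quad.
have NC2 : C2 * N <= 1 by rewrite -(mulfV (lt0r_neq0 C20)) ler_pM2l.
have N2 : 0 <= N ^+ 2 by exact: sqr_ge0.
have N3 : 0 <= N ^+ 3 by exact: exprn_ge0.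
have G0 : 0 <= G := le_trans (sqr_ge0 P) hP.
pose Q := rho * q.
pose D := G - 2 * Q * P + Q ^+ 2 * sb.
pose E := N ^+ 2 / 2 - rho * k1 * b ^+ 2 / 2.
have b2 : b ^+ 2 <= N ^+ 2 by rewrite -real_normK ?num_real// lerXn2r ?nnegrE.
have E0 : 0 <= E.
  have : rho * k1 * b ^+ 2 <= rho * k1 * (V0 * N ^+ 2) by rewrite ler_pM2l.
  have : 0 <= theta * N ^+ 2 by rewrite mulr_ge0// ltW.
  by rewrite /E /theta; lra.
have E1 : E <= N ^+ 2 / 2.
  by rewrite /E gerBl divr_ge0// mulr_ge0 ?sqr_ge0// ltW.
(* The Poincare inequality exceeds the claim by Lam times [rho k1 (V0 N^2 - b^2)], which is
   nonnegative; this is where theta appears. *)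
have DE : 2 * (Lam * theta) * E <= D.
  apply: le_trans poinc; rewrite (_ : 2 * (Lam * theta) * E = Lam * (2 * theta * E)); last by ring.
  rewrite ler_pM2l// -subr_ge0.
  have : 0 <= rho * k1 * (V0 * N ^+ 2 - b ^+ 2) by rewrite mulr_ge0 ?subr_ge0// ltW.
  by congr (_ <= _); rewrite /E /q /theta; field.
have q1 : `|q| <= k1 * N by rewrite normrM (gtr0_norm k10) ler_pM2l.
have e2 : `|e| <= CK * N ^+ 2 by rewrite (le_trans he)// ler_wpM2l.
have qe : `|q + e| <= a * N.
  apply: (le_trans (ler_normD _ _)); rewrite mulrDl lerD// (le_trans e2)//.
  by rewrite ler_wpM2l// expr2 ler_piMl.
have Q1 : `|Q| <= rho * k1 * N by rewrite normrM (gtr0_norm rho0) -mulrA ler_pM2l.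
pose g := Num.sqrt G; have g0 : 0 <= g by exact: sqrtr_ge0.
have gG : g ^+ 2 = G by rewrite sqr_sqrtr.
have P1 : `|P| <= g by rewrite -(ler_pXn2r (n := 2))// ?nnegrE// gG real_normK ?num_real.
have P21 : `|P2| <= N * g.
  by rewrite -(ler_pXn2r (n := 2))// ?nnegrE ?mulr_ge0// exprMn gG real_normK ?num_real.
(* The gradient of eta is not bounded by [N], so it is recovered from [D]: this is the second
   quadratic hypothesis rearranged. *)
have GD : G <= 2 * D + 2 * (rho * k1) ^+ 2 * N ^+ 2.
  have Q2 : Q ^+ 2 * sb <= (rho * k1 * N) ^+ 2.
    rewrite -[leRHS]mulr1; apply: ler_pM => //; first exact: sqr_ge0.
    by rewrite -real_normK ?num_real// lerXn2r ?nnegrE// !mulr_ge0// ltW.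
  by move: quad Q2; rewrite -/Q /D exprMn; lra.
have Ng : N ^+ 2 * g <= N * D + (2^-1 + (rho * k1) ^+ 2) * N ^+ 3.
  have h1 : 0 <= N * (N - g) ^+ 2 by rewrite mulr_ge0 ?sqr_ge0.
  have h2 : N * G <= N * (2 * D + 2 * (rho * k1) ^+ 2 * N ^+ 2) by rewrite ler_wpM2l.
  have h3 : 2 * (N ^+ 2 * g) = N ^+ 3 + N * G - N * (N - g) ^+ 2 by rewrite -gG; ring.
  have h4 : N * (2 * D + 2 * (rho * k1) ^+ 2 * N ^+ 2) =
    2 * (N * D) + 2 * ((rho * k1) ^+ 2 * N ^+ 3) by ring.
  by rewrite h4 in h2; lra.
(* All that remains of the derivative once [- D] is removed: each term is of order [N^3] or [N^2]
   times the norm [g] of the gradient of eta. *)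
pose S := e * rho * P + (q + e) * P2 - Q * e * rho * sb - Q * (q + e) * s2.
have nM (x y X Y : R) : `|x| <= X -> `|y| <= Y -> `|x * y| <= X * Y.
  by move=> hx hy; rewrite normrM ler_pM.
have S1 : S <= C2 * (N ^+ 2 * g + N ^+ 3).
  have t1 : `|e * rho * P| <= CK * N ^+ 2 * rho * g by (apply: (nM _ _ _ _ _ P1); apply: (nM _ _ _ _ e2); rewrite gtr0_norm).
  have t2 : `|(q + e) * P2| <= a * N * (N * g) by exact: (nM _ _ _ _ qe P21).
  have t3 : `|Q * e * rho * sb| <= rho * k1 * N * (CK * N ^+ 2) * rho * 1.
    apply: (nM); last by rewrite ger0_norm.
    by apply: (nM); [exact: (nM _ _ _ _ Q1 e2)|rewrite gtr0_norm].
  have t4 : `|Q * (q + e) * s2| <= rho * k1 * N * (a * N) * N by exact: (nM _ _ _ _ (nM _ _ _ _ Q1 qe) hs2).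
  have u1 : e * rho * P <= CK * N ^+ 2 * rho * g := le_trans (ler_norm _) t1.
  have u2 : (q + e) * P2 <= a * N * (N * g) := le_trans (ler_norm _) t2.
  have u3 : - (Q * e * rho * sb) <= rho * k1 * N * (CK * N ^+ 2) * rho * 1.
    by rewrite (le_trans (ler_norm _))// normrN.
  have u4 : - (Q * (q + e) * s2) <= rho * k1 * N * (a * N) * N.
    by rewrite (le_trans (ler_norm _))// normrN.
  have N2g : 0 <= N ^+ 2 * g by exact: mulr_ge0.
  have f1 : 0 <= rho * CK * N ^+ 3 by rewrite !mulr_ge0// ltW.
  have f2 : 0 <= a * N ^+ 3 by rewrite !mulr_ge0// ltW.
  have f3 : 0 <= rho * (rho * k1) * CK * (N ^+ 2 * g).
    by apply: mulr_ge0 => //; rewrite !mulr_ge0// ltW.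
  have f4 : 0 <= rho * k1 * a * (N ^+ 2 * g).
    by apply: mulr_ge0 => //; rewrite !mulr_ge0// ltW.
  have -> : C2 * (N ^+ 2 * g + N ^+ 3) =
    CK * N ^+ 2 * rho * g + a * N * (N * g) + rho * k1 * N * (CK * N ^+ 2) * rho * 1
    + rho * k1 * N * (a * N) * N
    + (rho * CK * N ^+ 3 + a * N ^+ 3 + rho * (rho * k1) * CK * (N ^+ 2 * g) + rho * k1 * a * (N ^+ 2 * g)).
    by rewrite /C2; ring.
  by rewrite /S; lra.
have S2 : S <= C2 * N * D + C2 * C4 * N ^+ 3.
  apply: (le_trans S1); rewrite [leRHS](_ : _ = C2 * (N * D + C4 * N ^+ 3)); last by ring.
  rewrite ler_pM2l//.
  by rewrite /C4; move: Ng; rewrite !mulrDl; lra.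
rewrite (_ : _ + W = tr * (- D + S) + W); last by rewrite /D /S /Q; ring.
have h1 : - D + S <= - ((1 - C2 * N) * (2 * (Lam * theta) * E)) + C2 * C4 * N ^+ 3.
  have : (1 - C2 * N) * (2 * (Lam * theta) * E) <= (1 - C2 * N) * D.
    by rewrite ler_wpM2l// subr_ge0.
  by rewrite mulrBl mul1r; lra.
have h2 : tr * (- D + S) <= tr * (- ((1 - C2 * N) * (2 * (Lam * theta) * E)) + C2 * C4 * N ^+ 3).
  by rewrite ler_pM2l.
have h3 : tr * (C2 * C4 * N ^+ 3) <= TM * (C2 * C4 * N ^+ 3).
  by rewrite ler_wpM2r// mulr_ge0// mulr_ge0// ltW.
have h4 : tr * (C2 * N * (2 * (Lam * theta) * E)) <= TM * (C2 * N * ((Lam * theta) * N ^+ 2)).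
  have x0 : 0 <= C2 * N by rewrite mulr_ge0// ltW.
  have x1 : 2 * (Lam * theta) * E <= Lam * theta * N ^+ 2.
    rewrite (_ : 2 * (Lam * theta) * E = Lam * theta * (2 * E)); last by ring.
    by rewrite ler_pM2l// mulrC -ler_pdivlMr.
  have x2 : 0 <= 2 * (Lam * theta) * E by rewrite !mulr_ge0// ltW.
  by apply: ler_pM => //; [exact: ltW|rewrite mulr_ge0|rewrite ler_wpM2l].
have h5 : - (tr - tau0) * (2 * (Lam * theta) * E) <= L * N * ((Lam * theta) * N ^+ 2).
  have x1 : 2 * (Lam * theta) * E <= Lam * theta * N ^+ 2.
    rewrite (_ : 2 * (Lam * theta) * E = Lam * theta * (2 * E)); last by ring.
    by rewrite ler_pM2l// mulrC -ler_pdivlMr.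
  have x2 : 0 <= 2 * (Lam * theta) * E by rewrite !mulr_ge0// ltW.
  have x3 : `|- (tr - tau0)| <= L * N by rewrite normrN (le_trans htr)// ler_wpM2l.
  apply: (le_trans (ler_norm _)); apply: (nM) => //.
  by rewrite ger0_norm.
have h6 : W <= Cw * N ^+ 3 := le_trans (ler_norm _) hW.
have -> : C * N ^+ 3 = TM * (C2 * C4 * N ^+ 3) + TM * (C2 * N * ((Lam * theta) * N ^+ 2))
  + L * N * ((Lam * theta) * N ^+ 2) + Cw * N ^+ 3 by rewrite /C; ring.
rewrite -/E.
have e1 : tr * (- ((1 - C2 * N) * (2 * (Lam * theta) * E)) + C2 * C4 * N ^+ 3) =
  - 2 * (tau0 * Lam * theta) * E + - (tr - tau0) * (2 * (Lam * theta) * E)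
  + tr * (C2 * N * (2 * (Lam * theta) * E)) + tr * (C2 * C4 * N ^+ 3) by ring.
by rewrite e1 in h2; lra.
Qed.

End EnergyArithmetic.

(** * The perturbation eta and the weak form of the collision operator *)

Section Energy.
Context {R : realType} {n : nat}.
Variable sigma : probability (borelRn R n) R.
Hypothesis hsigma : uniform_on_sphere sigma.
Hypothesis n2 : (2 <= n)%N.
Local Notation V := 'rV[R]_n.
Local Notation I := (sint sigma).
Variable k : R.
Hypothesis k0 : 0 <= k.
Local Notation M := (vm sigma n2 k).
Local Notation Z := (vmZ sigma n2 k).
Local Notation c := (order_param n k).
Local Notation V0 := (vmvar sigma n2 k).
Local Notation Lam := (poincare_constant sigma k).
Implicit Types (f g u phi : V -> R) (v w z : V).

Lemma vm_CS v f g : sphere v -> scont f -> scont g ->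
  I (fun w => M v w * (f w * g w)) ^+ 2 <=
  I (fun w => M v w * f w ^+ 2) * I (fun w => M v w * g w ^+ 2).
Proof.
move=> v1 cf cg; apply: sint_CS => //; first exact: scont_vm.
by move=> w _; rewrite ltW// vm_gt0.
Qed.

Lemma vm_average_le v g (B : R) : sphere v -> scont g -> (forall w, sphere w -> g w <= B) ->
  I (fun w => M v w * g w) <= B.
Proof.
move=> v1 cg gB; have cM : scont (M v) by exact: scont_vm.
rewrite -[leRHS]mulr1 -(sint_vm hsigma n2 k v1) -sintZ//.
apply: ler_sint; [exact: scontM|exact: scontZ|move=> w w1].
by rewrite mulrC ler_wpM2r ?gB// ltW// vm_gt0.
Qed.

Lemma sgdot_CSw f g w : sgdot f g w ^+ 2 <= sgdot f f w * sgdot g g w.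
Proof.
apply: quad_disc => x y; rewrite /sgdot !mulr_sumr -!big_split/=.
apply: sumr_ge0 => i _; have := sqr_ge0 (x * sd i f w + y * sd i g w).
by congr (_ <= _); ring.
Qed.

Definition xdot v : V -> R := fun w => dot w v.

Lemma sgdot_xdot v w : sphere v -> sphere w -> sgdot (xdot v) (xdot v) w = 1 - dot w v ^+ 2.
Proof.
move=> v1 w1; rewrite sgdot_dot//; last exact: smooth_dot.
rewrite (eq_bigr (fun i => v 0 i * v 0 i - dot w v * (w 0 i * v 0 i))); last first.
  by move=> i _; rewrite sd_dot//; ring.
rewrite sumrB -mulr_sumr -!dotE; move/sphereE: v1 => ->; ring.
Qed.

Lemma sgdot_xdot_le1 v w : sphere v -> sphere w -> sgdot (xdot v) (xdot v) w <= 1.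
Proof. by move=> v1 w1; rewrite sgdot_xdot// gerBl sqr_ge0. Qed.

(* u = vm v * (rho + eta) *)
Definition eta v (rho : R) u : V -> R := fun w => Z * (expR (- k * dot w v) * u w) - rho.

Lemma smooth_eta v rho u : smooth u -> smooth (eta v rho u).
Proof. by move=> su; rewrite /eta; smooth_tac. Qed.

Lemma vm_eta v rho u w : M v w * eta v rho u w = u w - rho * M v w.
Proof.
have Z0 := vmZ_gt0 hsigma n2 k.
rewrite /eta mulrBr (mulrC _ rho); congr (_ - _); rewrite /vm mulNr expRN.
by field; rewrite !gt_eqF ?expR_gt0.
Qed.

Lemma vm_etaD v rho u w : u w = M v w * (eta v rho u w + rho).
Proof. by rewrite mulrDr vm_eta; ring. Qed.

Lemma sgdot_eta v rho u phi w : smooth u -> smooth phi -> sphere w ->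
  sgdot u phi w = M v w * sgdot (eta v rho u) phi w + k * u w * sgdot (xdot v) phi w.
Proof.
move=> su sp w1; have se := smooth_eta v rho su; have sM := smooth_vm sigma n2 k v.
rewrite /sgdot !mulr_sumr -big_split/=; apply: eq_bigr => i _.
rewrite (@eq_sd _ _ i _ (fun w => M v w * (eta v rho u w + rho)) w w1); last first.
  by move=> x _; exact: vm_etaD.
rewrite sdM//; last by apply: smoothD => //; exact: smooth_cst.
rewrite sdD//; last exact: smooth_cst.
rewrite (sd_cst i rho) sd_vm// -sd_dot// [u w](vm_etaD v rho) addr0; ring.
Qed.

Section State.
Variables (v : V) (rho r : R) (u : V -> R).
Hypotheses (v1 : sphere v) (su : smooth u) (Iu : I u = rho)
  (Ju : forall z, I (fun w => dot w z * u w) = r * dot v z).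
Local Notation h := (eta v rho u).
Local Notation x := (xdot v).

Let sh : smooth h. Proof. exact: smooth_eta. Qed.
Let ch : scont h. Proof. exact: smooth_scont. Qed.
Let sx : smooth x. Proof. exact: smooth_dot. Qed.
Let cx : scont x. Proof. exact: smooth_scont. Qed.
Let cM : scont (M v). Proof. exact: scont_vm. Qed.
Let cu : scont u. Proof. exact: smooth_scont. Qed.
Let vv : dot v v = 1. Proof. exact/sphereE. Qed.

Lemma eta_mean : I (fun w => M v w * h w) = 0.
Proof.
rewrite (@eq_sint _ _ _ _ (fun w => u w - rho * M v w)) => [|w _]; last exact: vm_eta.
by rewrite sintB ?sintZ ?sint_vm ?Iu//; [ring|exact: scontZ].
Qed.

Lemma eta_dot z : I (fun w => M v w * (h w * dot w z)) = (r - rho * c) * dot v z.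
Proof.
have cz := @scont_dot R n z.
rewrite (@eq_sint _ _ _ _ (fun w => dot w z * u w - rho * (M v w * dot w z))) => [|w _]; last first.
  by rewrite mulrA vm_eta; ring.
have cMz := scontM cM cz.
by rewrite sintB ?sintZ ?Ju ?vm_mean_dot//; [ring|exact: scontM|exact: scontZ].
Qed.

Definition eta2 : R := I (fun w => M v w * h w ^+ 2).

Lemma eta2_ge0 : 0 <= eta2.
Proof. by apply: sint_ge0 => w _; rewrite mulr_ge0 ?sqr_ge0// ltW// vm_gt0. Qed.

Local Notation b := (r - rho * c).

(** Cauchy-Schwarz with x - c in place of x, which is allowed because eta has mean 0: the constant
    is then the variance and not the second moment. *)
Lemma eta_dot_sqr : b ^+ 2 <= V0 * eta2.
Proof.
have cxc : scont (fun w => x w - c) by apply: scontB => //; exact: scont_cst.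
have := vm_CS v1 cxc ch.
have := vm_centered hsigma n2 k v1 cx.
rewrite vm_mean_dot// vm_mean_sqr// vv mulr1 addrK => ->.
congr (_ ^+ 2 <= _).
rewrite (@eq_sint _ _ _ _ (fun w => M v w * (h w * dot w v) - c * (M v w * h w))); last first.
  by move=> w _; rewrite /xdot; ring.
have cMh := scontM cM ch; have chx := scontM ch cx.
by rewrite sintB ?sintZ ?eta_mean ?eta_dot ?vv//; [ring|exact: scontM|exact: scontZ].
Qed.

Lemma eta_dot_le : b ^+ 2 <= eta2.
Proof.
have := vm_CS v1 ch cx; rewrite eta_dot vv mulr1 => /le_trans; apply.
rewrite -[leRHS]mulr1 ler_wpM2l ?eta2_ge0//.
apply: vm_average_le => //; first exact: scontX.
move=> w w1; rewrite -real_normK ?num_real// exprn_ile1//.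
by rewrite ler_norml; exact: dot_sphere_le1.
Qed.

(* The weak form of Q, where tr and kr stand for tau(|J|) and k(|J|). *)
Definition weakQ (tr kr : R) phi : R :=
  tr * (kr * I (fun w => u w * sgdot x phi w) - I (sgdot u phi)).

(** As M is an equilibrium for k, only [kr - k] multiplies the alignment term, besides the Dirichlet
    form of eta. *)
Lemma weakQE tr kr phi : smooth phi -> weakQ tr kr phi =
  tr * ((kr - k) * (rho * I (fun w => M v w * sgdot x phi w) +
                    I (fun w => M v w * (h w * sgdot x phi w)))
        - I (fun w => M v w * sgdot h phi w)).
Proof.
move=> sp; have sg := smooth_sgdot sx sp; have cg := smooth_scont sg.
have cgh : scont (sgdot h phi) by exact/smooth_scont/smooth_sgdot.
have cug := scontM cu cg; have cMgh := scontM cM cgh; have cMg := scontM cM cg.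
have cMhg := scontM cM (scontM ch cg).
rewrite /weakQ; congr (_ * _).
rewrite (@eq_sint _ _ _ (sgdot u phi)
  (fun w => M v w * sgdot h phi w + k * (u w * sgdot x phi w))) => [|w w1]; last first.
  by rewrite (sgdot_eta v rho su sp w1); ring.
rewrite sintD ?sintZ//; last exact: scontZ.
have -> : I (fun w => u w * sgdot x phi w) = rho * I (fun w => M v w * sgdot x phi w) +
                    I (fun w => M v w * (h w * sgdot x phi w)).
  rewrite -sintZ// -sintD//; last exact: scontZ.
  by apply: eq_sint => w _; rewrite [u w](vm_etaD v rho); ring.
by ring.
Qed.

(** Moves the derivative from eta to the test function, so that for coordinates the result is
    bounded by the norm of eta alone. *)
Lemma eta_by_parts phi : smooth phi ->
  I (fun w => M v w * sgdot h phi w) = - I (fun w => M v w * (h w * (k * sgdot x phi w + slap phi w))).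
Proof.
move=> sp; have sM := smooth_vm sigma n2 k v; have sMh := smoothM sM sh.
have sg := smooth_sgdot sx sp; have sl := smooth_slap sp; have shp := smooth_sgdot sh sp.
have e := sint_slap hsigma sMh sp.
rewrite (@eq_sint _ _ _ (sgdot (fun w => M v w * h w) phi)
  (fun w => M v w * sgdot h phi w + k * (M v w * (h w * sgdot x phi w)))) in e; last first.
  move=> w w1; rewrite /sgdot !mulr_sumr -big_split/=; apply: eq_bigr => i _.
  by rewrite sdM// sd_vm// -sd_dot// /xdot; ring.
rewrite (@eq_sint _ _ _ (fun w => M v w * (h w * (k * sgdot x phi w + slap phi w)))
  (fun w => k * (M v w * (h w * sgdot x phi w)) + (M v w * h w * slap phi w))); last first.
  by move=> w _; ring.
have c1 : scont (fun w => k * (M v w * (h w * sgdot x phi w))).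
  by apply: scontZ; apply: scontM => //; apply: scontM => //; exact: smooth_scont.
have c2 : scont (fun w => M v w * h w * slap phi w) by apply: smooth_scont; exact: smoothM.
have c3 : scont (fun w => M v w * sgdot h phi w) by apply: scontM => //; exact: smooth_scont.
rewrite [in RHS]sintD//; rewrite sintD// in e; lra.
Qed.

Lemma weakQ_coord_le (tr kr : R) (TM B : R) z : sphere z -> 0 <= tr <= TM -> 0 <= B ->
  `|kr - k| <= B * Num.sqrt eta2 -> Num.sqrt eta2 <= 1 ->
  `|weakQ tr kr (xdot z)| <= TM * (B * (2 * (`|rho| + 1)) + (2 * k + n%:R)) * Num.sqrt eta2.
Proof.
move=> z1 /andP[tr0 trM] B0 hk N1; set N := Num.sqrt eta2 in hk N1 *.
have N0 : 0 <= N by exact: sqrtr_ge0.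
have NE : N ^+ 2 = eta2 by rewrite sqr_sqrtr// eta2_ge0.
have sz := @smooth_dot R n z; have sg := smooth_sgdot sx sz; have cg := smooth_scont sg.
rewrite weakQE// eta_by_parts// opprK.
have g1 w : sphere w -> `|sgdot x (xdot z) w| <= 2.
  move=> w1; rewrite -(ler_pXn2r (n := 2))// ?nnegrE// real_normK ?num_real//.
  apply: (le_trans (sgdot_CSw _ _ _)); rewrite (@le_trans _ _ (1 * 1))//; last by rewrite mul1r; lra.
  by apply: ler_pM; rewrite ?sgdot_ge0 ?sgdot_xdot_le1.
have bnd (g : V -> R) (K : R) : 0 <= K -> scont g -> (forall w, sphere w -> `|g w| <= K) ->
    `|I (fun w => M v w * (h w * g w))| <= K * N.
  move=> K0 cg' gK; rewrite -(ler_pXn2r (n := 2))// ?nnegrE ?mulr_ge0// real_normK ?num_real//.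
  apply: (le_trans (vm_CS v1 ch cg')); rewrite -/eta2 exprMn NE mulrC ler_wpM2r ?eta2_ge0//.
  apply: vm_average_le => //; first exact: scontX.
  by move=> w w1; rewrite -real_normK ?num_real// lerXn2r ?nnegrE ?gK.
have h1 : `|I (fun w => M v w * sgdot x (xdot z) w)| <= 2.
  rewrite ler_norml; apply/andP; split.
    rewrite lerNl -sintN; last exact: scontM.
    rewrite (@eq_sint _ _ _ _ (fun w => M v w * - sgdot x (xdot z) w)); last by move=> w _; rewrite mulrN.
    apply: vm_average_le => //; first exact: scontN.
    by move=> w w1; rewrite (le_trans (ler_norm _))// normrN g1.
  by apply: vm_average_le => // w w1; rewrite (le_trans (ler_norm _))// g1.
have h2 := bnd _ 2 ltac:(done) cg g1.
have h3 : `|I (fun w => M v w * (h w * (k * sgdot x (xdot z) w + slap (xdot z) w)))| <= (2 * k + n%:R) * N.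
  apply: bnd; first by rewrite addr_ge0// mulr_ge0.
    by apply: scontD; [exact: scontZ|apply: smooth_scont; exact: smooth_slap].
  move=> w w1; apply: (le_trans (ler_normD _ _)); apply: lerD.
    by rewrite normrM (ger0_norm k0) mulrC ler_wpM2r// g1.
  rewrite slap_dot// normrM normrN (ger0_norm (le_trans ler01 (@n1_ge1 R n n2))).
  apply: (@le_trans _ _ ((n%:R - 1) * 1)); last by lra.
  rewrite ler_wpM2l ?(le_trans ler01 (@n1_ge1 R n n2))//.
  by rewrite ler_norml; exact: dot_sphere_le1.
rewrite normrM (ger0_norm tr0) -mulrA; apply: ler_pM => //.
apply: (le_trans (ler_normD _ _)); rewrite [leRHS]mulrDl; apply: lerD => //.
rewrite normrM mulrAC; apply: ler_pM => //.
apply: (le_trans (ler_normD _ _)); rewrite normrM mulrDr mulr1 [2 * _]mulrC; apply: lerD.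
  by rewrite ler_wpM2l.
by apply: (le_trans h2); lra.
Qed.

(** Provides the hypotheses of [energy_arith]; the two test functions are the derivatives of the
    energy with respect to the density and to |J|. *)
Lemma weakQ_energy (tr kr k1 : R) :
  let q := k1 * b in let e := kr - k - q in
  let G := I (fun w => M v w * sgdot h h w) in
  let P := I (fun w => M v w * sgdot x h w) in
  let P2 := I (fun w => M v w * (h w * sgdot x h w)) in
  let sb := I (fun w => M v w * sgdot x x w) in
  let s2 := I (fun w => M v w * (h w * sgdot x x w)) in
  [/\ weakQ tr kr h = tr * ((q + e) * (rho * P + P2) - G),
      weakQ tr kr x = tr * ((q + e) * (rho * sb + s2) - P),
      0 <= sb <= 1 & [/\ P ^+ 2 <= G, P2 ^+ 2 <= eta2 * G, s2 ^+ 2 <= eta2,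
      Lam * (eta2 - 2 * (rho * q) * b + (rho * q) ^+ 2 * V0) <=
        G - 2 * (rho * q) * P + (rho * q) ^+ 2 * sb &
      0 <= G - 4 * (rho * q) * P + 4 * (rho * q) ^+ 2 * sb]].
Proof.
move=> q e G P P2 sb s2.
have sxx := smooth_sgdot sx sx; have sxh := smooth_sgdot sx sh; have shh := smooth_sgdot sh sh.
have cxx := smooth_scont sxx; have cxh := smooth_scont sxh; have chh := smooth_scont shh.
have cG := scontM cM chh; have cP := scontM cM cxh; have csb := scontM cM cxx.
have qE : q + e = kr - k by rewrite /e; ring.
have xx0 w : sphere w -> 0 <= sgdot x x w by move=> _; exact: sgdot_ge0.
have xx1 w : sphere w -> sgdot x x w <= 1 by exact: sgdot_xdot_le1.
have M0 w : 0 <= M v w by rewrite ltW// vm_gt0.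
have sb01 : 0 <= sb <= 1.
  apply/andP; split; first by apply: sint_ge0 => w w1; rewrite mulr_ge0 ?xx0.
  exact: vm_average_le.
have G0 : 0 <= G by apply: sint_ge0 => w w1; rewrite mulr_ge0 ?sgdot_ge0.
(* The weighted Dirichlet integral of [h - a x], used below with [a = rho q] and with twice that
   value. *)
have quad (a : R) : G - 2 * a * P + a ^+ 2 * sb =
    I (fun w => M v w * sgdot (fun w => h w - a * x w) (fun w => h w - a * x w) w).
  rewrite -!sintZ// -sintB//; last exact: scontZ.
  rewrite -sintD//; [|by apply: scontB => //; exact: scontZ|exact: scontZ].
  apply: eq_sint => w w1; rewrite /sgdot !mulr_sumr -sumrB -big_split/=.
  apply: eq_bigr => i _; rewrite sdB ?sdZ//; last exact: smoothZ.
  by ring.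
have quad0 a : 0 <= G - 2 * a * P + a ^+ 2 * sb.
  by rewrite quad; apply: sint_ge0 => w w1; rewrite mulr_ge0 ?sgdot_ge0.
split => //; last split.
- rewrite weakQE// qE; congr (_ * _); rewrite /P /P2 /G; ring.
- rewrite weakQE// qE; congr (_ * (_ - _)).
  by apply: eq_sint => w _; rewrite sgdotC.
- apply: (@le_trans _ _ (sb * G)); last by rewrite ler_piMl//; case/andP: sb01.
  apply: quad_disc => a a'.
  have := quad0; rewrite /=.
  rewrite -!sintZ// -sintD//; try exact: scontZ.
  rewrite -sintD//; [|by apply: scontD; exact: scontZ|exact: scontZ].
  move=> _; apply: sint_ge0 => w w1.
  rewrite (_ : _ + _ = M v w * (a ^+ 2 * sgdot x x w + 2 * a * a' * sgdot x h w + a' ^+ 2 * sgdot h h w)); last by ring.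
  rewrite mulr_ge0// /sgdot !mulr_sumr -!big_split/=.
  apply: sumr_ge0 => i _; have := sqr_ge0 (a * sd i x w + a' * sd i h w).
  by congr (_ <= _); ring.
- apply: (le_trans (vm_CS v1 ch cxh)); rewrite ler_wpM2l ?eta2_ge0//.
  apply: ler_sint => //; first by apply: scontM => //; exact: scontX.
  move=> w w1; rewrite ler_wpM2l// (le_trans (sgdot_CSw _ _ _))// ler_piMl ?sgdot_ge0//.
  exact: xx1.
- apply: (le_trans (vm_CS v1 ch cxx)); rewrite -[leRHS]mulr1 ler_wpM2l ?eta2_ge0//.
  apply: vm_average_le => //; first exact: scontX.
  by move=> w w1; rewrite exprn_ile1 ?xx0 ?xx1.
- rewrite quad; set a := rho * q.
  have sha : smooth (fun w => h w - a * x w) by apply: smoothB => //; exact: smoothZ.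
  apply: le_trans (vm_poincare hsigma n2 k0 v1 sha).
  have chx := scontM ch cx; have cx2 := scontX (k := 2) cx; have ch2 := scontX (k := 2) ch.
  have cMhx := scontM cM chx; have cMx2 := scontM cM cx2; have cMh2 := scontM cM ch2.
  have cMh := scontM cM ch; have cMx := scontM cM cx.
  (* Subtracting the square of this mean turns the second moment of x into its variance. *)
  have -> : I (fun w => M v w * (h w - a * x w)) = - (a * c).
    rewrite (@eq_sint _ _ _ _ (fun w => M v w * h w - a * (M v w * x w))) => [|w _]; last by ring.
    by rewrite sintB ?sintZ ?eta_mean ?vm_mean_dot ?vv//; [ring|exact: scontZ].
  rewrite (@eq_sint _ _ _ (fun w => M v w * (h w - a * x w) ^+ 2)
    (fun w => M v w * h w ^+ 2 - (2 * a) * (M v w * (h w * x w)) + a ^+ 2 * (M v w * x w ^+ 2))) => [|w _]; last by ring.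
  rewrite sintD; [|by apply: scontB => //; exact: scontZ|exact: scontZ].
  rewrite sintB ?sintZ ?eta_dot ?vm_mean_sqr ?vv//; last exact: scontZ.
  rewrite le_eqVlt; apply/orP; left; apply/eqP; congr (_ * _); rewrite /eta2; ring.
- have := quad0 (2 * (rho * q)).
  by congr (_ <= _); ring.
Qed.

End State.
End Energy.

(** * Differential inequalities *)

Section OdeLemmas.
Context {R : realType}.
Implicit Types (f F E N r : R -> R) (t s : R).

Lemma derive_le0_nincr F (dF : R -> R) (a b : R) : a <= b ->
  (forall z : R, a <= z <= b -> is_derive z (1 : R) F (dF z)) ->
  (forall z : R, a <= z <= b -> dF z <= 0) -> F b <= F a.
Proof.
move=> ab hF h0; have [z zi e] := MVT_le ab hF.
by rewrite -subr_le0 e mulr_le0_ge0 ?h0// subr_ge0.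
Qed.

Lemma is_derive_scale (c d t : R) f : is_derive t (1 : R) f d ->
  is_derive t (1 : R) (fun t => c * f t) (c * d).
Proof.
move=> h; have := is_deriveM (is_derive_cst c t (1 : R)) h.
by move/is_derive_eq; apply; rewrite /GRing.scale/= mulr0 addr0.
Qed.

Lemma is_derive_expZ (a b t : R) :
  is_derive t (1 : R) (fun t => expR (a * (t - b))) (a * expR (a * (t - b))).
Proof.
have h : is_derive t (1 : R) (fun t : R => a * (t - b)) a.
  have h1 : is_derive t (1 : R) (fun t : R => t - b) (1 - 0) by exact: is_deriveB.
  have := is_derive_scale a h1.
  by move/is_derive_eq; apply; rewrite subr0 mulr1.
have := @is_derive1_comp R (@expR R) (fun t => a * (t - b)) t _ _ (is_derive_expR _) h.
by move/is_derive_eq; apply; rewrite mulrC.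
Qed.

(** Both [F] and [- F], after adding the primitive [K / lam * exp (- lam (z - a))], are
    nonincreasing. *)
Lemma drift F (dF : R -> R) (lam K a b : R) : 0 < lam -> 0 <= K -> a <= b ->
  (forall z : R, a <= z <= b -> is_derive z (1 : R) F (dF z)) ->
  (forall z : R, a <= z <= b -> `|dF z| <= K * expR (- lam * (z - a))) ->
  `|F b - F a| <= K / lam.
Proof.
move=> l0 K0 ab hF hd.
pose G z := (K / lam) * expR (- lam * (z - a)).
have dG z : is_derive z (1 : R) G (- K * expR (- lam * (z - a))).
  have h := is_derive_expZ (- lam) a z.
  have := is_derive_scale (K / lam) h.
  by move/is_derive_eq; apply; rewrite mulrA mulrN divfK// gt_eqF.
have Ga : G a = K / lam by rewrite /G subrr mulr0 expR0 mulr1.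
have Gb : 0 <= G b by rewrite mulr_ge0 ?expR_ge0// divr_ge0// ltW.
have h1 : F b + G b <= F a + G a.
  apply: (@derive_le0_nincr (fun z => F z + G z) (fun z => dF z + - K * expR (- lam * (z - a)))) => //.
    by move=> z zab; exact: (is_deriveD (hF z zab) (dG z)).
  by move=> z zab; have := le_trans (ler_norm _) (hd z zab); lra.
have h2 : - F b + G b <= - F a + G a.
  apply: (@derive_le0_nincr (fun z => - F z + G z) (fun z => - dF z + - K * expR (- lam * (z - a)))) => //.
    by move=> z zab; exact: (is_deriveD (is_deriveN (hF z zab)) (dG z)).
  by move=> z zab; have := hd z zab; rewrite -normrN => /(le_trans (ler_norm _)); lra.
by rewrite ler_norml; apply/andP; split; lra.
Qed.

(** Induction along the half-line: the infimum of the times where P fails would satisfy P by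
    closedness, and openness then contradicts that it is an infimum. *)
Lemma continuous_induction (P : R -> Prop) (t1 : R) : P t1 ->
  (forall t, t1 <= t -> P t -> \forall s \near t, P s) ->
  (forall t, t1 < t -> (forall s, t1 <= s < t -> P s) -> P t) ->
  forall t, t1 <= t -> P t.
Proof.
move=> P1 Po Pc t t1t; apply: contrapT => nPt.
pose A := [set b : R | t1 <= b /\ ~ P b].
have A0 : A !=set0 by exists t.
have lA : has_lbound A by exists t1 => b [].
have hA : has_inf A by [].
pose T := inf A; have t1T : t1 <= T by apply: lb_le_inf => // b [].
have below s : t1 <= s < T -> P s.
  move=> /andP[s1 sT]; apply: contrapT => nPs.
  have Ts : T <= s by apply: ge_inf => //; split.
  by move: sT; rewrite ltNge Ts.
have PT : P T.
  move: t1T; rewrite le_eqVlt => /predU1P[<-//|t1T]; exact: Pc.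
have /nbhs_ballP[d /= d0 hd] := Po T t1T PT.
have [b Ab bT] : exists2 b, A b & b < T + d by apply: inf_adherent.
have Tb : T <= b by apply: ge_inf.
case: Ab => _; apply; apply: hd; rewrite /ball/= distrC ger0_norm ?subr_ge0//.
by rewrite ltrBlDl.
Qed.

(** A bootstrap in two stages. While [E < e0] the cubic term takes at most half of the rate 2 lam,
    so [E] decays at rate lam and never leaves this region, and [r] stays at least r0. The cubic
    term is then an integrable multiple of [E], which restores the full rate 2 lam up to a constant
    factor. *)
Lemma ode_decay (lam C a eps : R) : 0 < lam -> 0 < C -> 0 < a -> 0 < eps ->
  exists e0 K : R, [/\ 0 < e0, 0 < K &
  forall E N r (dE : R -> R) (r0 t1 : R), 0 < r0 ->
    (forall t, t1 <= t -> {for t, continuous r}) ->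
    (forall t, t1 <= t -> 0 < r t ->
       [/\ is_derive t (1 : R) E (dE t), 0 <= N t & N t ^+ 2 <= a * E t]) ->
    (forall t, t1 <= t -> 0 < r t -> N t <= eps ->
       dE t <= - 2 * lam * E t + C * N t ^+ 3 /\ r0 <= r t) ->
    0 < r t1 -> E t1 < e0 ->
    forall t, t1 <= t -> [/\ 0 < r t, N t <= eps &
      N t <= K * Num.sqrt (E t1) * expR (- lam * (t - t1))]].
Proof.
move=> l0 C0 a0 eps0.
(* Below [lam / (C a)], the cubic term [C N^3] is at most [lam E]. *)
pose m := Num.min eps (lam / (C * a)).
have m0 : 0 < m by rewrite lt_min eps0/= divr_gt0// mulr_gt0.
pose e0 := m ^+ 2 / a; have e00 : 0 < e0 by rewrite divr_gt0// exprn_gt0.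
pose A0 := C * a * (Num.sqrt a * Num.sqrt e0).
have A00 : 0 < A0 by rewrite !mulr_gt0// sqrtr_gt0.
pose K := Num.sqrt (a * expR (2 * A0 / lam)).
have K0 : 0 < K by rewrite sqrtr_gt0 mulr_gt0 ?expR_gt0.
exists e0, K; split => // E N r dE r0 t1 r00 cr hE hd r1 E1.
have Nm t : t1 <= t -> 0 < r t -> E t < e0 -> N t <= m.
  move=> tt rt Et; have [_ N0 NE] := hE t tt rt.
  rewrite -(ler_pXn2r (n := 2)) ?nnegrE ?(ltW m0)//.
  by apply: (le_trans NE); rewrite -ler_pdivlMl// mulrC ltW.
have E0 t : t1 <= t -> 0 < r t -> 0 <= E t.
  move=> tt rt; have [_ N0 NE] := hE t tt rt.
  by rewrite -(pmulr_rge0 _ a0) (le_trans _ NE)// sqr_ge0.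
have good t : t1 <= t -> 0 < r t -> E t < e0 ->
    [/\ N t <= eps, r0 <= r t & dE t <= - lam * E t].
  move=> tt rt Et; have NM := Nm t tt rt Et; have [_ N0 NE] := hE t tt rt.
  have Neps : N t <= eps by apply: (le_trans NM); rewrite ge_min lexx.
  have [h1 h2] := hd t tt rt Neps; split => //; apply: (le_trans h1).
  have : C * N t ^+ 3 <= lam * E t.
    rewrite exprS mulrA; apply: (@le_trans _ _ (C * N t * (a * E t))).
      by rewrite ler_wpM2l// mulr_ge0// ltW.
    rewrite (_ : C * N t * (a * E t) = (C * a * N t) * E t); last by ring.
    rewrite ler_wpM2r ?E0// mulrC -ler_pdivlMr ?mulr_gt0//.
    by apply: (le_trans NM); rewrite ge_min lexx orbT.
  lra.
have decr t : t1 <= t -> (forall s, t1 <= s <= t -> 0 < r s /\ E s < e0) ->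
    E t <= E t1 * expR (- lam * (t - t1)).
  move=> tt H.
  have : E t * expR (lam * (t - t1)) <= E t1 * expR (lam * (t1 - t1)).
    apply: (@derive_le0_nincr (fun t => E t * expR (lam * (t - t1)))
      (fun t => E t * (lam * expR (lam * (t - t1))) + expR (lam * (t - t1)) * dE t)) => //.
      move=> z /[dup] zi /andP[z1 _]; have [rz _] := H z zi; have [dEz _ _] := hE z z1 rz.
      exact: (is_deriveM dEz (is_derive_expZ lam t1 z)).
    move=> z /[dup] zi /andP[z1 _]; have [rz Ez] := H z zi; have [_ _ h] := good z z1 rz Ez.
    rewrite (_ : _ + _ = expR (lam * (z - t1)) * (lam * E z + dE z)); last by ring.
    by rewrite pmulr_rle0 ?expR_gt0//; lra.
  rewrite subrr mulr0 expR0 mulr1 => h.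
  by rewrite mulNr expRN -ler_pdivrMr ?invr_gt0 ?expR_gt0// invrK.
have le1 s : t1 <= s -> expR (- lam * (s - t1)) <= 1.
  by move=> s1; rewrite -expR0 ler_expR mulNr oppr_le0 mulr_ge0 ?subr_ge0// ltW.
have main t : t1 <= t -> 0 < r t /\ E t < e0.
  apply: (@continuous_induction (fun t => 0 < r t /\ E t < e0)) => //.
  - move=> s s1 [rs Es]; have [dEs _ _] := hE s s1 rs.
    have cE : {for s, continuous E}.
      by apply: differentiable_continuous; apply/derivable1_diffP; case: dEs.
    have h1 := cvgr_gt _ (cr s s1) _ rs; have h2 := cvgr_lt _ cE _ Es.
    by near=> z; split; near: z; [exact: h1|exact: h2].
  (* At the end of an interval where the bounds hold, left limits preserve only large inequalities;
     the strict ones return because [r0 > 0] and [E s <= E t1 < e0]. *)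
  - move=> s s1 H; have s1' := ltW s1.
    have rs : r0 <= r s.
      have cl : r z @[z --> s^'-] --> r s by apply: cvg_at_left_filter; exact: cr.
      apply: (cvgr_to_ge cl); near=> z.
      have zi : t1 <= z < s.
        by apply/andP; split; near: z; [exact: nbhs_left_ge|exact: nbhs_left_lt].
      have [rz Ez] := H z zi; have /andP[z1 _] := zi.
      by have [] := good z z1 rz Ez.
    have rs0 := lt_le_trans r00 rs; split => //.
    have [dEs _ _] := hE s s1' rs0.
    have cE : {for s, continuous E}.
      by apply: differentiable_continuous; apply/derivable1_diffP; case: dEs.
    apply: le_lt_trans E1.
    have cl : E z @[z --> s^'-] --> E s by apply: cvg_at_left_filter.
    apply: (cvgr_to_le cl); near=> z.
    have zi : t1 <= z < s.
      by apply/andP; split; near: z; [exact: nbhs_left_ge|exact: nbhs_left_lt].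
    have /andP[z1 zs] := zi.
    apply: (@le_trans _ _ (E t1 * expR (- lam * (z - t1)))).
      by apply: decr => // y /andP[y1 yz]; apply: H; rewrite y1 (le_lt_trans yz).
    by rewrite ler_piMr ?E0 ?le1.
move=> t tt; have [rt Et] := main t tt; have [Neps _ _] := good t tt rt Et; split => //.
have [_ N0 NE] := hE t tt rt.
have Et1 : 0 <= E t1 by exact: E0.
pose g z := expR (- (lam / 2) * (z - t1)).
have g1 z : expR (- lam * (z - t1)) = g z ^+ 2.
  by rewrite /g -expRM_natl; congr expR; field.
have dE2 z : t1 <= z -> dE z <= - 2 * lam * E z + A0 * g z * E z.
  move=> z1; have [rz Ez] := main z z1; have [_ Nz NEz] := hE z z1 rz.
  have [Nz2 _ _] := good z z1 rz Ez.
  have [h _] := hd z z1 rz Nz2; apply: (le_trans h); rewrite lerD2l.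
  have Ng : N z <= Num.sqrt a * Num.sqrt e0 * g z.
    rewrite -(ler_pXn2r (n := 2)) ?nnegrE ?mulr_ge0 ?sqrtr_ge0 ?expR_ge0//.
    rewrite !exprMn !sqr_sqrtr ?(ltW a0) ?(ltW e00)// -g1; apply: (le_trans NEz).
    rewrite -mulrA ler_pM2l//; apply: le_trans (decr z z1 _) _.
      by move=> s /andP[s1 _]; exact: main.
    by rewrite ler_wpM2r ?expR_ge0// ltW.
  rewrite exprS mulrA (_ : A0 * g z * E z = C * (Num.sqrt a * Num.sqrt e0 * g z) * (a * E z)); last first.
    by rewrite /A0; ring.
  apply: ler_pM => //; first by rewrite mulr_ge0// ltW.
    exact: sqr_ge0.
  by rewrite ler_pM2l.
pose B := 2 * A0 / lam.
(* An integrating factor with logarithmic derivative [2 lam - A0 g]: the constant [B] makes the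
   derivative of [B g] equal to [- A0 g]. *)
pose f z := expR (2 * lam * (z - t1)) * expR (B * g z).
have df z : is_derive z (1 : R) f ((2 * lam - A0 * g z) * f z).
  have h1 := is_derive_expZ (2 * lam) t1 z.
  have h2 := is_derive_expZ (- (lam / 2)) t1 z.
  have h3 := is_derive_scale B h2.
  have h4 := @is_derive1_comp R (@expR R) (fun z => B * g z) z _ _ (is_derive_expR _) h3.
  have := is_deriveM h1 h4; move/is_derive_eq; apply.
  by rewrite /f /B /GRing.scale/= -/(g z); field; rewrite gt_eqF.
have hf : E t * f t <= E t1 * f t1.
  apply: (@derive_le0_nincr (fun z => E z * f z)
     (fun z => E z * ((2 * lam - A0 * g z) * f z) + f z * dE z)) => //.
    move=> z /andP[z1 _]; have [rz _] := main z z1; have [dEz _ _] := hE z z1 rz.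
    exact: (is_deriveM dEz (df z)).
  move=> z /andP[z1 _]; have f0 : 0 < f z by rewrite mulr_gt0 ?expR_gt0.
  rewrite (_ : _ + _ = f z * ((2 * lam - A0 * g z) * E z + dE z)); last by ring.
  by rewrite pmulr_rle0//; have := dE2 z z1; lra.
have f1 : f t1 = expR B by rewrite /f /g subrr !mulr0 expR0 mulr1 mul1r.
have f2 : expR (2 * lam * (t - t1)) <= f t.
  rewrite /f ler_peMr ?expR_ge0// -expR0 ler_expR mulr_ge0 ?expR_ge0//.
  by rewrite divr_ge0 ?mulr_ge0// ltW.
have hE2 : E t <= E t1 * expR B * g t ^+ 2 ^+ 2.
  have Ett := E0 t tt rt.
  have : E t * expR (2 * lam * (t - t1)) <= E t1 * expR B.
    by rewrite -f1; apply: le_trans hf; rewrite ler_wpM2l.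
  rewrite -ler_pdivlMr ?expR_gt0// => /le_trans; apply; rewrite -expRN.
  rewrite -g1 -expRM_natl (_ : - (2 * lam * (t - t1)) = 2 * (- lam * (t - t1)))//.
  by ring.
rewrite g1 -(ler_pXn2r (n := 2)) ?nnegrE ?mulr_ge0 ?sqrtr_ge0 ?exprn_ge0 ?expR_ge0//.
apply: (le_trans NE); rewrite !exprMn !sqr_sqrtr ?mulr_ge0 ?expR_ge0 ?(ltW a0)//.
apply: (@le_trans _ _ (a * (E t1 * expR B * g t ^+ 2 ^+ 2))); first by rewrite ler_pM2l.
rewrite le_eqVlt; apply/orP; left; apply/eqP; rewrite /B; ring.
Unshelve. all: by end_near. Qed.

End OdeLemmas.

Lemma is_deriveP {R : realType} (f : R -> R) (t df : R) : is_derive t (1 : R) f df <->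
  forall e, 0 < e -> \forall h \near (0 : R), `|f (t + h) - f t - h * df| <= e * `|h|.
Proof.
have key (d e h : R) : h != 0 -> (`|d - h^-1 *: ((f \o shift t) (h *: (1 : R)) - f t)| <= e) =
    (`|f (t + h) - f t - h * d| <= e * `|h|).
  move=> h0; rewrite /GRing.scale/= mulr1 (addrC h t) -ler_pdivrMr ?normr_gt0//.
  rewrite -normfV -normrM -normrN; congr (`|_| <= _).
  by field.
split=> [[fd <-] e e0|H].
  have /cvgrPdist_le/(_ e e0)/nbhs_ballP[r /= r0 hr] := fd.
  apply/nbhs_ballP; exists r => //= h hh; have [->|h0] := eqVneq h 0.
    by rewrite addr0 subrr mul0r subr0 normr0 mulr0.
  by rewrite -key//; exact: (hr h hh h0).
suff h : h^-1 *: ((f \o shift t) (h *: (1 : R)) - f t) @[h --> 0^'] --> df.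
  by apply: DeriveDef; [exact: cvgP h|exact: cvg_lim h].
apply/cvgrPdist_le => e e0; have /nbhs_ballP[r /= r0 hr] := H e e0.
apply/nbhs_ballP; exists r => //= h hh h0; rewrite key//; exact: hr.
Qed.

(** * Time derivatives uniform on the sphere *)

Section UniformDerivative.
Context {R : realType} {n : nat}.
Variable sigma : probability (borelRn R n) R.
Hypothesis hsigma : uniform_on_sphere sigma.
Local Notation V := 'rV[R]_n.
Local Notation I := (sint sigma).
Implicit Types (F G : R -> V -> R) (D f : V -> R) (t : R).

(** Differentiability in time for the supremum norm over the sphere. It passes to integrals against
    fixed functions; space derivatives are moved to the test function by parts. *)
Definition udiff F t D := forall e : R, 0 < e -> \forall h \near (0 : R),
  forall w, sphere w -> `|F (t + h) w - F t w - h * D w| <= e * `|h|.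

Lemma smooth_cvg_udiff F t D :
  smooth_cvg (0^') (fun h w => h^-1 * (F (t + h) w - F t w)) D -> udiff F t D.
Proof.
move=> H e e0; have /nbhs_ballP[r /= r0 hr] := H [::] e e0.
apply/nbhs_ballP; exists r => //= h hh w w1; have [->|h0] := eqVneq h 0.
  by rewrite addr0 subrr mul0r subr0 normr0 mulr0.
have := hr h hh h0 w w1; rewrite /= !radial_extE// => /ltW.
rewrite -ler_pdivrMr ?normr_gt0//; congr (_ <= _).
by rewrite -normfV -normrM; congr `|_|; field.
Qed.

Lemma udiff_int F t D f : (\forall h \near (0 : R), scont (F (t + h))) ->
  scont (F t) -> scont D -> scont f -> udiff F t D ->
  is_derive t (1 : R) (fun t => I (fun w => f w * F t w)) (I (fun w => f w * D w)).
Proof.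
move=> cF cFt cD cf H; apply/is_deriveP => e e0.
have [M M0 hM] := scont_bounded cf.
have e1 : 0 < e / M by rewrite divr_gt0.
near=> h.
have cFh : scont (F (t + h)) by near: h.
have hH : forall w, sphere w -> `|F (t + h) w - F t w - h * D w| <= e / M * `|h|.
  by near: h; exact: H.
have c1 := scontM cf cFh; have c2 := scontM cf cFt; have c3 := scontM cf cD.
rewrite -sintB// -sintZ// -sintB//; [|exact: scontB|exact: scontZ].
apply: (ler_norm_sint hsigma).
  by apply: scontB; [exact: scontB|exact: scontZ].
move=> w w1; rewrite (_ : _ - _ = f w * (F (t + h) w - F t w - h * D w)); last by ring.
rewrite normrM; apply: (@le_trans _ _ (M * (e / M * `|h|))).
  by apply: ler_pM => //; [exact: hM|exact: hH].
by rewrite mulrA mulrCA divff ?mulr1// gt_eqF.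
Unshelve. all: by end_near. Qed.

Lemma udiff_lip F t D (B : R) : (forall w, sphere w -> `|D w| <= B) -> udiff F t D ->
  \forall h \near (0 : R), forall w, sphere w -> `|F (t + h) w - F t w| <= (B + 1) * `|h|.
Proof.
move=> DB H; apply: filterS (H 1 ltr01) => h hh w w1.
have := hh w w1; rewrite mul1r => h1.
rewrite (_ : _ - _ = (F (t + h) w - F t w - h * D w) + h * D w); last by ring.
apply: (le_trans (ler_normD _ _)); rewrite mulrDl mul1r addrC lerD//.
by rewrite normrM mulrC ler_wpM2r// DB.
Qed.

Lemma near0_small (d : R) : 0 < d -> \forall h \near (0 : R), `|h| < d.
Proof.
by move=> d0; apply/nbhs_ballP; exists d => //= h; rewrite /ball/= sub0r normrN.
Qed.

Lemma udiffM F G t D D' : scont (F t) -> scont (G t) -> scont D -> scont D' ->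
  udiff F t D -> udiff G t D' ->
  udiff (fun t w => F t w * G t w) t (fun w => F t w * D' w + G t w * D w).
Proof.
move=> cF cG cD cD' HF HG e e0.
have [B1 B10 hB1] := scont_bounded cF; have [B2 B20 hB2] := scont_bounded cG.
have [B3 B30 hB3] := scont_bounded cD; have [B4 B40 hB4] := scont_bounded cD'.
pose B := B1 + B2 + B3 + B4 + 1.
have B0 : 0 < B by rewrite /B; lra.
pose e1 := e / (4 * B); have e10 : 0 < e1 by rewrite divr_gt0// mulr_gt0.
have hB : B1 + 1 + B4 + B2 <= 4 * B by rewrite /B; lra.
near=> h => w w1.
have h1 : forall w, sphere w -> `|F (t + h) w - F t w - h * D w| <= e1 * `|h| by near: h; exact: HF.
have h2 : forall w, sphere w -> `|G (t + h) w - G t w - h * D' w| <= e1 * `|h| by near: h; exact: HG.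
have h3 : forall w, sphere w -> `|F (t + h) w - F t w| <= (B3 + 1) * `|h|.
  by near: h; exact: (udiff_lip hB3 HF).
have hsmall : `|h| < Num.min (B + 1)^-1 (e1 / (B + 1)).
  by near: h; apply: near0_small; rewrite lt_min invr_gt0 divr_gt0// ?andbT; lra.
move: hsmall; rewrite lt_min => /andP[s1 s2].
have {}h1 := h1 w w1; have {}h2 := h2 w w1; have {}h3 := h3 w w1.
have {}hB1 := hB1 w w1; have {}hB2 := hB2 w w1; have {}hB4 := hB4 w w1.
have n0 : 0 <= `|h| by [].
have Bp : 0 < B + 1 by lra.
have s1' : `|h| * (B + 1) <= 1 by rewrite -ler_pdivlMr// mul1r ltW.
have s2' : `|h| * (B + 1) <= e1 by rewrite -ler_pdivlMr// ltW.
have h3' : `|F (t + h) w - F t w| <= `|h| * (B + 1).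
  by apply: (le_trans h3); rewrite mulrC ler_wpM2l// /B; lra.
rewrite (_ : _ - _ = F (t + h) w * (G (t + h) w - G t w - h * D' w)
   + h * D' w * (F (t + h) w - F t w) + G t w * (F (t + h) w - F t w - h * D w)); last by ring.
have t1 : `|F (t + h) w * (G (t + h) w - G t w - h * D' w)| <= (B1 + 1) * (e1 * `|h|).
  rewrite normrM; apply: ler_pM => //.
  rewrite -[F (t + h) w](subrK (F t w)) addrC (le_trans (ler_normD _ _))// lerD//.
  exact: le_trans s1'.
have t2 : `|h * D' w * (F (t + h) w - F t w)| <= `|h| * B4 * e1.
  rewrite !normrM; apply: ler_pM => //; [exact: ler_wpM2l|exact: le_trans s2'].
have t3 : `|G t w * (F (t + h) w - F t w - h * D w)| <= B2 * (e1 * `|h|).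
  by rewrite normrM; apply: ler_pM.
apply: (le_trans (ler_normD _ _)); apply: (le_trans (lerD (ler_normD _ _) (lexx _))).
apply: (le_trans (lerD (lerD t1 t2) t3)).
rewrite (_ : _ + _ = (B1 + 1 + B4 + B2) * (e1 * `|h|)); last by ring.
rewrite (_ : e * `|h| = 4 * B * (e1 * `|h|)); last by rewrite /e1; field; rewrite gt_eqF.
by rewrite ler_wpM2r// mulr_ge0// ltW.
Unshelve. all: by end_near. Qed.

Lemma udiff_exp F t D : scont (F t) -> scont D -> udiff F t D ->
  udiff (fun t w => expR (F t w)) t (fun w => expR (F t w) * D w).
Proof.
move=> cF cD HF e e0.
have cE : scont (fun w => expR (F t w)) by apply: scont_comp => //; exact: continuous_expR.
have [B1 B10 hB1] := scont_bounded cE; have [B3 B30 hB3] := scont_bounded cD.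
pose e1 := e / (2 * B1); have e10 : 0 < e1 by rewrite divr_gt0// mulr_gt0.
pose q := 2 * (B3 + 1) ^+ 2; have q0 : 0 < q by rewrite mulr_gt0// exprn_gt0// addr_gt0.
have Bp : 0 < B3 + 1 by lra.
have m0 : 0 < Num.min ((B3 + 1)^-1 / 2) (e1 / q).
  by rewrite lt_min; apply/andP; split; rewrite divr_gt0// invr_gt0.
near=> h => w w1.
have h1 : forall w, sphere w -> `|F (t + h) w - F t w - h * D w| <= e1 * `|h| by near: h; exact: HF.
have h3 : forall w, sphere w -> `|F (t + h) w - F t w| <= (B3 + 1) * `|h|.
  by near: h; exact: (udiff_lip hB3 HF).
have hsmall : `|h| < Num.min ((B3 + 1)^-1 / 2) (e1 / q).
  by near: h; exact: near0_small.
move: hsmall; rewrite lt_min => /andP[s1 s2].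
have {}h1 := h1 w w1; have {}h3 := h3 w w1; have {}hB1 := hB1 w w1.
pose d := F (t + h) w - F t w.
have d2 : `|d| <= 2^-1.
  apply: (le_trans h3); rewrite -ler_pdivlMl//; exact: ltW.
have := expR_taylor2 d2 => td.
rewrite (_ : _ - _ = expR (F t w) * ((expR d - 1 - d) + (d - h * D w))); last first.
  by rewrite -[F (t + h) w](subrK (F t w)) -/d expRD; ring.
rewrite normrM; apply: (@le_trans _ _ (B1 * (2 * e1 * `|h|))); last first.
  by rewrite le_eqVlt; apply/orP; left; apply/eqP; rewrite /e1; field; rewrite gt_eqF.
apply: ler_pM => //; apply: (le_trans (ler_normD _ _)); rewrite mulrDl mul1r mulrDl; apply: lerD => //.
apply: (le_trans td); rewrite -[d ^+ 2]ger0_norm ?sqr_ge0// normrX.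
apply: (@le_trans _ _ (2 * ((B3 + 1) * `|h|) ^+ 2)).
  by rewrite ler_pM2l// lerXn2r ?nnegrE// mulr_ge0// ltW.
rewrite (_ : 2 * _ ^+ 2 = q * `|h| * `|h|); last by rewrite /q; ring.
by rewrite ler_wpM2r// mulrC -ler_pdivlMr// ltW.
Unshelve. all: by end_near. Qed.

Lemma udiff_dot (v : R -> V) (t : R) (dv : 'I_n -> R) :
  (forall i, is_derive t (1 : R) (fun t => v t 0 i) (dv i)) ->
  udiff (fun t w => dot w (v t)) t (fun w => dot w (\row_i dv i)).
Proof.
move=> H e e0.
pose e1 := e / (n%:R + 1); have n0 : 0 < n%:R + 1 :> R by rewrite ltr_wpDl.
have e10 : 0 < e1 by rewrite divr_gt0.
have : \forall h \near (0 : R), forall i, `|v (t + h) 0 i - v t 0 i - h * dv i| <= e1 * `|h|.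
  apply: (@filter_forall _ _ (fun i h => `|v (t + h) 0 i - v t 0 i - h * dv i| <= e1 * `|h|) (nbhs (0 : R))).
  by move=> i; have /is_deriveP := H i; exact.
apply: filterS => h hh w w1.
rewrite !dotE mulr_sumr -!sumrB; apply: (le_trans (ler_norm_sum _ _ _)).
apply: (@le_trans _ _ (\sum_(i < n) e1 * `|h|)).
  apply: ler_sum => i _; rewrite !mxE (_ : _ - _ = w 0 i * (v (t + h) 0 i - v t 0 i - h * dv i)); last by ring.
  rewrite normrM -[leRHS]mul1r; apply: ler_pM => //.
  by apply: le_trans (ler_coord_eucl _ _) _; rewrite w1.
rewrite sumr_const card_ord -mulr_natl mulrA ler_wpM2r//.
by rewrite /e1 mulrA ler_pdivrMr// mulrC ler_pM2l// lerDl.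
Qed.

Lemma udiffZ (c : R) F t D : udiff F t D -> udiff (fun t w => c * F t w) t (fun w => c * D w).
Proof.
move=> H e e0; have c0 : 0 < `|c| + 1 by rewrite ltr_wpDl.
have := H (e / (`|c| + 1)) ltac:(by rewrite divr_gt0).
apply: filterS => h hh w w1.
rewrite (_ : _ - _ = c * (F (t + h) w - F t w - h * D w)); last by ring.
rewrite normrM; apply: (@le_trans _ _ ((`|c| + 1) * (e / (`|c| + 1) * `|h|))).
  by apply: ler_pM => //; [rewrite lerDl|exact: hh].
by rewrite mulrA mulrCA divff ?mulr1// gt_eqF.
Qed.

End UniformDerivative.

(** * Time derivatives along the flow *)

Section Collision.
Context {R : realType} {n : nat}.
Variable sigma : probability (borelRn R n) R.
Hypothesis hsigma : uniform_on_sphere sigma.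
Hypothesis n2 : (2 <= n)%N.
Local Notation V := 'rV[R]_n.
Local Notation I := (sint sigma).
Variables (nu tau : R -> R).
Implicit Types (u phi : V -> R) (z : V).

Lemma fluxE u i : flux sigma u 0 i = I (fun w => w 0 i * u w).
Proof. by rewrite mxE sintE. Qed.

Lemma flux_dot u z : scont u -> dot (flux sigma u) z = I (fun w => dot w z * u w).
Proof.
move=> cu; rewrite dotE.
have c i : scont (fun w => w 0 i * u w) by apply: scontM => //; exact: scont_coord.
rewrite (eq_bigr (fun i => I (fun w => z 0 i * (w 0 i * u w)))); last first.
  by move=> i _; rewrite fluxE mulrC -sintZ.
rewrite -sint_sum; last by move=> i; exact: scontZ.
by apply: eq_sint => w _; rewrite dotE mulr_suml; apply: eq_bigr => i _; ring.
Qed.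

Lemma direction_sphere u : 0 < eucl (flux sigma u) -> sphere (direction sigma u).
Proof. by move=> r0; apply: sphere_normalize; rewrite -eucl_gt0. Qed.

Lemma flux_direction u z : scont u -> 0 < eucl (flux sigma u) ->
  I (fun w => dot w z * u w) = eucl (flux sigma u) * dot (direction sigma u) z.
Proof.
by move=> cu r0; rewrite -flux_dot// /direction dotZl mulrA mulfV ?mul1r// gt_eqF.
Qed.

(** The field [u] times the projection of Omega is tangent, so both terms of Q integrate by parts
    without curvature contribution. *)
Lemma Q_weak u phi : smooth u -> smooth phi -> 0 < eucl (flux sigma u) ->
  0 < tau (eucl (flux sigma u)) ->
  I (fun w => phi w * Q sigma nu tau u w) =
  weakQ sigma (direction sigma u) u (tau (eucl (flux sigma u)))
    (nu (eucl (flux sigma u)) / tau (eucl (flux sigma u))) phi.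
Proof.
move=> su sp r0 t0; set r := eucl (flux sigma u); set v := direction sigma u.
have J0 : (flux sigma u == 0) = false by apply/eqP/eqP; rewrite -eucl_gt0.
pose A i w := u w * (v 0 i - dot w v * w 0 i).
have sA i : smooth (A i) by rewrite /A; smooth_tac.
have sdA : smooth (fun w => \sum_i sd i (A i) w) by apply: smooth_sum => i; exact: smooth_sd.
have v1 : sphere v by exact: direction_sphere.
rewrite (@eq_sint _ _ _ _ (fun w => (- nu r) * (phi w * \sum_i sd i (A i) w) + tau r * (phi w * slap u w))); last first.
  move=> w w1; rewrite /Q J0 -/r -/v sdivE slaplacianE -/(slap u w).
  rewrite (eq_bigr (fun i => sd i (A i) w)); last first.
    move=> i _; apply: eq_sd => // x x1; rewrite /A !mxE /tproj; congr (_ * (_ - _)).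
  by ring.
have c1 : scont (fun w => phi w * \sum_i sd i (A i) w) by apply: smooth_scont; exact: smoothM.
have c2 : scont (fun w => phi w * slap u w).
  by apply: smooth_scont; apply: smoothM => //; exact: smooth_slap.
rewrite sintD; [|exact: scontZ|exact: scontZ].
rewrite !sintZ// sint_slap//.
rewrite (@sint_div_tangent _ _ _ hsigma A phi)//; last first.
  move=> w w1; rewrite (eq_bigr (fun i => u w * (w 0 i * v 0 i - dot w v * (w 0 i * w 0 i)))); last first.
    by move=> i _; rewrite /A; ring.
  rewrite -mulr_sumr sumrB -mulr_sumr -!dotE; move/sphereE: w1 => ->; ring.
have -> : I (fun w => \sum_i A i w * sd i phi w) = I (fun w => u w * sgdot (xdot v) phi w).
  apply: eq_sint => w w1; rewrite /sgdot mulr_sumr; apply: eq_bigr => i _.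
  by rewrite /xdot sd_dot// /A; ring.
rewrite /weakQ; have -> : I (sgdot phi u) = I (sgdot u phi) by apply: eq_sint => w _; exact: sgdotC.
by field; rewrite gt_eqF.
Qed.

Lemma Q_mass u : smooth u -> 0 < tau (eucl (flux sigma u)) -> I (Q sigma nu tau u) = 0.
Proof.
move=> su t0; have s1 := @smooth_cst R n 1.
have z1 f w : sphere w -> sgdot f (cst 1) w = 0.
  by move=> w1; rewrite /sgdot big1// => i _; rewrite sd_cst mulr0.
have [J0|J0] := eqVneq (flux sigma u) 0.
  rewrite (@eq_sint _ _ _ _ (fun w => tau 0 * (cst 1 w * slap u w))); last first.
    by move=> w _; rewrite /Q J0 eqxx slaplacianE mul1r.
  rewrite sintZ; last by apply: smooth_scont; apply: smoothM => //; exact: smooth_slap.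
  rewrite sint_slap// (@eq_sint _ _ _ _ (cst 0)) ?(sint1 hsigma) ?oppr0 ?mulr0//.
  by move=> w w1; rewrite sgdotC z1.
rewrite -eucl_gt0 in J0.
rewrite (@eq_sint _ _ _ _ (fun w => cst 1 w * Q sigma nu tau u w)); last first.
  by move=> w _; rewrite mul1r.
rewrite Q_weak// /weakQ.
rewrite (@eq_sint _ _ _ (fun w => u w * _) (cst 0)); last by move=> w w1; rewrite z1 ?mulr0.
rewrite (@eq_sint _ _ _ (sgdot u (cst 1)) (cst 0)); last by move=> w w1; rewrite z1.
by rewrite !(sint1 hsigma) mulr0 subr0 mulr0.
Qed.

(** Here the direction only occurs in one exponent and [u] without derivatives, the form in which
    the quantity is differentiated in time. *)
Lemma eta2E k v rho u : sphere v -> smooth u -> I u = rho ->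
  eta2 sigma n2 k v rho u =
  vmZ sigma n2 k * I (fun w => u w * u w * expR (- k * dot w v)) - rho ^+ 2.
Proof.
move=> v1 su Iu; have cM := smooth_scont (smooth_vm sigma n2 k v); have cu := smooth_scont su.
have ce : scont (fun w => u w * u w * expR (- k * dot w v)) by apply: smooth_scont; smooth_tac.
rewrite /eta2 (@eq_sint _ _ _ _ (fun w => vmZ sigma n2 k * (u w * u w * expR (- k * dot w v))
   - 2 * rho * u w + rho ^+ 2 * vm sigma n2 k v w)); last first.
  move=> w _; rewrite expr2 mulrA (vm_eta hsigma).
  by rewrite mulrBl -(mulrA rho) (vm_eta hsigma) /eta; ring.
rewrite sintD; [|by apply: scontB; exact: scontZ|exact: scontZ].
rewrite sintB; [|exact: scontZ|exact: scontZ].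
by rewrite !sintZ// (sint_vm hsigma)// Iu; ring.
Qed.

End Collision.

(** * Evolution of the flux, of its direction and of the weighted norm *)

Section Flow.
Context {R : realType} {n : nat}.
Variable sigma : probability (borelRn R n) R.
Hypothesis hsigma : uniform_on_sphere sigma.
Hypothesis n2 : (2 <= n)%N.
Local Notation V := 'rV[R]_n.
Local Notation I := (sint sigma).
Variables (nu tau : R -> R) (k rho : R).
Hypothesis k0 : 0 < k.
Hypothesis tau0 : forall r, 0 <= r -> 0 < tau r.
Implicit Types (u du : R -> V -> R) (t : R).
Local Notation r := (fun u t => eucl (flux sigma (u t))).
Local Notation Om := (fun u t => direction sigma (u t)).

Definition flow u du := forall t, 0 < t -> [/\ smooth (u t), smooth (du t), udiff u t (du t),
  forall w, sphere w -> du t w = Q sigma nu tau (u t) w & I (u t) = rho].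

Section Solution.
Variables (u du : R -> V -> R).
Hypothesis F : flow u du.

Lemma near_pos t : 0 < t -> \forall h \near (0 : R), 0 < t + h.
Proof.
move=> t0; apply: filterS (near0_small t0) => h; rewrite ltr_norml => /andP[]; lra.
Qed.

Lemma near_gt0 t : 0 < t -> \forall s \near t, 0 < s.
Proof. by move=> t0; exact: lt_nbhsr. Qed.

Lemma flow_scont t : 0 < t -> scont (u t).
Proof. by move=> /F[su _ _ _ _]; exact: smooth_scont. Qed.

Lemma flow_near_scont t : 0 < t -> \forall h \near (0 : R), scont (u (t + h)).
Proof. by move=> t0; apply: filterS (near_pos t0) => h; exact: flow_scont. Qed.

Lemma is_derive_pairing t f : 0 < t -> scont f ->
  is_derive t (1 : R) (fun t => I (fun w => f w * u t w)) (I (fun w => f w * du t w)).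
Proof.
move=> t0 cf; have [su sdu du' _ _] := F t0.
by apply: udiff_int => //; [exact: flow_near_scont|exact: flow_scont|exact: smooth_scont].
Qed.

Definition dJ t i := I (fun w => w 0 i * du t w).

Lemma is_derive_flux t i : 0 < t -> is_derive t (1 : R) (fun t => flux sigma (u t) 0 i) (dJ t i).
Proof.
move=> t0; under eq_fun do rewrite fluxE.
by apply: is_derive_pairing => //; exact: scont_coord.
Qed.

Lemma is_derive_sqr_r t : 0 < t ->
  is_derive t (1 : R) (fun t => r u t ^+ 2) (2 * \sum_i flux sigma (u t) 0 i * dJ t i).
Proof.
move=> t0.
have -> : (fun t => r u t ^+ 2) = \sum_(i < n) (fun t => flux sigma (u t) 0 i * flux sigma (u t) 0 i).
  by apply/funext => s; rewrite sqr_eucl dotE fct_sumE.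
have H i : is_derive t (1 : R) (fun t => flux sigma (u t) 0 i * flux sigma (u t) 0 i)
    (2 * (flux sigma (u t) 0 i * dJ t i)).
  have h := is_derive_flux i t0; have := is_deriveM h h.
  by move/is_derive_eq; apply; rewrite /GRing.scale/=; ring.
by rewrite mulr_sumr; exact: is_derive_sum.
Qed.

Lemma r_continuous t : 0 < t -> {for t, continuous (r u)}.
Proof.
move=> t0; have -> : r u = (fun t => Num.sqrt (r u t ^+ 2)).
  by apply/funext => s; rewrite sqrtr_sqr ger0_norm ?eucl_ge0.
apply: (@continuous_comp _ _ _ (fun t => r u t ^+ 2) Num.sqrt); last exact: sqrt_continuous.
apply: differentiable_continuous; apply/derivable1_diffP.
by case: (is_derive_sqr_r t0).
Qed.

Lemma is_derive_r t : 0 < t -> 0 < r u t ->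
  is_derive t (1 : R) (r u) (I (fun w => dot w (Om u t) * du t w)).
Proof.
move=> t0 r0; have [su sdu _ _ _] := F t0.
have e : r u = (fun t => Num.sqrt (r u t ^+ 2)).
  by apply/funext => s; rewrite sqrtr_sqr ger0_norm ?eucl_ge0.
have r2 : 0 < r u t ^+ 2 by rewrite exprn_gt0.
have h := @is_derive1_comp R Num.sqrt (fun t => r u t ^+ 2) t _ _ (is_derive1_sqrt r2) (is_derive_sqr_r t0).
rewrite e; apply: (is_derive_eq h).
have -> : I (fun w => dot w (Om u t) * du t w) = \sum_i (r u t)^-1 * (flux sigma (u t) 0 i * dJ t i).
  rewrite -flux_dot//; last exact: smooth_scont.
  rewrite dotE; apply: eq_bigr => i _; rewrite fluxE -/(dJ t i) !mxE; ring.
rewrite -mulr_sumr sqrtr_sqr ger0_norm ?eucl_ge0//.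
by field; rewrite gt_eqF.
Qed.

Definition dOm t i := (r u t)^-1 * (dJ t i - I (fun w => dot w (Om u t) * du t w) * Om u t 0 i).

Lemma is_derive_Om t i : 0 < t -> 0 < r u t ->
  is_derive t (1 : R) (fun t => Om u t 0 i) (dOm t i).
Proof.
move=> t0 r0; have -> : (fun t => Om u t 0 i) = (fun t => (r u t)^-1 * flux sigma (u t) 0 i).
  by apply/funext => s; rewrite !mxE.
have rn0 : r u t != 0 by rewrite gt_eqF.
have := is_deriveM (@is_deriveV R (r u) t _ (1 : R) rn0 (is_derive_r t0 r0)) (is_derive_flux i t0).
by move/is_derive_eq; apply; rewrite /dOm /GRing.scale/= !mxE; field.
Qed.

Lemma flow_weak t phi : 0 < t -> 0 < r u t -> smooth phi ->
  I (fun w => phi w * du t w) =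
  weakQ sigma (Om u t) (u t) (tau (r u t)) (nu (r u t) / tau (r u t)) phi.
Proof.
move=> t0 r0 sp; have [su sdu _ hQ _] := F t0.
rewrite -(Q_weak hsigma nu)//; last by apply: tau0; exact: ltW.
by apply: eq_sint => w w1; rewrite hQ.
Qed.

Lemma flow_mass0 t : 0 < t -> I (du t) = 0.
Proof.
move=> t0; have [su sdu _ hQ _] := F t0.
rewrite (@eq_sint _ _ _ _ (Q sigma nu tau (u t)))//.
by apply: Q_mass => //; apply: tau0; exact: eucl_ge0.
Qed.

Lemma dOm_orthogonal t : 0 < t -> 0 < r u t -> dot (Om u t) (\row_i dOm t i) = 0.
Proof.
move=> t0 r0; have [su sdu _ _ _] := F t0.
rewrite dotE (eq_bigr (fun i => (r u t)^-1 * (dJ t i * Om u t 0 i -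
  I (fun w => dot w (Om u t) * du t w) * (Om u t 0 i * Om u t 0 i)))); last first.
  by move=> i _; rewrite [X in _ * X = _]mxE /dOm; ring.
rewrite -mulr_sumr sumrB -mulr_sumr -dotE.
have /sphereE -> : sphere (Om u t) by exact: direction_sphere.
have -> : \sum_i dJ t i * Om u t 0 i = I (fun w => dot w (Om u t) * du t w).
  rewrite -flux_dot//; last exact: smooth_scont.
  by rewrite dotE; apply: eq_bigr => i _; rewrite fluxE.
by rewrite mulr1 subrr mulr0.
Qed.

Local Notation M t := (vm sigma n2 k (Om u t)).
Local Notation h t := (eta sigma n2 k (Om u t) rho (u t)).
Definition N2 t := eta2 sigma n2 k (Om u t) rho (u t).

(** The weight moves with Omega. Among the terms it brings, those linear in eta or free of it are
    multiples of <Omega, Omega'> and vanish as Omega has constant norm; the one quadratic in eta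
    stays. Mass conservation removes the term in rho. *)
Lemma is_derive_N2 t : 0 < t -> 0 < r u t -> is_derive t (1 : R) N2
  (2 * I (fun w => h t w * du t w) - k * I (fun w => M t w * (h t w ^+ 2 * dot w (\row_i dOm t i)))).
Proof.
move=> t0 r0; have [su sdu hu _ Iu] := F t0.
have v1 : sphere (Om u t) by exact: direction_sphere.
pose z := \row_i dOm t i.
pose G s w := (u s w * u s w) * expR (- k * dot w (Om u s)).
have cu := smooth_scont su; have cdu := smooth_scont sdu.
have sdot v : smooth (fun w : V => - k * dot w v) by smooth_tac.
have uexp : udiff (fun s w => expR (- k * dot w (Om u s))) t
    (fun w => expR (- k * dot w (Om u t)) * (- k * dot w z)).
  apply: (@udiff_exp _ _ (fun s w => - k * dot w (Om u s))); try (apply: smooth_scont; exact: sdot).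
  apply: (@udiffZ _ _ (- k) (fun s w => dot w (Om u s))); apply: udiff_dot => i.
  exact: is_derive_Om.
have uuu := udiffM cu cu cdu cdu hu hu.
have cexp v : scont (fun w : V => expR (- k * dot w v)) by apply: smooth_scont; smooth_tac.
have cuu : scont (fun w => u t w * u t w) by exact: scontM.
have cduu : scont (fun w => u t w * du t w + u t w * du t w) by apply: scontD; exact: scontM.
have cdexp : scont (fun w => expR (- k * dot w (Om u t)) * (- k * dot w z)).
  by apply: scontM => //; apply: smooth_scont; exact: sdot.
have uG : udiff G t _ := udiffM cuu (cexp _) cduu cdexp uuu uexp.
have cG s : 0 < s -> scont (G s).
  by move=> s0; have cus := flow_scont s0; apply: scontM => //; exact: scontM.
have cGn : \forall h' \near (0 : R), scont (G (t + h')).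
  by apply: filterS (near_pos t0) => h'; exact: cG.
have dG := udiff_int hsigma cGn (cG t t0) (scontD (scontM cuu cdexp) (scontM (cexp _) cduu))
  (@scont_cst R n 1) uG.
have dN := is_deriveB (is_derive_scale (vmZ sigma n2 k) dG) (is_derive_cst (rho ^+ 2) t (1 : R)).
have nE : \forall s \near t, vmZ sigma n2 k * I (fun w => cst 1 w * G s w) - rho ^+ 2 = N2 s.
  have := cvgr_gt _ (r_continuous t0) _ r0 => rs.
  near=> s; have s0 : 0 < s by near: s; exact: near_gt0.
  have [sus _ _ _ Ius] := F s0.
  rewrite /N2 (eta2E hsigma)//; last first.
    by apply: direction_sphere; near: s; exact: rs.
  by congr (_ * _ - _); apply: eq_sint => w _; rewrite mul1r.
have := near_eq_is_derive nE dN; move/is_derive_eq; apply.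
have Mh w : M t w * h t w = u t w - rho * M t w by exact: vm_eta.
have cM : scont (M t) by exact: scont_vm.
have sh : smooth (h t) by exact: smooth_eta.
have ch := smooth_scont sh; have cz := @scont_dot R n z.
have cMz := scontM cM cz; have cMhz := scontM cM (scontM ch cz).
have cMh2z := scontM cM (scontM (scontX (k := 2) ch) cz).
have chd := scontM ch cdu.
rewrite subr0 -sintZ; last first.
  exact: (scontM (@scont_cst R n 1) (scontD (scontM cuu cdexp) (scontM (cexp _) cduu))).
rewrite (@eq_sint _ _ _ _ (fun w => (2 * (h t w * du t w) + 2 * rho * du t w) +
   (- k * (M t w * (h t w ^+ 2 * dot w z)) + (- k * (2 * rho)) * (M t w * (h t w * dot w z))
    + (- k * rho ^+ 2) * (M t w * dot w z)))); last first.
  move=> w _; rewrite /cst mul1r.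
  have e1 : vmZ sigma n2 k * (expR (- k * dot w (Om u t)) * u t w) = h t w + rho by rewrite /eta subrK.
  have e2 : u t w = M t w * (h t w + rho) by exact: vm_etaD.
  transitivity (2 * (vmZ sigma n2 k * (expR (- k * dot w (Om u t)) * u t w)) * du t w
    + (vmZ sigma n2 k * (expR (- k * dot w (Om u t)) * u t w)) * u t w * (- k * dot w z)); first by ring.
  by rewrite e1 [X in _ * X * (- k * _)]e2; ring.
rewrite sintD; [|by apply: scontD; exact: scontZ|by do 2 (apply: scontD; last exact: scontZ); exact: scontZ].
rewrite sintD; [|exact: scontZ|exact: scontZ].
rewrite sintD; [|by apply: scontD; exact: scontZ|exact: scontZ].
rewrite sintD; [|exact: scontZ|exact: scontZ].
have Ju := fun z => flux_direction z cu r0.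
rewrite !sintZ// (flow_mass0 t0) (eta_dot hsigma n2 k rho v1 su Ju) (vm_mean_dot hsigma)//.
by rewrite (dOm_orthogonal t0 r0); ring.
Unshelve. all: by end_near. Qed.

End Solution.
End Flow.

(** * Convergence of the direction *)

Section Decay.
Context {R : realType} {n : nat}.
Variable sigma : probability (borelRn R n) R.
Hypothesis hsigma : uniform_on_sphere sigma.
Hypothesis n2 : (2 <= n)%N.
Local Notation V := 'rV[R]_n.
Local Notation I := (sint sigma).
Variables (nu tau : R -> R) (k rho k1 CK TM L : R).
Hypotheses (k0 : 0 < k) (rho0 : 0 < rho) (k10 : 0 < k1) (CK0 : 0 < CK) (TM0 : 0 < TM) (L0 : 0 < L).
Local Notation c := (order_param n k).
Local Notation rk := (rho * c).
Hypothesis tau_pos : forall r, 0 <= r -> 0 < tau r.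
Hypothesis tau_le : forall r, 0 <= r -> tau r <= TM.
Hypothesis tau_lip : forall r, 0 <= r -> `|tau r - tau rk| <= L * `|r - rk|.
Hypothesis k_taylor2 : forall r, 0 < r -> `|nu r / tau r - k - k1 * (r - rk)| <= CK * (r - rk) ^+ 2.
Let theta := 1 - rho * k1 * vmvar sigma n2 k.
Hypothesis theta0 : 0 < theta.
Local Notation Lam := (poincare_constant sigma k).
Let lam := tau rk * Lam * theta.

Local Notation r := (fun u t => eucl (flux sigma (u t))).
Local Notation Om := (fun u t => direction sigma (u t)).
Local Notation N u t := (Num.sqrt (N2 sigma n2 k rho u t)).
Local Notation flow := (flow sigma nu tau rho).
Implicit Types (u du : R -> V -> R) (t : R).

Let c0 : 0 < c. Proof. exact: (order_param_gt0 hsigma n2 (ltW k0) k0). Qed.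
Let rk0 : 0 < rk. Proof. exact: mulr_gt0. Qed.

Definition energy u t : R := N2 sigma n2 k rho u t / 2 - rho * k1 * (r u t - rk) ^+ 2 / 2.

Definition coordC : R := TM * ((k1 + CK) * (2 * (`|rho| + 1)) + (2 * k + n%:R)).
(** Each coordinate of Omega' is at most [2 coordC N / |J|], with |J| at least rk / 2. *)
Definition driftC : R := 4 * coordC / rk.

Let coordC0 : 0 < coordC.
Proof.
have h1 : 0 < (k1 + CK) * (2 * (`|rho| + 1)) by rewrite mulr_gt0 ?addr_gt0// mulr_gt0// ltr_wpDl.
by rewrite mulr_gt0// ltr_pwDl// addr_ge0// mulr_ge0// ltW.
Qed.

Let driftC0 : 0 < driftC. Proof. by rewrite divr_gt0// mulr_gt0. Qed.

Section State.
Variables (u du : R -> V -> R) (t : R).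
Hypotheses (F : flow u du) (t0 : 0 < t) (r0 : 0 < r u t).

Let v1 : sphere (Om u t). Proof. exact: direction_sphere. Qed.
Let su : smooth (u t). Proof. by case: (F t0). Qed.
Let Iu : I (u t) = rho. Proof. by case: (F t0). Qed.
Let Ju z : I (fun w => dot w z * u t w) = r u t * dot (Om u t) z.
Proof. by apply: flux_direction => //; exact: smooth_scont. Qed.

Let N0 : 0 <= N u t. Proof. exact: sqrtr_ge0. Qed.
Let NE : N u t ^+ 2 = N2 sigma n2 k rho u t.
Proof. by rewrite sqr_sqrtr//; exact: eta2_ge0. Qed.

Lemma flux_dev_le : `|r u t - rk| <= N u t.
Proof.
rewrite -(ler_pXn2r (n := 2)) ?nnegrE// real_normK ?num_real// NE.
exact: (eta_dot_le hsigma n2 k rho v1 su Ju).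
Qed.

Lemma flux_dev_sqr : (r u t - rk) ^+ 2 <= vmvar sigma n2 k * N u t ^+ 2.
Proof. rewrite NE; exact: (eta_dot_sqr hsigma n2 k v1 su Iu Ju). Qed.

Lemma k_dev_le : N u t <= 1 -> `|nu (r u t) / tau (r u t) - k| <= (k1 + CK) * N u t.
Proof.
move=> N1; have h := k_taylor2 r0; have b := flux_dev_le.
rewrite -[X in `|X|](subrK (k1 * (r u t - rk))) (le_trans (ler_normD _ _))// mulrDl addrC lerD//.
  by rewrite normrM gtr0_norm// ler_pM2l.
apply: (le_trans h); rewrite ler_pM2l// -real_normK ?num_real//.
apply: (@le_trans _ _ (N u t ^+ 2)); first by rewrite lerXn2r ?nnegrE.
by rewrite expr2 ler_piMl.
Qed.

Lemma coord_dev_le z : N u t <= 1 -> sphere z ->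
  `|I (fun w => dot w z * du t w)| <= coordC * N u t.
Proof.
move=> N1 z1; have sz := @smooth_dot R n z.
rewrite (flow_weak hsigma tau_pos F t0 r0 sz).
apply: (weakQ_coord_le hsigma (ltW k0) v1 su z1) => //.
- by rewrite (ltW (tau_pos _)) ?tau_le ?eucl_ge0.
- by rewrite addr_ge0// ltW.
- exact: k_dev_le.
Qed.

Lemma dOm_le i : N u t <= 1 -> rk / 2 <= r u t -> `|dOm sigma u du t i| <= driftC * N u t.
Proof.
move=> N1 rr; rewrite /dOm normrM gtr0_norm ?invr_gt0//.
have e : dJ sigma du t i = I (fun w => dot w (delta_mx 0 i) * du t w).
  by apply: eq_sint => w _; rewrite dot_delta.
have s1 : sphere (delta_mx 0 i : V) by apply/sphereE; rewrite dot_delta mxE !eqxx.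
have h1 := coord_dev_le N1 s1; have h2 := coord_dev_le N1 v1.
have h3 : `|Om u t 0 i| <= 1 by apply: le_trans (ler_coord_eucl _ _) _; rewrite v1.
have h4 : `|dJ sigma du t i - I (fun w => dot w (Om u t) * du t w) * Om u t 0 i| <= 2 * (coordC * N u t).
  rewrite e (le_trans (ler_normB _ _))// mulrDl mul1r lerD// normrM -[leRHS]mulr1.
  exact: ler_pM.
rewrite ler_pdivrMl//; apply: (le_trans h4).
rewrite /driftC; have : rk / 2 * (4 * coordC / rk * N u t) <= r u t * (4 * coordC / rk * N u t).
  by rewrite ler_wpM2r// mulr_ge0// ltW.
by congr (_ <= _); field; rewrite !gt_eqF.
Qed.

Lemma dot_dOm_le w : N u t <= 1 -> rk / 2 <= r u t -> sphere w ->
  `|dot w (\row_i dOm sigma u du t i)| <= n%:R * driftC * N u t.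
Proof.
move=> N1 rr w1; rewrite dotE (le_trans (ler_norm_sum _ _ _))//.
apply: (@le_trans _ _ (\sum_(i < n) driftC * N u t)).
  apply: ler_sum => i _; rewrite mxE normrM -[leRHS]mul1r; apply: ler_pM => //.
    by apply: le_trans (ler_coord_eucl _ _) _; rewrite w1.
  exact: dOm_le.
by rewrite sumr_const card_ord -[leLHS]mulr_natl mulrA.
Qed.

(* The derivative of [energy] when the flow and its rotation are both taken into
   account: the last term comes from the motion of the direction in the weight. *)
Definition energy_rate : R :=
  weakQ sigma (Om u t) (u t) (tau (r u t)) (nu (r u t) / tau (r u t)) (eta sigma n2 k (Om u t) rho (u t))
  - rho * (k1 * (r u t - rk)) *
    weakQ sigma (Om u t) (u t) (tau (r u t)) (nu (r u t) / tau (r u t)) (xdot (Om u t))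
  - k / 2 * I (fun w => vm sigma n2 k (Om u t) w * (eta sigma n2 k (Om u t) rho (u t) w ^+ 2 *
       dot w (\row_i dOm sigma u du t i))).

Lemma is_derive_energy : is_derive t (1 : R) (energy u) energy_rate.
Proof.
have sx := @smooth_dot R n (Om u t).
have sh : smooth (eta sigma n2 k (Om u t) rho (u t)) by exact: smooth_eta.
have dN := is_derive_N2 hsigma n2 k tau_pos F t0 r0.
have dr := is_derive_r hsigma F t0 r0.
have db := is_deriveB dr (is_derive_cst rk t (1 : R)).
have db2 := is_deriveM db db.
have := is_deriveB (is_derive_scale (2^-1) dN) (is_derive_scale (rho * k1 / 2) db2).
have -> : (fun t => 2^-1 * N2 sigma n2 k rho u t) -
    (fun t => rho * k1 / 2 * ((r u - cst rk) * (r u - cst rk)) t) = energy u.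
  apply/funext => s.
  change (2^-1 * N2 sigma n2 k rho u s - rho * k1 / 2 * ((r u s - rk) * (r u s - rk)) = energy u s).
  by rewrite /energy; field.
move/is_derive_eq; apply.
rewrite (flow_weak hsigma tau_pos F t0 r0 sh).
have -> : I (fun w => dot w (Om u t) * du t w) = weakQ sigma (Om u t) (u t) (tau (r u t))
    (nu (r u t) / tau (r u t)) (xdot (Om u t)) by exact: (flow_weak hsigma tau_pos F t0 r0 sx).
set W := weakQ _ _ _ _ _ (xdot _); set Wh := weakQ _ _ _ _ _ _; set T := I _.
change (2^-1 * (2 * Wh - k * T) - rho * k1 / 2 * ((r u t - rk) * (W - 0) + (r u t - rk) * (W - 0)) =
  energy_rate).
by rewrite /energy_rate -/W -/Wh -/T; field.
Qed.

Lemma energy_ge : theta * N2 sigma n2 k rho u t <= 2 * energy u t.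
Proof.
have := flux_dev_sqr; rewrite NE => h.
have : rho * k1 * (r u t - rk) ^+ 2 <= rho * k1 * (vmvar sigma n2 k * N2 sigma n2 k rho u t).
  by rewrite ler_pM2l// mulr_gt0.
by rewrite /energy /theta; lra.
Qed.

Lemma energy_le : energy u t <= N2 sigma n2 k rho u t / 2.
Proof. by rewrite /energy gerBl divr_ge0// mulr_ge0 ?sqr_ge0// mulr_ge0// ltW. Qed.

End State.

Lemma energy_dissipation : exists C eps : R, [/\ 0 < C, 0 < eps & forall u du, flow u du ->
  forall t, 0 < t -> 0 < r u t -> N u t <= eps ->
  [/\ energy_rate u du t <= - 2 * lam * energy u t + C * N u t ^+ 3, rk / 2 <= r u t & N u t <= 1]].
Proof.
have Lam0 : 0 < Lam by exact: (poincare_constant_gt0 hsigma n2 (ltW k0)).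
pose Cw := k / 2 * (n%:R * driftC).
have Cw0 : 0 <= Cw by apply: mulr_ge0; [rewrite divr_ge0// ltW|rewrite mulr_ge0// ltW].
have [C [eps [C0 eps0 H]]] := energy_arith (tau rk) rho0 k10 Lam0 (ltW CK0) TM0 (ltW L0) Cw0 theta0.
(* The bound rk / 2 keeps |J| at least rk / 2, since | |J| - rk | is at most the weighted norm of
   eta. *)
exists C, (Num.min eps (Num.min 1 (rk / 2))); split => //.
  by rewrite !lt_min eps0 ltr01 divr_gt0.
move=> u du F t t0 r0; rewrite !le_min => /and3P[Neps N1 Nr].
have [su sdu _ _ Iu] := F t t0; have v1 := direction_sphere r0.
have Ju z : I (fun w => dot w z * u t w) = r u t * dot (Om u t) z.
  by apply: flux_direction => //; exact: smooth_scont.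
have NE : N u t ^+ 2 = N2 sigma n2 k rho u t by rewrite sqr_sqrtr//; exact: eta2_ge0.
have N0 : 0 <= N u t by exact: sqrtr_ge0.
have b1 := flux_dev_le F t0 r0.
have rr : rk / 2 <= r u t.
  by have := le_trans b1 Nr; rewrite ler_norml => /andP[]; lra.
split => //.
have [e1 e2 sb01 [hP hP2 hs2 hp hq]] := weakQ_energy hsigma n2 (ltW k0) v1 su Iu Ju
  (tau (r u t)) (nu (r u t) / tau (r u t)) k1.
rewrite /energy_rate /energy e1 e2 (_ : N2 sigma n2 k rho u t / 2 = N u t ^+ 2 / 2); last by rewrite NE.
(* The motion of the weight is cubic: |Omega'| is of order N and it multiplies the squared norm of
   eta. *)
set W := - (k / 2 * _).
apply: H => //.
- by rewrite N0.
- exact: (flux_dev_sqr F t0 r0).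
- by rewrite NE.
- rewrite -(ler_pXn2r (n := 2)) ?nnegrE// NE real_normK ?num_real//.
- by rewrite k_taylor2.
- by rewrite tau_pos ?tau_le ?eucl_ge0.
- by rewrite tau_lip ?eucl_ge0.
- rewrite /W normrN normrM gtr0_norm ?divr_gt0// /Cw -mulrA; rewrite ler_pM2l ?divr_gt0//.
  pose z := \row_i dOm sigma u du t i; pose h := eta sigma n2 k (Om u t) rho (u t).
  have ch : scont h by exact/smooth_scont/smooth_eta.
  have cM : scont (vm sigma n2 k (Om u t)) by exact: scont_vm.
  have ch2 := scontX (k := 2) ch; have cz := @scont_dot R n z.
  have cMh := scontM cM ch2; have cMhz := scontM cM (scontM ch2 cz).
  pose A := n%:R * driftC * N u t.
  have zA w : sphere w -> `|dot w z| <= A by exact: (dot_dOm_le F t0 r0).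
  have M0 w : 0 <= vm sigma n2 k (Om u t) w * h w ^+ 2.
    by rewrite mulr_ge0 ?sqr_ge0// ltW// vm_gt0.
  have -> : n%:R * driftC * N u t ^+ 3 = A * I (fun w => vm sigma n2 k (Om u t) w * h w ^+ 2).
    have -> : I (fun w => vm sigma n2 k (Om u t) w * h w ^+ 2) = N u t ^+ 2 by rewrite NE.
    by rewrite /A; ring.
  rewrite ler_norml; apply/andP; split.
    rewrite lerNl -sintN// -sintZ//; apply: ler_sint; [exact: scontN|exact: scontZ|].
    move=> w w1; rewrite mulrA -mulrN mulrC ler_wpM2r//.
    by rewrite (le_trans (ler_norm _))// normrN zA.
  rewrite -sintZ//; apply: ler_sint => //; first exact: scontZ.
  by move=> w w1; rewrite mulrA mulrC ler_wpM2r// (le_trans (ler_norm _))// zA.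
- by rewrite NE.
Qed.

Lemma flow_decay : exists e0 K : R, [/\ 0 < e0, 0 < K & forall u du, flow u du ->
  forall t1, 0 < t1 -> 0 < r u t1 -> N2 sigma n2 k rho u t1 < e0 ->
  forall t, t1 <= t -> [/\ 0 < r u t, N u t <= 1, rk / 2 <= r u t,
    N u t <= K * N u t1 * expR (- lam * (t - t1)) &
    forall s i, t <= s -> `|Om u s 0 i - Om u t 0 i| <= K * N u t1 * expR (- lam * (t - t1))]].
Proof.
have Lam0 : 0 < Lam by exact: (poincare_constant_gt0 hsigma n2 (ltW k0)).
have lam0 : 0 < lam by rewrite !mulr_gt0// tau_pos// ltW.
have [C [eps [C0 eps0 H]]] := energy_dissipation.
pose a := 2 / theta; have a0 : 0 < a by rewrite divr_gt0.
have [e0 [K [e00 K0 D]]] := ode_decay lam0 C0 a0 eps0.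
(* The second term is the total displacement of Omega, obtained by integrating its exponentially
   small speed. *)
pose K' := K + driftC * K / lam.
have K'0 : 0 < K' by rewrite addr_gt0// divr_gt0// mulr_gt0.
exists e0, K'; split => // u du F t1 t10 r1 N1 t tt.
have rk20 : 0 < rk / 2 by rewrite divr_gt0.
have pos s : t1 <= s -> 0 < s by exact: lt_le_trans.
have main : forall t, t1 <= t -> [/\ 0 < r u t, N u t <= eps &
    N u t <= K * Num.sqrt (energy u t1) * expR (- lam * (t - t1))].
  apply: (D (energy u) (fun t => N u t) (r u) (energy_rate u du) (rk / 2) t1 rk20).
  - by move=> s s1; exact: (r_continuous hsigma F (pos s s1)).
  - move=> s s1 rs; split; first exact: (is_derive_energy F (pos s s1) rs).
      exact: sqrtr_ge0.
    rewrite sqr_sqrtr ?(eta2_ge0 hsigma)// /a mulrAC ler_pdivlMr// mulrC.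
    exact: (energy_ge F (pos s s1) rs).
  - by move=> s s1 rs Ns; have [] := H u du F s (pos s s1) rs Ns.
  - exact: r1.
  - apply: le_lt_trans N1; apply: le_trans (energy_le u t1) _.
    by rewrite ler_pdivrMr// ler_peMr ?(eta2_ge0 hsigma)// ler1n.
have eN : Num.sqrt (energy u t1) <= N u t1.
  rewrite ler_sqrt ?(eta2_ge0 hsigma)//; apply: le_trans (energy_le u t1) _.
  by rewrite ler_pdivrMr// ler_peMr ?(eta2_ge0 hsigma)// ler1n.
have dec s : t1 <= s -> [/\ 0 < r u s, N u s <= 1, rk / 2 <= r u s &
    N u s <= K * N u t1 * expR (- lam * (s - t1))].
  move=> s1; have [rs Ns Nd] := main s s1.
  have [_ rr N1'] := H u du F s (pos s s1) rs Ns; split => //.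
  by apply: (le_trans Nd); rewrite ler_wpM2r ?expR_ge0// ler_pM2l.
have [rt Nt rrt Nd] := dec t tt; split => //.
  apply: (le_trans Nd); rewrite ler_wpM2r ?expR_ge0// ler_wpM2r ?sqrtr_ge0//.
  by rewrite /K' lerDl divr_ge0 ?(mulr_ge0 (ltW driftC0) (ltW K0))// ltW.
move=> s i ts.
apply: (@le_trans _ _ (driftC * (K * N u t1 * expR (- lam * (t - t1))) / lam)).
  apply: (@drift _ (fun t => Om u t 0 i) (fun t => dOm sigma u du t i)) => //.
  - by rewrite mulr_ge0 ?(ltW driftC0)// mulr_ge0 ?expR_ge0// mulr_ge0 ?sqrtr_ge0// ltW.
  - move=> z /andP[tz _]; have z1 := le_trans tt tz; have [rz _ _ _] := dec z z1.
    exact: (is_derive_Om hsigma F i (pos z z1) rz).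
  - move=> z /andP[tz _]; have z1 := le_trans tt tz; have [rz Nz rrz Ndz] := dec z z1.
    apply: (le_trans (dOm_le F (pos z z1) rz i Nz rrz)).
    rewrite -mulrA ler_pM2l//; apply: (le_trans Ndz); rewrite -[leRHS]mulrA -expRD.
    by rewrite (_ : - lam * (t - t1) + - lam * (z - t) = - lam * (z - t1)) //; ring.
rewrite (_ : _ / lam = driftC * K / lam * N u t1 * expR (- lam * (t - t1))); last by ring.
rewrite ler_wpM2r ?expR_ge0// ler_wpM2r ?sqrtr_ge0//.
by rewrite /K' lerDr ltW.
Qed.

End Decay.

(** * Comparison of the weighted norm, the L^2 distance and the direction *)

Section Comparison.
Context {R : realType} {n : nat}.
Variable sigma : probability (borelRn R n) R.
Hypothesis hsigma : uniform_on_sphere sigma.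
Hypothesis n2 : (2 <= n)%N.
Local Notation V := 'rV[R]_n.
Local Notation I := (sint sigma).
Variables (k rho : R).
Hypotheses (k0 : 0 < k) (rho0 : 0 < rho).
Local Notation c := (order_param n k).
Local Notation rk := (rho * c).
Local Notation M := (vm sigma n2 k).
Local Notation Z := (vmZ sigma n2 k).
Implicit Types (u f g : V -> R) (v w x z : V).

Let c0 : 0 < c. Proof. exact: (order_param_gt0 hsigma n2 (ltW k0) k0). Qed.
Let rk0 : 0 < rk. Proof. exact: mulr_gt0. Qed.
Let Z0 : 0 < Z. Proof. exact: vmZ_gt0. Qed.
Let cM v : scont (M v). Proof. exact: scont_vm. Qed.

Lemma eucl_le_dot x (D : R) : 0 <= D -> (forall z, sphere z -> dot x z <= D) -> eucl x <= D.
Proof.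
move=> D0 H; have [->|x0] := eqVneq x 0; first by rewrite /eucl dot0l sqrtr0.
have := H _ (sphere_normalize x0); rewrite dotZr -sqr_eucl expr2 mulKf//.
by rewrite eucl_eq0.
Qed.

Lemma eucl_le_coord x (D : R) : 0 <= D -> (forall i, `|x 0 i| <= D) -> eucl x <= n%:R * D.
Proof.
move=> D0 H; apply: eucl_le_dot; first exact: mulr_ge0.
move=> z z1; rewrite dotE; apply: (le_trans (ler_norm _)); apply: (le_trans (ler_norm_sum _ _ _)).
apply: (@le_trans _ _ (\sum_(i < n) D)); last by rewrite sumr_const card_ord -[leLHS]mulr_natl.
apply: ler_sum => i _; rewrite normrM -[leRHS]mulr1; apply: ler_pM => //.
by apply: le_trans (ler_coord_eucl _ _) _; rewrite z1.
Qed.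

Definition Mlip : R := expR k * k / Z.

Lemma Mlip_ge0 : 0 <= Mlip.
Proof. by rewrite divr_ge0 ?mulr_ge0 ?expR_ge0// ltW. Qed.

Lemma l2_vm_diff v v' : sphere v -> sphere v' ->
  l2 sigma (fun w => M v w - M v' w) <= Mlip * eucl (v - v').
Proof.
move=> v1 v1'; apply: l2_sup => //; first by rewrite mulr_ge0 ?Mlip_ge0 ?eucl_ge0.
  exact: scontB.
by move=> w w1; exact: (vm_lip hsigma n2 (ltW k0) v1 v1' w1).
Qed.

Lemma l2_vm_change u v v' : scont u -> sphere v -> sphere v' ->
  l2 sigma (fun w => u w - rho * M v' w) <=
  l2 sigma (fun w => u w - rho * M v w) + rho * (Mlip * eucl (v - v')).
Proof.
move=> cu v1 v1'.
rewrite (@eq_l2 _ _ _ _ (fun w => (u w - rho * M v w) + rho * (M v w - M v' w))); last first.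
  by move=> w _; ring.
have cd : scont (fun w => M v w - M v' w) by exact: scontB.
apply: (le_trans (l2D _ _ _)).
- by apply: scontB => //; exact: scontZ.
- exact: scontZ.
by rewrite lerD2l l2Z// gtr0_norm// ler_pM2l// l2_vm_diff.
Qed.

(** Since [u - rho M = M eta], the two norms differ by a factor M in the integrand. The two summands
    come from the lower and the upper bound of M, so that one constant serves in both directions. *)
Definition l2C : R := Num.sqrt (expR k * Z + expR k / Z).

Lemma l2C_ge0 : 0 <= l2C. Proof. exact: sqrtr_ge0. Qed.

Let sqr_l2C : l2C ^+ 2 = expR k * Z + expR k / Z.
Proof. by rewrite sqr_sqrtr// addr_ge0 ?divr_ge0 ?mulr_ge0 ?expR_ge0// ltW. Qed.

Lemma eta2_le_l2 u v : scont u -> sphere v -> scont (eta sigma n2 k v rho u) ->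
  Num.sqrt (eta2 sigma n2 k v rho u) <= l2C * l2 sigma (fun w => u w - rho * M v w).
Proof.
move=> cu v1 ch; rewrite -(ler_pXn2r (n := 2)) ?nnegrE ?mulr_ge0 ?sqrtr_ge0//.
rewrite sqr_sqrtr ?eta2_ge0// exprMn sqr_l2 sqr_l2C -sintZ; last first.
  by apply: (scontX (k := 2)); apply: scontB => //; exact: scontZ.
apply: ler_sint.
- by apply: scontM => //; exact: (scontX (k := 2)).
- by apply: scontZ; apply: (scontX (k := 2)); apply: scontB => //; exact: scontZ.
move=> w w1; rewrite -(vm_eta hsigma) exprMn.
have M0 := vm_gt0 hsigma n2 k v w; have Mge := vm_ge hsigma n2 (ltW k0) v1 w1.
set h := eta _ _ _ _ _ _ _; rewrite [leRHS]mulrA ler_wpM2r ?sqr_ge0// expr2 [leRHS]mulrA ler_peMl ?(ltW M0)//.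
apply: (@le_trans _ _ (expR k * Z * (expR (- k) / Z))).
  by rewrite expRN; rewrite le_eqVlt; apply/orP; left; apply/eqP; field; rewrite !gt_eqF ?expR_gt0.
apply: ler_pM => //.
- by rewrite mulr_ge0 ?expR_ge0// ltW.
- by rewrite divr_ge0 ?expR_ge0// ltW.
- by rewrite lerDl divr_ge0 ?expR_ge0// ltW.
Qed.

Lemma l2_le_eta2 u v : scont u -> sphere v -> scont (eta sigma n2 k v rho u) ->
  l2 sigma (fun w => u w - rho * M v w) <= l2C * Num.sqrt (eta2 sigma n2 k v rho u).
Proof.
move=> cu v1 ch; rewrite -(ler_pXn2r (n := 2)) ?nnegrE ?mulr_ge0 ?sqrtr_ge0 ?l2_ge0//.
have ch2 : scont (fun w => M v w * eta sigma n2 k v rho u w ^+ 2).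
  by apply: scontM => //; exact: (scontX (k := 2)).
rewrite exprMn (sqr_sqrtr (eta2_ge0 _ _ _ _ _ _))// sqr_l2 sqr_l2C -sintZ//.
apply: ler_sint.
- by apply: (scontX (k := 2)); apply: scontB => //; exact: scontZ.
- exact: scontZ.
move=> w w1; rewrite -(vm_eta hsigma) exprMn.
have M0 := vm_gt0 hsigma n2 k v w; have Mle := vm_le hsigma n2 (ltW k0) v1 w1.
set h := eta _ _ _ _ _ _ _; rewrite mulrA ler_wpM2r ?sqr_ge0// expr2 ler_wpM2r ?(ltW M0)//.
by apply: (le_trans Mle); rewrite lerDr mulr_ge0 ?expR_ge0// ltW.
Qed.

(** The flux of [rho M v] is [rk v], and a unit coordinate function has L^2 norm at most 1. *)
Lemma flux_near u v (D : R) : scont u -> sphere v ->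
  l2 sigma (fun w => u w - rho * M v w) <= D -> eucl (flux sigma u - rk *: v) <= D.
Proof.
move=> cu v1 uD; have D0 : 0 <= D := le_trans (l2_ge0 _ _) uD.
apply: eucl_le_dot => // z z1; have cz := @scont_dot R n z.
have cd : scont (fun w => u w - rho * M v w) by apply: scontB => //; exact: scontZ.
have -> : dot (flux sigma u - rk *: v) z = I (fun w => dot w z * (u w - rho * M v w)).
  rewrite dotBl dotZl flux_dot// -mulrA -(vm_mean_dot hsigma)// -sintZ; last exact: scontM.
  rewrite -sintB; [|exact: scontM|by apply: scontZ; exact: scontM].
  by apply: eq_sint => w _; ring.
apply: (le_trans (ler_norm _)); apply: (le_trans (l2_CS sigma cz cd)).
rewrite -[leRHS]mul1r; apply: ler_pM; rewrite ?l2_ge0//.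
apply: l2_sup => // w w1; rewrite ler_norml; exact: dot_sphere_le1.
Qed.

Lemma flux_norm_near u v (D : R) : scont u -> sphere v ->
  l2 sigma (fun w => u w - rho * M v w) <= D -> `|eucl (flux sigma u) - rk| <= D.
Proof.
move=> cu v1 uD; have h := flux_near cu v1 uD.
have e : eucl (rk *: v) = rk by rewrite euclZ v1 mulr1 gtr0_norm.
rewrite ler_norml; apply/andP; split.
  have := ler_euclD (rk *: v - flux sigma u) (flux sigma u).
  by rewrite subrK e -opprB euclN; lra.
by have := ler_euclD (flux sigma u - rk *: v) (rk *: v); rewrite subrK e; lra.
Qed.

Lemma direction_near u v (D : R) : scont u -> sphere v ->
  l2 sigma (fun w => u w - rho * M v w) <= D -> D <= rk / 2 ->
  0 < eucl (flux sigma u) /\ eucl (direction sigma u - v) <= 4 / rk * D.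
Proof.
move=> cu v1 uD Drk; have h1 := flux_near cu v1 uD; have h2 := flux_norm_near cu v1 uD.
have rr : rk / 2 <= eucl (flux sigma u) by move: h2; rewrite ler_norml => /andP[]; lra.
have r0 : 0 < eucl (flux sigma u) by apply: lt_le_trans rr; rewrite divr_gt0.
split => //; set r := eucl (flux sigma u) in h2 rr r0 *.
(* The error has two parts of size at most D, divided by a flux at least rk / 2. *)
have -> : direction sigma u - v = r^-1 *: ((flux sigma u - rk *: v) + (rk - r) *: v).
  by rewrite scalerBl addrA subrK scalerBr scalerA mulVf ?gt_eqF// scale1r.
rewrite euclZ gtr0_norm ?invr_gt0// ler_pdivrMl//.
apply: (le_trans (ler_euclD _ _)); rewrite euclZ v1 mulr1 distrC.
apply: (@le_trans _ _ (D + D)); first exact: lerD.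
have D0 : 0 <= D := le_trans (l2_ge0 _ _) uD.
have : rk / 2 * (4 / rk * D) <= r * (4 / rk * D) by rewrite ler_wpM2r// mulr_ge0// divr_ge0// ltW.
by apply: le_trans; rewrite le_eqVlt; apply/orP; left; apply/eqP; field; rewrite !gt_eqF.
Qed.

End Comparison.

(** * Decay counted from time 0, and the limit direction *)

Section Asymptotics.
Context {R : realType} {n : nat}.
Variable sigma : probability (borelRn R n) R.
Hypothesis hsigma : uniform_on_sphere sigma.
Hypothesis n2 : (2 <= n)%N.
Local Notation V := 'rV[R]_n.
Local Notation I := (sint sigma).
Variables (nu tau : R -> R) (k rho k1 CK TM L : R).
Hypotheses (k0 : 0 < k) (rho0 : 0 < rho) (k10 : 0 < k1) (CK0 : 0 < CK) (TM0 : 0 < TM) (L0 : 0 < L).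
Local Notation c := (order_param n k).
Local Notation rk := (rho * c).
Hypothesis tau_pos : forall r, 0 <= r -> 0 < tau r.
Hypothesis tau_le : forall r, 0 <= r -> tau r <= TM.
Hypothesis tau_lip : forall r, 0 <= r -> `|tau r - tau rk| <= L * `|r - rk|.
Hypothesis k_taylor2 : forall r, 0 < r -> `|nu r / tau r - k - k1 * (r - rk)| <= CK * (r - rk) ^+ 2.
Let theta := 1 - rho * k1 * vmvar sigma n2 k.
Hypothesis theta0 : 0 < theta.
Local Notation Lam := (poincare_constant sigma k).
Let lam := tau rk * Lam * theta.

Local Notation r := (fun u t => eucl (flux sigma (u t))).
Local Notation Om := (fun u t => direction sigma (u t)).
Local Notation N u t := (Num.sqrt (N2 sigma n2 k rho u t)).
Local Notation flow := (flow sigma nu tau rho).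
Implicit Types (u du : R -> V -> R) (t : R).

Let c0 : 0 < c. Proof. exact: (order_param_gt0 hsigma n2 (ltW k0) k0). Qed.
Let rk0 : 0 < rk. Proof. exact: mulr_gt0. Qed.

Let lam0 : 0 < lam.
Proof. by rewrite !mulr_gt0// ?tau_pos ?(ltW rk0)// (poincare_constant_gt0 hsigma n2 (ltW k0)). Qed.
Local Notation M := (vm sigma n2 k).

(* A solution is only an element of H^s at time 0, so that L^2 closeness is
   required along positive times tending to 0. *)
Definition starts_near u (v : V) (D : R) := forall d : R, 0 < d -> exists2 t1, 0 < t1 < d &
  l2 sigma (fun w => u t1 w - rho * M v w) <= D.

Definition limit_direction u (x : V) := forall e : R, 0 < e -> exists s0 : R,
  forall s, s0 <= s -> forall i, `|x 0 i - Om u s 0 i| <= e.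

Lemma exp_small (A e s0 : R) : 0 <= A -> 0 < e -> exists2 s, s0 <= s & A * expR (- lam * s) <= e.
Proof.
move=> A0 e0; exists (Num.max s0 (A / (e * lam))); first by rewrite le_max lexx.
set s := Num.max _ _; have hs : A / (e * lam) <= s by rewrite le_max lexx orbT.
rewrite mulNr expRN ler_pdivrMr ?expR_gt0//.
have h := expR_ge1Dx (lam * s).
move: hs; rewrite ler_pdivrMr; last exact: mulr_gt0.
move=> h2; apply: (le_trans h2).
by rewrite mulrCA [s * _]mulrC ler_pM2l//; lra.
Qed.

Lemma flow_l2_decay : exists D0 K : R, [/\ 0 < D0, 0 < K & forall u du, flow u du ->
  forall v, sphere v -> forall D, D <= D0 -> starts_near u v D -> forall t, 0 < t ->
  [/\ 0 < r u t, N u t <= 1, N u t <= K * D * expR (- lam * t),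
    forall s i, t <= s -> `|Om u s 0 i - Om u t 0 i| <= K * D * expR (- lam * t) &
    forall i e, 0 < e -> exists2 s, 0 < s < e & `|Om u s 0 i - v 0 i| <= K * D]].
Proof.
have [e0 [K [e00 K0 H]]] := flow_decay hsigma (n2 := n2) k0 rho0 k10 CK0 TM0 L0 tau_pos tau_le tau_lip k_taylor2 theta0.
(* Converts the L^2 distance to [M v] into the weighted norm centred at the direction of the density
   itself, which is within [4 / rk * D] of [v]. *)
pose B : R := l2C sigma n2 k * (1 + rho * (Mlip sigma n2 k * (4 / rk))).
have B0 : 0 <= B.
  apply: mulr_ge0; first exact: l2C_ge0.
  have := Mlip_ge0 hsigma n2 k0.
  by move=> ?; rewrite addr_ge0// mulr_ge0 ?(ltW rho0)// mulr_ge0// divr_ge0// ltW.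
pose K' : R := K * (B + 1) * expR 1 + 4 / rk.
have K'0 : 0 < K' by rewrite addr_gt0 ?divr_gt0// !mulr_gt0 ?expR_gt0// ltr_wpDl.
pose D0 : R := Num.min (rk / 2) (Num.sqrt e0 / (B + 1) / 2).
have se0 : 0 < Num.sqrt e0 by rewrite sqrtr_gt0.
have B1 : 0 < B + 1 by rewrite ltr_wpDl.
exists D0, K'; split => //.
  by rewrite lt_min; apply/andP; split; rewrite !divr_gt0.
move=> u du F v v1 D; rewrite le_min => /andP[D1 D2] S t t0.
have start t1 : 0 < t1 -> l2 sigma (fun w => u t1 w - rho * M v w) <= D ->
   [/\ 0 < r u t1, N2 sigma n2 k rho u t1 < e0, N u t1 <= B * D & eucl (Om u t1 - v) <= 4 / rk * D].
  move=> t10 uD; have [su _ _ _ _] := F t1 t10; have cu := smooth_scont su.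
  have [r1 h] := direction_near hsigma k0 rho0 cu v1 uD D1.
  have Om1 := direction_sphere r1.
  have ch : scont (eta sigma n2 k (Om u t1) rho (u t1)) by exact/smooth_scont/smooth_eta.
  have Dp : 0 <= D := le_trans (l2_ge0 _ _) uD.
  have NB : N u t1 <= B * D.
    apply: (le_trans (eta2_le_l2 hsigma k0 cu Om1 ch)); rewrite /B -mulrA ler_wpM2l ?l2C_ge0//.
    apply: (le_trans (l2_vm_change hsigma n2 k0 rho0 cu v1 Om1)).
    rewrite mulrDl mul1r lerD// -mulrA ler_pM2l// -mulrA ler_wpM2l ?(Mlip_ge0 hsigma)//.
    by rewrite -euclN opprB.
  split => //.
  have : N u t1 < Num.sqrt e0.
    apply: (le_lt_trans NB); apply: (@le_lt_trans _ _ ((B + 1) * (Num.sqrt e0 / (B + 1) / 2))).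
      by apply: ler_pM => //; rewrite lerDl.
    by rewrite mulrA mulrCA divff ?gt_eqF// mulr1 ltr_pdivrMr// ltr_pMr// ltr1n.
  by rewrite ltr_sqrt.
(* A starting time below 1 / lam costs at most the factor [expR 1] present in [K'] when the decay is
   counted from 0. *)
have small : 0 < Num.min t lam^-1 by rewrite lt_min t0 invr_gt0.
have [t1 /andP[t10]] := S _ small; rewrite lt_min => /andP[t1t t1l] uD.
have Dp : 0 <= D := le_trans (l2_ge0 _ _) uD.
have [r1 N2e NB OmD] := start t1 t10 uD.
have [rt Nt _ Nd Od] := H u du F t1 t10 r1 N2e t (ltW t1t).
have bnd : K * N u t1 * expR (- lam * (t - t1)) <= K' * D * expR (- lam * t).
  have -> : - lam * (t - t1) = lam * t1 + - lam * t by ring.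
  rewrite expRD mulrA ler_wpM2r ?expR_ge0//.
  have h1 : expR (lam * t1) <= expR 1 by rewrite ler_expR mulrC -ler_pdivlMr// mul1r ltW.
  apply: (@le_trans _ _ (K * (B * D) * expR 1)).
    by apply: ler_pM; rewrite ?expR_ge0// ?mulr_ge0 ?sqrtr_ge0 ?(ltW K0)// ler_pM2l.
  rewrite /K' mulrDl ler_wpDr//; first by apply: mulr_ge0 => //; apply: divr_ge0 => //; exact: ltW.
  have -> : K * (B + 1) * expR 1 * D = K * ((B + 1) * D) * expR 1 by ring.
  rewrite ler_wpM2r ?expR_ge0// ler_pM2l// ler_wpM2r//.
  by rewrite lerDl.
split => //.
- exact: (le_trans Nd).
- by move=> s i ts; exact: (le_trans (Od s i ts)).
- move=> i e e0'; have [t2 /andP[t20 t2e] uD2] := S e e0'.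
  have [_ _ _ h] := start t2 t20 uD2; exists t2; first by rewrite t20.
  have := ler_coord_eucl (Om u t2 - v) i; rewrite [(direction sigma (u t2) - v) 0 i]mxE [(- v) 0 i]mxE => h2.
  apply: (le_trans h2); apply: (le_trans h).
  by rewrite ler_wpM2r// /K' lerDr !mulr_ge0 ?expR_ge0 ?(ltW K0)// ltW.
Qed.

Lemma limit_direction_sphere u du x : flow u du -> (forall t, 0 < t -> 0 < r u t) ->
  limit_direction u x -> sphere x.
Proof.
move=> F rp lx; suff : `|eucl x - 1| <= 0 by rewrite normr_le0 subr_eq0 => /eqP.
apply/ler_addgt0Pr => e e0; rewrite add0r.
have en : 0 < e / (n%:R + 1) by rewrite divr_gt0// ltr_wpDl.
have [s0 hs] := lx _ en; pose s := Num.max s0 1.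
have s1 : 0 < s by rewrite lt_max ltr01 orbT.
have ss : s0 <= s by rewrite le_max lexx.
have Om1 : eucl (Om u s) = 1 := direction_sphere (rp s s1).
have h : eucl (x - Om u s) <= e.
  apply: (@le_trans _ _ (n%:R * (e / (n%:R + 1)))).
    apply: eucl_le_coord; first exact: ltW.
    by move=> i; have := hs s ss i; rewrite [(x - _) 0 i]mxE [(- _ : V) 0 i]mxE.
  by rewrite mulrA ler_pdivrMr ?ltr_wpDl// mulrC ler_pM2l// lerDl.
rewrite -Om1 ler_norml; apply/andP; split.
  have := ler_euclD (Om u s - x) x; rewrite subrK -opprB euclN; lra.
by have := ler_euclD (x - Om u s) (Om u s); rewrite subrK; lra.
Qed.

(** Nested intervals: each coordinate of the limit is the infimum of the upper ends
    [Om u t 0 i + A expR (- lam * t)]. *)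
Lemma limit_direction_ex u (A : R) : 0 <= A ->
  (forall t, 0 < t -> forall s i, t <= s -> `|Om u s 0 i - Om u t 0 i| <= A * expR (- lam * t)) ->
  exists x, limit_direction u x.
Proof.
move=> A0 H.
pose B i t : R := Om u t 0 i + A * expR (- lam * t).
pose S i := [set y : R | exists2 t, 0 < t & y = B i t].
have low i t y : 0 < t -> S i y -> Om u t 0 i - A * expR (- lam * t) <= y.
  move=> t0 [s s0 ->]; rewrite /B; have [ts|st] := leP t s.
    have := H t t0 s i ts; rewrite ler_norml => /andP[h _].
    have : 0 <= A * expR (- lam * s) by rewrite mulr_ge0 ?expR_ge0.
    lra.
  have := H s s0 t i (ltW st); rewrite ler_norml => /andP[_ h].
  have : 0 <= A * expR (- lam * t) by rewrite mulr_ge0 ?expR_ge0.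
  lra.
exists (\row_i inf (S i)) => e e0.
have [s0 s01 hs] := exp_small 1 A0 e0.
exists s0 => s ss i; rewrite mxE.
have sp : 0 < s by apply: lt_le_trans ss; apply: lt_le_trans s01.
have ne : S i !=set0 by exists (B i s); exists s.
have h1 : inf (S i) <= B i s.
  apply: ge_inf; last by exists s.
  by exists (Om u s 0 i - A * expR (- lam * s)) => y Sy; exact: low.
have h2 : Om u s 0 i - A * expR (- lam * s) <= inf (S i).
  by apply: lb_le_inf => // y Sy; exact: low.
have h3 : A * expR (- lam * s) <= e.
  apply: le_trans hs; rewrite ler_wpM2l// ler_expR !mulNr lerN2 ler_pM2l//.
rewrite ler_norml; apply/andP; split; move: h1; rewrite /B; lra.
Qed.

Lemma limit_direction_dist u x (A : R) t i : limit_direction u x -> 0 <= A ->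
  (forall s i, t <= s -> `|Om u s 0 i - Om u t 0 i| <= A) -> `|x 0 i - Om u t 0 i| <= A.
Proof.
move=> lx A0 H; apply/ler_addgt0Pr => e e0.
have [s0 hs] := lx e e0; pose s := Num.max s0 t.
have h1 := hs s ltac:(by rewrite le_max lexx) i.
have h2 := H s i ltac:(by rewrite le_max lexx orbT).
rewrite -[_ - _](subrKA (Om u s 0 i)) addrC; apply: (le_trans (ler_normD _ _)); rewrite lerD//.
Qed.

End Asymptotics.

(** * Decay of the spectral coefficients *)

(** The barrier [P expR (- lam z)] is a supersolution: its distance [q] to [y] satisfies
    [q' >= - tau m q]. Half of the damping [t0 m] pays for the decay of the barrier and half for the
    source. Multiplying by an exponential of rate [T m] keeps [q] strictly positive. *)
Lemma relaxation {R : realType} (y dy tau : R -> R) (m G lam t0 T P t1 : R) :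
  0 < m -> 0 <= G -> 0 <= P -> 2 * lam <= t0 * m -> 2 * G <= m * P -> 0 <= t0 ->
  (forall z : R, t1 <= z -> is_derive z (1 : R) y (dy z)) ->
  (forall z, t1 <= z -> t0 <= tau z <= T) ->
  (forall z, t1 <= z -> dy z <= - (tau z * m) * y z + tau z * G * expR (- lam * z)) ->
  y t1 < P * expR (- lam * t1) -> forall t, t1 <= t -> y t < P * expR (- lam * t).
Proof.
move=> m0 G0 P0 lm GP t00 hy ht hd y1.
pose e z := expR (- lam * (z - 0)); have eE z : e z = expR (- lam * z) by rewrite /e subr0.
pose q z := P * e z - y z; pose dq z := P * (- lam * e z) - dy z.
have hq (z : R) : t1 <= z -> is_derive z (1 : R) q (dq z).
  by move=> tz; apply: is_deriveB; [apply: is_derive_scale; exact: is_derive_expZ|exact: hy].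
have dq_ge z : t1 <= z -> - (tau z * m) * q z <= dq z.
  move=> tz; have h := hd z tz; have /andP[ta tb] := ht z tz; rewrite -eE in h.
  have e0 : 0 <= e z by exact: expR_ge0.
  have h1 : 0 <= e z * ((tau z - t0) * m * P + (t0 * m - 2 * lam) * P + tau z * (m * P - 2 * G)).
    have tz0 := le_trans t00 ta.
    apply: mulr_ge0 => //; apply: addr_ge0; first apply: addr_ge0.
    - by apply: mulr_ge0 => //; apply: mulr_ge0; [rewrite subr_ge0|exact: ltW].
    - by apply: mulr_ge0 => //; rewrite subr_ge0.
    - by apply: mulr_ge0 => //; rewrite subr_ge0.
  move: h1 h; rewrite /q /dq; move: (e z) (tau z) (y z) (dy z) => a b c d; lra.
have qE z : (0 < q z) = (y z < P * expR (- lam * z)) by rewrite /q eE subr_gt0.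
move=> t tt; rewrite -qE; move: t tt; clearbody q dq.
apply: (@continuous_induction _ (fun t => 0 < q t)).
- by rewrite qE.
- move=> s s1 qs; have cq : {for s, continuous q}.
    by apply: differentiable_continuous; apply/derivable1_diffP; case: (hq s s1).
  exact: (cvgr_gt _ cq).
- move=> s s1 H; have s1' := ltW s1.
  have cq : {for s, continuous q}.
    by apply: differentiable_continuous; apply/derivable1_diffP; case: (hq s s1').
  have qs0 : 0 <= q s.
    have cl : q z @[z --> s^'-] --> q s by apply: cvg_at_left_filter.
    apply: (cvgr_to_ge cl); near=> z; apply/ltW/H.
    by apply/andP; split; near: z; [exact: nbhs_left_ge|exact: nbhs_left_lt].
  have q0 z : t1 <= z <= s -> 0 <= q z.
    by move=> /andP[z1]; rewrite le_eqVlt => /predU1P[->//|zs]; rewrite ltW// H// z1.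
  pose a := T * m; have : - (q s * expR (a * (s - t1))) <= - (q t1 * expR (a * (t1 - t1))).
    apply: (@derive_le0_nincr R (fun z => - (q z * expR (a * (z - t1))))
      (fun z => - (q z * (a * expR (a * (z - t1))) + expR (a * (z - t1)) * dq z)) t1 s s1') => //.
      move=> z /andP[z1 _]; apply: is_deriveN.
      exact: (is_deriveM (hq z z1) (is_derive_expZ a t1 z)).
    move=> z /[dup] zi /andP[z1 _]; have qz := q0 z zi; have h := dq_ge z z1.
    have /andP[_ tb] := ht z z1; rewrite oppr_le0.
    have -> : q z * (a * expR (a * (z - t1))) + expR (a * (z - t1)) * dq z =
      expR (a * (z - t1)) * (a * q z + dq z) by ring.
    apply: mulr_ge0; first exact: expR_ge0.
    have : 0 <= (T - tau z) * m * q z by rewrite !mulr_ge0// ?subr_ge0// ltW.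
    by move: h; rewrite /a; move: (q z) (dq z) (tau z) => x1 x2 x3; lra.
  rewrite subrr mulr0 expR0 mulr1 lerN2 => h.
  have : 0 < q s * expR (a * (s - t1)) by apply: lt_le_trans h; rewrite qE.
  by rewrite pmulr_lgt0// expR_gt0.
Unshelve. all: by end_near. Qed.

(** * Evolution of the coefficients in each degree *)

Section Spectral.
Context {R : realType} {n : nat}.
Variable sigma : probability (borelRn R n) R.
Hypothesis hsigma : uniform_on_sphere sigma.
Hypothesis n2 : (2 <= n)%N.
Local Notation V := 'rV[R]_n.
Local Notation I := (sint sigma).
Variables (nu tau : R -> R) (k rho k1 CK TM L : R).
Hypotheses (k0 : 0 < k) (rho0 : 0 < rho) (k10 : 0 < k1) (CK0 : 0 < CK) (TM0 : 0 < TM) (L0 : 0 < L).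
Local Notation c := (order_param n k).
Local Notation rk := (rho * c).
Hypothesis tau_pos : forall r, 0 <= r -> 0 < tau r.
Hypothesis tau_le : forall r, 0 <= r -> tau r <= TM.
Hypothesis tau_lip : forall r, 0 <= r -> `|tau r - tau rk| <= L * `|r - rk|.
Hypothesis k_taylor2 : forall r, 0 < r -> `|nu r / tau r - k - k1 * (r - rk)| <= CK * (r - rk) ^+ 2.
Let theta := 1 - rho * k1 * vmvar sigma n2 k.
Hypothesis theta0 : 0 < theta.
Local Notation Lam := (poincare_constant sigma k).
Let lam := tau rk * Lam * theta.

Local Notation r := (fun u t => eucl (flux sigma (u t))).
Local Notation Om := (fun u t => direction sigma (u t)).
Local Notation N u t := (Num.sqrt (N2 sigma n2 k rho u t)).
Local Notation flow := (flow sigma nu tau rho).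
Implicit Types (u du : R -> V -> R) (t : R).

Let c0 : 0 < c. Proof. exact: (order_param_gt0 hsigma n2 (ltW k0) k0). Qed.
Let rk0 : 0 < rk. Proof. exact: mulr_gt0. Qed.

Let lam0 : 0 < lam.
Proof. by rewrite !mulr_gt0// ?tau_pos ?(ltW rk0)// (poincare_constant_gt0 hsigma n2 (ltW k0)). Qed.
Local Notation M := (vm sigma n2 k).
Local Notation md := (@deg_eig R n).
Local Notation kr u t := (nu (r u t) / tau (r u t)).
Let sM v : smooth (M v). Proof. exact: smooth_vm. Qed.
Let cM v : scont (M v). Proof. exact: scont_vm. Qed.

Definition dev u (x : V) t : V -> R := fun w => u t w - rho * M x w.

Lemma dev_scont u du x t : flow u du -> 0 < t -> scont (dev u x t).
Proof. by move=> F t0; apply: scontB; [exact: (flow_scont F)|exact: scontZ]. Qed.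

Lemma pairing_dev u du x t Y : flow u du -> 0 < t -> scont Y ->
  pairing sigma (dev u x t) Y = I (fun w => Y w * u t w) - rho * I (fun w => M x w * Y w).
Proof.
move=> F t0 cY; have cu := flow_scont F t0; have cMY : scont (fun w => M x w * Y w) by exact: scontM.
rewrite -sintZ// -sintB; [|exact: scontM|exact: scontZ].
by apply: eq_sint => w _; rewrite /dev; ring.
Qed.

(** The stationarity of [M x] is subtracted from the weak equation, so the only source is the
    mismatch between [kr Omega] and [k x]. *)
Lemma is_derive_dev u du x t l Y : flow u du -> 0 < t -> 0 < r u t -> harm l Y ->
  is_derive t (1 : R) (fun t => I (fun w => Y w * u t w) - rho * I (fun w => M x w * Y w))
    (tau (r u t) * (- md l * pairing sigma (dev u x t) Y +
       kr u t * pairing sigma (dev u x t) (fun w => \sum_i Om u t 0 i * sd i Y w) +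
       rho * pairing sigma (M x) (fun w => \sum_i (kr u t *: Om u t - k *: x) 0 i * sd i Y w))).
Proof.
move=> F t0 r0 hY; have sY := harm_smooth hY; have cY := smooth_scont sY.
have su : smooth (u t) by case: (F t t0). have cu := smooth_scont su.
have sg (z : V) : smooth (fun w => \sum_i z 0 i * sd i Y w).
  by apply: smooth_sum => i; apply: smoothZ; exact: smooth_sd.
have cg (z : V) : scont (fun w => \sum_i z 0 i * sd i Y w) by exact: smooth_scont (sg z).
have := is_derive_pairing hsigma F t0 cY.
rewrite (flow_weak hsigma tau_pos F t0 r0 sY) /weakQ => h.
have h2 := is_deriveB h (is_derive_cst (rho * I (fun w => M x w * Y w)) t (1 : R)).
apply: (is_derive_eq h2); rewrite subr0; congr (_ * _).
rewrite (@eq_sint _ _ _ (fun w => u t w * sgdot (xdot _) Y w)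
  (fun w => u t w * \sum_i Om u t 0 i * sd i Y w)); last first.
  by move=> w w1; rewrite /xdot sgdot_dot.
have -> : I (sgdot (u t) Y) = md l * I (fun w => Y w * u t w).
  rewrite -[LHS]opprK -sint_slap// -sintZ; last exact: scontM.
  rewrite -sintN; last by apply: scontM => //; apply: smooth_scont; exact: smooth_slap.
  by apply: eq_sint => w w1; case: hY => _ ->//; ring.
rewrite (pairing_dev x F t0 cY) (pairing_dev x F t0 (cg _)) /pairing.
have -> : I (fun w => M x w * \sum_i (kr u t *: Om u t - k *: x) 0 i * sd i Y w) =
   kr u t * I (fun w => M x w * \sum_i Om u t 0 i * sd i Y w) - md l * I (fun w => M x w * Y w).
  rewrite vm_eigen// -sintZ; last exact: scontM.
  rewrite -sintZ; last exact: scontM.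
  rewrite -sintB; [|by apply: scontZ; exact: scontM|by apply: scontZ; exact: scontM].
  apply: eq_sint => w _; rewrite mulrCA [k * _]mulrCA -mulrBr; congr (_ * _).
  rewrite !mulr_sumr -sumrB; apply: eq_bigr => i _.
  by rewrite [(_ *: _ - k *: x) 0 i]mxE [(- (k *: x)) 0 i]mxE [(_ *: direction _ _) 0 i]mxE [(k *: x) 0 i]mxE; ring.
rewrite (@eq_sint _ _ _ (fun w => (\sum_i Om u t 0 i * sd i Y w) * u t w)
  (fun w => u t w * \sum_i Om u t 0 i * sd i Y w)); last by move=> w _; rewrite mulrC.
by ring.
Qed.

Lemma ler_addeps (a b d : R) : 0 <= d -> (forall e, 0 < e -> e <= 1 -> a <= b + e * d) -> a <= b.
Proof.
move=> d0 H; apply/ler_addgt0Pr => e e0; have d1 : 0 < d + 1 by rewrite ltr_wpDl.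
have e1 : 0 < e / (d + 1) by rewrite divr_gt0.
apply: (le_trans (H (Num.min 1 (e / (d + 1))) _ _)); rewrite ?lt_min ?ltr01// ?ge_min ?lexx//.
rewrite lerD2l; apply: (@le_trans _ _ (e / (d + 1) * d)).
  by rewrite ler_wpM2r// ge_min lexx orbT.
by rewrite mulrAC ler_pdivrMr// ler_pM2l// lerDl.
Qed.

Section Step.
Variables (u du : R -> V -> R) (x : V) (D K2 K3 kM : R) (mu b : nat -> R) (l0 : nat).
Hypotheses (F : flow u du) (D0 : 0 <= D) (K20 : 0 <= K2) (K30 : 0 <= K3) (kM0 : 0 <= kM).
Hypothesis bounds : forall t, 0 < t -> [/\ 0 < r u t, tau rk / 2 <= tau (r u t), `|kr u t| <= kM,
  eucl (kr u t *: Om u t - k *: x) <= K2 * D * expR (- lam * t) &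
  l2 sigma (dev u x t) <= K3 * D * expR (- lam * t)].
Hypotheses (mu0 : forall l, 0 <= mu l) (hmu : degree_bound sigma (pairing sigma (M x)) mu).
Hypothesis b0 : forall l, 0 <= b l.
Hypothesis hl0 : forall l, (l0 < l)%N -> 2 * lam <= tau rk / 2 * md l.
Hypothesis start : forall l Y (e : R), (0 < l)%N -> harm l Y -> 0 < e -> exists2 t1 : R, 0 < t1 < e &
  pairing sigma (dev u x t1) Y <= b l * l2 sigma Y + e.

Local Notation gf := (@gfac R n).
Definition spectral_bound (a : nat -> R) := forall l Y (t : R), harm l Y -> 0 < t ->
  `|pairing sigma (dev u x t) Y| <= a l * expR (- lam * t) * l2 sigma Y.

(** Up to degree [l0] the damping need not beat the rate, and the L^2 decay serves as bound. *)
Definition low (l : nat) : R := if (l <= l0)%N then K3 * D else 0.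

(** What does not depend on the current bounds: the initial coefficients, the low degrees, and the
    mismatch of the moving equilibrium tested on [M x]. *)
Definition source : nat -> R := fun l => b l + low l + D * gain (fun=> 0) (gf (2 * rho * K2)) mu l.

Lemma low_ge0 l : 0 <= low l.
Proof. by rewrite /low; case: ifP => // _; exact: mulr_ge0. Qed.

Lemma source_ge0 l : 0 <= source l.
Proof.
rewrite /source addr_ge0 ?addr_ge0 ?low_ge0// mulr_ge0// gain_ge0// => l'.
by apply: (gfac_ge0 n2); rewrite !mulr_ge0// ltW.
Qed.

Lemma spectral_base : spectral_bound (fun=> K3 * D).
Proof.
move=> l Y t hY t0; have [_ _ _ _ h] := bounds t0.
have cd : scont (dev u x t) by exact: (dev_scont F t0).
exact: (degree_bound_l2 cd h hY).
Qed.

(** The assumed bounds in the neighbouring degrees make the equation for the coefficient one of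
    relaxation towards a source of size [G expR (- lam z)]; the result is the initial value plus
    [2 G / md l]. The opposite sign is covered by [- Y]. *)
Lemma spectral_step_high a l Y t : (forall l, 0 <= a l) -> spectral_bound a -> (l0 < l)%N -> (0 < l)%N ->
  harm l Y -> 0 < t -> pairing sigma (dev u x t) Y <=
    (b l + gf (2 * kM) l * tri a l + D * (gf (2 * rho * K2) l * tri mu l)) *
    expR (- lam * t) * l2 sigma Y.
Proof.
move=> a0 Pa l0l lp hY t0; have sY := harm_smooth hY; have cY := smooth_scont sY.
have m0 : 0 < md l by rewrite -(@deg_eig0 R n); exact: deg_eig_lt.
pose y s := I (fun w => Y w * u s w) - rho * I (fun w => M x w * Y w).
have yE s : 0 < s -> pairing sigma (dev u x s) Y = y s by move=> s0; exact: (pairing_dev x F s0 cY).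
have Y0 := l2_ge0 sigma Y.
have ta : 0 <= tri a l by rewrite /tri !addr_ge0.
have tm : 0 <= tri mu l by rewrite /tri !addr_ge0.
pose G := (l%:R + n%:R) * l2 sigma Y * (kM * tri a l + rho * K2 * D * tri mu l).
have G0 : 0 <= G.
  by apply: mulr_ge0; [apply: mulr_ge0|apply: addr_ge0; apply: mulr_ge0] => //; rewrite !mulr_ge0// ltW.
have GE : 2 * G / md l =
    (gf (2 * kM) l * tri a l + D * (gf (2 * rho * K2) l * tri mu l)) * l2 sigma Y.
  by rewrite /G /gfac; field; rewrite gt_eqF.
have B0 : 0 <= b l * l2 sigma Y by exact: mulr_ge0.
set X := b l * l2 sigma Y in B0 *.
have -> : (b l + gf (2 * kM) l * tri a l + D * (gf (2 * rho * K2) l * tri mu l)) * expR (- lam * t) *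
   l2 sigma Y = (X + 2 * G / md l) * expR (- lam * t) by rewrite GE /X; ring.
have Gm : 0 <= 2 * G / md l by rewrite divr_ge0 ?(ltW m0)// mulr_ge0.
rewrite -ler_pdivrMr ?expR_gt0//; apply: (@ler_addeps _ _ (X + 4)); first by rewrite addr_ge0.
move=> e e0 e1; have ln0 : 0 < ln (1 + e) / lam by rewrite divr_gt0// ln_gt0// ltrDl.
(* The starting time is so small that [expR (lam * t1) <= 1 + e]; it disappears as e tends to 0. *)
have e'0 : 0 < Num.min (Num.min t e) (ln (1 + e) / lam) by rewrite !lt_min t0 e0.
have [t1 /andP[t10]] := start lp hY e'0; rewrite !lt_min => /andP[/andP[t1t t1e] t1l].
rewrite yE// => y1.
have {}y1 : y t1 <= X + e.
  by apply: (le_trans y1); rewrite lerD2l ge_min ge_min lexx orbT.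
have E1 : expR (lam * t1) <= 1 + e.
  rewrite -[leRHS]lnK ?posrE ?addr_gt0// ler_expR mulrC -ler_pdivlMr//; exact: ltW.
(* The value at t1 is at most X + e; the second e makes the initial inequality of [relaxation]
   strict. *)
pose P := (X + 2 * e) * expR (lam * t1) + 2 * G / md l.
have P0 : 0 <= P by rewrite addr_ge0// mulr_ge0 ?expR_ge0// addr_ge0// mulr_ge0// ltW.
have hP : y t < P * expR (- lam * t).
  pose dy s := tau (r u s) * (- md l * pairing sigma (dev u x s) Y +
       kr u s * pairing sigma (dev u x s) (fun w => \sum_i Om u s 0 i * sd i Y w) +
       rho * pairing sigma (M x) (fun w => \sum_i (kr u s *: Om u s - k *: x) 0 i * sd i Y w)).
  apply: (@relaxation R y dy (fun s => tau (r u s)) (md l) G lam (tau rk / 2) TM P t1) => //.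
  - exact: hl0.
  - rewrite /P mulrDr [md l * (2 * G / md l)]mulrC divfK ?gt_eqF// lerDr.
    apply: mulr_ge0; first exact: ltW.
    by apply: mulr_ge0; rewrite ?expR_ge0// addr_ge0// mulr_ge0// ltW.
  - by rewrite divr_ge0// ltW// tau_pos// ltW.
  - move=> z z1; have z0 : 0 < z by exact: lt_le_trans z1.
    by have [r0 _ _ _ _] := bounds z0; exact: (is_derive_dev x F z0 r0 hY).
  - move=> z z1; have z0 : 0 < z by exact: lt_le_trans z1.
    by have [r0 -> _ _ _] := bounds z0; rewrite tau_le// ltW.
  - move=> z z1; have z0 : 0 < z by exact: lt_le_trans z1.
    have [r0 tz kz oz _] := bounds z0; have tz0 : 0 <= tau (r u z) by rewrite ltW// tau_pos// ltW.
    have -> : - (tau (r u z) * md l) * y z + tau (r u z) * G * expR (- lam * z) =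
      tau (r u z) * (- md l * y z + G * expR (- lam * z)) by ring.
    rewrite /dy yE// ler_wpM2l// -addrA lerD2l.
    have Om1 : eucl (Om u z) = 1 := direction_sphere r0.
    have cd : scont (dev u x z) by exact: (dev_scont F z0).
    have h1 : `|pairing sigma (dev u x z) (fun w => \sum_i Om u z 0 i * sd i Y w)| <=
       (l%:R + n%:R) * (tri a l * expR (- lam * z)) * l2 sigma Y.
      have hb : degree_bound sigma (pairing sigma (dev u x z)) (fun l => a l * expR (- lam * z)).
        by move=> l' Y' hY'; exact: Pa.
      apply: (le_trans (degree_bound_grad hsigma n2 (Om u z)
        (pairing_linear sigma cd) hb _ hY)).
        by move=> l'; rewrite mulr_ge0 ?expR_ge0.
      rewrite Om1 mulr1 le_eqVlt; apply/orP; left; apply/eqP; rewrite /tri; ring.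
    have h2 : `|pairing sigma (M x) (fun w => \sum_i (kr u z *: Om u z - k *: x) 0 i * sd i Y w)| <=
       (l%:R + n%:R) * (K2 * D * expR (- lam * z)) * tri mu l * l2 sigma Y.
      have cMx : scont (M x) by exact: cM.
      apply: (le_trans (degree_bound_grad hsigma n2 _ (pairing_linear sigma cMx) hmu mu0 hY)).
      by rewrite ler_wpM2r// ler_wpM2r// ler_wpM2l.
    have -> : G * expR (- lam * z) = kM * ((l%:R + n%:R) * (tri a l * expR (- lam * z)) * l2 sigma Y) +
       rho * ((l%:R + n%:R) * (K2 * D * expR (- lam * z)) * tri mu l * l2 sigma Y).
      by rewrite /G; ring.
    apply: lerD.
      apply: (le_trans (ler_norm _)); rewrite normrM; exact: ler_pM.
    by rewrite ler_pM2l// (le_trans (ler_norm _)).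
  - rewrite /P mulrDl -mulrA -expRD mulNr addrN expR0 mulr1.
    apply: (@lt_le_trans _ _ (X + 2 * e)); last by rewrite lerDl mulr_ge0 ?expR_ge0.
    by apply: (le_lt_trans y1); rewrite ltrD2l; lra.
  - exact: ltW.
rewrite yE// ler_pdivrMr ?expR_gt0//; apply: (le_trans (ltW hP)).
rewrite ler_wpM2r ?expR_ge0// /P.
have : (X + 2 * e) * expR (lam * t1) <= (X + 2 * e) * (1 + e).
  by rewrite ler_wpM2l// addr_ge0// mulr_ge0// ltW.
have : e * e <= e by rewrite ler_piMl// ltW.
move: (expR _) (2 * G / md l) => p q; lra.
Qed.

Lemma spectral_step a : (forall l, 0 <= a l) -> spectral_bound a ->
  spectral_bound (gain source (gf (2 * kM)) a).
Proof.
move=> a0 Pa l Y t hY t0; have Y0 := l2_ge0 sigma Y; have E0 := expR_ge0 (- lam * t).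
have ta : 0 <= tri a l by rewrite /tri !addr_ge0.
have tm : 0 <= tri mu l by rewrite /tri !addr_ge0.
have ga : 0 <= gf (2 * kM) l by apply: (gfac_ge0 n2); rewrite mulr_ge0.
have gm : 0 <= gf (2 * rho * K2) l by apply: (gfac_ge0 n2); rewrite !mulr_ge0// ltW.
rewrite /gain /source /gain add0r.
have [ll0|l0l] := leqP l l0.
  apply: (le_trans (spectral_base hY t0)); rewrite ler_wpM2r// ler_wpM2r// /low ll0.
  have := b0 l; have : 0 <= D * (gf (2 * rho * K2) l * tri mu l) by rewrite mulr_ge0// mulr_ge0.
  have : 0 <= gf (2 * kM) l * tri a l by rewrite mulr_ge0.
  lra.
rewrite /low leqNgt l0l/= addr0; have lp : (0 < l)%N by exact: leq_ltn_trans l0l.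
have up Z : harm l Z -> l2 sigma Z = l2 sigma Y -> pairing sigma (dev u x t) Z <=
    (b l + D * (gf (2 * rho * K2) l * tri mu l) + gf (2 * kM) l * tri a l) * expR (- lam * t) * l2 sigma Y.
  by move=> hZ <-; rewrite addrAC; exact: spectral_step_high.
rewrite ler_norml; apply/andP; split; last exact: up.
have cd : scont (dev u x t) by exact: (dev_scont F t0).
have [_ _ lZ] := pairing_linear sigma cd.
have := up _ (harmZ (-1) hY); rewrite l2Z ?normrN1 ?mul1r; last exact/smooth_scont/harm_smooth/hY.
rewrite lZ; last exact: harm_smooth hY.
by rewrite mulN1r lerNl => /(_ erefl).
Qed.

End Step.

(** The limit direction comes before its bounds, so that one [x] serves for all admissible D. *)
Lemma limit_bounds : exists D1 K2 K3 K4 kM : R,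
  [/\ 0 < D1, [/\ 0 <= K2, 0 <= K3, 0 <= K4 & 0 <= kM] & forall u du, flow u du ->
  forall v D, sphere v -> D <= D1 -> starts_near sigma n2 k rho u v D ->
  (exists2 x, limit_direction sigma u x & sphere x) /\
  forall x, limit_direction sigma u x -> sphere x -> eucl (v - x) <= K4 * D /\
  forall t, 0 < t -> [/\ 0 < r u t, tau rk / 2 <= tau (r u t), `|kr u t| <= kM,
    eucl (kr u t *: Om u t - k *: x) <= K2 * D * expR (- lam * t) &
    l2 sigma (dev u x t) <= K3 * D * expR (- lam * t)]].
Proof.
have [D0 [K [D00 K0 H]]] := flow_l2_decay hsigma (n2 := n2) k0 rho0 k10 CK0 TM0 L0 tau_pos tau_le tau_lip k_taylor2 theta0.
have trk : 0 < tau rk by rewrite tau_pos// ltW.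
have kc : 0 < k1 + CK by exact: addr_gt0.
have nK : 0 <= n%:R * K by rewrite mulr_ge0// ltW.
have ml := Mlip_ge0 hsigma n2 k0.
(* The second bound on D keeps tau(|J|) within half of tau(rk). [K4] adds the distances from v to
   Omega at an early time and from there to x. *)
exists (Num.min D0 (tau rk / 2 / (L * K))), ((k1 + CK) * K + k * (n%:R * K)),
  (l2C sigma n2 k * K + rho * (Mlip sigma n2 k * (n%:R * K))), (n%:R * (2 * K)), (k + (k1 + CK)).
split.
- by rewrite lt_min D00/= !divr_gt0// mulr_gt0.
- split.
  + by apply: addr_ge0; apply: mulr_ge0 => //; exact: ltW.
  + apply: addr_ge0; apply: mulr_ge0; [exact: l2C_ge0|exact: ltW|exact: ltW|exact: mulr_ge0].
  + by rewrite mulr_ge0// mulr_ge0// ltW.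
  + by rewrite addr_ge0// ltW.
move=> u du F v D v1; rewrite le_min => /andP[D1 D2] S.
have {}H t : 0 < t -> _ := H u du F v v1 D D1 S t.
have Dp : 0 <= D.
  by have [t1 _ h] := S 1 ltr01; exact: (le_trans (l2_ge0 _ _) h).
have KD : 0 <= K * D by rewrite mulr_ge0// ltW.
have rp t : 0 < t -> 0 < r u t by move=> /H[].
split.
  have [|x lx] := @limit_direction_ex R n sigma hsigma n2 tau k rho k1 k0 rho0 tau_pos theta0 u (K * D) KD.
    by move=> t t0 s i ts; have [_ _ _ h _] := H t t0; exact: h.
  by exists x => //; exact: (limit_direction_sphere F rp lx).
move=> x lx x1.
have xO t i : 0 < t -> `|x 0 i - Om u t 0 i| <= K * D * expR (- lam * t).
  move=> t0; apply: (limit_direction_dist i lx); first by rewrite mulr_ge0// expR_ge0.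
  by move=> s i' ts; have [_ _ _ h _] := H t t0; exact: h.
have Ele t : 0 < t -> expR (- lam * t) <= 1.
  by move=> t0; rewrite -expR0 ler_expR mulNr oppr_le0 mulr_ge0// ltW.
split.
  rewrite -mulrA; apply: eucl_le_coord; first by rewrite mulr_ge0// mulr_ge0// ltW.
  move=> i; have [_ _ _ _ hv] := H 1 ltr01.
  have [s /andP[s0 _] h] := hv i 1 ltr01; have h2 := xO s i s0.
  have h3 : K * D * expR (- lam * s) <= K * D by rewrite ler_piMr// Ele.
  rewrite [(v - x) 0 i]mxE [(- x) 0 i]mxE.
  have -> : v 0 i - x 0 i = - (Om u s 0 i - v 0 i) - (x 0 i - Om u s 0 i) by ring.
  apply: (le_trans (ler_normB _ _)); rewrite normrN.
  have -> : 2 * K * D = K * D + K * D by ring.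
  by apply: lerD => //; exact: (le_trans h2).
move=> t t0; have [r0 N1 Nd _ _] := H t t0; have E0 := expR_ge0 (- lam * t).
have su : smooth (u t) by case: (F t t0). have cu := smooth_scont su.
have Om1 : sphere (Om u t) by exact: direction_sphere.
have fd := flux_dev_le hsigma n2 k F t0 r0.
have kd := k_dev_le hsigma k10 CK0 k_taylor2 F t0 r0 N1.
have eO : eucl (Om u t - x) <= n%:R * K * D * expR (- lam * t).
  rewrite -!mulrA; apply: eucl_le_coord; first by rewrite mulrA mulr_ge0.
  move=> i; rewrite [(_ - x) 0 i]mxE [(- x) 0 i]mxE distrC mulrA; exact: xO.
split => //.
- have h := tau_lip (ltW r0).
  have : L * `|r u t - rk| <= tau rk / 2.
    apply: (@le_trans _ _ (L * (K * D))).
      rewrite ler_pM2l//; apply: (le_trans fd); apply: (le_trans Nd).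
      by rewrite ler_piMr// Ele.
    by move: D2; rewrite ler_pdivlMr ?mulr_gt0// => D2; apply: le_trans D2; rewrite mulrC -mulrA mulrC -mulrA; rewrite le_eqVlt; apply/orP; left; apply/eqP; ring.
  move: h; rewrite ler_norml => /andP[h _]; move: h; lra.
- have := ler_normD (kr u t - k) k; rewrite subrK (gtr0_norm k0) => h.
  apply: (le_trans h); rewrite addrC lerD2l; apply: (le_trans kd).
  by rewrite ler_piMr// ltW.
- have -> : kr u t *: Om u t - k *: x = (kr u t - k) *: Om u t + k *: (Om u t - x).
    by rewrite scalerBl scalerBr addrA subrK.
  apply: (le_trans (ler_euclD _ _)); rewrite (euclZ _ (direction sigma (u t))) (euclZ k) (gtr0_norm k0).
  have -> : eucl (direction sigma (u t)) = 1 by exact: Om1.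
  rewrite mulr1.
  rewrite -mulrA mulrDl; apply: lerD.
    by apply: (le_trans kd); rewrite -mulrA ler_pM2l// mulrA.
  by rewrite -mulrA ler_pM2l// mulrA.
- have ch : scont (eta sigma n2 k (Om u t) rho (u t)) by exact/smooth_scont/smooth_eta.
  apply: (le_trans (l2_vm_change hsigma n2 k0 rho0 cu Om1 x1)).
  rewrite -mulrA mulrDl; apply: lerD.
    apply: (le_trans (l2_le_eta2 hsigma k0 cu Om1 ch)).
    by rewrite -mulrA ler_wpM2l ?l2C_ge0// mulrA.
  by rewrite -mulrA ler_pM2l// -mulrA ler_wpM2l// mulrA.
Qed.
End Spectral.

Section Weights.
Context {R : realType} {n : nat}.
Variable sigma : probability (borelRn R n) R.
Hypothesis hsigma : uniform_on_sphere sigma.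
Hypothesis n2 : (2 <= n)%N.
Local Notation md := (@deg_eig R n).
Local Notation V := 'rV[R]_n.
Local Notation wsum := (@weighted_sum R n).
Local Notation wtn := (@wt R n).

Lemma md_ge1 l : (0 < l)%N -> 1 <= md l.
Proof. by move=> l0; apply: le_trans (deg_eig_ge n2 l : l%:R <= md l); rewrite ler1n. Qed.

Lemma wt_le_md (s : R) l : 0 <= s -> (0 < l)%N -> wtn s l <= 2 `^ s * md l `^ s.
Proof.
move=> s0 /md_ge1 m1; have m0 : 0 <= md l := le_trans ler01 m1.
rewrite -powRM// /wt; apply: ge0_ler_powR => //; rewrite ?nnegrE.
- exact: addr_ge0.
- exact: mulr_ge0.
- lra.
Qed.

Lemma md_le_wt (s : R) l : 0 <= s -> md l `^ s <= wtn s l.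
Proof.
move=> s0; have m0 := md_ge0 n2 l : 0 <= md l.
rewrite /wt; apply: ge0_ler_powR => //; rewrite ?nnegrE ?addr_ge0//.
by rewrite lerDl.
Qed.

Lemma wsum_trunc (s K : R) l0 N :
  wsum s (fun l => if (l <= l0)%N then K else 0) N <= K ^+ 2 * \sum_(l < l0.+1) wtn s l.
Proof.
pose a l := if (l <= l0)%N then K else 0.
apply: (@le_trans _ _ (wsum s a (l0.+1 + N)%N)).
  rewrite addnC /weighted_sum big_split_ord/= lerDl; apply: sumr_ge0 => i _.
  by rewrite mulr_ge0 ?powR_ge0// sqr_ge0.
rewrite /weighted_sum big_split_ord/= [X in _ + X]big1 ?addr0; last first.
  by move=> i _; rewrite /a leqNgt ltnS leq_addr/= expr0n mulr0.
rewrite mulr_sumr; apply: ler_sum => i _.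
by rewrite /a -ltnS ltn_ord mulrC.
Qed.

Lemma sphere_linearB (L L' : (V -> R) -> R) : sphere_linear L -> sphere_linear L' ->
  sphere_linear (fun f => L f - L' f).
Proof.
move=> [e a z] [e' a' z']; split=> [f g fg|f g sf sg|c f sf].
- by rewrite (e f g fg) (e' f g fg).
- by rewrite a// a'//; ring.
- by rewrite z// z'//; ring.
Qed.

End Weights.

(** * Summation over the degrees *)

Section Stability.
Context {R : realType} {n : nat}.
Variable sigma : probability (borelRn R n) R.
Hypothesis hsigma : uniform_on_sphere sigma.
Hypothesis n2 : (2 <= n)%N.
Local Notation V := 'rV[R]_n.
Local Notation I := (sint sigma).
Variables (nu tau : R -> R) (k rho k1 CK TM L : R).
Hypotheses (k0 : 0 < k) (rho0 : 0 < rho) (k10 : 0 < k1) (CK0 : 0 < CK) (TM0 : 0 < TM) (L0 : 0 < L).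
Local Notation c := (order_param n k).
Local Notation rk := (rho * c).
Hypothesis tau_pos : forall r, 0 <= r -> 0 < tau r.
Hypothesis tau_le : forall r, 0 <= r -> tau r <= TM.
Hypothesis tau_lip : forall r, 0 <= r -> `|tau r - tau rk| <= L * `|r - rk|.
Hypothesis k_taylor2 : forall r, 0 < r -> `|nu r / tau r - k - k1 * (r - rk)| <= CK * (r - rk) ^+ 2.
Let theta := 1 - rho * k1 * vmvar sigma n2 k.
Hypothesis theta0 : 0 < theta.
Local Notation Lam := (poincare_constant sigma k).
Let lam := tau rk * Lam * theta.

Local Notation r := (fun u t => eucl (flux sigma (u t))).
Local Notation Om := (fun u t => direction sigma (u t)).
Local Notation N u t := (Num.sqrt (N2 sigma n2 k rho u t)).
Local Notation flow := (flow sigma nu tau rho).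
Implicit Types (u du : R -> V -> R) (t : R).

Let c0 : 0 < c. Proof. exact: (order_param_gt0 hsigma n2 (ltW k0) k0). Qed.
Let rk0 : 0 < rk. Proof. exact: mulr_gt0. Qed.

Let lam0 : 0 < lam.
Proof. by rewrite !mulr_gt0// ?tau_pos ?(ltW rk0)// (poincare_constant_gt0 hsigma n2 (ltW k0)). Qed.
Local Notation M := (vm sigma n2 k).
Local Notation md := (@deg_eig R n).
Local Notation kr u t := (nu (r u t) / tau (r u t)).
Local Notation gf := (@gfac R n).
Local Notation dev := (dev sigma n2 k rho).
Local Notation wsum := (@weighted_sum R n).
Let sM v : smooth (M v). Proof. exact: smooth_vm. Qed.
Let cM (v : V) : scont (M v). Proof. exact: scont_vm. Qed.
Let crM (v : V) : scont (fun w => rho * M v w). Proof. exact: scontZ. Qed.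

Definition rhoM v := pairing sigma (fun w => rho * M v w).

(** The initial datum is an arbitrary linear form, reached by the densities along small positive
    times that may depend on the test function. *)
Definition initial_trace u (T0 : (V -> R) -> R) := forall l Y, (0 < l)%N -> smooth Y ->
  (forall w, sphere w -> slap Y w = - md l * Y w) -> forall e : R, 0 < e ->
  exists2 t, 0 < t < e & `|I (fun w => Y w * u t w) - T0 Y| <= e.

Lemma pairing_rhoM v Y : scont Y -> rhoM v Y = rho * I (fun w => M v w * Y w).
Proof.
move=> cY; rewrite -sintZ; last by apply: scontM => //; exact: cM.
by apply: eq_sint => w _; rewrite mulrA.
Qed.

(** The initial data are known to be close to [M v], while the evolution is compared with [M x]: the
    difference of the two densities is added to the coefficients. *)
Lemma initial_degree_bound (s : R) (T0 : (V -> R) -> R) (v x : V) (D q : R) (nu' : nat -> R) : 0 <= s -> sphere v -> sphere x ->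
  sphere_linear T0 -> 0 <= D -> 0 <= q ->
  (sobolev_norm sigma s (fun Y => T0 Y - rhoM v Y)%R <= D%:E)%E ->
  (forall l, 0 <= nu' l) -> degree_bound sigma (pairing sigma (fun w => M v w - M x w)) nu' ->
  (forall N, wsum s nu' N <= q * eucl (v - x) ^+ 2) ->
  exists b, [/\ forall l, 0 <= b l, forall l Y, (0 < l)%N -> harm l Y ->
    `|T0 Y - rhoM x Y| <= b l * l2 sigma Y &
    forall N, wsum s b N <= 2 * (2 `^ s * D ^+ 2) + 2 * (rho ^+ 2 * (q * eucl (v - x) ^+ 2))].
Proof.
move=> s0 v1 x1 lL D0 q0 hD nu0 hnu wnu.
have lR v' : sphere_linear (rhoM v') by exact: pairing_linear.
have lB := sphere_linearB lL (lR v).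
have [a [a0 La aB]] := sobolev_norm_ge hsigma n2 lB hD.
pose b' l := if l is 0%N then 0 else Num.sqrt (a l).
have b'0 l : 0 <= b' l by case: l => // l; exact: sqrtr_ge0.
exists (fun l => b' l + rho * nu' l); split.
- by move=> l; rewrite addr_ge0// mulr_ge0// ltW.
- move=> l Y lp hY; have sY := harm_smooth hY; have cY := smooth_scont sY.
  have -> : T0 Y - rhoM x Y = (T0 Y - rhoM v Y) + rho * pairing sigma (fun w => M v w - M x w) Y.
    rewrite !pairing_rhoM// /pairing (@eq_sint _ _ _ (fun w => (M v w - M x w) * Y w)
      (fun w => M v w * Y w - M x w * Y w)); last by move=> w _; ring.
    by rewrite sintB; [ring|apply: scontM => //; exact: cM|apply: scontM => //; exact: cM].
  apply: (le_trans (ler_normD _ _)); rewrite mulrDl; apply: lerD.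
    have := La l Y lp sY (proj2 hY); case: l lp {hY} => // l _ h.
    rewrite -(ler_pXn2r (n := 2)) ?nnegrE ?mulr_ge0 ?l2_ge0 ?sqrtr_ge0//.
    by rewrite real_normK ?num_real// exprMn sqr_sqrtr// sqr_l2.
  by rewrite normrM gtr0_norm// -mulrA ler_pM2l// hnu.
- move=> N; apply: (le_trans (wsumD _ _ _ _)); apply: lerD; rewrite ler_pM2l//; last first.
    by rewrite wsumZ ler_wpM2l// sqr_ge0.
  apply: (@le_trans _ _ (2 `^ s * \sum_(0 <= l < N | (0 < l)%N) md l `^ s * a l)); last first.
    rewrite ler_wpM2l ?powR_ge0//; apply: le_trans (aB N); rewrite lerDr sqr_ge0//.
  rewrite big_mkord big_mkcond/= mulr_sumr; apply: ler_sum => -[[|l] ?] _ /=.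
    by rewrite expr0n !mulr0.
  by rewrite sqr_sqrtr// mulrA ler_wpM2r// wt_le_md.
Qed.

Local Notation source := (@source R n).
Local Notation wtn := (@wt R n).

Lemma source_weighted (s K2 K3 : R) (l0 : nat) : exists2 q, 0 < q & forall (D mu2 B : R) (mu b : nat -> R),
  0 <= D -> (forall N, wsum s mu N <= mu2) -> 0 <= mu2 -> (forall N, wsum s b N <= B * D ^+ 2) ->
  forall N : nat, wsum s (source rho D K2 K3 mu b l0) N <= (q * (mu2 + 1) + 4 * B) * D ^+ 2.
Proof.
have [g g0 hg] := @wsum_gain R n n2 (s - 1) (2 * (2 * rho * K2 * (1 + n%:R)) ^+ 2).
pose W := \sum_(l < l0.+1) wtn s l.
have W0 : 0 <= W by apply: sumr_ge0 => i _; exact: powR_ge0.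
exists (4 * (K3 ^+ 2 * W) + 2 * g); first by rewrite ltr_wpDl ?mulr_gt0// mulr_ge0// mulr_ge0// sqr_ge0.
move=> D mu2 B mu b D0 hmu mu20 hb N.
have h1 : wsum s (low D K3 l0) N <= K3 ^+ 2 * W * D ^+ 2.
  by apply: (le_trans (wsum_trunc s (K3 * D) l0 N)); rewrite exprMn mulrAC.
have h2 : wsum s (gain (fun=> 0) (gf (2 * rho * K2)) mu) N <= g * mu2.
  have := hg (fun=> 0) (gf (2 * rho * K2)) mu mu2 0; rewrite subrK addr0; apply.
  - by move=> l; exact: gfac_le.
  - move=> N'; apply: le_trans (hmu N'); apply: (wsum_le n2); lra.
  - by move=> N'; rewrite /weighted_sum big1// => i _; rewrite expr0n mulr0.
have h3 := @wsumD R n s (fun l => b l + low D K3 l0 l) (fun l => D * gain (fun=> 0) (gf (2 * rho * K2)) mu l) N.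
have h4 := @wsumD R n s b (low D K3 l0) N.
have eZ := @wsumZ R n s D (gain (fun=> 0) (gf (2 * rho * K2)) mu) N; rewrite eZ in h3.
have h5 := hb N.
have h6 : D ^+ 2 * wsum s (gain (fun=> 0) (gf (2 * rho * K2)) mu) N <= D ^+ 2 * (g * mu2).
  by rewrite ler_wpM2l// sqr_ge0.
apply: (le_trans h3).
have h7 : 0 <= (4 * (K3 ^+ 2 * W) * mu2 + 2 * g) * D ^+ 2.
  apply: mulr_ge0; last exact: sqr_ge0.
  apply: addr_ge0; last by rewrite mulr_ge0// ltW.
  by rewrite mulr_ge0// mulr_ge0// mulr_ge0// sqr_ge0.
move: h1 h4 h5 h6 h7; move: (D ^+ 2) (wsum _ _ _) (wsum _ _ _) (wsum _ _ _) (wsum _ _ _) => d a1 a2 a3 a4; lra.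
Qed.

(** A single direction [x] is obtained for all D, so that D may afterwards decrease to the initial
    distance. The bound at time 0 is stated for [T0] itself. *)
Lemma flow_stability (s : R) : 0 < s -> exists D1 C : R, [/\ 0 < D1, 0 < C & forall u du, flow u du ->
  forall (T0 : (V -> R) -> R) v, sphere_linear T0 -> T0 (cst 1) = rho -> initial_trace u T0 -> sphere v ->
  let S D := (sobolev_norm sigma s (fun Y => T0 Y - rhoM v Y)%R <= D%:E)%E /\
    starts_near sigma n2 k rho u v D in
  (exists2 D, D <= D1 & S D) -> exists2 x, sphere x & forall D, D <= D1 -> S D ->
    (sobolev_norm sigma s (fun Y => T0 Y - rhoM x Y)%R <= (C * D)%:E)%E /\
    forall t, 0 < t -> (sobolev_norm sigma s (pairing sigma (dev u x t)) <= (C * D * expR (- lam * t))%:E)%E].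
Proof.
move=> sp; have s0 := ltW sp.
have [D1 [K2 [K3 [K4 [kM [D10 [K20 K30 K40 kM0] HB]]]]]] := limit_bounds hsigma k0 rho0 k10 CK0 TM0 L0 tau_pos tau_le tau_lip k_taylor2 theta0.
have trk : 0 < tau rk by rewrite tau_pos// ltW.
(* Beyond this degree the damping [tau rk / 2 * md l] is at least twice the rate, as [md l >= l]. *)
pose l0 := Num.bound ((tau rk / 2)^-1 * (2 * lam)).
have hl0 l : (l0 < l)%N -> 2 * lam <= tau rk / 2 * md l.
  move=> l0l; rewrite -ler_pdivrMl ?divr_gt0//.
  apply: (@le_trans _ _ l0%:R).
    apply/ltW/archi_boundP; apply: mulr_ge0; last by apply: mulr_ge0 => //; exact: ltW.
    by rewrite invr_ge0 divr_ge0// ltW.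
  apply: le_trans (deg_eig_ge n2 l : l%:R <= md l); rewrite ler_nat; exact: ltnW.
have [q q0 hq] := source_weighted s K2 K3 l0.
have [m m0 hm] := vm_degree_bound hsigma n2 (ltW k0) s.
have [p p0 hp] := vm_diff_degree_bound hsigma n2 (ltW k0) s.
have [c1 c10 hc] := regularity n2 s (2 * (2 * kM * (1 + n%:R)) ^+ 2).
pose B := 2 * 2 `^ s + 2 * (rho ^+ 2 * (p * K4 ^+ 2)).
have B0 : 0 <= B.
  by apply: addr_ge0; rewrite !mulr_ge0 ?powR_ge0 ?sqr_ge0// ltW.
(* [A * D ^+ 2] bounds the weighted sum of squares after the iteration: source terms, initial terms
   and the constant [K3 * D] from which it starts. *)
pose A := c1 * (q * (m + 1) + 4 * B + K3 ^+ 2).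
have A0 : 0 <= A.
  apply: mulr_ge0; first exact: ltW.
  rewrite addr_ge0 ?sqr_ge0// addr_ge0 ?mulr_ge0// ?addr_ge0//; exact: ltW.
exists D1, (Num.sqrt A + 1); split; [exact: D10|exact: ltr_wpDl (sqrtr_ge0 _) ltr01|].
move=> u du F T0 v lT T1 hT v1 S [D' D'1 [_ S']].
have [[x lx x1] _] := HB u du F v D' v1 D'1 S'.
exists x => // D DD1 [hD SD]; have [_ HBx] := HB u du F v D v1 DD1 SD.
have [vx bounds] := HBx x lx x1.
have D0 : 0 <= D by have [t1 _ h] := SD 1 ltr01; exact: (le_trans (l2_ge0 _ _) h).
have [mu [mu0 hmu wmu]] := hm x x1.
have [nu' [nu'0 hnu wnu]] := hp v x v1 x1.
have [b [b0 hb wb]] := initial_degree_bound s0 v1 x1 lT D0 (ltW p0) hD nu'0 hnu wnu.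
have wbB N : wsum s b N <= B * D ^+ 2.
  apply: (le_trans (wb N)).
  have e2 : eucl (v - x) ^+ 2 <= (K4 * D) ^+ 2.
    by rewrite lerXn2r ?nnegrE ?eucl_ge0// mulr_ge0.
  have : rho ^+ 2 * (p * eucl (v - x) ^+ 2) <= rho ^+ 2 * (p * (K4 * D) ^+ 2).
    by rewrite ler_wpM2l ?sqr_ge0// ler_pM2l.
  rewrite /B exprMn; lra.
have start l Y (e : R) : (0 < l)%N -> harm l Y -> 0 < e -> exists2 t1 : R, 0 < t1 < e &
    pairing sigma (dev u x t1) Y <= b l * l2 sigma Y + e.
  move=> lp hY e0; have sY := harm_smooth hY; have [_ eY] := hY.
  have [t1 t1e h] := hT l Y lp sY eY e e0; exists t1 => //; have /andP[t10 _] := t1e.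
  have cY := smooth_scont sY.
  rewrite (pairing_dev n2 k x F t10 cY) -pairing_rhoM//.
  have := hb l Y lp hY; move: h; rewrite !ler_norml => /andP[_ h] /andP[_ h']; move: h h'.
  move: (I _) (T0 _) (rhoM _ _) (b l * _) => x1' x2' x3' x4'; lra.
have sw := hq D m B mu b D0 wmu (ltW m0) wbB.
have src0 l : 0 <= source rho D K2 K3 mu b l0 l by exact: source_ge0.
have gf0 l : 0 <= gf (2 * kM) l by apply: (gfac_ge0 n2); rewrite mulr_ge0.
have base := spectral_base F bounds.
have step := spectral_step hsigma k0 rho0 tau_pos tau_le theta0 F D0 K20 kM0 bounds mu0 hmu b0 hl0 start.
have [a [a0 Pa wa]] := hc _ _ _ _ _ (mulr_ge0 K30 D0) src0 gf0 (gfac_le n2 (2 * kM)) sw base step.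
have A_le (E : R) N : 0 <= E -> E <= 1 ->
    \sum_(0 <= l < N | (0 < l)%N) md l `^ s * (a l * E) ^+ 2 <= ((Num.sqrt A + 1) * D * E) ^+ 2.
  move=> E0 E1; apply: (@le_trans _ _ (E ^+ 2 * wsum s a N)).
    rewrite big_mkord big_mkcond/= mulr_sumr; apply: ler_sum => l _.
    have h : 0 <= E ^+ 2 * (wtn s l * a l ^+ 2) by rewrite !mulr_ge0 ?sqr_ge0 ?powR_ge0.
    case: ifP => // _.
    have -> : md l `^ s * (a l * E) ^+ 2 = E ^+ 2 * (md l `^ s * a l ^+ 2) by ring.
    rewrite ler_wpM2l ?sqr_ge0// ler_wpM2r ?sqr_ge0//.
    exact: md_le_wt.
  rewrite [leRHS]exprMn mulrC ler_wpM2r ?sqr_ge0//; apply: (le_trans (wa N)).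
  rewrite exprMn (_ : c1 * _ = A * D ^+ 2); last by rewrite /A; ring.
  rewrite [leRHS]exprMn ler_wpM2r ?sqr_ge0// sqrrD sqr_sqrtr// -addrA lerDl.
  by rewrite addr_ge0 ?mulrn_wge0 ?mulr_ge0 ?sqrtr_ge0 ?sqr_ge0.
have eigen l Y t : (0 < l)%N -> smooth Y -> (forall w, sphere w -> slap Y w = - md l * Y w) ->
    l2 sigma Y <= 1 -> 0 < t -> `|pairing sigma (dev u x t) Y| <= a l * expR (- lam * t).
  move=> lp sY eY Y1 t0; have cd : scont (dev u x t) by exact: (dev_scont F t0).
  have aE : 0 <= a l * expR (- lam * t) by rewrite mulr_ge0 ?expR_ge0.
  apply: (@le_trans _ _ (a l * expR (- lam * t) * l2 sigma Y)); last by rewrite ler_piMr.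
  apply: (eigen_bound hsigma n2 cd sY aE eY) => Z hZ; exact: (Pa l Z t hZ t0).
have E1 t : 0 < t -> expR (- lam * t) <= 1.
  by move=> t0; rewrite -expR0 ler_expR mulNr oppr_le0; apply: mulr_ge0; exact: ltW.
have CD0 : 0 <= (Num.sqrt A + 1) * D by rewrite mulr_ge0// addr_ge0 ?sqrtr_ge0.
have one : scont (cst 1 : V -> R) by exact: (@scont_cst R n 1).
have M1 : I (fun w => M x w * cst 1 w) = 1.
  by rewrite (@eq_sint _ _ _ _ (M x)) ?(sint_vm hsigma)// => w _; rewrite /cst mulr1.
split.
  have lTx : sphere_linear (fun Y => T0 Y - rhoM x Y).
    by apply: sphere_linearB => //; exact: pairing_linear.
  apply: (sobolev_norm_le hsigma n2 (a := fun l => (a l * 1) ^+ 2) lTx CD0).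
    move=> l Y lp sY eY Y1; have cY := smooth_scont sY.
    rewrite mulr1 -[leLHS]real_normK ?num_real// lerXn2r ?nnegrE//.
    (* At time 0 the bound is the limit of those at positive times, along the times of the trace. *)
    apply/ler_addgt0Pr => e e0; have [t /andP[t0 te] h] := hT l Y lp sY eY e e0.
    have := eigen l Y t lp sY eY Y1 t0.
    rewrite (pairing_dev n2 k x F t0 cY) -pairing_rhoM// => h2.
    have h3 : a l * expR (- lam * t) <= a l by rewrite ler_piMr// E1.
    move: h h2; rewrite !ler_norml => /andP[h h'] /andP[h2 h2']; apply/andP; split.
      by move: h h' h2 h2' h3; move: (I _) (T0 _) (rhoM _ _) (a l * _) => x1' x2' x3' x4'; lra.
    by move: h h' h2 h2' h3; move: (I _) (T0 _) (rhoM _ _) (a l * _) => x1' x2' x3' x4'; lra.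
  move=> N; rewrite T1 pairing_rhoM// M1 mulr1 subrr expr0n add0r.
  by have := A_le 1 N ler01 (lexx _); rewrite mulr1.
move=> t t0; have cd : scont (dev u x t) by exact: (dev_scont F t0).
have lP := pairing_linear sigma cd; have E0 := expR_ge0 (- lam * t).
apply: (sobolev_norm_le hsigma n2 (a := fun l => (a l * expR (- lam * t)) ^+ 2) lP).
- exact: mulr_ge0.
- move=> l Y lp sY eY Y1; rewrite -[leLHS]real_normK ?num_real// lerXn2r ?nnegrE//.
    by rewrite mulr_ge0.
  exact: eigen.
- move=> N; rewrite (pairing_dev n2 k x F t0 one) M1 mulr1.
  have -> : I (fun w => cst 1 w * u t w) = rho.
    have [_ _ _ _ <-] := F t t0; by apply: eq_sint => w _; rewrite /cst mul1r.
  by rewrite subrr expr0n add0r; apply: A_le => //; exact: E1.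
Qed.

End Stability.

(** * Initial trace *)

Section Distributions.
Context {R : realType} {n : nat}.
Variable sigma : probability (borelRn R n) R.
Hypothesis hsigma : uniform_on_sphere sigma.
Hypothesis n2 : (2 <= n)%N.
Local Notation V := 'rV[R]_n.
Local Notation I := (sint sigma).
Local Notation md := (@deg_eig R n).

Lemma of_measureE (mu : {finite_measure set (borelRn R n) -> \bar R}) phi :
  of_measure mu phi = sint mu phi.
Proof. by rewrite sintE. Qed.

Lemma of_measure_linear (mu : {finite_measure set (borelRn R n) -> \bar R}) :
  sphere_linear (of_measure mu).
Proof.
split=> [f g fg|f g sf sg|c f sf]; rewrite !of_measureE.
- exact: eq_sint.
- by apply: sintD; exact: smooth_scont.
- by apply: sintZ; exact: smooth_scont.
Qed.

Lemma eq_sobolev_norm (s : R) (T T' : (V -> R) -> R) : (forall Y, smooth Y -> T Y = T' Y) ->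
  sobolev_norm sigma s T = sobolev_norm sigma s T'.
Proof.
move=> e; rewrite /sobolev_norm e; last exact: smooth_cst.
congr (sqrte (_ + _)%E); apply: eq_esum => m _; congr (_ * _)%E.
rewrite /spectral_mass; congr ereal_sup; apply/seteqP; split => _ [Y [[sY eY] Y1] <-]; exists Y => //.
  by rewrite e.
by rewrite e.
Qed.

Lemma sobolev_mean (s : R) (T : (V -> R) -> R) (B : R) : sphere_linear T ->
  (sobolev_norm sigma s T <= B%:E)%E -> `|T (cst 1)| <= B.
Proof.
move=> lT hB; have [a [_ _ h]] := sobolev_norm_ge hsigma n2 lT hB.
have B0 : 0 <= B by rewrite -lee_fin (le_trans _ hB)// sqrte_ge0.
rewrite -(ler_pXn2r (n := 2)) ?nnegrE// real_normK ?num_real//.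
by have := h 0%N; rewrite big_geq// addr0.
Qed.

Lemma sobolev_eigen (s : R) (T : (V -> R) -> R) (B : R) l Y : 0 <= s -> sphere_linear T ->
  (sobolev_norm sigma s T <= B%:E)%E -> (0 < l)%N -> smooth Y ->
  (forall w, sphere w -> slap Y w = - md l * Y w) -> `|T Y| <= B * l2 sigma Y.
Proof.
move=> s0 lT hB lp sY eY; have [a [a0 Ta h]] := sobolev_norm_ge hsigma n2 lT hB.
have B0 : 0 <= B by rewrite -lee_fin (le_trans _ hB)// sqrte_ge0.
rewrite -(ler_pXn2r (n := 2)) ?nnegrE ?mulr_ge0 ?l2_ge0// real_normK ?num_real//.
apply: (le_trans (Ta l Y lp sY eY)); rewrite exprMn sqr_l2 ler_wpM2r ?sint_sqr_ge0//.
have := h l.+1; rewrite big_mkcond/= big_nat_recr//= lp; apply: le_trans.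
rewrite addrA ler_wpDl//.
  rewrite addr_ge0 ?sqr_ge0//; apply: sumr_ge0 => i _; case: ifP => // _.
  by rewrite mulr_ge0 ?powR_ge0.
by rewrite ler_peMl// -[leLHS](powRr0 (md l)) ler_powR// md_ge1.
Qed.

(** The measure is absolutely continuous with respect to sigma, and its Radon-Nikodym derivative
    equals [u] almost everywhere on the sphere because both have the same integrals over measurable
    subsets. *)
Lemma density_integral (mu : {finite_measure set (borelRn R n) -> \bar R}) u phi :
  (forall B : set (borelRn R n), measurable B ->
     mu B = (\int[sigma]_(w in B `&` sphere) (u w)%:E)%E) ->
  scont u -> scont phi -> sint mu phi = I (fun w => u w * phi w).
Proof.
move=> hmu cu cp; rewrite !sintE /Rintegral; congr fine.
have mS : measurable (@sphere R n : set (borelRn R n)) by exact: sphere_measurable.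
have mu_ : measurable_fun (@sphere R n : set (borelRn R n)) (EFin \o u).
  exact: measurable_int (scont_integrable sigma cu).
have mphi : measurable_fun (@sphere R n : set (borelRn R n)) (EFin \o phi).
  exact: measurable_int (scont_integrable sigma cp).
have musig : mu `<< sigma.
  move=> A nA B mB BA; rewrite hmu//.
  have mBS : measurable ((B : set (borelRn R n)) `&` sphere) by exact: measurableI.
  apply: null_set_integral => //.
    apply: (measurable_funS mS) mu_; exact: subIsetr.
  by apply: nA => // w [wB _]; exact: BA.
pose d := Radon_Nikodym (charge_of_finite_measure mu) sigma.
have id_ : sigma.-integrable setT d by exact: Radon_Nikodym_integrable.
have md_ : measurable_fun (@sphere R n : set (borelRn R n)) d.
  by apply: measurable_funTS; exact: measurable_int id_.
rewrite -(@Radon_Nikodym_change_of_variables _ _ _ mu sigma musig)//; last exact: scont_integrable.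
apply: ae_eq_integral => //.
- exact: emeasurable_funM.
- by under eq_fun do rewrite EFinM; exact: emeasurable_funM.
have h : ae_eq sigma (@sphere R n : set (borelRn R n)) d (EFin \o u).
  apply: integral_ae_eq => //.
    by apply: integrableS id_.
  move=> E ES mE; rewrite /d -Radon_Nikodym_integral//.
  by have := hmu E mE; rewrite (setIidl ES).
apply: filterS h => w /= h w1; by rewrite -/d (h w1) EFinM muleC.
Qed.

End Distributions.

(** * From the initial condition in H^s to positive times *)

Section Trace.
Context {R : realType} {n : nat}.
Variable sigma : probability (borelRn R n) R.
Hypothesis hsigma : uniform_on_sphere sigma.
Hypothesis n2 : (2 <= n)%N.
Local Notation V := 'rV[R]_n.
Local Notation I := (sint sigma).
Local Notation md := (@deg_eig R n).
Variables (nu tau : R -> R) (k rho : R).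
Hypotheses (k0 : 0 < k) (rho0 : 0 < rho).
Hypothesis tau_pos : forall r, 0 <= r -> 0 < tau r.
Implicit Types (u du : R -> V -> R).
Local Notation M := (vm sigma n2 k).

Lemma mass_constant u du : (forall t, 0 < t -> [/\ smooth (u t), smooth (du t), udiff u t (du t) &
    forall w, sphere w -> du t w = Q sigma nu tau (u t) w]) ->
  forall t t', 0 < t -> t <= t' -> I (u t) = I (u t').
Proof.
move=> H t t' t0 tt'; have one := @scont_cst R n 1.
pose F z := I (fun w => cst 1 w * u z w).
have FE z : F z = I (u z) by apply: eq_sint => w _; rewrite /cst mul1r.
have dF (z : R) : t <= z <= t' -> is_derive z (1 : R) F 0.
  move=> /andP[tz _]; have z0 := lt_le_trans t0 tz; have [sz sdz dz qz] := H z z0.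
  have -> : 0 = I (fun w => cst 1 w * du z w).
    rewrite -(Q_mass hsigma nu sz (tau_pos (eucl_ge0 (flux sigma (u z))))).
    by apply: eq_sint => w w1; rewrite qz// /cst mul1r.
  apply: udiff_int => //; last 2 first.
  - exact: smooth_scont.
  - exact: smooth_scont.
  by apply: filterS (near_pos z0) => h h0; apply: smooth_scont; case: (H _ h0).
apply/eqP; rewrite eq_le -!FE; apply/andP; split.
  rewrite -lerN2; apply: (@derive_le0_nincr R (fun z => - F z) (fun=> - 0) t t' tt').
    by move=> z zi; exact: is_deriveN (dF z zi).
  by move=> z _; rewrite oppr0.
by apply: (@derive_le0_nincr R F (fun=> 0) t t' tt').
Qed.

(** For [s >= 0] the Sobolev norm controls the L^2 norm by duality against sums of harmonics. The
    gap D - d is spent on the continuity of the solution at time 0. *)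
Lemma starts_near_sobolev (s d D : R) u (T0 : (V -> R) -> R) v : 0 <= s ->
  (forall t, 0 < t -> scont (u t)) -> sphere_linear T0 ->
  (forall e : R, 0 < e -> exists2 t1, 0 < t1 & forall t, 0 < t < t1 ->
    (sobolev_norm sigma s (fun Y => pairing sigma (u t) Y - T0 Y)%R <= e%:E)%E) ->
  (sobolev_norm sigma s (fun Y => T0 Y - rhoM sigma n2 k rho v Y)%R <= d%:E)%E -> d < D ->
  starts_near sigma n2 k rho u v D.
Proof.
move=> s0 cu lT H hd dD e e0.
have Dd : 0 < D - d by rewrite subr_gt0.
have [t1 t10 h] := H _ Dd; pose t := Num.min (e / 2) (t1 / 2).
have t0 : 0 < t by rewrite lt_min !divr_gt0.
have te : t < e by rewrite gt_min; apply/orP; left; rewrite ltr_pdivrMr// ltr_pMr// ltr1n.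
have tt1 : t < t1 by rewrite gt_min; apply/orP; right; rewrite ltr_pdivrMr// ltr_pMr// ltr1n.
have {h} h := h t ltac:(by rewrite t0); exists t; first by rewrite t0.
have ct := cu t t0; have cM : scont (fun w => rho * M v w) by apply: scontZ; exact: scont_vm.
have lR : sphere_linear (rhoM sigma n2 k rho v) by exact: pairing_linear.
have lP : sphere_linear (pairing sigma (u t)) by exact: pairing_linear.
have d0 : 0 <= d by rewrite -lee_fin (le_trans _ hd)// sqrte_ge0.
have D0 : 0 <= D by apply: ltW; exact: le_lt_trans dD.
have cd : scont (fun w => u t w - rho * M v w) by exact: scontB.
rewrite -(ler_pXn2r (n := 2)) ?nnegrE ?l2_ge0// sqr_l2.
apply: (l2_duality hsigma n2 cd (sqr_ge0 D)) => m p hp.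
have sp := sum_harm_smooth m hp; have cp := smooth_scont sp.
set P := fun w => \sum_(l < m) p l w in sp cp *.
have l1 := sphere_linearB lP lT; have l2' := sphere_linearB lT lR.
have := sobolev_duality hsigma n2 s0 l1 h m hp; have := sobolev_duality hsigma n2 s0 l2' hd m hp.
rewrite -/P => h2 h1.
have -> : I (fun w => (u t w - rho * M v w) * P w) =
    (pairing sigma (u t) P - T0 P) + (T0 P - rhoM sigma n2 k rho v P).
  rewrite /pairing /rhoM /pairing addrA subrK -sintB; [|exact: scontM|exact: scontM].
  by apply: eq_sint => w _; ring.
move: h1 h2; rewrite -!sqr_l2 -!exprMn => h1 h2.
rewrite -real_normK ?num_real// lerXn2r ?nnegrE ?mulr_ge0 ?l2_ge0//.
apply: (le_trans (ler_normD _ _)).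
have -> : D * l2 sigma P = (D - d) * l2 sigma P + d * l2 sigma P by ring.
apply: lerD.
  by rewrite -(ler_pXn2r (n := 2)) ?nnegrE ?mulr_ge0 ?l2_ge0 ?(ltW Dd)// real_normK ?num_real.
by rewrite -(ler_pXn2r (n := 2)) ?nnegrE ?mulr_ge0 ?l2_ge0// real_normK ?num_real.
Qed.

Lemma trace_limit (s : R) (f : R -> {finite_measure set (borelRn R n) -> \bar R}) :
  sobolev_norm sigma s (of_measure (f t) \- of_measure (f 0)) @[t --> within [set t | 0 <= t] (nbhs (0 : R))]
    --> 0%E ->
  forall e : R, 0 < e -> exists2 t1, 0 < t1 & forall t, 0 < t < t1 ->
    (sobolev_norm sigma s (of_measure (f t) \- of_measure (f 0))%R <= e%:E)%E.
Proof.
move=> H e e0; have := H [set y | (y < e%:E)%E] (@open_ereal_lt' R 0%E e%:E ltac:(by rewrite lte_fin)).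
move=> /nbhs_ballP[t1 /= t10 h]; exists t1 => // t /andP[t0 tt1].
apply/ltW/h; rewrite /ball/= ?sub0r ?normrN ?gtr0_norm// ?ltW//.
Qed.

End Trace.

(** Lets D decrease to the exact initial distance d, since closeness in L^2 at positive times is
    only available for D > d. *)
Lemma le_EFin_right (R : realType) (X : \bar R) (a d D1 : R) : 0 <= a -> d < D1 ->
  (forall D, d < D -> D <= D1 -> (X <= (a * D)%:E)%E) -> (X <= (a * d)%:E)%E.
Proof.
move=> a0 dD H; apply/lee_addgt0Pr => e e0; rewrite -EFinD.
have a1 : 0 < a + 1 by rewrite ltr_wpDl.
apply: (le_trans (H (Num.min D1 (d + e / (a + 1))) _ _)).
- by rewrite lt_min dD ltrDl divr_gt0.
- by rewrite ge_min lexx.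
rewrite lee_fin; apply: (@le_trans _ _ (a * (d + e / (a + 1)))).
  by rewrite ler_wpM2l// ge_min lexx orbT.
by rewrite mulrDr lerD2l mulrCA ler_piMr ?(ltW e0)// ler_pdivrMr// mul1r lerDl.
Qed.

Theorem theorem2 (R : realType) (n : nat) (hn : (2 <= n)%N)
  (sigma : probability (borelRn R n) R) (hsigma : uniform_on_sphere sigma)
  (nu tau : R -> R) (kmax : \bar R) (j : R -> R)
  (hcoef : coefficients nu tau kmax j)
  (kappa : R) (hkappa0 : 0 < kappa) (hkappa1 : (kappa%:E < kmax)%E)
  (hderivable : derivable (fun x => j x / order_param n x) kappa 1)
  (hderiv : 0 < derive1 (fun x => j x / order_param n x) kappa) :
  let rho := j kappa / order_param n kappa in
  let lambda := order_param n kappa * tau (j kappa) / derive1 j kappa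
                * poincare_constant sigma kappa
                * derive1 (fun x => j x / order_param n x) kappa in
  let dist s (mu : {finite_measure set (borelRn R n) -> \bar R}) Omega :=
    sobolev_norm sigma s
      (of_measure mu
         \- of_density sigma (fun w => rho * vonMises sigma kappa Omega w)) in
  forall s : R, (n%:R - 1) / 2 < s ->
  exists delta C : R, [/\ 0 < delta, 0 < C &
    forall (f0 : {finite_measure set (borelRn R n) -> \bar R})
           (Omega : 'rV[R]_n)
           (f : R -> {finite_measure set (borelRn R n) -> \bar R}),
      f0 (~` sphere) = 0%E ->
      (sobolev_norm sigma s (of_measure f0) < +oo)%E ->
      f0 sphere = rho%:E ->
      sphere Omega ->
      (dist s f0 Omega < delta%:E)%E ->
      solution sigma nu tau s f ->
      f 0 = f0 ->
      exists2 Omega_oo : 'rV[R]_n, sphere Omega_oo &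
        forall t : R, 0 <= t ->
          (dist s (f t) Omega_oo
             <= C%:E * dist s f0 Omega * (expR (- lambda * t))%:E)%E].
Proof.
move=> rho lambda dist s hs.
have k0' := ltW hkappa0.
have c0 : 0 < order_param n kappa := order_param_gt0 hsigma hn k0' hkappa0.
have j0 : 0 < j kappa := j_gt0 hcoef hkappa0 hkappa1.
have rho0 : 0 < rho by rewrite divr_gt0.
have rkE : rho * order_param n kappa = j kappa by rewrite /rho divfK// gt_eqF.
have s0 : 0 < s.
  apply: le_lt_trans hs; rewrite divr_ge0// subr_ge0 ler1n; exact: ltnW.
have [k1 [CK CK0 [k10 dk kt]]] := k_taylor hsigma hn hcoef hkappa0 hkappa1 hderivable.
have [TM TM0 tle] := tau_bnd_ex hcoef; have [L L0 tlip] := tau_lip_ex hcoef.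
have [th0 rate] := rate_factor hsigma hn hcoef hkappa0 hkappa1 hderivable dk k10 hderiv.
have tau_pos := tau_gt0 hcoef.
have stab := @flow_stability R n sigma hsigma hn nu tau kappa rho k1 CK TM L hkappa0 rho0 k10 CK0 TM0 L0
  tau_pos tle.
rewrite !rkE in stab; have [||//|D1 [C [D10 C0 H]]] := stab _ _ _ s s0.
- by move=> r r0; apply: tlip => //; exact: ltW.
- exact: kt.
have lamE : tau (j kappa) * poincare_constant sigma kappa * (1 - rho * k1 * vmvar sigma hn kappa) = lambda.
  by rewrite /lambda rate.
rewrite lamE in H.
exists D1, C; split => // f0 Omega f _ _ f0m O1 hd [_ hcont [u [du U]]] f0E; subst f0.
have su t : 0 < t -> smooth (u t) by move=> /U[_ []].
have cu t : 0 < t -> scont (u t) by move=> t0; exact: smooth_scont (su t t0).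
pose T0 : ('rV[R]_n -> R) -> R := of_measure (f 0).
have lT : sphere_linear T0 by exact: of_measure_linear.
have T1 : T0 (cst 1) = rho by rewrite /T0 of_measureE sint_cst f0m mul1r.
have fE t Y : 0 < t -> scont Y -> of_measure (f t) Y = pairing sigma (u t) Y.
  by move=> t0 cY; rewrite of_measureE; apply: density_integral (cu t t0) cY; case: (U t t0).
have tr (e : R) : 0 < e -> exists2 t1, 0 < t1 & forall t, 0 < t < t1 ->
    (sobolev_norm sigma s (fun Y => pairing sigma (u t) Y - T0 Y)%R <= e%:E)%E.
  move=> e0; have [t1 t10 h] := trace_limit (hcont 0 (lexx 0)) e0.
  exists t1 => // t /[dup] ti /andP[t0 _]; apply: le_trans (h t ti).
  rewrite (@eq_sobolev_norm _ _ _ _ _ (of_measure (f t) \- of_measure (f 0)))// => Y sY.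
  by rewrite -fE//; exact: smooth_scont.
have lD t : 0 < t -> sphere_linear (fun Y => pairing sigma (u t) Y - T0 Y).
  by move=> t0; apply: sphere_linearB => //; apply: pairing_linear; exact: cu.
have pre t : 0 < t -> [/\ smooth (u t), smooth (du t), udiff u t (du t) &
    forall w, sphere w -> du t w = Q sigma nu tau (u t) w].
  move=> t0; have [_ [s1 s2] h _ q] := U t t0; split => //; first exact: smooth_cvg_udiff.
  by move=> w w1; have [] := q w w1.
(* The mass is constant for t > 0, and the norm controls the mean, so continuity at 0 identifies it
   with the mass of the initial measure. *)
have mass t : 0 < t -> sint sigma (u t) = rho.
  move=> t0; apply/eqP; rewrite -subr_eq0 -normr_le0; apply/ler_addgt0Pr => e e0; rewrite add0r.
  have [t1 t10 h] := tr e e0; pose z := Num.min t (t1 / 2).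
  have z0 : 0 < z by rewrite lt_min t0 divr_gt0.
  have zt : z <= t by rewrite ge_min lexx.
  have z1 : z < t1 by rewrite gt_min; apply/orP; right; rewrite ltr_pdivrMr// ltr_pMr// ltr1n.
  rewrite -(mass_constant hsigma tau_pos pre z0 zt) -T1.
  have := sobolev_mean hsigma hn (lD z z0) (h z ltac:(by rewrite z0)).
  by rewrite /pairing (@eq_sint _ _ _ _ (u z))// => w _; rewrite /cst mulr1.
have F : flow sigma nu tau rho u du.
  by move=> t t0; have [s1 s2 h q] := pre t t0; split => //; exact: mass.
have hT : initial_trace sigma u T0.
  move=> l Y lp sY eY e e0; have cY := smooth_scont sY.
  have y1 : 0 < l2 sigma Y + 1 by rewrite ltr_wpDl ?l2_ge0.
  (* A norm at most this number bounds the pairing with [Y] by its product with [l2 sigma Y], which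
     is at most e. *)
  have [t1 t10 h] := tr (e / (l2 sigma Y + 1)) ltac:(by rewrite divr_gt0).
  pose t := Num.min (e / 2) (t1 / 2).
  have t0 : 0 < t by rewrite lt_min !divr_gt0.
  have te : t < e by rewrite gt_min; apply/orP; left; rewrite ltr_pdivrMr// ltr_pMr// ltr1n.
  have tt1 : t < t1 by rewrite gt_min; apply/orP; right; rewrite ltr_pdivrMr// ltr_pMr// ltr1n.
  exists t; first by rewrite t0.
  have := sobolev_eigen hsigma hn (ltW s0) (lD t t0) (h t ltac:(by rewrite t0)) lp sY eY.
  rewrite /pairing (@eq_sint _ _ _ _ (fun w => Y w * u t w)); last by move=> w _; rewrite mulrC.
  move=> h2; apply: (le_trans h2); rewrite mulrAC ler_pdivrMr// ler_pM2l// lerDl//.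
have vE v Y : sphere v -> of_density sigma (fun w => rho * vonMises sigma kappa v w) Y =
    rhoM sigma hn kappa rho v Y.
  move=> v1; rewrite of_densityE; apply: eq_sint => w _.
  by rewrite (vonMisesE hsigma hn _ v1).
have distE v : sphere v ->
    dist s (f 0) v = sobolev_norm sigma s (fun Y => T0 Y - rhoM sigma hn kappa rho v Y).
  by move=> v1; apply: eq_sobolev_norm => Y sY; rewrite -vE.
have dist0 : (0 <= dist s (f 0%R) Omega)%E by exact: sqrte_ge0.
(* The initial distance is finite because it is below delta. *)
have [d dE] : exists d : R, dist s (f 0) Omega = d%:E.
  exists (fine (dist s (f 0) Omega)); rewrite fineK// ge0_fin_numE//.
  exact: lt_trans hd (ltry _).
rewrite dE lte_fin in hd; rewrite dE lee_fin in dist0.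
rewrite distE// in dE.
have near D : d < D -> starts_near sigma hn kappa rho u Omega D.
  by move=> dD; apply: (starts_near_sobolev hsigma (ltW s0) cu lT tr _ dD); rewrite dE.
have hD D : d < D -> (sobolev_norm sigma s (fun Y => T0 Y - rhoM sigma hn kappa rho Omega Y)%R <= D%:E)%E.
  by move=> dD; rewrite dE lee_fin ltW.
have [|x x1 Hx] := H u du F T0 Omega lT T1 hT O1.
  by exists D1 => //; split; [exact: hD|exact: near].
(* Time 0 is separate: no density is available there, and the bound comes from the part of [Hx]
   about the initial measure. *)
exists x => // t; rewrite distE// dE -!EFinM le_eqVlt => /predU1P[<-|t0].
  rewrite mulr0 expR0 mulr1 distE//.
  apply: (le_EFin_right (ltW C0) hd) => D dD DD1.
  by have [] := Hx D DD1 (conj (hD D dD) (near D dD)).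
rewrite mulrAC; apply: (le_EFin_right _ hd); first by rewrite mulr_ge0 ?expR_ge0// ltW.
move=> D dD DD1; have [_ h] := Hx D DD1 (conj (hD D dD) (near D dD)).
rewrite mulrAC; apply: le_trans (h t t0).
rewrite /dist (@eq_sobolev_norm _ _ _ _ _ (pairing sigma (dev sigma hn kappa rho u x t)))// => Y sY.
have cY := smooth_scont sY.
rewrite (pairing_dev hn kappa x F t0 cY) /= vE// pairing_rhoM// fE//.
by congr (_ - _); apply: eq_sint => w _; rewrite mulrC.
Qed.
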